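(* Let $\sigma_0(t)=e^{-t}(1-t)$ and $\sigma_1(t)=e^{-t}t$ for all $t\in\mathbb{R}_+$. Every continuous linear operator $A:L^2(\mathbb{R}_+)\rightarrow L^2(\mathbb{R}_+)$ with the property that $A(\mathcal{M})\subset\mathcal{M}$ is determined by its two values $A\sigma_0$ and $A\sigma_1$. Explicitly, for every such $A$, setting \[ \alpha=\mathcal{L}A\sigma_0+\mathcal{L}A\sigma_1\quad\text{and}\quad \xi=\frac{\mathcal{L}A\sigma_0}{\mathcal{L}A\sigma_1}, \] one has \[ A=\mathcal{L}^{-1}M_\kappa C_\xi\mathcal{L}\quad\text{with}\quad \kappa=\sqrt{2\pi}\,(1+\xi)\alpha; \] equivalently, $A$ has the integral representation \[ (Af)(t)=\frac{1}{\sqrt{2\pi}}\int_{y=-\infty}^{\infty}\int_{\tau=0}^{\infty}\alpha(iy)\,(1+\xi(iy))\,e^{-\tau\xi(iy)+iyt}f(\tau)\,d\tau\,dy . \] Moreover, $\alpha\in H^2_{\mathbb{C}_+}$ is necessarily an outer function, and $\xi:\mathbb{C}_+\rightarrow\mathbb{C}_+$ is analytic.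
   Context: $\mathbb{C}_+$ is the open right half plane, $\mathbb{D}$ the open unit disk, $\mathbb{R}_+$ the half line $[0,\infty)$; $L^2(\mathbb{R}_+)$ consists of complex-valued functions. $H^2_{\mathbb{C}_+}$ is the Hardy space of analytic functions on $\mathbb{C}_+$ whose square integrals along vertical lines of constant positive real part are uniformly bounded; $H^2_{\mathbb{D}}$ is the Hardy space of analytic functions on $\mathbb{D}$ with square summable Taylor coefficients. Values on the imaginary axis (resp. the unit circle) refer to boundary functions. The Fourier-Laplace transform $\mathcal{L}:L^2(\mathbb{R}_+)\to H^2_{\mathbb{C}_+}$, $(\mathcal{L}f)(w)=\frac{1}{\sqrt{2\pi}}\int_0^\infty f(t)e^{-wt}\,dt$, is a surjective isometry. The map $\Phi:H^2_{\mathbb{C}_+}\to H^2_{\mathbb{D}}$, $(\Phi F)(z)=\frac{2\sqrt{\pi}}{1+z}F\!\left(\frac{1-z}{1+z}\right)$, is a surjective isometry. Put $\mathcal{H}=\Phi\mathcal{L}:L^2(\mathbb{R}_+)\to H^2_{\mathbb{D}}$. A nonzero $G\in H^2_{\mathbb{D}}$ is outer if there is a scalar $\lambda$ with $|\lambda|=1$ such that $G(z)=\lambda\exp\!\left(\frac{1}{2\pi}\int_0^{2\pi}\frac{e^{i\theta}+z}{e^{i\theta}-z}\log|G(e^{i\theta})|\,d\theta\right)$ for all $z\in\mathbb{D}$. A nonzero $F\in H^2_{\mathbb{C}_+}$ is outer if there is a scalar $\lambda$ with $|\lambda|=1$ such that $F(w)=\lambda\exp\!\left(\frac{1}{\pi}\int_{-\infty}^\infty\frac{yw+i}{y+iw}\log|F(iy)|\frac{dy}{1+y^2}\right)$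 for all $w\in\mathbb{C}_+$. A function $f\in L^2(\mathbb{R}_+)$ is minimum phase if $\mathcal{H}f$ is outer; $\mathcal{M}$ is the set of all minimum phase functions in $L^2(\mathbb{R}_+)$. For analytic $\kappa$ on $\mathbb{C}_+$ and analytic $\xi:\mathbb{C}_+\to\mathbb{C}_+$, $(M_\kappa F)(w)=\kappa(w)F(w)$ and $(C_\xi F)(w)=F(\xi(w))$. The integral representation is $\mathcal{L}^{-1}M_\kappa C_\xi\mathcal{L}f$ written out using boundary values on the imaginary axis; when the integrals do not converge absolutely they are interpreted (as oscillatory integrals) as in the standard theory of the Fourier transform on $L^2$. *)

(* Defs.v *)
From HB Require Import structures.
From mathcomp Require Import all_boot all_order all_algebra.
From mathcomp Require Import all_classical all_reals all_analysis.
From mathcomp Require Import complex.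

Set Implicit Arguments.
Unset Strict Implicit.
Unset Printing Implicit Defensive.

Import Order.TTheory GRing.Theory Num.Theory.
Import numFieldNormedType.Exports.
Import Normc.

Local Open Scope classical_set_scope.
Local Open Scope complex_scope.
Local Open Scope ring_scope.

Definition cexp (R : realType) (z : R[i]) : R[i] :=
  (expR (complex.Re z))%:C * (cos (complex.Im z) +i* sin (complex.Im z)).

Definition cintegral (R : realType) (D : set R) (f : R -> R[i]) : R[i] :=
  (\int[lebesgue_measure]_(t in D) complex.Re (f t))
  +i* (\int[lebesgue_measure]_(t in D) complex.Im (f t)).

(* Elements of the complex space L^2(D) are represented by Borel functions
   R -> R[i]; values outside D are irrelevant, and two representatives denote
   the same element when they are ae_eq on D. *)
Definition L2norm (R : realType) (D : set R) (f : R -> R[i]) : \bar R :=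
  Lnorm lebesgue_measure 2%:E (fun t : R => (normc (f t) * \1_D t)%:E).

Definition isL2 (R : realType) (D : set R) (f : R -> R[i]) : Prop :=
  [/\ measurable_fun D (fun t => complex.Re (f t)),
      measurable_fun D (fun t => complex.Im (f t)) & (L2norm D f < +oo)%E].

Definition L2eq (R : realType) (D : set R) (f g : R -> R[i]) : Prop :=
  ae_eq lebesgue_measure D f g.

Definition L2lim (R : realType) (D : set R) (u : R -> R -> R[i])
    (g : R -> R[i]) : Prop :=
  [/\ \forall T \near +oo, isL2 D (u T), isL2 D g
    & L2norm D (fun t => u T t - g t)%R @[T --> +oo] --> (0 : \bar R)%E].

Definition Rplus {R : realType} : set R := `[0, +oo[.

(* A continuous linear operator on L^2(R_+), given on representatives. *)
Record L2_continuous_linear (R : realType)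
    (A : (R -> R[i]) -> (R -> R[i])) : Prop := {
  L2op_stable : forall f, isL2 Rplus f -> isL2 Rplus (A f) ;
  L2op_proper : forall f g, isL2 Rplus f -> isL2 Rplus g ->
    L2eq Rplus f g -> L2eq Rplus (A f) (A g) ;
  L2op_linear : forall (a b : R[i]) f g,
    isL2 Rplus f -> isL2 Rplus g ->
    L2eq Rplus (A (fun t => a * f t + b * g t))
                (fun t => a * A f t + b * A g t) ;
  L2op_continuous : forall f, isL2 Rplus f ->
    forall e : R, 0 < e -> exists2 d : R, 0 < d &
      forall g, isL2 Rplus g -> (L2norm Rplus (fun t => g t - f t)%R < d%:E)%E ->
        (L2norm Rplus (fun t => A g t - A f t)%R < e%:E)%E }.

Definition Cplus {R : realType} : set R[i] := [set w | 0 < complex.Re w].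

Definition Cdisk {R : realType} : set R[i] := [set z | normc z < 1].

Definition holomorphic_on (R : realType) (U : set R[i])
    (F : R[i] -> R[i]) : Prop :=
  forall w, U w -> derivable (F : R[i]^o -> R[i]^o) w 1.

Definition H2Cplus (R : realType) (F : R[i] -> R[i]) : Prop :=
  holomorphic_on Cplus F /\
  exists M : R, forall x : R, 0 < x ->
    (\int[lebesgue_measure]_(y in [set: R]) (normc (F (x +i* y)) ^+ 2)%:E
       <= M%:E)%E.

Definition H2disk (R : realType) (G : R[i] -> R[i]) : Prop :=
  holomorphic_on Cdisk G /\
  exists a : nat -> R[i],
    (forall z, Cdisk z ->
       series (fun k => a k * z ^+ k : R[i]^o) n @[n --> \oo]
         --> (G z : R[i]^o)) /\
    cvg (series (fun k => normc (a k) ^+ 2) n @[n --> \oo]).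

(* Boundary functions as one-sided horizontal, resp. radial, limits. On H^2
   they exist almost everywhere; elsewhere lim takes an arbitrary value. *)
Definition boundary_Cplus (R : realType) (F : R[i] -> R[i]) (y : R) : R[i] :=
  lim ((F (x +i* y) : R[i]^o) @[x --> (0 : R)^'+]).

Definition boundary_disk (R : realType) (G : R[i] -> R[i]) (theta : R) :
    R[i] :=
  lim ((G (r%:C * cexp (0 +i* theta)) : R[i]^o) @[r --> (1 : R)^'-]).

Definition outer_disk (R : realType) (G : R[i] -> R[i]) : Prop :=
  [/\ H2disk G, (exists2 z, Cdisk z & G z != 0)
    & exists2 lambda : R[i], normc lambda = 1 & forall z, Cdisk z ->
        G z = lambda * cexp ((2 * pi)^-1%:C *
          cintegral `[0, 2 * pi] (fun theta =>
            (cexp (0 +i* theta) + z) / (cexp (0 +i* theta) - z) *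
            (ln (normc (boundary_disk G theta)))%:C))].

Definition outer_Cplus (R : realType) (F : R[i] -> R[i]) : Prop :=
  [/\ H2Cplus F, (exists2 w, Cplus w & F w != 0)
    & exists2 lambda : R[i], normc lambda = 1 & forall w, Cplus w ->
        F w = lambda * cexp (pi^-1%:C *
          cintegral setT (fun y =>
            (y%:C * w + 'i%C) / (y%:C + 'i%C * w) *
            (ln (normc (boundary_Cplus F y)) / (1 + y ^+ 2))%:C))].

Definition laplace (R : realType) (f : R -> R[i]) (w : R[i]) : R[i] :=
  (Num.sqrt (2 * pi))^-1%:C *
  cintegral Rplus (fun t => f t * cexp (- (w * t%:C))).

(* g represents L^{-1} F; g is unique up to L2eq since L is an isometry. *)
Definition is_inverse_laplace (R : realType) (F : R[i] -> R[i])
    (g : R -> R[i]) : Prop :=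
  [/\ H2Cplus F, isL2 Rplus g & forall w, Cplus w -> laplace g w = F w].

Definition Phi (R : realType) (F : R[i] -> R[i]) (z : R[i]) : R[i] :=
  (2 * Num.sqrt pi)%:C / (1 + z) * F ((1 - z) / (1 + z)).

Definition minimum_phase (R : realType) (f : R -> R[i]) : Prop :=
  isL2 Rplus f /\ outer_disk (Phi (laplace f)).

Definition preserves_minimum_phase (R : realType)
    (A : (R -> R[i]) -> (R -> R[i])) : Prop :=
  forall f, minimum_phase f -> minimum_phase (A f).

Definition Mop (R : realType) (kappa F : R[i] -> R[i]) (w : R[i]) : R[i] :=
  kappa w * F w.

Definition Cop (R : realType) (xi F : R[i] -> R[i]) (w : R[i]) : R[i] :=
  F (xi w).

Definition sigma0 {R : realType} (t : R) : R[i] := (expR (- t) * (1 - t))%:C.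

Definition sigma1 {R : realType} (t : R) : R[i] := (expR (- t) * t)%:C.

(* h(t) = (2 pi)^{-1/2} \int_y \int_{tau >= 0}
            alpha(iy) (1 + xi(iy)) e^{- tau xi(iy) + iyt} f(tau) dtau dy,
   both integrals being limits in the mean of truncated ones, as in the
   Plancherel theory: the inner one in L^2(R, dy), the outer in L^2(R_+, dt). *)
Definition oscillatory_representation (R : realType)
    (alpha xi : R[i] -> R[i]) (f h : R -> R[i]) : Prop :=
  exists2 g : R -> R[i],
    L2lim setT (fun T y =>
      boundary_Cplus alpha y * (1 + boundary_Cplus xi y) *
      cintegral `[0, T] (fun tau =>
        cexp (- (tau%:C * boundary_Cplus xi y)) * f tau)) g
  & L2lim Rplus (fun N t =>
      (Num.sqrt (2 * pi))^-1%:C *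
      cintegral `[- N, N] (fun y => cexp (0 +i* (y * t)) * g y)) h.

(* Main.v *)
Require Import Defs.
From HB Require Import structures.
From mathcomp Require Import all_boot all_order all_algebra.
From mathcomp Require Import all_classical all_reals all_analysis.
From mathcomp Require Import measurable_realfun.
From mathcomp Require Import complex ring lra.

Set Implicit Arguments.
Unset Strict Implicit.
Unset Printing Implicit Defensive.

Import Order.TTheory GRing.Theory Num.Theory.
Import numFieldNormedType.Exports.
Import Normc.

Local Open Scope classical_set_scope.
Local Open Scope complex_scope.
Local Open Scope ring_scope.

(** For a fixed [w] in the right half plane the functional
    [f |-> laplace (A f) w] is continuous, and it does not vanish on the minimum
    phase functions, because outer functions have no zeros. On the disk the
    functions [(1 - a z) ^ n] with [normc a <= 1] are outer
    ([outer_disk_power]): this is Schwarz's formula [schwarz_log] for the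
    logarithm of [normc (1 - a zeta)]. So the functional induces a linear form
    [l] on polynomials without zeros on the [(1 - a X) ^ n]. The polynomial of
    degree [n] whose coefficients are, up to sign, the products of the moments
    [l (X ^ k)] with binomial coefficients then has all its roots in the closed
    unit disk, and Newton's relations between its elementary symmetric
    functions force the moments, as [n] grows, to form a geometric progression:
    [l] is a multiple of an evaluation ([zero_free_evaluation]). Since
    exponentials are total ([exponentials_total]), the same holds on the whole
    space: [laplace (A f) w = c * laplace f v] with [v] in the right half plane
    ([laplace_op_evaluation]).

    The transforms of [sigma0] and [sigma1] are proportional to
    [v / (1 + v) ^ 2] and [1 / (1 + v) ^ 2] at [v], so the quotient of
    the transforms of their images is [v], and the sum determines [c]
    ([op_evaluation]). This gives the
    formula for [A], the uniqueness, and the analyticity of [xi]. The function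
    [alpha] is the transform of the image of [exp (- t)], which is minimum
    phase; that the two notions of outer function agree under the Cayley map
    ([outer_Cplus_of_disk]) is a change of variables in the integrals together
    with the identification of the boundary functions.

    The boundary functions are handled through the isometric extension of the
    Laplace transform to the imaginary axis: it is computed on sums of
    exponentials, whose transforms are sums of Cauchy kernels, and extended by
    continuity ([fourier_pair]). A transform is the Poisson integral of its
    boundary function ([fourier_pair_poisson]), hence converges to it within
    cones almost everywhere ([laplace_nontangential]).

    For the integral representation, the formula for [A] applied to the
    truncations of [f] passes to the imaginary axis almost everywhere
    ([truncated_boundary]), so the truncated inner integrals are the boundary
    functions of the images of the truncations, which converge by continuity of
    [A]. The outer integral inverts the Fourier transform
    ([fourier_inversion]); there the truncated integral is estimated by duality,
    using the isometry and one exchange of integrals over a bounded region. *)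

(** * Complex numbers *)

Section ComplexBasics.
Variable R : realType.
Implicit Types (x y z w : R[i]) (a b t : R).

Lemma normc_sqr z : normc z ^+ 2 = complex.Re z ^+ 2 + complex.Im z ^+ 2.
Proof. by case: z => a b; rewrite /= sqr_sqrtr// addr_ge0 ?sqr_ge0. Qed.

Lemma norm_normc z : `|z| = (normc z)%:C.
Proof. by case: z. Qed.

Lemma normc_ge0 z : 0 <= normc z.
Proof. by case: z => a b; rewrite sqrtr_ge0. Qed.

Lemma ler_normcD z w : normc (z + w) <= normc z + normc w.
Proof. exact: le_normcD. Qed.

Lemma normcNr z : normc (- z) = normc z.
Proof. exact: normcN. Qed.

Lemma normc_distC z w : normc (z - w) = normc (w - z).
Proof. by rewrite -normcNr opprB. Qed.

Lemma ler_normcB z w : normc (z - w) <= normc z + normc w.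
Proof. by rewrite (le_trans (ler_normcD _ _))// normcNr. Qed.

Lemma ler_normc_distD x y z : normc (x - z) <= normc (x - y) + normc (y - z).
Proof. by rewrite (le_trans _ (ler_normcD _ _))// addrA subrK. Qed.

Lemma lerB_normc z w : normc z - normc w <= normc (z - w).
Proof. by rewrite lerBlDr (le_trans _ (ler_normcD _ _))// subrK. Qed.

Lemma ler_normc_sum (I : Type) (r : seq I) (P : pred I) (F : I -> R[i]) :
  normc (\sum_(i <- r | P i) F i) <= \sum_(i <- r | P i) normc (F i).
Proof.
elim/big_rec2 : _ => [|i y x _ le]; first by rewrite normc0.
by rewrite (le_trans (ler_normcD _ _))// lerD.
Qed.

Lemma normcX z n : normc (z ^+ n) = normc z ^+ n.
Proof. by elim: n => [|n IH]; rewrite ?expr0 ?normc1// !exprS normcM IH. Qed.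

Lemma normc_real a : normc a%:C = `|a|.
Proof. by rewrite /= expr0n/= addr0 sqrtr_sqr. Qed.

Lemma normc_eq0 z : (normc z == 0) = (z == 0).
Proof.
by apply/eqP/eqP => [|->]; [exact: eq0_normc|exact: normc0].
Qed.

Lemma normc_gt0 z : (0 < normc z) = (z != 0).
Proof. by rewrite lt_def normc_ge0 andbT normc_eq0. Qed.

Lemma normc_conj z : normc (conjc z) = normc z.
Proof. by case: z => a b /=; rewrite sqrrN. Qed.

Lemma normRe_le z : `|complex.Re z| <= normc z.
Proof.
rewrite -[leLHS]sqrtr_sqr; case: z => a b /=.
by rewrite ler_wsqrtr// lerDl sqr_ge0.
Qed.

Lemma normIm_le z : `|complex.Im z| <= normc z.
Proof.
rewrite -[leLHS]sqrtr_sqr; case: z => a b /=.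
by rewrite ler_wsqrtr// lerDr sqr_ge0.
Qed.

Lemma normc_le z : normc z <= `|complex.Re z| + `|complex.Im z|.
Proof.
have -> : z = (complex.Re z)%:C + 'i%C * (complex.Im z)%:C by rewrite -complexE.
rewrite (le_trans (ler_normcD _ _))// normcM !normc_real /=.
rewrite !(mul0r,mulr0,mul1r,addr0,add0r,subr0,sub0r,oppr0).
by rewrite expr0n/= add0r expr1n sqrtr1 mul1r.
Qed.

Lemma ReD z w : complex.Re (z + w) = complex.Re z + complex.Re w.
Proof. by case: z; case: w. Qed.

Lemma ImD z w : complex.Im (z + w) = complex.Im z + complex.Im w.
Proof. by case: z; case: w. Qed.

Lemma ReN z : complex.Re (- z) = - complex.Re z.
Proof. by case: z. Qed.

Lemma ImN z : complex.Im (- z) = - complex.Im z.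
Proof. by case: z. Qed.

Lemma ReM z w : complex.Re (z * w) =
  complex.Re z * complex.Re w - complex.Im z * complex.Im w.
Proof. by case: z; case: w. Qed.

Lemma ImM z w : complex.Im (z * w) =
  complex.Re z * complex.Im w + complex.Im z * complex.Re w.
Proof. by case: z; case: w. Qed.

Lemma complex_eq z w : complex.Re z = complex.Re w ->
  complex.Im z = complex.Im w -> z = w.
Proof. by case: z => a b; case: w => c d /= -> ->. Qed.

Lemma mulc_conj z : z * conjc z = (normc z ^+ 2)%:C.
Proof.
rewrite normc_sqr; case: z => a b /=; apply: complex_eq => /=; ring.
Qed.

Lemma Re_inv z : complex.Re z^-1 = complex.Re z / normc z ^+ 2.
Proof. by rewrite normc_sqr; case: z. Qed.

Lemma Im_inv z : complex.Im z^-1 = - (complex.Im z / normc z ^+ 2).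
Proof. by rewrite normc_sqr; case: z. Qed.

Lemma conjcD z w : conjc (z + w) = conjc z + conjc w.
Proof. by case: z => a b; case: w => c d; apply: complex_eq; rewrite //= opprD. Qed.

Lemma conjcM z w : conjc (z * w) = conjc z * conjc w.
Proof. by case: z => a b; case: w => c d; apply: complex_eq => /=; ring. Qed.

(** ** The exponential *)

Lemma cexp0 : cexp 0 = 1 :> R[i].
Proof. by rewrite /cexp /= expR0 cos0 sin0 mul1r. Qed.

Lemma cexpD z w : cexp (z + w) = cexp z * cexp w.
Proof.
rewrite /cexp ReD ImD expRD cosD sinD; apply: complex_eq => /=; ring.
Qed.

Lemma normc_cexp z : normc (cexp z) = expR (complex.Re z).
Proof.
rewrite /cexp normcM normc_real ger0_norm ?expR_ge0//=.
by rewrite cos2Dsin2 sqrtr1 mulr1.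
Qed.

Lemma cexp_neq0 z : cexp z != 0.
Proof. by rewrite -normc_gt0 normc_cexp expR_gt0. Qed.

Lemma cexpN z : cexp (- z) = (cexp z)^-1.
Proof.
apply: (mulfI (cexp_neq0 z)).
by rewrite -cexpD subrr cexp0 mulfV// cexp_neq0.
Qed.

Lemma cexpB z w : cexp (z - w) = cexp z / cexp w.
Proof. by rewrite cexpD cexpN. Qed.

Lemma cexpMn z n : cexp (n%:R * z) = cexp z ^+ n.
Proof.
elim: n => [|n IH]; first by rewrite mul0r cexp0.
by rewrite -natr1 mulrDl mul1r cexpD IH exprSr.
Qed.

Lemma cexp_real a : cexp a%:C = (expR a)%:C.
Proof. by rewrite /cexp /= cos0 sin0 mulr1. Qed.

Lemma cexp_im_normc t : normc (cexp (0 +i* t)) = 1 :> R.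
Proof. by rewrite normc_cexp /= expR0. Qed.

Lemma conj_cexp z : conjc (cexp z) = cexp (conjc z).
Proof.
case: z => a b; rewrite /cexp /= cosN sinN; apply: complex_eq => /=; ring.
Qed.

(** ** Differentiation along the real line *)

Definition cderiv (f : R -> R[i]) (t : R) (d : R[i]) : Prop :=
  is_derive t 1 (fun s => complex.Re (f s)) (complex.Re d) /\
  is_derive t 1 (fun s => complex.Im (f s)) (complex.Im d).

Lemma cderiv_eq f t d d' : cderiv f t d -> d = d' -> cderiv f t d'.
Proof. by move=> ? <-. Qed.

Lemma cderiv_cst z t : cderiv (fun=> z) t 0.
Proof. by split; exact: is_derive_cst. Qed.

Lemma cderiv_id t : cderiv (fun s => s%:C) t 1.
Proof. by split; [exact: is_derive_id|exact: is_derive_cst]. Qed.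

Lemma cderivD f g t d e : cderiv f t d -> cderiv g t e ->
  cderiv (fun s => f s + g s) t (d + e).
Proof.
move=> [f1 f2] [g1 g2]; split.
  rewrite ReD; rewrite (_ : (fun _ => _) =
    (fun s => complex.Re (f s)) + (fun s => complex.Re (g s))).
    exact: is_deriveD.
  by apply/funext => s; rewrite ReD.
rewrite ImD; rewrite (_ : (fun _ => _) =
  (fun s => complex.Im (f s)) + (fun s => complex.Im (g s))).
  exact: is_deriveD.
by apply/funext => s; rewrite ImD.
Qed.

Lemma cderivN f t d : cderiv f t d -> cderiv (fun s => - f s) t (- d).
Proof.
move=> [f1 f2]; split.
  rewrite ReN; rewrite (_ : (fun _ => _) = - (fun s => complex.Re (f s))).
    exact: is_deriveN.
  by apply/funext => s; rewrite ReN.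
rewrite ImN; rewrite (_ : (fun _ => _) = - (fun s => complex.Im (f s))).
  exact: is_deriveN.
by apply/funext => s; rewrite ImN.
Qed.

Lemma cderivM f g t d e : cderiv f t d -> cderiv g t e ->
  cderiv (fun s => f s * g s) t (d * g t + f t * e).
Proof.
move=> [f1 f2] [g1 g2].
pose rf s := complex.Re (f s); pose mf s := complex.Im (f s).
pose rg s := complex.Re (g s); pose mg s := complex.Im (g s).
split.
  rewrite (_ : (fun _ => _) = rf * rg - mf * mg); last first.
    by apply/funext => s; rewrite ReM.
  apply: is_derive_eq; rewrite ReD !ReM /rf /rg /mf /mg.
  rewrite /GRing.scale/=; ring.
rewrite (_ : (fun _ => _) = rf * mg + mf * rg); last first.
  by apply/funext => s; rewrite ImM.
apply: is_derive_eq; rewrite ImD !ImM /rf /rg /mf /mg.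
rewrite /GRing.scale/=; ring.
Qed.

Lemma cderivX f t d n : cderiv f t d ->
  cderiv (fun s => f s ^+ n.+1) t (n.+1%:R * f t ^+ n * d).
Proof.
move=> fd; elim: n => [|n IH].
  rewrite (_ : (fun _ => _) = f); first by apply: (cderiv_eq fd); rewrite expr0; ring.
  by apply/funext => s; rewrite expr1.
rewrite (_ : (fun _ => _) = fun s => f s * f s ^+ n.+1); last first.
  by apply/funext => s; rewrite exprS.
apply: (cderiv_eq (cderivM fd IH)).
by rewrite -[in RHS]natr1 exprS; ring.
Qed.

Lemma cderiv_cexp f t d : cderiv f t d ->
  cderiv (fun s => cexp (f s)) t (cexp (f t) * d).
Proof.
move=> [f1 f2].
pose rf s := complex.Re (f s); pose mf s := complex.Im (f s).
have de : is_derive t 1 (expR \o rf) (expR (rf t) * complex.Re d).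
  exact: is_derive1_comp.
have dc : is_derive t 1 (cos \o mf) (- sin (mf t) * complex.Im d).
  exact: is_derive1_comp.
have ds : is_derive t 1 (sin \o mf) (cos (mf t) * complex.Im d).
  exact: is_derive1_comp.
split.
  rewrite (_ : (fun _ => _) = (expR \o rf) * (cos \o mf)); last first.
    by apply/funext => s; rewrite /cexp ReM /= mul0r subr0.
  apply: is_derive_eq; rewrite ReM /cexp ReM ImM /= /rf /mf.
  rewrite /GRing.scale/=; ring.
rewrite (_ : (fun _ => _) = (expR \o rf) * (sin \o mf)); last first.
  by apply/funext => s; rewrite /cexp ImM /= mul0r addr0.
apply: is_derive_eq; rewrite ImM /cexp ReM ImM /= /rf /mf.
rewrite /GRing.scale/=; ring.
Qed.

(** The mean value inequality: the mean value theorem is applied to the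
    component of f in the direction of its increment. *)
Lemma cderiv_le (f f' : R -> R[i]) (M : R) :
  (forall t, 0 <= t <= 1 -> cderiv f t (f' t)) ->
  (forall t, 0 <= t <= 1 -> normc (f' t) <= M) ->
  normc (f 1 - f 0) <= M.
Proof.
move=> fd fM.
have M0 : 0 <= M by rewrite (le_trans (normc_ge0 _) (fM 0 _))// lexx ler01.
have [->|n0] := eqVneq (f 1 - f 0) 0; first by rewrite normc0.
pose c := conjc (f 1 - f 0).
have hd t : 0 <= t <= 1 ->
    is_derive t 1 (fun s => complex.Re (c * f s)) (complex.Re (c * f' t)).
  move=> t01.
  have := cderivM (cderiv_cst c t) (fd t t01).
  by rewrite mul0r add0r => -[].
have [||t t01 tE] := @MVT _ (fun s => complex.Re (c * f s))
    (fun t => complex.Re (c * f' t)) 0 1 ltr01.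
- by move=> t; rewrite in_itv/= => /andP[t0 t1]; apply: hd; rewrite !ltW.
- apply: derivable_within_continuous => t; rewrite in_itv/= => t01.
  by have [] := hd t t01.
have {}tE : normc (f 1 - f 0) ^+ 2 = complex.Re (c * f' t).
  move: tE; rewrite subr0 mulr1 => <-.
  by rewrite -ReN -ReD -mulrN -mulrDr /c mulrC mulc_conj.
have : normc (f 1 - f 0) ^+ 2 <= normc (f 1 - f 0) * M.
  rewrite tE (le_trans (ler_norm _))// (le_trans (normRe_le _))// normcM.
  rewrite /c normc_conj ler_wpM2l ?normc_ge0// fM//.
  by move: t01; rewrite in_itv/= => /andP[/ltW-> /ltW->].
by rewrite expr2 ler_pM2l// normc_gt0.
Qed.

Lemma cderiv_lin z t : cderiv (fun s => s%:C * z) t z.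
Proof.
apply: (cderiv_eq (cderivM (cderiv_id t) (cderiv_cst z t))).
by rewrite mul1r mulr0 addr0.
Qed.

Lemma normc_cexp_le z t : 0 <= t <= 1 ->
  normc (cexp (t%:C * z)) <= expR (normc z).
Proof.
move=> /andP[t0 t1]; rewrite normc_cexp ler_expR.
rewrite (le_trans (ler_norm _))// (le_trans (normRe_le _))//.
by rewrite normcM normc_real ger0_norm// ler_piMl// normc_ge0.
Qed.

Lemma cexpB1_le z : normc (cexp z - 1) <= normc z * expR (normc z).
Proof.
have := @cderiv_le (fun s => cexp (s%:C * z)) (fun s => cexp (s%:C * z) * z)
  (normc z * expR (normc z)).
rewrite !(mul0r, mul1r) cexp0; apply => t t01.
  exact/cderiv_cexp/cderiv_lin.
by rewrite normcM mulrC ler_wpM2l ?normc_ge0// normc_cexp_le.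
Qed.

Lemma cexpB1B_le z : normc (cexp z - 1 - z) <= normc z ^+ 2 * expR (normc z).
Proof.
have := @cderiv_le (fun s => cexp (s%:C * z) - s%:C * z)
  (fun s => cexp (s%:C * z) * z - z) (normc z ^+ 2 * expR (normc z)).
rewrite !(mul0r, mul1r) cexp0 subr0 addrAC; apply => t t01.
  apply: cderivD; first exact/cderiv_cexp/cderiv_lin.
  exact/cderivN/cderiv_lin.
rewrite -{3}[z]mul1r -mulrBl normcM mulrC expr2 -mulrA.
rewrite ler_wpM2l ?normc_ge0// (le_trans (cexpB1_le _))//.
have le1 : normc (t%:C * z) <= normc z.
  case/andP: t01 => t0 t1.
  by rewrite normcM normc_real ger0_norm// ler_piMl// normc_ge0.
by rewrite ler_pM ?normc_ge0 ?expR_ge0// ler_expR.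
Qed.

(** ** Convergence of complex functions in terms of the real modulus *)

Lemma cvg_normcP (T : Type) (F : set_system T) {FF : Filter F}
    (f : T -> R[i]) (l : R[i]) :
  ((f x : R[i]^o) @[x --> F] --> (l : R[i]^o)) <->
  (forall e : R, 0 < e -> \forall x \near F, normc (f x - l) < e).
Proof.
split=> [/cvgrPdist_lt fl e e0|fl].
  have := fl e%:C; rewrite ltcR => /(_ e0).
  by apply: filterS => x /=; rewrite norm_normc ltcR normc_distC.
apply/cvgrPdist_lt => -[e e'] /=; rewrite ltcE /= => /andP[/eqP -> e0].
by apply: filterS (fl e e0) => x; rewrite norm_normc ltcR normc_distC.
Qed.

Lemma cvg_normc0P (T : Type) (F : set_system T) {FF : Filter F}
    (f : T -> R[i]) (l : R[i]) :
  ((f x : R[i]^o) @[x --> F] --> (l : R[i]^o)) <->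
  (normc (f x - l) @[x --> F] --> (0 : R)).
Proof.
rewrite cvg_normcP; split=> [fl|/cvgrPdist_lt fl e e0].
  apply/cvgrPdist_lt => e e0; apply: filterS (fl e e0) => x.
  by rewrite sub0r normrN ger0_norm// normc_ge0.
by apply: filterS (fl e e0) => x; rewrite sub0r normrN ger0_norm// normc_ge0.
Qed.

Lemma cvg_ReIm (T : Type) (F : set_system T) {FF : Filter F}
    (f : T -> R[i]) (l : R[i]) :
  ((f x : R[i]^o) @[x --> F] --> (l : R[i]^o)) <->
  (complex.Re (f x) @[x --> F] --> complex.Re l /\
   complex.Im (f x) @[x --> F] --> complex.Im l).
Proof.
rewrite cvg_normcP; split=> [fl|[/cvgrPdist_lt f1 /cvgrPdist_lt f2] e e0].
  split; apply/cvgrPdist_lt => e e0; apply: filterS (fl e e0) => x.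
    by apply: le_lt_trans; rewrite distrC -ReN -ReD normRe_le.
  by apply: le_lt_trans; rewrite distrC -ImN -ImD normIm_le.
have e20 : 0 < e / 2 by rewrite divr_gt0.
apply: filterS2 (f1 _ e20) (f2 _ e20) => x h1 h2.
rewrite (le_lt_trans (normc_le _))// ReD ReN ImD ImN (splitr e).
by rewrite distrC (distrC (complex.Im _)) ltrD.
Qed.

End ComplexBasics.

(** * Integration of complex-valued functions *)

Section ComplexMeasurable.
Context d (T : measurableType d) (R : realType).
Implicit Types (D : set T) (f g : T -> R[i]).

Definition cmeas D f := measurable_fun D (fun t => complex.Re (f t)) /\
                        measurable_fun D (fun t => complex.Im (f t)).

Lemma cmeas_cst D z : cmeas D (fun=> z).
Proof. by split; exact: measurable_cst. Qed.

Lemma cmeas_pair D (u v : T -> R) : measurable_fun D u -> measurable_fun D v ->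
  cmeas D (fun t => u t +i* v t).
Proof. by []. Qed.

Lemma cmeas_real D (u : T -> R) : measurable_fun D u ->
  cmeas D (fun t => (u t)%:C).
Proof. by split => //; exact: measurable_cst. Qed.

Lemma cmeasD D f g : cmeas D f -> cmeas D g -> cmeas D (fun t => f t + g t).
Proof.
move=> [f1 f2] [g1 g2]; split.
  by under eq_fun do rewrite ReD; exact: measurable_funD.
by under eq_fun do rewrite ImD; exact: measurable_funD.
Qed.

Lemma cmeasN D f : cmeas D f -> cmeas D (fun t => - f t).
Proof.
move=> [f1 f2]; split.
  by under eq_fun do rewrite ReN; exact: measurable_funN.
by under eq_fun do rewrite ImN; exact: measurable_funN.
Qed.

Lemma cmeasB D f g : cmeas D f -> cmeas D g -> cmeas D (fun t => f t - g t).
Proof. by move=> mf mg; apply: cmeasD => //; exact: cmeasN. Qed.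

Lemma cmeasM D f g : cmeas D f -> cmeas D g -> cmeas D (fun t => f t * g t).
Proof.
move=> [f1 f2] [g1 g2]; split.
  under eq_fun do rewrite ReM.
  by apply: measurable_funB; exact: measurable_funM.
under eq_fun do rewrite ImM.
by apply: measurable_funD; exact: measurable_funM.
Qed.

Lemma cmeasX D f n : cmeas D f -> cmeas D (fun t => f t ^+ n).
Proof.
move=> mf; elim: n => [|n IH]; first exact: cmeas_cst.
by under eq_fun do rewrite exprS; exact: cmeasM.
Qed.

Lemma cmeas_conj D f : cmeas D f -> cmeas D (fun t => conjc (f t)).
Proof.
move=> [f1 f2]; split.
  by rewrite (_ : (fun _ => _) = (fun t => complex.Re (f t)))//; apply/funext => t; case: (f t).
rewrite (_ : (fun _ => _) = (fun t => - complex.Im (f t))).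
  exact: measurable_funN.
by apply/funext => t; case: (f t).
Qed.

Lemma cmeas_sum D (I : Type) (s : seq I) (F : I -> T -> R[i]) :
  (forall i, cmeas D (F i)) -> cmeas D (fun t => \sum_(i <- s) F i t).
Proof.
move=> mF; elim: s => [|i s IH].
  by under eq_fun do rewrite big_nil; exact: cmeas_cst.
by under eq_fun do rewrite big_cons; exact: cmeasD.
Qed.

Lemma measurable_normc D f : cmeas D f -> measurable_fun D (fun t => normc (f t)).
Proof.
move=> [f1 f2].
rewrite (_ : (fun _ => _) = @Num.sqrt R \o
    (fun t => complex.Re (f t) ^+ 2 + complex.Im (f t) ^+ 2)); last first.
  by apply/funext => t /=; case: (f t).
apply: (@measurableT_comp _ _ _ _ _ _ (Num.sqrt : R -> R)).
  by apply: continuous_measurable_fun; exact: sqrt_continuous.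
by apply: measurable_funD; exact: measurable_funX.
Qed.

Lemma cmeas_cexp D f : cmeas D f -> cmeas D (fun t => cexp (f t)).
Proof.
move=> [f1 f2]; apply: cmeasM.
  by apply: cmeas_real; apply: measurableT_comp f1; exact: measurable_expR.
apply: cmeas_pair; apply: measurableT_comp f2; apply: continuous_measurable_fun.
  exact: continuous_cos.
exact: continuous_sin.
Qed.

Lemma measurable_funVr D (u : T -> R) : measurable D -> measurable_fun D u ->
  measurable_fun D (fun t => (u t)^-1).
Proof.
move=> mD mu.
apply: (@measurable_comp _ _ _ _ _ _ setT (fun x : R => x^-1)) => //.
rewrite -(setUv [set 0 : R]).
have m0 : measurable (~` [set 0 : R]) by apply: measurableC; exact: measurable_set1.
apply/measurable_funU => //; split.
  have : measurable_fun [set 0 : R] (cst (0 : R)) by exact: measurable_cst.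
  by apply: eq_measurable_fun => x; rewrite inE/= => ->; rewrite invr0.
apply: subspace_continuous_measurable_fun => //.
apply: continuous_in_subspaceT => x; rewrite inE/= => /eqP x0.
exact: inv_continuous.
Qed.

Lemma cmeasV D f : measurable D -> cmeas D f -> cmeas D (fun t => (f t)^-1).
Proof.
move=> mD mf; have [f1 f2] := mf; have mn := measurable_normc mf.
have mi := measurable_funVr mD (measurable_funX 2 mn).
split.
  by under eq_fun do rewrite Re_inv; exact: measurable_funM.
by under eq_fun do rewrite Im_inv; apply/measurable_funN/measurable_funM.
Qed.

Lemma eq_cmeas D f g : {in D, f =1 g} -> cmeas D f -> cmeas D g.
Proof.
by move=> fg [f1 f2]; split; [move: f1|move: f2]; apply: eq_measurable_fun => x xD;
  rewrite fg.
Qed.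

Lemma cmeasS D E f : measurable E -> D `<=` E -> cmeas E f -> cmeas D f.
Proof. by move=> mE DE [f1 f2]; split; exact: measurable_funS DE _. Qed.

Lemma cmeas_indic D E : measurable E -> cmeas D (fun t => (\1_E t : R)%:C).
Proof. by move=> mE; apply: cmeas_real; exact: measurable_indic. Qed.

Lemma cmeas_cvg D (f_ : nat -> T -> R[i]) f : (forall n, cmeas D (f_ n)) ->
  (forall t, D t -> (f_ n t : R[i]^o) @[n --> \oo] --> (f t : R[i]^o)) ->
  cmeas D f.
Proof.
move=> mf_ ff; split.
  apply: (@measurable_fun_cvg _ _ _ _ (fun n t => complex.Re (f_ n t))) => [n|t Dt].
    by case: (mf_ n).
  by have /cvg_ReIm[] := ff t Dt.
apply: (@measurable_fun_cvg _ _ _ _ (fun n t => complex.Im (f_ n t))) => [n|t Dt].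
  by case: (mf_ n).
by have /cvg_ReIm[] := ff t Dt.
Qed.

End ComplexMeasurable.

Section ComplexIntegral.
Variable R : realType.
Local Notation mu := (@lebesgue_measure R).
Implicit Types (D : set R) (f g : R -> R[i]).

Lemma ae_imp (P Q : R -> Prop) : (forall t, P t -> Q t) ->
  {ae mu, forall t, P t} -> {ae mu, forall t, Q t}.
Proof. by move=> PQ; apply: (@filterS _ _ (ae_filter_ringOfSetsType mu)). Qed.

Lemma ae_imp2 (P Q S : R -> Prop) : (forall t, P t -> Q t -> S t) ->
  {ae mu, forall t, P t} -> {ae mu, forall t, Q t} -> {ae mu, forall t, S t}.
Proof.
by move=> PQ; apply: (@filterS2 _ _ (ae_filter_ringOfSetsType mu)).
Qed.

Section RealIntegrable.
Variables (D : set R) (mD : measurable D) (u v : R -> R).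
Hypotheses (iu : mu.-integrable D (EFin \o u)) (iv : mu.-integrable D (EFin \o v)).

Lemma integrable_EFinD : mu.-integrable D (EFin \o (fun t => u t + v t)).
Proof. by have : mu.-integrable D ((EFin \o u) \+ (EFin \o v))%E by apply: integrableD. Qed.

Lemma integrable_EFinB : mu.-integrable D (EFin \o (fun t => u t - v t)).
Proof. by have : mu.-integrable D ((EFin \o u) \- (EFin \o v))%E by apply: integrableB. Qed.

Lemma integrable_EFinZl k : mu.-integrable D (EFin \o (fun t => k * u t)).
Proof.
by have : mu.-integrable D (fun t => k%:E * (EFin \o u) t)%E by apply: integrableZl.
Qed.

End RealIntegrable.

Definition cintegrable D f :=
  mu.-integrable D (EFin \o (fun t => complex.Re (f t))) /\
  mu.-integrable D (EFin \o (fun t => complex.Im (f t))).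

Lemma cintegrable_cmeas D f : cintegrable D f -> cmeas D f.
Proof.
by move=> [/measurable_int/measurable_EFinP f1 /measurable_int/measurable_EFinP f2].
Qed.

Lemma cintegrable_normc D f : measurable D -> cintegrable D f ->
  mu.-integrable D (EFin \o (fun t => normc (f t))).
Proof.
move=> mD fi; have [f1 f2] := fi.
have := integrableD _ (integrable_abse f1) (integrable_abse f2) => /(_ mD).
apply: le_integrable => //.
  by apply/measurable_EFinP; exact: measurable_normc (cintegrable_cmeas fi).
move=> t Dt /=; rewrite lee_fin.
rewrite (ger0_norm (normc_ge0 _)) ger0_norm ?addr_ge0//.
exact: normc_le.
Qed.

Lemma cintegrable_le D f (h : R -> R) : measurable D -> cmeas D f ->
  mu.-integrable D (EFin \o h) -> (forall t, D t -> normc (f t) <= h t) ->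
  cintegrable D f.
Proof.
move=> mD [f1 f2] ih fh; split.
  apply: le_integrable ih => //; first exact/measurable_EFinP.
  move=> t Dt /=; rewrite lee_fin (le_trans (normRe_le _))//.
  by rewrite (le_trans (fh t Dt))// ler_norm.
apply: le_integrable ih => //; first exact/measurable_EFinP.
move=> t Dt /=; rewrite lee_fin (le_trans (normIm_le _))//.
by rewrite (le_trans (fh t Dt))// ler_norm.
Qed.

Lemma cintegrable_real D (u : R -> R) : measurable D ->
  mu.-integrable D (EFin \o u) -> cintegrable D (fun t => (u t)%:C).
Proof. by move=> mD iu; split => //=; exact: integrable0. Qed.

Lemma eq_cintegrable D f g : measurable D -> {in D, f =1 g} ->
  cintegrable D f -> cintegrable D g.
Proof.
move=> mD fg [f1 f2]; split; [apply: eq_integrable f1|apply: eq_integrable f2];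
  by move=> //= t tD; rewrite /= fg.
Qed.

Lemma cintegrableS D E f : measurable D -> measurable E -> D `<=` E ->
  cintegrable E f -> cintegrable D f.
Proof. by move=> mD mE DE [f1 f2]; split; [apply: integrableS f1|apply: integrableS f2]. Qed.

Lemma cintegrableD D f g : measurable D -> cintegrable D f -> cintegrable D g ->
  cintegrable D (fun t => f t + g t).
Proof.
move=> mD [f1 f2] [g1 g2]; split.
  by under eq_fun do rewrite ReD; exact: integrable_EFinD.
by under eq_fun do rewrite ImD; exact: integrable_EFinD.
Qed.

Lemma cintegrableZl D f (z : R[i]) : measurable D -> cintegrable D f ->
  cintegrable D (fun t => z * f t).
Proof.
move=> mD [f1 f2]; split.
  by under eq_fun do rewrite ReM; apply: integrable_EFinB => //; exact: integrable_EFinZl.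
by under eq_fun do rewrite ImM; apply: integrable_EFinD => //; exact: integrable_EFinZl.
Qed.

Lemma eq_cintegral D f g : {in D, f =1 g} -> cintegral D f = cintegral D g.
Proof. by move=> fg; congr (_ +i* _); apply: eq_Rintegral => t tD; rewrite fg. Qed.

Lemma cintegralD D f g : measurable D -> cintegrable D f -> cintegrable D g ->
  cintegral D (fun t => f t + g t) = cintegral D f + cintegral D g.
Proof.
move=> mD [f1 f2] [g1 g2]; apply: complex_eq => /=.
  by under eq_Rintegral do rewrite ReD; rewrite RintegralD.
by under eq_Rintegral do rewrite ImD; rewrite RintegralD.
Qed.

Lemma cintegralZl D f (z : R[i]) : measurable D -> cintegrable D f ->
  cintegral D (fun t => z * f t) = z * cintegral D f.
Proof.
move=> mD [f1 f2]; apply: complex_eq; rewrite ?ReM ?ImM /=.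
  under eq_Rintegral do rewrite ReM; rewrite RintegralB//; last 2 first.
  - exact: integrable_EFinZl.
  - exact: integrable_EFinZl.
  by rewrite !RintegralZl.
under eq_Rintegral do rewrite ImM; rewrite RintegralD//; last 2 first.
- exact: integrable_EFinZl.
- exact: integrable_EFinZl.
by rewrite !RintegralZl.
Qed.

Lemma cintegralZr D f (z : R[i]) : measurable D -> cintegrable D f ->
  cintegral D (fun t => f t * z) = cintegral D f * z.
Proof.
by move=> mD fi; rewrite mulrC -cintegralZl//; apply: eq_cintegral => t _; rewrite mulrC.
Qed.

Lemma cintegrableN D f : measurable D -> cintegrable D f ->
  cintegrable D (fun t => - f t).
Proof.
move=> mD /(cintegrableZl (-1) mD); apply: eq_cintegrable => // t _.
by rewrite mulN1r.
Qed.

Lemma cintegrableB D f g : measurable D -> cintegrable D f -> cintegrable D g ->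
  cintegrable D (fun t => f t - g t).
Proof. by move=> mD fi gi; apply: cintegrableD => //; exact: cintegrableN. Qed.

Lemma cintegralB D f g : measurable D -> cintegrable D f -> cintegrable D g ->
  cintegral D (fun t => f t - g t) = cintegral D f - cintegral D g.
Proof.
move=> mD fi gi; rewrite cintegralD//; last exact: cintegrableN.
by rewrite -[in RHS]mulN1r -cintegralZl//; congr +%R; apply: eq_cintegral => t _;
  rewrite mulN1r.
Qed.

Lemma cintegral_real D (u : R -> R) :
  cintegral D (fun t => (u t)%:C) = (\int[mu]_(t in D) u t)%:C.
Proof.
apply: complex_eq => //=.
by rewrite /Rintegral (eq_integral (cst 0)%E)// integral0.
Qed.

Lemma cintegral_cst0 D : cintegral D (fun=> 0) = 0 :> R[i].
Proof. by rewrite (cintegral_real D (fun=> 0)) /Rintegral integral0. Qed.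

(** Rotating the integral onto the positive real axis reduces this to the
    monotonicity of the real integral. *)
Lemma le_normc_cintegral D f : measurable D -> cintegrable D f ->
  normc (cintegral D f) <= \int[mu]_(t in D) normc (f t).
Proof.
move=> mD fi; set z := cintegral D f.
have [z0|z0] := eqVneq z 0; first by rewrite z0 normc0 Rintegral_ge0// => *; exact: normc_ge0.
have nf := cintegrable_normc mD fi.
have : normc z ^+ 2 <= normc z * \int[mu]_(t in D) normc (f t).
  have -> : normc z ^+ 2 = complex.Re (cintegral D (fun t => conjc z * f t)).
    by rewrite cintegralZl// mulrC mulc_conj.
  rewrite -RintegralZl//; apply: (@le_Rintegral _ _ _ mu) => //.
  - by have [] := cintegrableZl (conjc z) mD fi.
  - exact: integrable_EFinZl.
  - move=> t Dt; rewrite (le_trans (ler_norm _))// (le_trans (normRe_le _))//.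
    by rewrite normcM normc_conj.
by rewrite expr2 ler_pM2l// normc_gt0.
Qed.

Lemma le_normc_cintegral_bound D f (h : R -> R) : measurable D -> cmeas D f ->
  mu.-integrable D (EFin \o h) -> (forall t, D t -> normc (f t) <= h t) ->
  normc (cintegral D f) <= \int[mu]_(t in D) h t.
Proof.
move=> mD mf ih fh; have fi := cintegrable_le mD mf ih fh.
rewrite (le_trans (le_normc_cintegral mD fi))// le_Rintegral//.
exact: cintegrable_normc.
Qed.

Lemma cintegral_ae_eq D f g : measurable D -> cmeas D f -> cmeas D g ->
  ae_eq mu D f g -> cintegral D f = cintegral D g.
Proof.
move=> mD [f1 f2] [g1 g2] fg; apply: complex_eq => /=; congr fine;
  apply: ae_eq_integral => //; try (by apply/measurable_EFinP);
  by move: fg; apply: ae_imp => t fgt Dt; rewrite fgt.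
Qed.

Lemma Rintegral_dominated D (u_ : nat -> R -> R) (u h : R -> R) :
  measurable D -> (forall n, measurable_fun D (u_ n)) -> measurable_fun D u ->
  {ae mu, forall t, D t -> u_ n t @[n --> \oo] --> u t} ->
  mu.-integrable D (EFin \o h) ->
  (forall n t, D t -> `|u_ n t| <= h t) ->
  mu.-integrable D (EFin \o u) /\
  \int[mu]_(t in D) u_ n t @[n --> \oo] --> \int[mu]_(t in D) u t.
Proof.
move=> mD mu_ mu0 uu ih uh.
have [||||iu _ uc] := @dominated_convergence _ _ _ mu D mD
  (fun n => EFin \o u_ n) (EFin \o u) (EFin \o h) _ _ _ ih.
- by move=> n; apply/measurable_EFinP; exact: mu_.
- by apply/measurable_EFinP; exact: mu0.
- by move: uu; apply: ae_imp => t uu Dt; apply: cvg_EFin; [exact: nearW|exact: uu].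
- by apply: aeW => t n Dt; rewrite /= lee_fin uh.
- split => //; apply: fine_cvg; rewrite fineK//; exact: integrable_fin_num.
Qed.

Lemma cintegral_dominated D (f_ : nat -> R -> R[i]) f (h : R -> R) :
  measurable D -> (forall n, cmeas D (f_ n)) -> cmeas D f ->
  {ae mu, forall t, D t -> (f_ n t : R[i]^o) @[n --> \oo] --> (f t : R[i]^o)} ->
  mu.-integrable D (EFin \o h) ->
  (forall n t, D t -> normc (f_ n t) <= h t) ->
  (cintegral D (f_ n) : R[i]^o) @[n --> \oo] --> (cintegral D f : R[i]^o).
Proof.
move=> mD mf_ [f1 f2] ff ih fh; apply/cvg_ReIm => /=; split.
  have [|||//] := @Rintegral_dominated D (fun n t => complex.Re (f_ n t))
    (fun t => complex.Re (f t)) h mD _ f1 _ ih.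
  - by move=> n; have [] := mf_ n.
  - by move: ff; apply: ae_imp => t ff Dt; have /cvg_ReIm[] := ff Dt.
  - by move=> n t Dt; rewrite (le_trans (normRe_le _))// fh.
have [|||//] := @Rintegral_dominated D (fun n t => complex.Im (f_ n t))
  (fun t => complex.Im (f t)) h mD _ f2 _ ih.
- by move=> n; have [] := mf_ n.
- by move: ff; apply: ae_imp => t ff Dt; have /cvg_ReIm[] := ff Dt.
- by move=> n t Dt; rewrite (le_trans (normIm_le _))// fh.
Qed.

Lemma cintegral_indic D E f : measurable D ->
  cintegral D (fun t => f t * (\1_E t)%:C) = cintegral (D `&` E) f.
Proof.
have h (u : R -> R) : \int[mu]_(t in D `&` E) u t = \int[mu]_(t in D) (u t * \1_E t).
  rewrite Rintegral_mkcondr; apply: eq_Rintegral => t _.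
  by rewrite patchE indicE; case: (t \in E); rewrite ?mulr1 ?mulr0.
move=> mD; apply: complex_eq => /=; rewrite h; apply: eq_Rintegral => t _.
  by rewrite ReM /= mulr0 subr0.
by rewrite ImM /= mulr0 add0r.
Qed.

End ComplexIntegral.

(** * The space of square integrable functions *)

Section SquareIntegrable.
Variable R : realType.
Local Notation mu := (@lebesgue_measure R).
Implicit Types (D : set R) (f g : R -> R[i]).

Definition sqn D f : \bar R := (\int[mu]_(t in D) (normc (f t) ^+ 2)%:E)%E.

Definition nrm D f : R := Num.sqrt (fine (sqn D f)).

Lemma sqn_ge0 D f : (0 <= sqn D f)%E.
Proof. by apply: integral_ge0 => t _; rewrite lee_fin sqr_ge0. Qed.

Lemma nrm_ge0 D f : 0 <= nrm D f.
Proof. exact: sqrtr_ge0. Qed.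

Lemma L2norm_sqn D f : L2norm D f = sqrte (sqn D f).
Proof.
rewrite /L2norm Lnorm.unlock poweR12_sqrt; last first.
  by apply: integral_ge0 => t _; exact: poweR_ge0.
congr sqrte; rewrite /sqn [RHS]integral_mkcond; apply: eq_integral => t _.
rewrite abse_EFin poweR_EFin powR_mulrn// patchE indicE.
case: (t \in D); rewrite ?mulr1 ?mulr0 /= ?normr0 ?expr0n//=.
by rewrite ger0_norm ?normc_ge0.
Qed.

Lemma measurable_sqn D f : cmeas D f ->
  measurable_fun D (fun t => (normc (f t) ^+ 2)%:E).
Proof. by move=> mf; apply/measurable_EFinP/measurable_funX; exact: measurable_normc. Qed.

Lemma isL2P D f : isL2 D f <-> cmeas D f /\ (sqn D f < +oo)%E.
Proof.
rewrite /isL2 L2norm_sqn.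
have -> : (sqrte (sqn D f) < +oo)%E = (sqn D f < +oo)%E.
  have := sqn_ge0 D f; case: (sqn D f) => [r|//|//] _; by rewrite /= !ltry.
by split=> [[f1 f2 ?]|[[f1 f2] ?]].
Qed.

Lemma isL2_cmeas D f : isL2 D f -> cmeas D f.
Proof. by case/isL2P. Qed.

Lemma L2norm_nrm D f : isL2 D f -> L2norm D f = (nrm D f)%:E.
Proof.
case/isL2P => _; rewrite L2norm_sqn /nrm; have := sqn_ge0 D f.
by case: (sqn D f).
Qed.

Lemma sqn_fin D f : isL2 D f -> sqn D f = (nrm D f ^+ 2)%:E.
Proof.
case/isL2P => _; rewrite /nrm; have := sqn_ge0 D f.
by case: (sqn D f) => //= r; rewrite lee_fin => r0 _; rewrite sqr_sqrtr.
Qed.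

Lemma isL2_integrable D f : isL2 D f ->
  mu.-integrable D (EFin \o (fun t => normc (f t) ^+ 2)).
Proof.
case/isL2P => mf fy; apply/integrableP; split; first exact: measurable_sqn.
apply: le_lt_trans fy; rewrite /sqn le_eqVlt; apply/orP; left; apply/eqP.
by apply: eq_integral => t _; rewrite /= ger0_norm// sqr_ge0.
Qed.

Lemma nrm_sqr D f : nrm D f ^+ 2 = \int[mu]_(t in D) (normc (f t) ^+ 2).
Proof. by rewrite sqr_sqrtr// fine_ge0// sqn_ge0. Qed.

Lemma isL2_le D f (h : R -> R) : measurable D -> cmeas D f ->
  mu.-integrable D (EFin \o h) -> (forall t, D t -> normc (f t) ^+ 2 <= h t) ->
  isL2 D f.
Proof.
move=> mD mf ih fh; apply/isL2P; split => //.
have /integrableP[_] : mu.-integrable D (EFin \o (fun t => normc (f t) ^+ 2)).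
  apply: le_integrable ih => //; first exact: measurable_sqn.
  move=> t Dt /=; rewrite lee_fin ger0_norm ?sqr_ge0//.
  by rewrite (le_trans (fh t Dt))// ler_norm.
apply: le_lt_trans; rewrite /sqn le_eqVlt; apply/orP; left; apply/eqP.
by apply: eq_integral => t _; rewrite /= ger0_norm// sqr_ge0.
Qed.

Lemma eq_isL2 D f g : measurable D -> {in D, f =1 g} -> isL2 D f -> isL2 D g.
Proof.
move=> mD fg lf; apply: (isL2_le mD _ (isL2_integrable lf)).
  by apply: eq_cmeas fg _; exact: isL2_cmeas.
by move=> t Dt; rewrite fg// inE.
Qed.

Lemma isL2_dominated D f g : measurable D -> cmeas D f -> isL2 D g ->
  (forall t, D t -> normc (f t) <= normc (g t)) -> isL2 D f.
Proof.
move=> mD mf lg fg; apply: (isL2_le mD mf (isL2_integrable lg)) => t Dt.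
by rewrite ler_pXn2r ?nnegrE ?normc_ge0// fg.
Qed.

Lemma isL2_cst0 D : measurable D -> isL2 D (fun=> 0 : R[i]).
Proof.
move=> mD; apply: (isL2_le (h := cst 0) mD (cmeas_cst _ _)).
  exact: integrable0.
by move=> t _; rewrite normc0 expr0n.
Qed.

Lemma isL2Zl D f (z : R[i]) : measurable D -> isL2 D f ->
  isL2 D (fun t => z * f t).
Proof.
move=> mD lf.
apply: (isL2_le mD _ (integrable_EFinZl mD (isL2_integrable lf) (normc z ^+ 2))).
  by apply: cmeasM; [exact: cmeas_cst|exact: isL2_cmeas].
by move=> t _; rewrite normcM exprMn.
Qed.

Lemma isL2D D f g : measurable D -> isL2 D f -> isL2 D g ->
  isL2 D (fun t => f t + g t).
Proof.
move=> mD lf lg.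
have i2 := integrable_EFinZl mD (integrable_EFinD mD (isL2_integrable lf)
  (isL2_integrable lg)) 2.
apply: (isL2_le mD _ i2) => [|t _]; first by apply: cmeasD; exact: isL2_cmeas.
have : normc (f t + g t) ^+ 2 <= (normc (f t) + normc (g t)) ^+ 2.
  by rewrite ler_pXn2r ?nnegrE ?addr_ge0 ?normc_ge0// ler_normcD.
by move=> /le_trans; apply; have := sqr_ge0 (normc (f t) - normc (g t)); nra.
Qed.

Lemma isL2N D f : measurable D -> isL2 D f -> isL2 D (fun t => - f t).
Proof.
move=> mD /(isL2Zl (-1) mD); apply: eq_isL2 => // t _; by rewrite mulN1r.
Qed.

Lemma isL2B D f g : measurable D -> isL2 D f -> isL2 D g ->
  isL2 D (fun t => f t - g t).
Proof. by move=> mD lf lg; apply: isL2D => //; exact: isL2N. Qed.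

Lemma isL2_conj D f : measurable D -> isL2 D f -> isL2 D (fun t => conjc (f t)).
Proof.
move=> mD lf; apply: (isL2_dominated mD _ lf).
  by apply: cmeas_conj; exact: isL2_cmeas.
by move=> t _; rewrite normc_conj.
Qed.

Lemma isL2_indic D E f : measurable D -> measurable E -> isL2 D f ->
  isL2 D (fun t => f t * (\1_E t)%:C).
Proof.
move=> mD mE lf; apply: (isL2_dominated mD _ lf).
  by apply: cmeasM; [exact: isL2_cmeas|exact: cmeas_indic].
move=> t _; rewrite normcM normc_real ger0_norm ?indicE ?ler0n//.
by rewrite ler_piMr ?normc_ge0//; case: (_ \in _).
Qed.

Lemma isL2S D E f : measurable D -> measurable E -> D `<=` E -> isL2 E f ->
  isL2 D f.
Proof.
move=> mD mE DE lf.
apply: (isL2_le (h := fun t => normc (f t) ^+ 2) mD) => //.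
  by apply: cmeasS DE (isL2_cmeas lf).
by apply: integrableS (isL2_integrable lf).
Qed.

Lemma isL2_sum D (I : Type) (s : seq I) (F : I -> R -> R[i]) : measurable D ->
  (forall i, isL2 D (F i)) -> isL2 D (fun t => \sum_(i <- s) F i t).
Proof.
move=> mD lF; elim: s => [|i s IH].
  by under eq_fun do rewrite big_nil; exact: isL2_cst0.
by under eq_fun do rewrite big_cons; exact: isL2D.
Qed.

Lemma eq_nrm D f g : {in D, f =1 g} -> nrm D f = nrm D g.
Proof.
by move=> fg; rewrite /nrm /sqn; congr (Num.sqrt (fine _)); apply: eq_integral => t tD;
  rewrite fg.
Qed.

Lemma nrmN D f : nrm D (fun t => - f t) = nrm D f.
Proof.
by rewrite /nrm /sqn; congr (Num.sqrt (fine _)); apply: eq_integral => t _;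
  rewrite normcNr.
Qed.

Lemma nrm_distC D f g : nrm D (fun t => f t - g t) = nrm D (fun t => g t - f t).
Proof. by rewrite -nrmN; apply: eq_nrm => t _; rewrite opprB. Qed.

Lemma nrmZ D f (z : R[i]) : measurable D -> isL2 D f ->
  nrm D (fun t => z * f t) = normc z * nrm D f.
Proof.
move=> mD lf; apply: (pexpIrn (n := 2)) => //; rewrite ?nnegrE ?mulr_ge0 ?nrm_ge0 ?normc_ge0//.
rewrite exprMn !nrm_sqr -RintegralZl//; last exact: isL2_integrable.
by apply: eq_Rintegral => t _; rewrite normcM exprMn.
Qed.

Lemma nrm_le D f g : measurable D -> isL2 D f -> isL2 D g ->
  (forall t, D t -> normc (f t) <= normc (g t)) -> nrm D f <= nrm D g.
Proof.
move=> mD lf lg fg; rewrite -(ler_pXn2r (n := 2))// ?nnegrE ?nrm_ge0// !nrm_sqr.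
apply: le_Rintegral => //; try exact: isL2_integrable.
by move=> t Dt; rewrite ler_pXn2r ?nnegrE ?normc_ge0// fg.
Qed.

Lemma isL2_mul_integrable D f g : measurable D -> isL2 D f -> isL2 D g ->
  mu.-integrable D (EFin \o (fun t => normc (f t) * normc (g t))).
Proof.
move=> mD lf lg.
have i2 := integrable_EFinD mD (isL2_integrable lf) (isL2_integrable lg).
apply: le_integrable i2 => //.
  apply/measurable_EFinP.
  by apply: measurable_funM; apply: measurable_normc; exact: isL2_cmeas.
move=> t _; rewrite /= lee_fin !ger0_norm ?addr_ge0 ?sqr_ge0 ?mulr_ge0 ?normc_ge0//.
by have := normc_ge0 (f t); have := normc_ge0 (g t); nra.
Qed.

(** The Cauchy-Schwarz inequality: the weighted inequality
    2xy <= cx^2 + y^2/c is integrated with the weight c that balances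
    the two terms. *)
Lemma cauchy_schwarz D f g : measurable D -> isL2 D f -> isL2 D g ->
  \int[mu]_(t in D) (normc (f t) * normc (g t)) <= nrm D f * nrm D g.
Proof.
move=> mD lf lg; set I := Rintegral _ _ _.
have key (a b : R) : 0 < a -> 0 < b -> nrm D f <= a -> nrm D g <= b -> I <= a * b.
  move=> a0 b0 fa gb.
  have h : I <= \int[mu]_(t in D) ((b / a / 2) * normc (f t) ^+ 2 +
                                   (a / b / 2) * normc (g t) ^+ 2).
    apply: le_Rintegral => //; first exact: isL2_mul_integrable.
      by apply: integrable_EFinD => //; apply: integrable_EFinZl => //; exact: isL2_integrable.
    move=> t _; set x := normc (f t); set y := normc (g t).
    have : 0 <= (b * x - a * y) ^+ 2 / (2 * a * b).
      by rewrite divr_ge0 ?sqr_ge0// !mulr_ge0// ltW.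
    rewrite (_ : _ / _ = b / a / 2 * x ^+ 2 + a / b / 2 * y ^+ 2 - x * y); first by rewrite subr_ge0.
    by field; rewrite !gt_eqF.
  rewrite (le_trans h)// RintegralD//; last 2 first.
  - by apply: integrable_EFinZl => //; exact: isL2_integrable.
  - by apply: integrable_EFinZl => //; exact: isL2_integrable.
  rewrite !RintegralZl//; try exact: isL2_integrable.
  rewrite -!nrm_sqr.
  have -> : a * b = b / a / 2 * a ^+ 2 + a / b / 2 * b ^+ 2.
    by field; rewrite !gt_eqF.
  have a0' := ltW a0; have b0' := ltW b0.
  by rewrite lerD// ler_wpM2l ?ler_pXn2r ?nnegrE ?nrm_ge0 ?divr_ge0.
have [f0|f0] := eqVneq (nrm D f) 0.
  rewrite f0 mul0r; apply/ler_addgt0Pr => e e0; rewrite add0r.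
  have b0 : 0 < nrm D g + 1 by rewrite ltr_wpDl ?nrm_ge0.
  rewrite -[e](divfK (lt0r_neq0 b0)); apply: key => //; rewrite ?divr_gt0//.
    by rewrite f0 divr_ge0 ?ltW.
  by rewrite lerDl.
have [g0|g0] := eqVneq (nrm D g) 0.
  rewrite g0 mulr0; apply/ler_addgt0Pr => e e0; rewrite add0r.
  have a0 : 0 < nrm D f + 1 by rewrite ltr_wpDl ?nrm_ge0.
  rewrite -[e](divfK (lt0r_neq0 a0)) mulrC; apply: key => //; rewrite ?divr_gt0//.
    by rewrite lerDl.
  by rewrite g0 divr_ge0 ?ltW.
by apply: key => //; rewrite lt_def ?f0 ?g0 nrm_ge0.
Qed.

Lemma isL2_mul_cintegrable D f g : measurable D -> isL2 D f -> isL2 D g ->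
  cintegrable D (fun t => f t * g t).
Proof.
move=> mD lf lg; apply: (cintegrable_le mD _ (isL2_mul_integrable mD lf lg)).
  by apply: cmeasM; exact: isL2_cmeas.
by move=> t _; rewrite normcM.
Qed.

Lemma normc_cintegralM_le D f g : measurable D -> isL2 D f -> isL2 D g ->
  normc (cintegral D (fun t => f t * g t)) <= nrm D f * nrm D g.
Proof.
move=> mD lf lg; apply: le_trans (cauchy_schwarz mD lf lg).
apply: le_normc_cintegral_bound => //.
- by apply: cmeasM; exact: isL2_cmeas.
- exact: isL2_mul_integrable.
- by move=> t _; rewrite normcM.
Qed.

Lemma ler_nrmD D f g : measurable D -> isL2 D f -> isL2 D g ->
  nrm D (fun t => f t + g t) <= nrm D f + nrm D g.
Proof.
move=> mD lf lg; rewrite -(ler_pXn2r (n := 2))// ?nnegrE ?addr_ge0 ?nrm_ge0//.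
have fi := isL2_integrable lf; have gi := isL2_integrable lg.
have fgi := isL2_mul_integrable mD lf lg.
have i2 := integrable_EFinZl mD fgi 2.
apply: (@le_trans _ _ (\int[mu]_(t in D) (normc (f t) ^+ 2 +
   2 * (normc (f t) * normc (g t)) + normc (g t) ^+ 2))).
  rewrite nrm_sqr; apply: le_Rintegral => //.
  - by apply: isL2_integrable; exact: isL2D.
  - by apply: integrable_EFinD => //; exact: integrable_EFinD.
  - move=> t _.
    have : normc (f t + g t) ^+ 2 <= (normc (f t) + normc (g t)) ^+ 2.
      by rewrite ler_pXn2r ?nnegrE ?addr_ge0 ?normc_ge0// ler_normcD.
    by move=> /le_trans; apply; rewrite le_eqVlt; apply/orP; left; apply/eqP; ring.
rewrite RintegralD//; last exact: integrable_EFinD.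
rewrite RintegralD// RintegralZl// -!nrm_sqr.
have := cauchy_schwarz mD lf lg; set I := Rintegral _ _ _ => h.
by move: h; nra.
Qed.

Lemma ler_nrm_distD D f g h : measurable D -> isL2 D f -> isL2 D g -> isL2 D h ->
  nrm D (fun t => f t - h t) <=
  nrm D (fun t => f t - g t) + nrm D (fun t => g t - h t).
Proof.
move=> mD lf lg lh.
rewrite (@eq_nrm _ _ (fun t => (f t - g t) + (g t - h t))); last first.
  by move=> t _; rewrite addrA subrK.
by apply: ler_nrmD => //; exact: isL2B.
Qed.

Lemma lerB_nrm D f g : measurable D -> isL2 D f -> isL2 D g ->
  `|nrm D f - nrm D g| <= nrm D (fun t => f t - g t).
Proof.
move=> mD lf lg; have lfg := isL2B mD lf lg.
rewrite ler_norml; apply/andP; split.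
  rewrite lerNl opprB lerBlDr nrm_distC.
  rewrite (@eq_nrm _ g (fun t => (g t - f t) + f t)); last by move=> t _; rewrite subrK.
  by apply: ler_nrmD => //; exact: isL2B.
rewrite lerBlDr (@eq_nrm _ f (fun t => (f t - g t) + g t)); last first.
  by move=> t _; rewrite subrK.
exact: ler_nrmD.
Qed.

Lemma nrm_ae_eq D f g : measurable D -> cmeas D f -> cmeas D g ->
  ae_eq mu D f g -> nrm D f = nrm D g.
Proof.
move=> mD mf mg fg; rewrite /nrm /sqn; congr (Num.sqrt (fine _)).
apply: ae_eq_integral => //; try exact: measurable_sqn.
by move: fg; apply: ae_imp => t fgt Dt; rewrite fgt.
Qed.

Lemma isL2_ae_eq D f g : measurable D -> isL2 D f -> cmeas D g ->
  ae_eq mu D f g -> isL2 D g.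
Proof.
move=> mD /isL2P[mf fy] mg fg; apply/isL2P; split => //.
apply: le_lt_trans fy; rewrite /sqn le_eqVlt; apply/orP; left; apply/eqP.
apply: ae_eq_integral => //; try exact: measurable_sqn.
by move: fg; apply: ae_imp => t fgt Dt; rewrite fgt.
Qed.

Lemma nrm0_ae_eq D f g : measurable D -> isL2 D f -> isL2 D g ->
  nrm D (fun t => f t - g t) = 0 -> ae_eq mu D f g.
Proof.
move=> mD lf lg n0; have lfg := isL2B mD lf lg.
have : (\int[mu]_(t in D) `|(normc (f t - g t) ^+ 2)%:E| = 0)%E.
  transitivity (sqn D (fun t => f t - g t)); last by rewrite sqn_fin// n0 expr0n.
  by apply: eq_integral => t _; rewrite gee0_abs// lee_fin sqr_ge0.
move/(ae_eq_integral_abs mu mD) => h.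
have {h} : ae_eq mu D (fun t => (normc (f t - g t) ^+ 2)%:E) (cst 0%E).
  apply: h.
  by apply: measurable_sqn; exact: isL2_cmeas.
apply: ae_imp => t h /h[] /eqP; rewrite sqrf_eq0 normc_eq0 subr_eq0.
by move/eqP.
Qed.

Lemma nrm_dominated D (f_ : nat -> R -> R[i]) f g : measurable D ->
  (forall n, cmeas D (f_ n)) -> isL2 D f -> isL2 D g ->
  {ae mu, forall t, D t -> (f_ n t : R[i]^o) @[n --> \oo] --> (f t : R[i]^o)} ->
  (forall n t, D t -> normc (f_ n t) <= normc (g t)) ->
  nrm D (fun t => f_ n t - f t) @[n --> \oo] --> 0.
Proof.
move=> mD mf_ lf lg ff fg.
have lf_ n : isL2 D (f_ n) by exact: isL2_dominated lg (fg n).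
have ih : mu.-integrable D (EFin \o (fun t => 2 * (normc (g t) ^+ 2 + normc (f t) ^+ 2))).
  apply: integrable_EFinZl => //.
  by apply: integrable_EFinD => //; exact: isL2_integrable.
have [||||_] := @Rintegral_dominated _ D (fun n t => normc (f_ n t - f t) ^+ 2)
    (cst 0) _ mD _ _ _ ih.
- move=> n; apply: measurable_funX; apply: measurable_normc.
  by apply: cmeasB => //; exact: isL2_cmeas.
- exact: measurable_cst.
- move: ff; apply: ae_imp => t h /h /cvg_normc0P c.
  have -> : cst 0 t = 0 * 0 :> R by rewrite mulr0.
  by under eq_fun do rewrite expr2; apply: cvgM.
- move=> n t Dt; rewrite ger0_norm ?sqr_ge0//.
  have h1 : normc (f_ n t - f t) ^+ 2 <= (normc (g t) + normc (f t)) ^+ 2.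
    rewrite ler_pXn2r ?nnegrE ?addr_ge0 ?normc_ge0//.
    by rewrite (le_trans (ler_normcB _ _))// lerD2r fg.
  rewrite (le_trans h1)//.
  by have := sqr_ge0 (normc (g t) - normc (f t)); nra.
rewrite [X in _ --> X]Rintegral_cst// mul0r => c.
have -> : (0 : R) = Num.sqrt 0 by rewrite sqrtr0.
rewrite (_ : (fun n => _) = (fun n => Num.sqrt
  (\int[mu]_(t in D) (normc (f_ n t - f t) ^+ 2)))); last first.
  by apply/funext => n.
by apply: continuous_cvg c; exact: sqrt_continuous.
Qed.

End SquareIntegrable.

(** * Limits and the fundamental theorem of calculus *)

Section ComplexLimits.
Variables (R : realType) (T : Type) (F : set_system T).
Context {FF : Filter F}.
Implicit Types (f g : T -> R[i]) (a b : R[i]).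

Lemma ccvgD f g a b :
  (f x : R[i]^o) @[x --> F] --> (a : R[i]^o) ->
  (g x : R[i]^o) @[x --> F] --> (b : R[i]^o) ->
  (f x + g x : R[i]^o) @[x --> F] --> (a + b : R[i]^o).
Proof. exact: (@cvgD _ R[i]^o). Qed.

Lemma ccvgB f g a b :
  (f x : R[i]^o) @[x --> F] --> (a : R[i]^o) ->
  (g x : R[i]^o) @[x --> F] --> (b : R[i]^o) ->
  (f x - g x : R[i]^o) @[x --> F] --> (a - b : R[i]^o).
Proof. exact: (@cvgB _ R[i]^o). Qed.

Lemma ccvgM f g a b :
  (f x : R[i]^o) @[x --> F] --> (a : R[i]^o) ->
  (g x : R[i]^o) @[x --> F] --> (b : R[i]^o) ->
  (f x * g x : R[i]^o) @[x --> F] --> (a * b : R[i]^o).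
Proof. exact: (@cvgM R[i]). Qed.

Lemma ccvg_cst a : (a : R[i]^o) @[x --> F] --> (a : R[i]^o).
Proof. exact: cvg_cst. Qed.

Lemma ccvgMl f a b :
  (f x : R[i]^o) @[x --> F] --> (a : R[i]^o) ->
  (b * f x : R[i]^o) @[x --> F] --> (b * a : R[i]^o).
Proof. by apply: ccvgM; exact: ccvg_cst. Qed.

Lemma ccvgV f a : a != 0 ->
  (f x : R[i]^o) @[x --> F] --> (a : R[i]^o) ->
  ((f x)^-1 : R[i]^o) @[x --> F] --> (a^-1 : R[i]^o).
Proof. by move=> a0; exact: (@cvgV R[i]). Qed.

Lemma ccvg_unique {PF : ProperFilter F} f a b :
  (f x : R[i]^o) @[x --> F] --> (a : R[i]^o) ->
  (f x : R[i]^o) @[x --> F] --> (b : R[i]^o) -> a = b.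
Proof. by apply: cvg_unique; exact: norm_hausdorff. Qed.

Lemma ccvg_normc f a : (f x : R[i]^o) @[x --> F] --> (a : R[i]^o) ->
  normc (f x) @[x --> F] --> normc a.
Proof.
move/cvg_normcP => fa; apply/cvgrPdist_lt => e e0; apply: filterS (fa e e0) => x.
apply: le_lt_trans; rewrite ler_norml lerNl opprB.
by rewrite lerB_normc normc_distC lerB_normc.
Qed.

End ComplexLimits.

(** * The Laplace transform on the half line *)

Section FundamentalTheorem.
Variable R : realType.
Local Notation mu := (@lebesgue_measure R).
Implicit Types (f F : R -> R[i]).

Lemma cderiv_continuous f t d : cderiv f t d ->
  {for t, continuous (fun s => complex.Re (f s))} /\
  {for t, continuous (fun s => complex.Im (f s))}.
Proof.
by move=> [[d1 _] [d2 _]]; split; apply: differentiable_continuous;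
  exact/derivable1_diffP.
Qed.

Lemma continuous_cmeas D f : measurable D ->
  continuous (fun s => complex.Re (f s)) ->
  continuous (fun s => complex.Im (f s)) -> cmeas D f.
Proof.
by move=> mD c1 c2; split; (apply: (@measurable_funS _ _ _ _ setT) => //);
  exact: continuous_measurable_fun.
Qed.

Lemma cderiv_cmeas D f f' : measurable D -> (forall t, cderiv f t (f' t)) ->
  cmeas D f.
Proof.
move=> mD fd; apply: continuous_cmeas => // t.
  by have [] := cderiv_continuous (fd t).
by have [] := cderiv_continuous (fd t).
Qed.

Lemma Rintegral_FTC2 (u U : R -> R) (a b : R) : a < b ->
  continuous u -> (forall t : R, is_derive t 1 U (u t)) ->
  \int[mu]_(t in `[a, b]) u t = U b - U a.
Proof.
move=> ab cu dU; rewrite /Rintegral (@continuous_FTC2 _ _ U)//.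
- exact: continuous_subspaceT.
- have cU : continuous U.
    move=> t; apply: differentiable_continuous; apply/derivable1_diffP.
    by have [] := dU t.
  split.
  + by move=> t _; have [] := dU t.
  + exact: cvg_at_right_filter (cU a).
  + exact: cvg_at_left_filter (cU b).
- by move=> t _; rewrite derive1E; have [_ ->] := dU t.
Qed.

Lemma cintegral_FTC2 F f f' (a b : R) : a < b ->
  (forall t, cderiv F t (f t)) -> (forall t, cderiv f t (f' t)) ->
  cintegral `[a, b] f = F b - F a.
Proof.
move=> ab dF df; apply: complex_eq; rewrite /= ?ReD ?ImD ?ReN ?ImN.
  apply: (Rintegral_FTC2 (U := fun t => complex.Re (F t))) => //.
    by move=> t; have [] := cderiv_continuous (df t).
  by move=> t; have [] := dF t.
apply: (Rintegral_FTC2 (U := fun t => complex.Im (F t))) => //.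
  by move=> t; have [] := cderiv_continuous (df t).
by move=> t; have [] := dF t.
Qed.

Lemma integrable_ge0 D (u : R -> R) : measurable_fun D u ->
  (forall t, D t -> 0 <= u t) -> (\int[mu]_(t in D) (u t)%:E < +oo)%E ->
  mu.-integrable D (EFin \o u).
Proof.
move=> mu_ u0 uy; apply/integrableP; split; first exact/measurable_EFinP.
apply: le_lt_trans uy; rewrite le_eqVlt; apply/orP; left; apply/eqP.
by apply: eq_integral => t /[1!inE] Dt; rewrite /= ger0_norm ?u0.
Qed.

(** The truncations of [f] to the segments are dominated by [f] itself. *)
Lemma cintegral_FTC_exhaust D F f f' (a b : nat -> R) (l : R[i]) :
  measurable D -> (forall t, cderiv F t (f t)) -> (forall t, cderiv f t (f' t)) ->
  cintegrable D f -> (forall n, a n < b n) -> (forall n, `[a n, b n] `<=` D) ->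
  (forall t, D t -> \forall n \near \oo, t \in `[a n, b n]) ->
  (F (b n) - F (a n) : R[i]^o) @[n --> \oo] --> (l : R[i]^o) ->
  cintegral D f = l.
Proof.
move=> mD dF df fi ab abD Dab Fl.
have mf := cintegrable_cmeas fi.
have : (cintegral D (fun t => f t * (\1_(`[a n, b n]%classic : set R) t)%:C) : R[i]^o)
    @[n --> \oo] --> (cintegral D f : R[i]^o).
  apply: (@cintegral_dominated _ D _ _ (fun t => normc (f t))) => //.
  - by move=> n; apply: cmeasM => //; exact: cmeas_indic.
  - apply: aeW => t Dt; apply: cvg_near_cst; apply: filterS (Dab t Dt) => n tab.
    by rewrite indicE mem_set//= mulr1.
  - exact: cintegrable_normc.
  - move=> n t Dt; rewrite normcM normc_real ger0_norm ?indicE ?ler0n//.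
    by rewrite ler_piMr ?normc_ge0//; case: (_ \in _).
have -> : (fun n => cintegral D (fun t => f t * (\1_(`[a n, b n]%classic : set R) t)%:C) : R[i]^o) =
    (fun n => F (b n) - F (a n)).
  apply/funext => n; rewrite cintegral_indic// (_ : D `&` _ = `[a n, b n]%classic).
    exact: cintegral_FTC2 df.
  by apply: setIidr; exact: abD.
by move=> h; exact: ccvg_unique h Fl.
Qed.

End FundamentalTheorem.

Section Exponentials.
Variable R : realType.
Local Notation mu := (@lebesgue_measure R).

Lemma measurable_Rplus : measurable (Rplus : set R).
Proof. exact: measurable_itv. Qed.

Lemma RplusP (t : R) : Rplus t <-> 0 <= t.
Proof. by rewrite /Rplus /= in_itv/= andbT. Qed.

Lemma expR_le1 (x : R) : x <= 0 -> expR x <= 1.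
Proof. by move=> x0; rewrite -expR0 ler_expR. Qed.

Lemma integrable_expN (c : R) : 0 < c ->
  mu.-integrable Rplus (EFin \o (fun t => expR (- (c * t)))).
Proof.
move=> c0.
have dE (t : R) : is_derive t 1 (fun t => - (c^-1 * expR (- (c * t)))) (expR (- (c * t))).
  have d1 : is_derive t 1 (fun s : R => - (c * s)) (- c).
    rewrite (_ : (fun s : R => - (c * s)) = - (c *: (@id R)))//.
    by apply: is_derive_eq; rewrite /GRing.scale/= mulr1.
  have d2 : is_derive t 1 (expR \o (fun s => - (c * s))) (expR (- (c * t)) * (- c)).
    exact: is_derive1_comp.
  rewrite (_ : (fun t => _) = - (c^-1 *: (expR \o (fun s => - (c * s)))))//.
  apply: is_derive_eq; rewrite /GRing.scale/=; field; exact: lt0r_neq0.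
have ce : continuous (fun t : R => expR (- (c * t))).
  move=> t; apply: continuous_comp; last exact: continuous_expR.
  by apply: cvgN; apply: cvgMr; exact: cvg_id.
have E : (\int[mu]_(t in `[0%R, +oo[) (expR (- (c * t)))%:E = 0%:E - (- (c^-1 * expR (- (c * 0))))%:E)%E.
  apply: (ge0_continuous_FTC2y (F := fun t => - (c^-1 * expR (- (c * t))))).
  - by move=> x _; exact: expR_ge0.
  - exact: continuous_subspaceT.
  - rewrite -oppr0; apply: cvgN; rewrite -(mulr0 c^-1); apply: cvgMr.
    apply: (@cvg_comp _ _ _ (fun t => c * t) (fun x => expR (- x)) _ (pinfty_nbhs R)).
      apply/cvgryPge => A; exists (A / c); split; first exact: num_real.
      by move=> t /ltW; rewrite ler_pdivrMr// mulrC.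
    exact: cvgr_expR.
  - by move=> x _; have [] := dE x.
  - by apply: cvg_at_right_filter; apply: cvgN; apply: cvgMr; exact: ce.
  - by move=> x _; rewrite derive1E; have [_ ->] := dE x.
apply: integrable_ge0 => [|t _|]; last by rewrite /Rplus E ltry.
  by apply: measurable_funTS; exact: continuous_measurable_fun.
exact: expR_ge0.
Qed.

Lemma powR_exp_bound (k : nat) (c : R) : 0 < c ->
  exists2 C : R, 0 <= C & forall t, 0 <= t ->
    t ^+ k * expR (- (c * t)) <= C * expR (- (c / 2 * t)).
Proof.
move=> c0; case: k => [|k].
  exists 1 => // t t0; rewrite expr0 !mul1r ler_expR lerN2 ler_wpM2r//.
  by rewrite ler_pdivrMr// ler_peMr ?(ltW c0)// ler1n.
exists ((k.+1)`!%:R / (c / 2) ^+ k.+1) => [|t t0].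
  by rewrite divr_ge0// exprn_ge0// divr_ge0// ltW.
have -> : - (c * t) = - (c / 2 * t) - (c / 2 * t) by field.
rewrite expRD mulrA ler_wpM2r ?expR_ge0//.
rewrite expRN -ler_pdivlMr ?invr_gt0 ?expR_gt0// invrK.
have c2 : 0 < c / 2 by rewrite divr_gt0.
have := @expR_ge1Dxn _ (c / 2 * t) k (mulr_ge0 (ltW c2) t0).
rewrite -lerBrDl => h.
have {}h : (c / 2 * t) ^+ k.+1 / (k.+1)`!%:R <= expR (c / 2 * t).
  by rewrite (le_trans h)// gerBl.
have f0 : 0 < (k.+1)`!%:R :> R by rewrite ltr0n fact_gt0.
move: h; rewrite ler_pdivrMr// exprMn => h.
rewrite mulrAC ler_pdivlMr ?exprn_gt0// mulrC [leRHS]mulrC.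
exact: h.
Qed.

Lemma integrable_powexpN (k : nat) (c : R) : 0 < c ->
  mu.-integrable Rplus (EFin \o (fun t => t ^+ k * expR (- (c * t)))).
Proof.
move=> c0; have [C C0 le] := powR_exp_bound k c0.
have ie := integrable_EFinZl measurable_Rplus (integrable_expN (divr_gt0 c0 (ltr0n _ 2))) C.
apply: le_integrable ie; first exact: measurable_Rplus.
  apply/measurable_EFinP; apply: measurable_funM; first exact: exprn_measurable.
  apply: measurable_funTS; apply: continuous_measurable_fun => t.
  apply: continuous_comp; last exact: continuous_expR.
  by apply: cvgN; apply: cvgMr; exact: cvg_id.
move=> t /RplusP t0; rewrite lee_fin ger0_norm; last first.
  by rewrite mulr_ge0 ?expR_ge0// exprn_ge0.
by rewrite (le_trans (le t t0))// ler_norm.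
Qed.

Definition powexp (k : nat) (a : R[i]) (t : R) : R[i] :=
  (t ^+ k)%:C * cexp (- (a * t%:C)).

Lemma normc_powexp k a t : 0 <= t ->
  normc (powexp k a t) = t ^+ k * expR (- (complex.Re a * t)).
Proof.
move=> t0; rewrite normcM normc_real normc_cexp ger0_norm ?exprn_ge0//.
by rewrite ReN ReM /= mulr0 subr0.
Qed.

Lemma cderiv_expN (a : R[i]) t :
  cderiv (fun s => cexp (- (a * s%:C))) t (- a * cexp (- (a * t%:C))).
Proof.
have := cderiv_cexp (cderivN (cderivM (cderiv_cst a t) (cderiv_id t))).
by move/cderiv_eq; apply; rewrite mul0r add0r mulr1 mulrN mulrC mulNr.
Qed.

Lemma cderiv_powexp0 a t : cderiv (powexp 0 a) t (- a * powexp 0 a t).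
Proof.
rewrite (_ : powexp 0 a = (fun s => cexp (- (a * s%:C)))).
  exact: cderiv_expN.
by apply/funext => s; rewrite /powexp expr0 mul1r.
Qed.

Lemma cderiv_powexpS k a t :
  cderiv (powexp k.+1 a) t (k.+1%:R * powexp k a t - a * powexp k.+1 a t).
Proof.
have := cderivM (cderivX k (cderiv_id t)) (cderiv_expN a t).
rewrite (_ : (fun s => _) = powexp k.+1 a); last first.
  by apply/funext => s; rewrite /powexp rmorphXn.
by move/cderiv_eq; apply; rewrite /powexp !rmorphXn/=; ring.
Qed.

Lemma cderiv_powexp k a : exists f', forall t, cderiv (powexp k a) t (f' t).
Proof.
case: k => [|k]; first by exists (fun t => - a * powexp 0 a t) => t; exact: cderiv_powexp0.
by exists (fun t => k.+1%:R * powexp k a t - a * powexp k.+1 a t) => t; exact: cderiv_powexpS.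
Qed.

Lemma cmeas_powexp D k a : measurable D -> cmeas D (powexp k a).
Proof. by move=> mD; have [f' df] := cderiv_powexp k a; exact: cderiv_cmeas df. Qed.

Lemma isL2_powexp (k : nat) (a : R[i]) : 0 < complex.Re a -> isL2 Rplus (powexp k a).
Proof.
move=> a0; have mR := measurable_Rplus.
apply: (isL2_le mR (cmeas_powexp k a mR) (integrable_powexpN (k * 2) (mulr_gt0 (ltr0n _ 2) a0))).
move=> t /RplusP t0; rewrite normc_powexp// exprMn -exprM -expRM_natl.
by rewrite mulrN mulrA.
Qed.

Lemma cintegrable_powexp (k : nat) (a : R[i]) : 0 < complex.Re a -> cintegrable Rplus (powexp k a).
Proof.
move=> a0; have mR := measurable_Rplus.
apply: (cintegrable_le mR (cmeas_powexp k a mR) (integrable_powexpN k a0)).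
by move=> t /RplusP t0; rewrite normc_powexp.
Qed.

Lemma cvg_powexp (k : nat) (a : R[i]) : 0 < complex.Re a ->
  (powexp k a n%:R : R[i]^o) @[n --> \oo] --> (0 : R[i]^o).
Proof.
move=> a0; apply/cvg_normc0P; under eq_fun do rewrite subr0 normc_powexp//.
have [C C0 le] := powR_exp_bound k a0.
have a20 : 0 < complex.Re a / 2 by rewrite divr_gt0.
apply: (@squeeze_cvgr _ _ _ _ (cst 0) (fun n => C * expR (- (complex.Re a / 2 * n%:R)))).
- by apply: nearW => n; rewrite mulr_ge0 ?exprn_ge0 ?expR_ge0//= le.
- exact: cvg_cst.
rewrite -(mulr0 C); apply: cvgMr.
apply: (@cvg_comp _ _ _ (fun n : nat => complex.Re a / 2 * n%:R) (fun x => expR (- x)) _ (pinfty_nbhs R)).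
  apply/cvgryPge => A; near=> n; rewrite mulrC -ler_pdivrMr//.
  by near: n; exact: nbhs_infty_ger.
exact: cvgr_expR.
Unshelve. all: by end_near. Qed.

(** Integration by parts reduces the moments of an exponential to each other. *)
Lemma cintegral_powexp (k : nat) (a : R[i]) : 0 < complex.Re a ->
  cintegral Rplus (powexp k a) = (k`!)%:R / a ^+ k.+1.
Proof.
move=> a0; have mR := measurable_Rplus.
have an0 : a != 0 by apply: contraTN a0 => /eqP ->; rewrite ltxx.
have sub n : `[0, n.+1%:R] `<=` (Rplus : set R).
  by move=> t; rewrite /= in_itv/= => /andP[t0 _]; exact/RplusP.
have cover (t : R) : Rplus t -> \forall n \near \oo, t \in `[0, n.+1%:R].
  move=> /RplusP t0; near=> n; rewrite in_itv/= t0/=.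
  rewrite (@le_trans _ _ n%:R)// ?ler_nat//.
  by near: n; exact: nbhs_infty_ger.
have lim j : (powexp j a n.+1%:R : R[i]^o) @[n --> \oo] --> (0 : R[i]^o).
  by have := @cvg_powexp j a a0; rewrite -(cvg_shiftS (fun n : nat => powexp j a n%:R : R[i]^o)).
elim: k => [|k IH].
  have := @cintegral_FTC_exhaust _ Rplus (powexp 0 a) (fun t => - a * powexp 0 a t)
    (fun t => - a * (- a * powexp 0 a t)) (fun=> 0) (fun n => n.+1%:R) (- 1) mR
    (cderiv_powexp0 a) _ _ _ sub cover.
  rewrite cintegralZl//; last exact: cintegrable_powexp.
  move=> h; apply: (mulfI an0); rewrite expr1 mulrCA mulfV// mulr1 fact0.
  apply: oppr_inj; rewrite -mulNr; apply: h.
  - move=> t; have := cderivM (cderiv_cst (- a) t) (cderiv_powexp0 a t).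
    by move/cderiv_eq; apply; rewrite mul0r add0r.
  - by apply: cintegrableZl => //; exact: cintegrable_powexp.
  - by move=> n; rewrite ltr0n.
  - have -> : (-1 : R[i]) = 0 - 1 by rewrite sub0r.
    apply: ccvgB; first exact: lim.
    rewrite (_ : powexp 0 a 0 = 1); first exact: ccvg_cst.
    by rewrite /powexp expr0 mulr0 oppr0 cexp0 mulr1.
have ik := cintegrable_powexp k a0; have ik1 := cintegrable_powexp k.+1 a0.
have := @cintegral_FTC_exhaust _ Rplus (powexp k.+1 a)
  (fun t => k.+1%:R * powexp k a t - a * powexp k.+1 a t) 
  (fun t => k.+1%:R * (if k is k'.+1 then k%:R * powexp k' a t - a * powexp k a t
                       else - a * powexp 0 a t)
     - a * (k.+1%:R * powexp k a t - a * powexp k.+1 a t))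
  (fun=> 0) (fun n => n.+1%:R) 0 mR (cderiv_powexpS k a) _ _ _ sub cover.
rewrite cintegralB ?cintegralZl ?IH//; try exact: cintegrableZl.
move=> h.
have {}h : k.+1%:R * (k`!%:R / a ^+ k.+1) - a * cintegral Rplus (powexp k.+1 a) = 0.
  apply: h.
  - move=> t; apply: cderivD.
      apply: (cderiv_eq (cderivM (cderiv_cst (k.+1%:R) t) _)); last by rewrite mul0r add0r.
      by case: (k) => [|k']; [exact: cderiv_powexp0|exact: cderiv_powexpS].
    apply: cderivN.
    apply: (cderiv_eq (cderivM (cderiv_cst a t) (cderiv_powexpS k a t))).
    by rewrite mul0r add0r.
  - by apply: cintegrableB => //; exact: cintegrableZl.
  - by move=> n; rewrite ltr0n.
  - rewrite (_ : powexp k.+1 a 0 = 0); last by rewrite /powexp expr0n mul0r.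
    by rewrite -[X in _ --> X](subr0 0); apply: ccvgB; [exact: lim|exact: ccvg_cst].
apply: (mulfI an0); move/eqP: h; rewrite subr_eq0 => /eqP <-.
have ak0 : a ^+ k.+1 != 0 by rewrite expf_neq0.
rewrite factS natrM (exprS a k.+1); set b := a ^+ k.+1 in ak0 *.
by field; rewrite an0 ak0.
Unshelve. all: by end_near. Qed.

End Exponentials.

Section LaplaceTransform.
Variable R : realType.
Local Notation mu := (@lebesgue_measure R).
Implicit Types (f g : R -> R[i]) (w : R[i]).

Lemma powexp0E w t : powexp 0 w t = cexp (- (w * t%:C)).
Proof. by rewrite /powexp expr0 mul1r. Qed.

Lemma laplaceE f w : laplace f w =
  (Num.sqrt (2 * pi))^-1%:C * cintegral Rplus (fun t => f t * powexp 0 w t).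
Proof. by congr *%R; apply: eq_cintegral => t _; rewrite powexp0E. Qed.

Lemma laplace_cintegrable f w : isL2 Rplus f -> Cplus w ->
  cintegrable Rplus (fun t => f t * powexp 0 w t).
Proof.
move=> lf w0; apply: isL2_mul_cintegrable => //; first exact: measurable_Rplus.
exact: isL2_powexp.
Qed.

Lemma laplace_linear f g (a b : R[i]) w : isL2 Rplus f -> isL2 Rplus g -> Cplus w ->
  laplace (fun t => a * f t + b * g t) w = a * laplace f w + b * laplace g w.
Proof.
move=> lf lg w0; have mR := @measurable_Rplus R.
have fi := laplace_cintegrable lf w0; have gi := laplace_cintegrable lg w0.
rewrite !laplaceE.
rewrite (@eq_cintegral _ _ _ (fun t => a * (f t * powexp 0 w t) + b * (g t * powexp 0 w t))); last first.
  by move=> t _; ring.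
rewrite cintegralD ?cintegralZl//; try exact: cintegrableZl.
ring.
Qed.

Lemma laplaceB f g w : isL2 Rplus f -> isL2 Rplus g -> Cplus w ->
  laplace (fun t => f t - g t) w = laplace f w - laplace g w.
Proof.
move=> lf lg w0.
rewrite (_ : (fun t => _) = (fun t => 1 * f t + (-1) * g t)).
  by rewrite laplace_linear// mul1r mulN1r.
by apply/funext => t; rewrite mul1r mulN1r.
Qed.

Lemma laplace_ae_eq f g w : isL2 Rplus f -> isL2 Rplus g -> L2eq Rplus f g ->
  laplace f w = laplace g w.
Proof.
move=> lf lg fg; rewrite !laplaceE; congr *%R; apply: cintegral_ae_eq.
- exact: measurable_Rplus.
- by apply: cmeasM; [exact: isL2_cmeas|apply: cmeas_powexp; exact: measurable_Rplus].
- by apply: cmeasM; [exact: isL2_cmeas|apply: cmeas_powexp; exact: measurable_Rplus].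
- by move: fg; apply: ae_imp => t fgt Dt; rewrite fgt.
Qed.

Definition laplace_bound w : R :=
  (Num.sqrt (2 * pi))^-1 * nrm Rplus (powexp 0 w).

Lemma laplace_bound_ge0 w : 0 <= laplace_bound w.
Proof. by rewrite mulr_ge0 ?invr_ge0 ?sqrtr_ge0 ?nrm_ge0. Qed.

Lemma normc_laplace_le f w : isL2 Rplus f -> Cplus w ->
  normc (laplace f w) <= laplace_bound w * nrm Rplus f.
Proof.
move=> lf w0; rewrite laplaceE normcM normc_real ger0_norm ?invr_ge0 ?sqrtr_ge0//.
rewrite /laplace_bound -mulrA ler_wpM2l ?invr_ge0 ?sqrtr_ge0// mulrC.
apply: normc_cintegralM_le => //; first exact: measurable_Rplus.
exact: isL2_powexp.
Qed.

Lemma powexpM (a b : R[i]) k t : powexp k a t * powexp 0 b t = powexp k (a + b) t.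
Proof. by rewrite /powexp expr0 mul1r -mulrA -cexpD mulrDl opprD. Qed.

Lemma laplace_powexp k (a : R[i]) w : 0 < complex.Re a -> Cplus w ->
  laplace (powexp k a) w =
  (Num.sqrt (2 * pi))^-1%:C * ((k`!)%:R / (a + w) ^+ k.+1).
Proof.
move=> a0 w0; rewrite laplaceE; congr *%R.
rewrite -cintegral_powexp; last by rewrite ReD addr_gt0.
by apply: eq_cintegral => t _; rewrite powexpM.
Qed.

Lemma derivable_normc (F : R[i] -> R[i]) w (l : R[i]) (C r : R) : 0 < r ->
  (forall k, normc k < r -> normc (F (k + w) - F w - k * l) <= C * normc k ^+ 2) ->
  derivable (F : R[i]^o -> R[i]^o) w 1.
Proof.
move=> r0 h; apply/cvg_ex; exists l; apply/(@cvg_normcP R).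
move=> e e0.
have e1 : 0 < Num.min r (e / (`|C| + 1)).
  by rewrite lt_min r0 divr_gt0// ltr_wpDl.
have e1' : (0 : R[i]) < (Num.min r (e / (`|C| + 1)))%:C by rewrite ltcR.
near=> k.
have k0 : k != 0 by near: k; exact: nbhs_dnbhs_neq.
have kr : normc k < Num.min r (e / (`|C| + 1)).
  rewrite -ltcR -norm_normc; near: k.
  by have := @dnbhs0_lt _ R[i]^o _ e1'.
move: kr; rewrite lt_min => /andP[kr ke].
rewrite /= /GRing.scale/= mulr1.
have -> : k^-1 * (F (k + w) - F w) - l = k^-1 * (F (k + w) - F w - k * l).
  by field.
have nk0 : 0 < normc k by rewrite normc_gt0.
rewrite normcM normcV mulrC ltr_pdivrMr// (le_lt_trans (h k kr))// expr2 mulrA.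
rewrite ltr_pM2r// (@le_lt_trans _ _ (`|C| * normc k))//.
  by rewrite ler_wpM2r ?normc_ge0// ler_norm.
move: ke; rewrite ltr_pdivlMr ?ltr_wpDl// => ke; apply: le_lt_trans ke.
by rewrite mulrC ler_wpM2l ?normc_ge0// lerDl.
Unshelve. all: by end_near. Qed.

(** Differentiation under the integral sign; the remainder of the first
    order expansion of the kernel is dominated by
    [normc k ^ 2 * t ^ 2 * exp (- x t / 2)], uniformly for small [k]. *)
Lemma laplace_holomorphic f : isL2 Rplus f -> holomorphic_on Cplus (laplace f).
Proof.
move=> lf w w0; have mR := @measurable_Rplus R.
have w20 : 0 < complex.Re w / 2 by rewrite divr_gt0.
pose c : R := (Num.sqrt (2 * pi))^-1.
have c0 : 0 <= c by rewrite invr_ge0 sqrtr_ge0.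
pose G := powexp 2 (complex.Re w / 2)%:C.
have lG : isL2 Rplus G by exact: isL2_powexp.
pose l := c%:C * cintegral Rplus (fun t => f t * - powexp 1 w t).
apply: (@derivable_normc _ _ l (c * (nrm Rplus f * nrm Rplus G)) (complex.Re w / 2) w20).
move=> k kw.
have kwp : Cplus (k + w).
  rewrite /Cplus/= ReD; have := normRe_le k; rewrite ler_norml => /andP[h _].
  move: w0 kw h; rewrite /Cplus/=; set x := complex.Re w; set y := complex.Re k.
  by set z := normc k => *; lra.
have i1 := laplace_cintegrable lf kwp; have i2 := laplace_cintegrable lf w0.
have lp : isL2 Rplus (fun t => - powexp 1 w t) by apply: isL2N => //; exact: isL2_powexp.
have i3 : cintegrable Rplus (fun t => f t * - powexp 1 w t).
  exact: isL2_mul_cintegrable.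
have -> : laplace f (k + w) - laplace f w - k * l =
    c%:C * cintegral Rplus (fun t => f t *
      (powexp 0 (k + w) t - powexp 0 w t + k * powexp 1 w t)).
  rewrite !laplaceE /l.
  rewrite (@eq_cintegral _ _ (fun t => f t * (_ - _ + _)) (fun t => (f t * powexp 0 (k + w) t
     - f t * powexp 0 w t) - k * (f t * - powexp 1 w t))); last by move=> t _; ring.
  rewrite !cintegralB ?cintegralZl//; last 2 first.
  - exact: cintegrableB.
  - exact: cintegrableZl.
  by rewrite /c; ring.
rewrite normcM normc_real ger0_norm// -mulrA ler_wpM2l//.
have mk : cmeas Rplus (fun t => powexp 0 (k + w) t - powexp 0 w t + k * powexp 1 w t).
  apply: cmeasD; first by apply: cmeasB; exact: cmeas_powexp.
  by apply: cmeasM; [exact: cmeas_cst|exact: cmeas_powexp].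
have lGk : isL2 Rplus (fun t => (normc k ^+ 2)%:C * G t) by exact: isL2Zl.
have le (t : R) : Rplus t ->
    normc (powexp 0 (k + w) t - powexp 0 w t + k * powexp 1 w t) <=
    normc ((normc k ^+ 2)%:C * G t).
  move=> /RplusP t0; rewrite normcM normc_real ger0_norm ?sqr_ge0//.
  rewrite normc_powexp//=.
  have -> : powexp 0 (k + w) t - powexp 0 w t + k * powexp 1 w t =
      powexp 0 w t * (cexp (- (k * t%:C)) - 1 - (- (k * t%:C))).
    rewrite /powexp expr0 expr1 !mul1r mulrDl opprD cexpD; ring.
  rewrite normcM normc_powexp// expr0 mul1r.
  rewrite (@le_trans _ _ (expR (- (complex.Re w * t)) *
    (normc (- (k * t%:C)) ^+ 2 * expR (normc (- (k * t%:C))))))//.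
    by rewrite ler_wpM2l ?expR_ge0// cexpB1B_le.
  rewrite normcNr normcM normc_real (ger0_norm t0) exprMn.
  rewrite [leLHS](_ : _ = normc k ^+ 2 * (t ^+ 2 *
    (expR (- (complex.Re w * t)) * expR (normc k * t)))); last by ring.
  rewrite ler_wpM2l ?sqr_ge0// ler_wpM2l ?sqr_ge0// -expRD ler_expR.
  rewrite (_ : _ + _ = (normc k - complex.Re w) * t); last by ring.
  rewrite -mulNr ler_wpM2r//; move: kw.
  by set x := complex.Re w => kw; lra.
rewrite (le_trans (normc_cintegralM_le mR lf (isL2_dominated mR mk lGk le)))//.
rewrite -[leRHS]mulrA ler_wpM2l ?nrm_ge0// [leRHS]mulrC.
rewrite (le_trans (nrm_le mR (isL2_dominated mR mk lGk le) lGk le))//.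
by rewrite nrmZ// normc_real ger0_norm ?sqr_ge0.
Qed.

End LaplaceTransform.

(** * Exponentials are total in the space of square integrable functions *)

Section Totality.
Import HBNNSimple.
Variable R : realType.
Local Notation mu := (@lebesgue_measure R).
Implicit Types (f g : R -> R[i]).

(** Subspaces stable under dominated limits: this is the only form of
    closedness that the proof of totality needs, and it is immediate to
    check for the kernel of a continuous functional. *)
Record dominated_closed (S : (R -> R[i]) -> Prop) : Prop := {
  dc_linear : forall (a b : R[i]) f g, isL2 Rplus f -> isL2 Rplus g ->
    S f -> S g -> S (fun t => a * f t + b * g t) ;
  dc_limit : forall (u : nat -> R -> R[i]) f g,
    (forall n, isL2 Rplus (u n)) -> isL2 Rplus f -> isL2 Rplus g ->
    (forall n, S (u n)) ->
    (forall n t, Rplus t -> normc (u n t) <= normc (g t)) ->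
    {ae mu, forall t, Rplus t -> (u n t : R[i]^o) @[n --> \oo] --> (f t : R[i]^o)} ->
    S f }.

Variable S : (R -> R[i]) -> Prop.
Hypothesis dcS : dominated_closed S.

Lemma dc_eq f g : isL2 Rplus f -> isL2 Rplus g ->
  (forall t, Rplus t -> f t = g t) -> S f -> S g.
Proof.
move=> lf lg fg Sf; apply: (dc_limit dcS (u := fun=> f) (g := f)) => //.
by apply: aeW => t Dt; rewrite fg//; exact: ccvg_cst.
Qed.

Lemma dc0 f : isL2 Rplus f -> S f -> S (fun=> 0).
Proof.
move=> lf Sf; have := dc_linear dcS 0 0 lf lf Sf Sf.
by congr S; apply/funext => t; rewrite !mul0r addr0.
Qed.

Lemma dcZ f a : isL2 Rplus f -> S f -> S (fun t => a * f t).
Proof.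
move=> lf Sf; have := dc_linear dcS a 0 lf lf Sf Sf.
by congr S; apply/funext => t; rewrite mul0r addr0.
Qed.

Lemma dcD f g : isL2 Rplus f -> isL2 Rplus g -> S f -> S g ->
  S (fun t => f t + g t).
Proof.
move=> lf lg Sf Sg; have := dc_linear dcS 1 1 lf lg Sf Sg.
by congr S; apply/funext => t; rewrite !mul1r.
Qed.

Lemma dcB f g : isL2 Rplus f -> isL2 Rplus g -> S f -> S g ->
  S (fun t => f t - g t).
Proof.
move=> lf lg Sf Sg; have := dc_linear dcS 1 (-1) lf lg Sf Sg.
by congr S; apply/funext => t; rewrite mul1r mulN1r.
Qed.

Lemma dc_sum (I : Type) (s : seq I) (F : I -> R -> R[i]) g :
  isL2 Rplus g -> S g ->
  (forall i, isL2 Rplus (F i)) -> (forall i, S (F i)) ->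
  S (fun t => \sum_(i <- s) F i t).
Proof.
move=> lg Sg lF SF; elim: s => [|i s IH].
  by under eq_fun do rewrite big_nil; exact: dc0 Sg.
under eq_fun do rewrite big_cons; apply: dcD => //.
by apply: isL2_sum => //; exact: measurable_Rplus.
Qed.

(** Expanding [exp (- (c' - c) t)] in powers of [t] moves the exponent
    from [c] to [c']; the partial sums are dominated by
    [exp (|c' - c| t)], which is absorbed when [|c' - c| < c]. *)
Lemma dc_powexp_step (c c' : R) : 0 < c -> `|c' - c| < c ->
  (forall k, S (powexp k c%:C)) -> forall k, S (powexp k c'%:C).
Proof.
move=> c0 cc Sc k; have mR := @measurable_Rplus R.
have c'0 : 0 < c' by move: cc; rewrite ltr_norml => /andP[h _]; lra.
pose d := - (c' - c).
pose u n t := powexp k c%:C t * (series (exp_coeff (d * t)) n)%:C.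
have uE n t : u n t = \sum_(0 <= j < n) (d ^+ j / j`!%:R)%:C * powexp (k + j) c%:C t.
  rewrite /u /series/= rmorph_sum/= mulr_sumr; apply: eq_bigr => j _.
  rewrite exp_coeffE /powexp exprMn exprD !rmorphM/=; ring.
have lu n : isL2 Rplus (u n).
  rewrite (_ : u n = fun t => \sum_(0 <= j < n) (d ^+ j / j`!%:R)%:C * powexp (k + j) c%:C t).
    by apply: isL2_sum => // j; apply: isL2Zl => //; exact: isL2_powexp.
  by apply/funext => t; exact: uE.
have le0 : 0 < c - `|d| by rewrite normrN subr_gt0.
apply: (dc_limit dcS (u := u) (g := powexp k (c - `|d|)%:C)) => //.
- exact: isL2_powexp.
- exact: isL2_powexp.
- move=> n.
  rewrite (_ : u n = fun t => \sum_(0 <= j < n) (d ^+ j / j`!%:R)%:C * powexp (k + j) c%:C t).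
    apply: (dc_sum (index_iota 0 n) (g := powexp 0 c%:C)
      (F := fun j t => (d ^+ j / j`!%:R)%:C * powexp (k + j) c%:C t)) => //.
    + exact: isL2_powexp.
    + by move=> j; apply: isL2Zl => //; exact: isL2_powexp.
    + by move=> j; apply: dcZ => //; exact: isL2_powexp.
  by apply/funext => t; exact: uE.
- move=> n t /RplusP t0; rewrite /u normcM !normc_powexp// normc_real.
  rewrite /= mulrBl opprB addrC expRD mulrA ler_wpM2l//.
    by rewrite mulr_ge0 ?exprn_ge0 ?expR_ge0.
  have le1 : `|series (exp_coeff (d * t)) n| <= series (exp_coeff (`|d| * t)) n.
    rewrite /series/= (le_trans (ler_norm_sum _ _ _))// ler_sum// => j _.
    by rewrite !exp_coeffE normrM normrX normrM (ger0_norm t0) ger0_norm ?invr_ge0.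
  rewrite (le_trans le1)// /expR; apply: nondecreasing_cvgn_le; last exact: is_cvg_series_exp_coeff.
  apply: nondecreasing_series => j _ _; apply: exp_coeff_ge0.
  by rewrite mulr_ge0.
- apply: aeW => t _; rewrite /u.
  have -> : powexp k c'%:C t = powexp k c%:C t * (expR (d * t))%:C.
    rewrite /powexp -mulrA; congr *%R; rewrite -cexp_real -cexpD; congr cexp.
    by rewrite /d rmorphM rmorphN rmorphB/=; ring.
  apply: ccvgMl; apply/cvg_ReIm; split => /=; last exact: cvg_cst.
  exact: is_cvg_series_exp_coeff.
Qed.

Lemma dc_powexp : (forall k, S (powexp k 1)) ->
  forall c : R, 0 < c -> forall k, S (powexp k c%:C).
Proof.
move=> S1.
have Sn n : forall k, S (powexp k ((3 / 2) ^+ n)%:C).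
  elim: n => [|n IH]; first by rewrite expr0.
  have p0 : 0 < (3 / 2 : R) ^+ n by rewrite exprn_gt0// divr_gt0.
  apply: (dc_powexp_step p0 _ IH); rewrite exprS.
  set x := (3 / 2) ^+ n in p0 *.
  by rewrite (_ : _ - _ = x / 2); [rewrite gtr0_norm; lra|field].
move=> c c0.
have [n cn] : exists n, c < 2 * (3 / 2 : R) ^+ n.
  have z1 : `|2 / 3 : R| < 1 by rewrite ger0_norm//; lra.
  have /cvgrPdist_lt/(_ c^-1) := cvg_expr z1.
  rewrite invr_gt0 => /(_ c0) [n _ /(_ n (leqnn n))] /=.
  rewrite sub0r normrN ger0_norm ?exprn_ge0// => h; exists n.
  have p0 : 0 < (3 / 2 : R) ^+ n by rewrite exprn_gt0// divr_gt0.
  have e32 : 2 / 3 = (3 / 2 : R)^-1 by rewrite invf_div.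
  rewrite e32 exprVn in h.
  move: h; rewrite ltf_pV2 ?posrE// => h.
  by rewrite (lt_le_trans h)// ler_peMl ?(ltW p0)// ler1n.
apply: (dc_powexp_step _ _ (Sn n)); first by rewrite exprn_gt0// divr_gt0.
by rewrite ltr_norml; apply/andP; split; [lra|move: cn; lra].
Qed.

(** The span of the exponentials contains the products of [exp (- t)] with
    the polynomials in [exp (- c t)]. *)
Lemma dc_horner (p : {poly R}) (c : R) : 0 < c ->
  (forall a : R, 0 < a -> S (powexp 0 a%:C)) ->
  S (fun t => (expR (- t) * p.[expR (- (c * t))])%:C).
Proof.
move=> c0 Se; have mR := @measurable_Rplus R.
have E t : (expR (- t) * p.[expR (- (c * t))])%:C =
    \sum_(i < size p) (p`_i)%:C * powexp 0 (1 + c * i%:R)%:C t.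
  rewrite horner_coef mulr_sumr rmorph_sum; apply: eq_bigr => i _.
  rewrite powexp0E -rmorphM -rmorphN cexp_real -rmorphM; congr (_%:C).
  rewrite mulrCA; congr *%R; rewrite -expRM_natl -expRD; congr expR; ring.
have ci (i : nat) : 0 < 1 + c * i%:R :> R by rewrite ltr_pwDl// mulr_ge0// ltW.
under eq_fun do rewrite E.
apply: (dc_sum (index_enum 'I_(size p)) (g := powexp 0 1%:C)
  (F := fun i t => (p`_i)%:C * powexp 0 (1 + c * i%:R)%:C t)).
- by apply: isL2_powexp => /=.
- exact: Se.
- by move=> i; apply: isL2Zl => //; apply: isL2_powexp => /=.
- by move=> i; apply: dcZ; [apply: isL2_powexp => /=|exact: Se].
Qed.

(** The polynomials [(1 - x ^ n) ^ (2 ^ n)] converge on [[0, 1]] to the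
    indicator function of [[0, 1/2)], boundedly and off the point [1/2]. *)
Definition step_poly n : {poly R} := (1 - 'X^n) ^+ (2 ^ n).

Lemma horner_step_poly n x : (step_poly n).[x] = (1 - x ^+ n) ^+ (2 ^ n).
Proof. by rewrite /step_poly !hornerE. Qed.

Lemma bernoulli_ineq (x : R) n : 0 <= x -> 1 + n%:R * x <= (1 + x) ^+ n.
Proof.
move=> x0; elim: n => [|n IH]; first by rewrite mul0r addr0 expr0.
rewrite exprS; have : (1 + x) * (1 + n%:R * x) <= (1 + x) * (1 + x) ^+ n.
  by rewrite ler_wpM2l// addr_ge0.
apply: le_trans; rewrite -natr1.
have : 0 <= n%:R * x * x by rewrite !mulr_ge0.
lra.
Qed.

Lemma bernoulli_ineqN (x : R) n : 0 <= x <= 1 -> 1 - n%:R * x <= (1 - x) ^+ n.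
Proof.
move=> /andP[x0 x1]; elim: n => [|n IH]; first by rewrite mul0r subr0 expr0.
rewrite exprS; have : (1 - x) * (1 - n%:R * x) <= (1 - x) * (1 - x) ^+ n.
  by rewrite ler_wpM2l// subr_ge0.
apply: le_trans; rewrite -natr1.
have : 0 <= n%:R * x * x by rewrite !mulr_ge0.
lra.
Qed.

Lemma step_poly_itv n (x : R) : 0 <= x <= 1 -> 0 <= (step_poly n).[x] <= 1.
Proof.
move=> /andP[x0 x1]; rewrite horner_step_poly.
have h : 0 <= 1 - x ^+ n <= 1.
  by rewrite subr_ge0 exprn_ile1// gerBl exprn_ge0.
by case/andP: h => h0 h1; rewrite exprn_ge0//= exprn_ile1.
Qed.

Lemma cvg_step_poly1 (x : R) : 0 <= x < 2^-1 ->
  (step_poly n).[x] @[n --> \oo] --> (1 : R).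
Proof.
move=> /andP[x0 x1]; have xl : x <= 1 by lra.
have z1 : `|2 * x| < 1 by rewrite ger0_norm ?mulr_ge0//; lra.
apply: (@squeeze_cvgr _ _ _ _ (fun n => 1 - (2 * x) ^+ n) (cst 1)).
- apply: nearW => n; apply/andP; split; last first.
    by have := @step_poly_itv n x; rewrite x0 xl => /(_ isT) /andP[].
  rewrite horner_step_poly exprMn -natrX; apply: bernoulli_ineqN.
  by rewrite exprn_ge0// exprn_ile1.
- by rewrite -[X in _ --> X]subr0; apply: cvgB; [exact: cvg_cst|exact: cvg_expr].
- exact: cvg_cst.
Qed.

Lemma cvg_step_poly0 (x : R) : 2^-1 < x <= 1 ->
  (step_poly n).[x] @[n --> \oo] --> (0 : R).
Proof.
move=> /andP[x0 x1].
have x00 : 0 < x by apply: lt_trans x0; rewrite invr_gt0.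
have z1 : `|(2 * x)^-1| < 1.
  rewrite ger0_norm ?invr_ge0 ?mulr_ge0 ?(ltW x00)// invf_lt1 ?mulr_gt0//.
  by move: x0; lra.
apply: (@squeeze_cvgr _ _ _ _ (cst 0) (fun n => (2 * x)^-1 ^+ n)); last 2 first.
- exact: cvg_cst.
- exact: cvg_expr.
apply: nearW => n; apply/andP; split.
  by have := @step_poly_itv n x; rewrite x1 ltW// => /(_ isT) /andP[].
rewrite horner_step_poly.
have xn0 : 0 < x ^+ n by rewrite exprn_gt0.
have xn1 : x ^+ n <= 1 by rewrite exprn_ile1// ltW.
have p0 : 0 < (2 * x) ^+ n by rewrite exprn_gt0// mulr_gt0.
rewrite exprVn -[leRHS]mul1r ler_pdivlMr//.
apply: (@le_trans _ _ ((1 - x ^+ n) ^+ (2 ^ n) * (1 + x ^+ n) ^+ (2 ^ n))).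
  rewrite ler_wpM2l ?exprn_ge0 ?subr_ge0//.
  apply: le_trans (bernoulli_ineq _ (ltW xn0)).
  by rewrite natrX exprMn lerDr.
rewrite -exprMn exprn_ile1//; last by nra.
by rewrite mulr_ge0 ?subr_ge0 ?addr_ge0 ?ler01 ?(ltW xn0).
Qed.

Definition expN_indic (B : set R) (t : R) : R[i] := (expR (- t) * \1_B t)%:C.

Lemma measurable_expN D : measurable D -> measurable_fun D (fun t : R => expR (- t)).
Proof.
move=> mD; apply: (@measurable_funS _ _ _ _ setT) => //.
apply: continuous_measurable_fun => t.
by apply: continuous_comp; [apply: cvgN; exact: cvg_id|exact: continuous_expR].
Qed.

Lemma isL2_expN_bounded (h : R -> R) : measurable_fun Rplus h ->
  (forall t, Rplus t -> `|h t| <= 1) ->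
  isL2 Rplus (fun t => (expR (- t) * h t)%:C).
Proof.
move=> mh h1; have mR := @measurable_Rplus R.
apply: (isL2_dominated mR (g := powexp 0 1)).
- by apply: cmeas_real; apply: measurable_funM => //; exact: measurable_expN.
- by apply: isL2_powexp => /=.
- move=> t Dt; have /RplusP t0 := Dt.
  rewrite normc_powexp// expr0 !mul1r normc_real normrM ger0_norm ?expR_ge0//.
  by rewrite ler_piMr ?expR_ge0// h1.
Qed.

Lemma isL2_expN_indic B : measurable B -> isL2 Rplus (expN_indic B).
Proof.
move=> mB; apply: isL2_expN_bounded; first exact: measurable_indic.
by move=> t _; rewrite indicE; case: (_ \in _); rewrite ?normr0 ?normr1.
Qed.

Hypothesis Sexp : forall a : R, 0 < a -> S (powexp 0 a%:C).

Lemma dc_expN_setT : S (expN_indic setT).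
Proof.
apply: (dc_eq _ _ _ (Sexp ltr01)).
- by apply: isL2_powexp => /=.
- exact: isL2_expN_indic.
- move=> t _; rewrite powexp0E mul1r -rmorphN cexp_real /expN_indic indicT.
  by rewrite mulr1.
Qed.

Lemma dc_expN_ray (a : R) : S (expN_indic `]a, +oo[).
Proof.
have [a0|a0] := ltP a 0.
  apply: (dc_eq _ _ _ dc_expN_setT); try exact: isL2_expN_indic.
  move=> t /RplusP t0; rewrite /expN_indic indicT indicE mem_set//= in_itv/=.
  by rewrite andbT (lt_le_trans a0).
have [->|an0] := eqVneq a 0.
  (* the two functions differ at 0 only *)
  apply: (dc_limit dcS (u := fun=> expN_indic setT) (g := expN_indic setT));
    try by move=> *; exact: isL2_expN_indic.
  - by move=> _; exact: dc_expN_setT.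
  - by [].
  - exists [set 0]; split; [exact: measurable_set1|exact: lebesgue_measure_set1|].
    move=> t /=; apply: contra_notP => t0 /RplusP t00.
    rewrite /expN_indic indicT indicE mem_set//=; first exact: ccvg_cst.
    by rewrite in_itv/= andbT lt_def t00 andbT; apply/eqP.
have {}a0 : 0 < a by rewrite lt_def an0.
have l2 : 0 < ln 2 :> R by rewrite ln_gt0// ltr1n.
pose c := ln 2 / a; have c0 : 0 < c by rewrite divr_gt0.
have xE (t : R) : 0 <= t -> 0 <= expR (- (c * t)) <= 1.
  by move=> t0; rewrite expR_ge0 expR_le1// oppr_le0 mulr_ge0// ltW.
have e2 : 2^-1 = expR (- (c * a)) by rewrite /c divfK// expRN lnK// posrE.
have mR := @measurable_Rplus R.
have mu_ n : measurable_fun Rplus (fun t : R => (step_poly n).[expR (- (c * t))]).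
  apply: (@measurable_funS _ _ _ _ setT) => //; apply: continuous_measurable_fun => t.
  apply: (@continuous_comp _ _ _ (fun t : R => expR (- (c * t))) (fun x => (step_poly n).[x])).
    by apply: continuous_comp; [apply: cvgN; apply: cvgMr; exact: cvg_id|exact: continuous_expR].
  exact: continuous_horner.
have lu n : isL2 Rplus (fun t : R => (expR (- t) * (step_poly n).[expR (- (c * t))])%:C).
  apply: isL2_expN_bounded => // t /RplusP t0.
  by have /andP[h0 h1] := step_poly_itv n (xE t t0); rewrite ger0_norm.
apply: (dc_limit dcS (g := expN_indic setT) lu).
- exact: isL2_expN_indic.
- exact: isL2_expN_indic.
- by move=> n; exact: dc_horner.
- move=> n t /RplusP t0; rewrite /expN_indic indicT mulr1 !normc_real normrM.
  rewrite ler_piMr//.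
  by have /andP[h0 h1] := step_poly_itv n (xE t t0); rewrite ger0_norm.
- exists [set a]; split; [exact: measurable_set1|exact: lebesgue_measure_set1|].
  move=> t /=; apply: contra_notP => ta /RplusP t0.
  apply/cvg_ReIm; split => /=; last exact: cvg_cst.
  apply: cvgMr; rewrite indicE.
  have [at_|ta'] := ltP a t.
    rewrite mem_set/= ?in_itv/= ?at_//; apply: cvg_step_poly1.
    by rewrite expR_ge0 e2 ltr_expR ltrN2 ltr_pM2l.
  rewrite memNset/= ?in_itv/= ?andbT; last by apply/negP; rewrite -leNgt.
  apply: cvg_step_poly0; rewrite e2 ltr_expR ltrN2 ltr_pM2l//.
  by have /andP[_ ->] := xE t t0; rewrite andbT lt_def ta' andbT; apply/eqP => e; exact: ta.
Qed.

(** The measurable sets whose indicator function, weighted by [exp (- t)],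
    lies in the subspace form a lambda-system containing the open rays. *)
Lemma dc_expN_indic (B : set R) : measurable B -> S (expN_indic B).
Proof.
move=> mB.
pose H := [set B : set R | measurable B /\ S (expN_indic B)].
suff : H B by case.
have := @lambda_system_subset R (@RGenOInfty.G R) _ setT H _ _ _ B.
apply => //.
- move=> _ _ [x ->] [y ->]; exists (Num.max x y).
  apply/seteqP; split => t /=; rewrite !in_itv/= !andbT gt_max.
    by move=> [-> ->].
  by move/andP.
- split => //.
  + by split => //; exact: dc_expN_setT.
  + move=> A1 A2 A12 [m1 S1] [m2 S2]; split; first exact: measurableD.
    apply: (dc_eq _ _ _ (dcB _ _ S1 S2)); try exact: isL2_expN_indic.
    * by apply: isL2B; [exact: measurable_Rplus| |]; exact: isL2_expN_indic.
    * by apply: isL2_expN_indic; exact: measurableD.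
    * move=> t _; rewrite /expN_indic -rmorphB -mulrBr; congr (_ * _)%:C.
      rewrite !indicE in_setD; case: (boolP (t \in A2)) => tA2.
        by rewrite (mem_set (A12 _ (set_mem tA2))) subrr.
      by rewrite subr0 andbT.
  + move=> F ndF HF.
    have mF : measurable (\bigcup_i F i) by apply: bigcupT_measurable => i; case: (HF i).
    split => //.
    apply: (dc_limit dcS (u := fun n => expN_indic (F n)) (g := expN_indic setT)).
    * by move=> n; apply: isL2_expN_indic; case: (HF n).
    * exact: isL2_expN_indic.
    * exact: isL2_expN_indic.
    * by move=> n; case: (HF n).
    * move=> n t _; rewrite /expN_indic indicT mulr1 !normc_real normrM ler_piMr//.
      by rewrite indicE; case: (_ \in _); rewrite ?normr0 ?normr1.
    * apply: aeW => t _; apply/cvg_ReIm; split => /=; last exact: cvg_cst.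
      apply: cvgMr; rewrite [in X in _ --> X]indicE.
      have [[n _ tn]|nt] := pselect ((\bigcup_i F i) t).
        rewrite mem_set; last by exists n.
        apply: cvg_near_cst; exists n => // m /= nm.
        by rewrite indicE mem_set//; have /subsetPset := ndF _ _ nm; exact.
      rewrite memNset//; apply: cvg_near_cst; apply: nearW => m.
      by rewrite indicE memNset// => tm; apply: nt; exists m.
- move=> _ [x ->]; split; first exact: measurable_itv.
  exact: dc_expN_ray.
- exact: (eq_ind _ (fun X : set (set R) => X B) mB _ (@RGenOInfty.measurableE R)).
Qed.

Lemma dc_expN_sfun (s : {nnsfun R >-> R}) :
  S (fun t => (expR (- t) * s t)%:C) /\
  isL2 Rplus (fun t => (expR (- t) * s t)%:C).
Proof.
have mR := @measurable_Rplus R.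
have E : (fun t => (expR (- t) * s t)%:C) =
    (fun t => \sum_(y <- finmap.enum_fset (fset_set (range s)))
       y%:C * expN_indic (s @^-1` [set y]) t).
  apply/funext => t; rewrite fimfunE fsbig_finite//= mulr_sumr rmorph_sum/=.
  by apply: eq_bigr => y _; rewrite /expN_indic -rmorphM mulrCA.
have my y : measurable (s @^-1` [set y] : set R).
  by rewrite -[X in measurable X]setTI; exact: measurable_funP.
rewrite E; split.
  apply: (dc_sum _ (g := expN_indic setT)
    (F := fun y t => y%:C * expN_indic (s @^-1` [set y]) t)).
  - exact: isL2_expN_indic.
  - exact: dc_expN_setT.
  - by move=> y; apply: isL2Zl => //; exact: isL2_expN_indic.
  - by move=> y; apply: dcZ; [exact: isL2_expN_indic|exact: dc_expN_indic].
by apply: isL2_sum => // y; apply: isL2Zl => //; exact: isL2_expN_indic.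
Qed.

(** A nonnegative function is the limit from below of the products of
    [exp (- t)] with simple functions. *)
Lemma dc_ge0 (u : R -> R) : (forall t, 0 <= u t) ->
  isL2 Rplus (fun t => (u t)%:C) -> S (fun t => (u t)%:C).
Proof.
move=> u0 lu; have mR := @measurable_Rplus R.
have [mu_ _] := isL2_cmeas lu.
have mv : measurable_fun Rplus (fun t => (u t * expR t)%:E).
  apply/measurable_EFinP/measurable_funM => //.
  by apply: (@measurable_funS _ _ _ _ setT) => //; exact: measurable_expR.
pose s n := nnsfun_approx mR mv n.
have v0 (t : R) : Rplus t -> (0 <= (u t * expR t)%:E)%E.
  by move=> _; rewrite lee_fin mulr_ge0 ?expR_ge0.
have sc (t : R) : Rplus t -> s n t @[n --> \oo] --> u t * expR t.
  by move=> Dt; have /fine_cvg := cvg_nnsfun_approx mR mv v0 Dt; apply.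
have sl (t : R) n : Rplus t -> s n t <= u t * expR t.
  move=> Dt; have c := sc t Dt; rewrite -(cvg_lim _ c)//.
  apply: nondecreasing_cvgn_le; last by apply/cvg_ex; eexists; exact: c.
  by move=> m k mk; have /lefP := nd_nnsfun_approx mR mv mk; exact.
apply: (dc_limit dcS (u := fun n t => (expR (- t) * s n t)%:C) (g := fun t => (u t)%:C)) => //.
- by move=> n; case: (dc_expN_sfun (s n)).
- by move=> n; case: (dc_expN_sfun (s n)).
- move=> n t Dt; rewrite !normc_real !ger0_norm//; last first.
    by rewrite mulr_ge0 ?expR_ge0//; exact: fun_ge0.
  by rewrite expRN -ler_pdivlMl ?invr_gt0 ?expR_gt0// invrK mulrC sl.
- apply: aeW => t Dt; apply/cvg_ReIm; split => /=; last exact: cvg_cst.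
  have -> : u t = expR (- t) * (u t * expR t).
    by rewrite mulrCA -expRD addNr expR0 mulr1.
  by apply: cvgMr; exact: sc.
Qed.

(** The real and imaginary parts split into differences of nonnegative functions,
    which [dc_ge0] covers. *)
Theorem exponentials_total f : isL2 Rplus f -> S f.
Proof.
move=> lf; have mR := @measurable_Rplus R.
have part (h : R -> R) : measurable_fun Rplus h ->
    (forall t, `|h t| <= normc (f t)) ->
    S (fun t => (h t)%:C) /\ isL2 Rplus (fun t => (h t)%:C).
  move=> mh hf.
  have lp : isL2 Rplus (fun t => (Num.max (h t) 0)%:C).
    apply: (isL2_dominated mR _ lf) => [|t _].
      by apply: cmeas_real; apply: measurable_maxr => //; exact: measurable_cst.
    by rewrite normc_real (le_trans _ (hf t))//; case: (leP (h t) 0); rewrite ?normr0.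
  have ln : isL2 Rplus (fun t => (Num.max (- h t) 0)%:C).
    apply: (isL2_dominated mR _ lf) => [|t _].
      apply: cmeas_real; apply: measurable_maxr; last exact: measurable_cst.
      exact: measurable_funN.
    rewrite normc_real (le_trans _ (hf t))//.
    by case: (leP (- h t) 0); rewrite ?normr0 ?normrN.
  have E : (fun t => (h t)%:C) = (fun t => (Num.max (h t) 0)%:C - (Num.max (- h t) 0)%:C).
    apply/funext => t; rewrite -rmorphB; congr (_%:C).
    by have [h0|h0] := leP (h t) 0; have [h1|h1] := leP (- h t) 0; lra.
  rewrite E; split; last exact: isL2B.
  by apply: dcB => //; apply: dc_ge0 => // t; rewrite le_max lexx orbT.
have [m1 m2] := isL2_cmeas lf.
have [S1 l1] := part _ m1 (fun t => normRe_le (f t)).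
have [S2 l2] := part _ m2 (fun t => normIm_le (f t)).
have := dc_linear dcS 1 'i%C l1 l2 S1 S2.
by congr S; apply/funext => t; rewrite mul1r -complexE.
Qed.

End Totality.

(** * Cauchy kernels on the imaginary axis *)

Lemma eq_ccvg (R : realType) (T : Type) (F : set_system T) (f g : T -> R[i]) a :
  (forall x, f x = g x) -> (f x : R[i]^o) @[x --> F] --> (a : R[i]^o) ->
  (g x : R[i]^o) @[x --> F] --> (a : R[i]^o).
Proof. by move=> /funext ->. Qed.

Section CauchyKernel.
Variable R : realType.
Local Notation mu := (@lebesgue_measure R).

Lemma invcE (z : R[i]) : z^-1 = conjc z * ((normc z ^+ 2)^-1)%:C.
Proof.
rewrite normc_sqr; case: z => x y; apply: complex_eq; rewrite ?ReM ?ImM /=; ring.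
Qed.

Lemma inv_sqr_ReIm (d z : R[i]) : let x := complex.Re z in let y := complex.Im z in
  d / z ^+ 2 =
  ((complex.Re d * (x ^+ 2 - y ^+ 2) + complex.Im d * (2 * x * y)) / (normc z ^+ 2) ^+ 2) +i*
  ((complex.Im d * (x ^+ 2 - y ^+ 2) - complex.Re d * (2 * x * y)) / (normc z ^+ 2) ^+ 2).
Proof.
rewrite -exprVn invcE; move: (normc z ^+ 2) => N; rewrite -exprVn.
move: (N^-1) => M; case: z => x y; case: d => u v.
by apply: complex_eq; rewrite /= ?expr2; ring.
Qed.

Lemma cderivV (f : R -> R[i]) t d : f t != 0 -> cderiv f t d ->
  cderiv (fun s => (f s)^-1) t (- (d / f t ^+ 2)).
Proof.
move=> f0 [d1 d2].
pose rf s := complex.Re (f s); pose mf s := complex.Im (f s).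
pose n2 := rf * rf + mf * mf.
have n2E s : n2 s = normc (f s) ^+ 2.
  by rewrite normc_sqr /n2 /rf /mf !expr2.
have n20 : n2 t != 0 by rewrite n2E sqrf_eq0 normc_eq0.
have dn : is_derive t 1 n2 (2 * (rf t * complex.Re d + mf t * complex.Im d)).
  have := is_deriveD (is_deriveM d1 d1) (is_deriveM d2 d2).
  move/is_derive_eq; apply; rewrite /GRing.scale/= -/(rf t) -/(mf t).
  by move: (rf t) (mf t) (complex.Re d) (complex.Im d) => x y u v; ring.
have dv := is_deriveV n20 dn.
have E := inv_sqr_ReIm d (f t); rewrite -n2E in E.
have N : n2 t = complex.Re (f t) ^+ 2 + complex.Im (f t) ^+ 2 by rewrite n2E normc_sqr.
move: N n20 E; rewrite /rf /mf in dv *.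
set N := n2 t in dv *; set x := complex.Re (f t) in dv *; set y := complex.Im (f t) in dv *.
move=> NE N0 E; split.
  rewrite (_ : (fun _ => _) = rf * (fun s => (n2 s)^-1)); last first.
    by apply/funext => s; rewrite Re_inv -n2E.
  apply: is_derive_eq; rewrite ReN E /GRing.scale/= -/N.
  move: NE N0; rewrite /rf -/x; move: N {dv E} => N NE N0.
  rewrite (_ : x ^+ 2 - y ^+ 2 = 2 * x ^+ 2 - N); last by rewrite NE; ring.
  by field.
rewrite (_ : (fun _ => _) = - (mf * (fun s => (n2 s)^-1))); last first.
  by apply/funext => s; rewrite Im_inv -n2E.
apply: is_derive_eq; rewrite ImN E /GRing.scale/= -/N.
move: NE N0; rewrite /mf -/y; move: N {dv E} => N NE N0.
rewrite (_ : x ^+ 2 - y ^+ 2 = N - 2 * y ^+ 2); last by rewrite NE; ring.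
by field.
Qed.

Lemma integrable_FTC_bounded (u U : R -> R) (M : R) : continuous u ->
  (forall t, 0 <= u t) -> (forall t : R, is_derive t 1 U (u t)) ->
  (forall t, `|U t| <= M) -> mu.-integrable setT (EFin \o u).
Proof.
move=> cu u0 dU UM.
have mu_ : measurable_fun setT u by exact: continuous_measurable_fun.
pose I n : set R := `[- n.+1%:R, n.+1%:R]%classic.
have mI n : measurable (I n) by exact: measurable_itv.
pose g n t : \bar R := (u t * \1_(I n) t)%:E.
have mg n : measurable_fun setT (g n).
  apply/measurable_EFinP/measurable_funM => //; exact: measurable_indic.
have g0 n t : setT t -> (0 <= g n t)%E.
  by move=> _; rewrite lee_fin mulr_ge0// indicE.
have gnd t : setT t -> {homo g^~ t : n m / (n <= m)%N >-> (n <= m)%E}.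
  move=> _ n m nm; rewrite lee_fin ler_wpM2l// !indicE.
  have [tn|] := boolP (t \in I n); last by rewrite ler0n.
  rewrite mem_set//; move: tn; rewrite inE /I/= !in_itv/= => /andP[h1 h2].
  have nm' : n.+1%:R <= m.+1%:R :> R by rewrite ler_nat.
  by rewrite (le_trans _ h1) ?lerN2// (le_trans h2).
have limg t : limn (g^~ t) = (u t)%:E.
  apply/cvg_lim => //; apply: cvg_near_cst; near=> n.
  rewrite /g indicE mem_set ?mulr1// /I/= in_itv/= -ler_norml.
  rewrite (@le_trans _ _ n%:R)// ?ler_nat//.
  by near: n; exact: nbhs_infty_ger.
have gM n : (\int[mu]_(t in setT) g n t <= (2 * M)%:E)%E.
  rewrite /g.
  have -> : (\int[mu]_t (u t * \1_(I n) t)%:E = \int[mu]_(t in I n) (u t)%:E)%E.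
    rewrite [RHS]integral_mkcond; apply: eq_integral => t _.
    by rewrite patchE indicE; case: (t \in I n); rewrite ?mulr1 ?mulr0.
  have lt : - n.+1%:R < n.+1%:R :> R.
    by rewrite -subr_gt0 opprK addr_gt0 ?ltr0n.
  rewrite /I (@continuous_FTC2 _ _ U)//.
  - rewrite lee_fin (_ : 2 * M = M + M); last by ring.
    rewrite (le_trans (ler_norm _))// (le_trans (ler_normB _ _))// lerD//.
  - exact: continuous_subspaceT.
  - have cU : continuous U.
      move=> t; apply: differentiable_continuous; apply/derivable1_diffP.
      by have [] := dU t.
    split.
    + by move=> t _; have [] := dU t.
    + exact: cvg_at_right_filter (cU _).
    + exact: cvg_at_left_filter (cU _).
  - by move=> t _; rewrite derive1E; have [_ ->] := dU t.
apply: integrable_ge0 => //.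
rewrite (@le_lt_trans _ _ (2 * M)%:E)// ?ltry//.
under eq_integral do rewrite -limg.
have := @cvg_monotone_convergence _ _ _ mu setT measurableT g mg g0 gnd.
move=> c; rewrite -(cvg_lim _ c)//; apply: lime_le; last by apply: nearW.
by apply/cvg_ex; eexists; exact: c.
Unshelve. all: by end_near. Qed.

(** The boundary values of the Laplace transform of [exp (- a t)]. *)
Definition ck (a : R[i]) (s : R) : R[i] := (a + 0 +i* s)^-1.

Lemma ck_neq0 (a : R[i]) s : 0 < complex.Re a -> a + 0 +i* s != 0.
Proof.
by move=> a0; apply: contraTneq a0 => /(congr1 (@complex.Re R)); rewrite ReD /= addr0 => ->;
  rewrite ltxx.
Qed.

Lemma cderiv_shift (a : R[i]) t : cderiv (fun s => a + 0 +i* s) t 'i%C.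
Proof.
have := cderivD (cderiv_cst a t) (cderivM (cderiv_id t) (cderiv_cst 'i%C t)).
rewrite (_ : (fun s => _) = (fun s => a + 0 +i* s)); last first.
  apply/funext => s; congr +%R; apply: complex_eq; rewrite ?ReM ?ImM /=; ring.
by move/cderiv_eq; apply; rewrite mul1r mulr0 addr0 add0r.
Qed.

Lemma cderiv_ck (a : R[i]) t : 0 < complex.Re a ->
  cderiv (ck a) t (- ('i%C * ck a t ^+ 2)).
Proof.
move=> a0; have := cderivV (ck_neq0 t a0) (cderiv_shift a t).
by move/cderiv_eq; apply; rewrite /ck exprVn.
Qed.

Lemma cmeas_ck (a : R[i]) D : measurable D -> 0 < complex.Re a -> cmeas D (ck a).
Proof. by move=> mD a0; apply: (cderiv_cmeas mD) => t; exact: cderiv_ck. Qed.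

Lemma normc_ck (a : R[i]) s : normc (ck a s) ^+ 2 =
  (complex.Re a ^+ 2 + (complex.Im a + s) ^+ 2)^-1.
Proof. by rewrite /ck normcV exprVn normc_sqr ReD ImD /= addr0. Qed.

(** A primitive of the Cauchy kernel: a branch of the logarithm of [a + i s]. *)
Definition ck_primitive (a : R[i]) (s : R) : R[i] :=
  atan ((complex.Im a + s) / complex.Re a) +i*
  (- (2^-1 * ln (complex.Re a ^+ 2 + (complex.Im a + s) ^+ 2))).

Lemma cderiv_ck_primitive (a : R[i]) t : 0 < complex.Re a ->
  cderiv (ck_primitive a) t (ck a t).
Proof.
move=> a0; set p := complex.Re a; set q := complex.Im a.
have p0 : p != 0 by rewrite lt0r_neq0.
have D0 : 0 < p ^+ 2 + (q + t) ^+ 2 by rewrite ltr_pwDl ?sqr_ge0// exprn_gt0.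
have D0' := lt0r_neq0 D0.
have dl : is_derive t 1 (fun s : R => (q + s) * p^-1) p^-1.
  have dq : is_derive t 1 (fun s : R => q + s) 1.
    rewrite (_ : (fun s : R => q + s) = cst q + id)//.
    by apply: is_derive_eq; rewrite add0r.
  rewrite (_ : (fun s : R => _) = p^-1 *: (fun s : R => q + s)); last first.
    by apply/funext => s; rewrite /GRing.scale/= mulrC.
  by apply: is_derive_eq; rewrite /GRing.scale/= mulr1.
have dn : is_derive t 1 (fun s : R => p ^+ 2 + (q + s) ^+ 2) (2 * (q + t)).
  have dq : is_derive t 1 (fun s : R => q + s) 1.
    rewrite (_ : (fun s : R => q + s) = cst q + id)//.
    by apply: is_derive_eq; rewrite add0r.
  have := is_deriveD (is_derive_cst (p ^+ 2) t 1) (is_deriveM dq dq).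
  rewrite (_ : cst _ + _ = (fun s : R => p ^+ 2 + (q + s) ^+ 2)); last first.
    by apply/funext => s; rewrite expr2.
  move/is_derive_eq; apply; rewrite /GRing.scale/=.
  by move: (q + t) => x; ring.
have E : complex.Re (ck a t) = p / (p ^+ 2 + (q + t) ^+ 2).
  by rewrite /ck Re_inv normc_sqr ReD ImD /= addr0.
have E' : complex.Im (ck a t) = - ((q + t) / (p ^+ 2 + (q + t) ^+ 2)).
  by rewrite /ck Im_inv normc_sqr ReD ImD /= addr0.
split.
  rewrite E; apply: is_derive_eq.
    exact: (is_derive1_comp (is_derive1_atan _) dl).
  move: D0'; rewrite /=; move: (q + t) => x Dx.
  by field; rewrite Dx p0.
rewrite E'.
have dln : is_derive t 1 (@ln R \o (fun s : R => p ^+ 2 + (q + s) ^+ 2))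
    ((p ^+ 2 + (q + t) ^+ 2)^-1 * (2 * (q + t))).
  apply: (@is_derive1_comp _ (@ln R) (fun s : R => p ^+ 2 + (q + s) ^+ 2) t _ _ _ dn).
  exact: is_derive1_ln.
rewrite (_ : (fun s => _) = - (2^-1 *: (@ln R \o (fun s : R => p ^+ 2 + (q + s) ^+ 2))))//.
apply: is_derive_eq; rewrite /GRing.scale/=.
by move: (q + t) D0' => x Dx; field.
Qed.

Lemma isL2_ck (a : R[i]) : 0 < complex.Re a -> isL2 setT (ck a).
Proof.
move=> a0.
have mT : measurable (setT : set R) by exact: measurableT.
have i1 : mu.-integrable setT (EFin \o (fun t => complex.Re (ck a t))).
  apply: (@integrable_FTC_bounded _ (fun t => complex.Re (ck_primitive a t)) (pi / 2)).
  - by move=> t; have [] := cderiv_continuous (cderiv_ck t a0).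
  - move=> t; rewrite /ck Re_inv divr_ge0 ?sqr_ge0// ReD /= addr0; exact: ltW.
  - by move=> t; have [] := cderiv_ck_primitive t a0.
  - by move=> t /=; rewrite ler_norml !ltW ?atan_ltpi2 ?atan_gtNpi2.
apply: (isL2_le mT (cmeas_ck mT a0) (integrable_EFinZl mT i1 (complex.Re a)^-1)).
move=> t _; rewrite normc_ck /ck Re_inv normc_sqr ReD ImD /= addr0.
by rewrite mulrA mulVf ?mul1r// lt0r_neq0.
Qed.

Lemma cvg_ck_primitive (a : R[i]) : 0 < complex.Re a ->
  (ck_primitive a n.+1%:R - ck_primitive a (- n.+1%:R) : R[i]^o) @[n --> \oo]
    --> ((pi : R)%:C : R[i]^o).
Proof.
move=> a0; set p := complex.Re a; set q := complex.Im a.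
have cy (f : nat -> R) : (forall A, \forall n \near \oo, A <= f n) ->
    atan (f n / p) @[n --> \oo] --> pi / 2.
  move=> fy; apply: (cvg_comp _ _ _ (@cvgy_atan R)); apply/cvgryPge => A.
  by apply: filterS (fy (A * p)) => n; rewrite ler_pdivlMr.
have nA A (b : R) : \forall n \near \oo, A <= n.+1%:R + b.
  near=> n; rewrite -lerBlDr (@le_trans _ _ n%:R)// ?ler_nat//.
  by near: n; exact: nbhs_infty_ger.
apply/cvg_ReIm; split => /=.
  rewrite (_ : pi = pi / 2 - (- (pi / 2)) :> R); last by field.
  apply: cvgB; first by apply: cy => A; under eq_near do rewrite addrC; exact: nA.
  rewrite (_ : (fun n => _) = (fun n => - atan ((n.+1%:R - q) / p))); last first.
    apply/funext => n; rewrite -atanN -mulNr; congr (atan (_ / _)); ring.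
  by apply: cvgN; apply: cy => A; exact: nA.
(* the logarithms cancel in the limit *)
pose rho (n : nat) : R := (p ^+ 2 + (q + n.+1%:R) ^+ 2) / (p ^+ 2 + (q - n.+1%:R) ^+ 2).
have D0 (x : R) : 0 < p ^+ 2 + x ^+ 2 by rewrite ltr_pwDl ?sqr_ge0// exprn_gt0.
rewrite (_ : (fun n => _) = (fun n => - (2^-1 * ln (rho n)))); last first.
  apply/funext => n; rewrite /rho ln_div ?posrE//; ring.
have nV : n.+1%:R^-1 @[n --> \oo] --> (0 : R) by exact: cvg_harmonic.
have rho1 : rho n @[n --> \oo] --> (1 : R).
  pose h (e : R) n : R := (p * n.+1%:R^-1) ^+ 2 + (q * n.+1%:R^-1 + e) ^+ 2.
  have ch e : h e n @[n --> \oo] --> (p * 0) ^+ 2 + (q * 0 + e) ^+ 2.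
    rewrite !expr2; apply: cvgD.
      by apply: cvgM; apply: cvgMr.
    by apply: cvgM; apply: cvgD; (try exact: cvg_cst); apply: cvgMr.
  rewrite (_ : rho = (fun n => h 1 n / h (-1) n)); last first.
    apply/funext => n; rewrite /rho /h.
    have n0 : n.+1%:R != 0 :> R by rewrite pnatr_eq0.
    have e1 : p ^+ 2 + (q - n.+1%:R) ^+ 2 != 0 by rewrite lt0r_neq0.
    move: (n.+1%:R) n0 e1 => N n0 e1.
    have e2 : (p * N^-1) ^+ 2 + (q * N^-1 + -1) ^+ 2 =
      (p ^+ 2 + (q - N) ^+ 2) / N ^+ 2 by field.
    have e3 : (p * N^-1) ^+ 2 + (q * N^-1 + 1) ^+ 2 =
      (p ^+ 2 + (q + N) ^+ 2) / N ^+ 2 by field.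
    by rewrite e2 e3; field; rewrite e1 n0.
  have E1 : (p * 0) ^+ 2 + (q * 0 + 1) ^+ 2 = 1.
    by rewrite !mulr0 add0r expr0n/= add0r expr1n.
  have E2 : (p * 0) ^+ 2 + (q * 0 + -1) ^+ 2 = 1.
    by rewrite !mulr0 add0r expr0n/= add0r sqrrN expr1n.
  have c1 := ch 1; have c2 := ch (-1); rewrite E1 in c1; rewrite E2 in c2.
  rewrite -[X in _ --> X]divr1; apply: cvgM; first exact: c1.
  by apply: cvgV; [exact: oner_neq0|exact: c2].
rewrite -oppr0 -(mulr0 2^-1); apply: cvgN; apply: cvgMr; rewrite -ln1.
by apply: continuous_cvg rho1; apply: continuous_ln.
Unshelve. all: by end_near. Qed.

Let exhaust_lt n : - n.+1%:R < n.+1%:R :> R.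
Proof. by rewrite -subr_gt0 opprK addr_gt0 ?ltr0n. Qed.

Let exhaust_cover (t : R) : setT t -> \forall n \near \oo, t \in `[- n.+1%:R, n.+1%:R].
Proof.
move=> _; near=> n; rewrite in_itv/= -ler_norml (@le_trans _ _ n%:R)// ?ler_nat//.
by near: n; exact: nbhs_infty_ger.
Unshelve. all: by end_near. Qed.

Lemma ckN (b : R[i]) s : 0 < complex.Re b ->
  cderiv (fun s => ck b (- s)) s ('i%C * ck b (- s) ^+ 2) /\
  cderiv (fun s => - ck_primitive b (- s)) s (ck b (- s)).
Proof.
move=> b0.
have comp (f f' : R -> R[i]) : (forall t, cderiv f t (f' t)) ->
    cderiv (fun s => f (- s)) s (- f' (- s)).
  move=> df; have [d1 d2] := df (- s).
  have dN : is_derive s 1 (fun s : R => - s) (- 1).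
    by rewrite (_ : (fun s : R => - s) = - id)//; exact: is_deriveN.
  split; [rewrite ReN|rewrite ImN].
    have := is_derive1_comp d1 dN.
    by rewrite mulrN1; apply.
  have := is_derive1_comp d2 dN.
  by rewrite mulrN1; apply.
split.
  apply: (cderiv_eq (comp _ _ (fun t => cderiv_ck t b0))).
  by rewrite opprK.
apply: (cderiv_eq (cderivN (comp _ _ (fun t => cderiv_ck_primitive t b0)))).
by rewrite opprK.
Qed.

Lemma conj_ck (b : R[i]) s : conjc (ck b s) = ck (conjc b) (- s).
Proof.
have E : conjc b + 0 +i* (- s) = conjc (b + 0 +i* s).
  by rewrite conjcD; congr +%R; apply: complex_eq.
rewrite /ck E; move: (b + _) => z.
by rewrite !invcE conjcM normc_conj; congr *%R; apply: complex_eq; rewrite //= oppr0.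
Qed.

Lemma isL2_ckN (b : R[i]) : 0 < complex.Re b -> isL2 setT (fun s => ck b (- s)).
Proof.
move=> b0; have mT : measurable (setT : set R) by exact: measurableT.
have -> : (fun s => ck b (- s)) = (fun s => conjc (ck (conjc b) s)).
  by apply/funext => s; rewrite conj_ck; case: b {b0} => p q; rewrite /= opprK.
by apply: isL2_conj => //; apply: isL2_ck; case: b b0.
Qed.

Lemma cvg_increment_ckN (b : R[i]) : 0 < complex.Re b ->
  (- ck_primitive b (- n.+1%:R) - (- ck_primitive b (- - n.+1%:R)) : R[i]^o)
    @[n --> \oo] --> ((pi : R)%:C : R[i]^o).
Proof.
move=> /cvg_ck_primitive.
by apply: eq_ccvg => n; rewrite !opprK addrC.
Qed.

(** The partial fraction decomposition reduces the products of two kernels to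
    single ones, whose principal values are computed from the primitive. *)
Lemma cintegral_ck_ckN (a b : R[i]) : 0 < complex.Re a -> 0 < complex.Re b ->
  cintegral setT (fun s => ck a s * ck b (- s)) = (2 * pi)%:C / (a + b).
Proof.
move=> a0 b0; have mT : measurable (setT : set R) by exact: measurableT.
have ab0 : a + b != 0.
  by apply: contraTneq (addr_gt0 a0 b0) => /(congr1 (@complex.Re R)); rewrite ReD /= => ->; rewrite ltxx.
have E s : ck a s * ck b (- s) = (a + b)^-1 * (ck a s + ck b (- s)).
  have := ck_neq0 s a0; have := ck_neq0 (- s) b0; rewrite /ck.
  have -> : (0 +i* (- s) : R[i]) = - (0 +i* s) by apply: complex_eq; rewrite //= oppr0.
  by move: (0 +i* s) => z h1 h2; field; rewrite ab0 h1 h2.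
have pi2 : ((2 * pi : R)%:C : R[i]) = pi%:C + pi%:C by rewrite -rmorphD; congr (_%:C); ring.
apply: (@cintegral_FTC_exhaust _ setT
    (fun s => (a + b)^-1 * (ck_primitive a s + - ck_primitive b (- s))) _
    (fun s => (a + b)^-1 * (- ('i%C * ck a s ^+ 2) + 'i%C * ck b (- s) ^+ 2))
    (fun n => - n.+1%:R) (fun n => n.+1%:R) _ mT) => //.
- move=> t; rewrite E; apply: (cderiv_eq (cderivM (cderiv_cst (a + b)^-1 t)
    (cderivD (cderiv_ck_primitive t a0) (ckN t b0).2))).
  by rewrite mul0r add0r.
- move=> t; under eq_fun do rewrite E.
  apply: (cderiv_eq (cderivM (cderiv_cst (a + b)^-1 t)
    (cderivD (cderiv_ck t a0) (ckN t b0).1))).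
  by rewrite mul0r add0r.
- by apply: isL2_mul_cintegrable => //; [exact: isL2_ck|exact: isL2_ckN].
- rewrite mulrC pi2.
  apply: (eq_ccvg _ (ccvgMl (ccvgD (cvg_ck_primitive a0) (cvg_increment_ckN b0)))).
  by move=> n; ring.
Qed.

Lemma cvg_ck0 (a : R[i]) (f : nat -> R) : 0 < complex.Re a ->
  (forall A, \forall n \near \oo, A <= `|f n|) ->
  (ck a (f n) : R[i]^o) @[n --> \oo] --> (0 : R[i]^o).
Proof.
move=> a0 fy; apply/cvg_normcP => e e0.
apply: filterS (fy (`|complex.Im a| + e^-1)) => n h; rewrite subr0.
have {}h : e^-1 <= `|complex.Im a + f n|.
  have := ler_distD 0 (complex.Im a + f n) (complex.Im a).
  rewrite subr0 sub0r normrN addrC addKr; move: h; lra.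
rewrite -(ltr_pXn2r (n := 2))// ?nnegrE ?normc_ge0 ?(ltW e0)// normc_ck.
rewrite -[ltRHS]invrK ltf_pV2 ?posrE ?invr_gt0 ?exprn_gt0//; last first.
  by rewrite ltr_pwDl ?sqr_ge0// exprn_gt0.
rewrite -exprVn ltr_pwDl ?exprn_gt0// -[leRHS]real_normK ?num_real//.
by rewrite ler_pXn2r ?nnegrE ?normr_ge0// invr_ge0 ltW.
Qed.

Lemma cintegral_ck_ck (a b : R[i]) : 0 < complex.Re a -> 0 < complex.Re b ->
  cintegral setT (fun s => ck a s * ck b s) = 0.
Proof.
move=> a0 b0; have mT : measurable (setT : set R) by exact: measurableT.
have ci : cintegrable setT (fun s => ck a s * ck b s).
  by apply: isL2_mul_cintegrable => //; exact: isL2_ck.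
have [ab|ab] := eqVneq a b.
  subst b; apply: (@cintegral_FTC_exhaust _ setT (fun s => 'i%C * ck a s) _
    (fun s => - ('i%C * ck a s ^+ 2) * ck a s + ck a s * - ('i%C * ck a s ^+ 2))
    (fun n => - n.+1%:R) (fun n => n.+1%:R) _ mT) => //.
  - move=> t; apply: (cderiv_eq (cderivM (cderiv_cst 'i%C t) (cderiv_ck t a0))).
    rewrite mul0r add0r mulrN mulrA (_ : 'i%C * 'i%C = -1 :> R[i]).
      by rewrite mulN1r opprK expr2.
    by apply: complex_eq; rewrite /= ?mulr0 ?mul0r; ring.
  - by move=> t; apply: cderivM; exact: cderiv_ck.
  - rewrite -(subr0 (0 : R[i])); apply: ccvgB; rewrite -(mulr0 'i%C); apply: ccvgMl;
      apply: cvg_ck0 => // A; near=> n; rewrite ?normrN ger0_norm//;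
      rewrite (@le_trans _ _ n%:R)// ?ler_nat//;
      near: n; exact: nbhs_infty_ger.
have ba0 : b - a != 0 by rewrite subr_eq0 eq_sym.
have E s : ck a s * ck b s = (b - a)^-1 * (ck a s - ck b s).
  have := ck_neq0 s a0; have := ck_neq0 s b0; rewrite /ck.
  by move: (0 +i* s) => z h1 h2; field; rewrite ba0 h1 h2.
apply: (@cintegral_FTC_exhaust _ setT
    (fun s => (b - a)^-1 * (ck_primitive a s - ck_primitive b s)) _
    (fun s => (b - a)^-1 * (- ('i%C * ck a s ^+ 2) - - ('i%C * ck b s ^+ 2)))
    (fun n => - n.+1%:R) (fun n => n.+1%:R) _ mT) => //.
- move=> t; rewrite E; apply: (cderiv_eq (cderivM (cderiv_cst (b - a)^-1 t)
    (cderivD (cderiv_ck_primitive t a0) (cderivN (cderiv_ck_primitive t b0))))).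
  by rewrite mul0r add0r.
- move=> t; under eq_fun do rewrite E.
  apply: (cderiv_eq (cderivM (cderiv_cst (b - a)^-1 t)
    (cderivD (cderiv_ck t a0) (cderivN (cderiv_ck t b0))))).
  by rewrite mul0r add0r.
- rewrite -(mulr0 (b - a)^-1) -(subrr (pi : R)%:C).
  apply: (eq_ccvg _ (ccvgMl (ccvgB (cvg_ck_primitive a0) (cvg_ck_primitive b0)))).
  by move=> n; ring.
Unshelve. all: by end_near. Qed.

End CauchyKernel.

(** * The Plancherel theorem on the half line *)

Section InnerProduct.
Variable R : realType.
Local Notation mu := (@lebesgue_measure R).
Implicit Types (D : set R) (f g h : R -> R[i]).

Definition inner D f g : R[i] := cintegral D (fun t => f t * conjc (g t)).

Lemma inner_integrable D f g : measurable D -> isL2 D f -> isL2 D g ->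
  cintegrable D (fun t => f t * conjc (g t)).
Proof. by move=> mD lf lg; apply: isL2_mul_cintegrable => //; exact: isL2_conj. Qed.

Lemma innerC D f g : measurable D -> isL2 D f -> isL2 D g ->
  inner D g f = conjc (inner D f g).
Proof.
move=> mD lf lg; have [i1 i2] := inner_integrable mD lf lg.
apply: complex_eq; rewrite /inner /=.
  by apply: eq_Rintegral => t _; case: (f t) => a b; case: (g t) => c d /=; ring.
rewrite -[RHS]mulN1r -RintegralZl//; apply: eq_Rintegral => t _.
by case: (f t) => a b; case: (g t) => c d /=; ring.
Qed.

Lemma innerDl D f g h : measurable D -> isL2 D f -> isL2 D g -> isL2 D h ->
  inner D (fun t => f t + g t) h = inner D f h + inner D g h.
Proof.
move=> mD lf lg lh; rewrite /inner -cintegralD//; try exact: inner_integrable.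
by apply: eq_cintegral => t _; rewrite mulrDl.
Qed.

Lemma innerZl D f h (c : R[i]) : measurable D -> isL2 D f -> isL2 D h ->
  inner D (fun t => c * f t) h = c * inner D f h.
Proof.
move=> mD lf lh; rewrite /inner -cintegralZl//; last exact: inner_integrable.
by apply: eq_cintegral => t _; rewrite mulrA.
Qed.

Lemma innerDr D f g h : measurable D -> isL2 D f -> isL2 D g -> isL2 D h ->
  inner D h (fun t => f t + g t) = inner D h f + inner D h g.
Proof.
move=> mD lf lg lh; rewrite (innerC mD (isL2D mD lf lg) lh) innerDl// conjcD.
by rewrite -!innerC.
Qed.

Lemma innerZr D f h (c : R[i]) : measurable D -> isL2 D f -> isL2 D h ->
  inner D h (fun t => c * f t) = conjc c * inner D h f.
Proof.
move=> mD lf lh; rewrite (innerC mD (isL2Zl c mD lf) lh) innerZl// conjcM.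
by rewrite -innerC.
Qed.

Lemma inner0l D h : inner D (fun=> 0) h = 0.
Proof. by rewrite /inner; under eq_fun do rewrite mul0r; exact: cintegral_cst0. Qed.

Lemma inner0r D h : inner D h (fun=> 0) = 0.
Proof.
rewrite /inner; have -> : (fun t => h t * conjc 0) = (fun=> 0 : R[i]).
  apply/funext => t; rewrite (_ : conjc 0 = 0) ?mulr0//.
  by apply: complex_eq; rewrite //= oppr0.
exact: cintegral_cst0.
Qed.

Lemma inner_nrm D f : inner D f f = (nrm D f ^+ 2)%:C.
Proof.
rewrite nrm_sqr -cintegral_real; apply: eq_cintegral => t _; exact: mulc_conj.
Qed.

Lemma normc_inner_le D f g : measurable D -> isL2 D f -> isL2 D g ->
  normc (inner D f g) <= nrm D f * nrm D g.
Proof.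
move=> mD lf lg; have lc := isL2_conj mD lg.
rewrite (le_trans (normc_cintegralM_le mD lf lc))//.
rewrite (_ : nrm D (fun t => conjc (g t)) = nrm D g)//.
rewrite /nrm /sqn; congr (Num.sqrt (fine _)); apply: eq_integral => t _.
by rewrite normc_conj.
Qed.

Lemma innerBl D f g h : measurable D -> isL2 D f -> isL2 D g -> isL2 D h ->
  inner D (fun t => f t - g t) h = inner D f h - inner D g h.
Proof.
move=> mD lf lg lh; rewrite /inner -cintegralB//; try exact: inner_integrable.
by apply: eq_cintegral => t _; rewrite mulrBl.
Qed.

Lemma innerBr D f g h : measurable D -> isL2 D f -> isL2 D g -> isL2 D h ->
  inner D h (fun t => f t - g t) = inner D h f - inner D h g.
Proof.
move=> mD lf lg lh; rewrite (innerC mD (isL2B mD lf lg) lh) innerBl//.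
by rewrite conjcD (innerC mD lf lh) (innerC mD lg lh); congr +%R;
  case: (inner D g h) => x y; apply: complex_eq.
Qed.

Lemma inner_perturb D f g f' g' (e : R) : measurable D ->
  isL2 D f -> isL2 D g -> isL2 D f' -> isL2 D g' -> 0 <= e <= 1 ->
  nrm D (fun t => f t - f' t) <= e -> nrm D (fun t => g t - g' t) <= e ->
  normc (inner D f g - inner D f' g') <= e * (nrm D f + nrm D g + 1).
Proof.
move=> mD lf lg lf' lg' /andP[e0 e1] ef eg.
have lff := isL2B mD lf lf'; have lgg := isL2B mD lg lg'.
have -> : inner D f g - inner D f' g' =
    inner D (fun t => f t - f' t) g + inner D f' (fun t => g t - g' t).
  by rewrite innerBl// innerBr//; ring.
have nf' : nrm D f' <= nrm D f + e.
  have := lerB_nrm mD lf lf'; rewrite ler_norml => /andP[h _].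
  by move: h ef; lra.
have h1 := normc_inner_le mD lff lg; have h2 := normc_inner_le mD lf' lgg.
rewrite (le_trans (ler_normcD _ _))//.
have h3 : nrm D (fun t => f t - f' t) * nrm D g <= e * nrm D g.
  by rewrite ler_wpM2r// nrm_ge0.
have h4 : nrm D f' * nrm D (fun t => g t - g' t) <= (nrm D f + e) * e.
  by rewrite ler_pM ?nrm_ge0.
have h5 : e * e <= e by rewrite ler_piMl.
move: h1 h2 h3 h4 h5; rewrite !mulrDr mulrDl mulr1 [nrm D f * e]mulrC; lra.
Qed.

End InnerProduct.

Section Completeness.
Variable R : realType.
Local Notation mu := (@lebesgue_measure R).

(** Fatou's lemma for the squared moduli. *)
Lemma le_nrm_fatou D (f_ : nat -> R -> R[i]) f (C : R) : measurable D ->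
  (forall n, isL2 D (f_ n)) ->
  (forall t, D t -> (f_ n t : R[i]^o) @[n --> \oo] --> (f t : R[i]^o)) ->
  (forall n, nrm D (f_ n) <= C) ->
  isL2 D f /\ nrm D f <= C.
Proof.
move=> mD lf_ ff fC.
have mf : cmeas D f by apply: (cmeas_cvg _ ff) => n; exact: isL2_cmeas.
have C0 : 0 <= C by exact: le_trans (nrm_ge0 _ _) (fC 0%N).
have mn n : measurable_fun D (fun t => (normc (f_ n t) ^+ 2)%:E).
  by apply: measurable_sqn; exact: isL2_cmeas.
have le : (sqn D f <= (C ^+ 2)%:E)%E.
  have F := @fatou _ _ _ mu D mD (fun n t => (normc (f_ n t) ^+ 2)%:E) mn
    (fun n t _ => sqr_ge0 _).
  have -> : sqn D f = (\int[mu]_(t in D) limn_einf (fun n => (normc (f_ n t) ^+ 2)%:E))%E.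
    apply: eq_integral => t /[!inE] Dt.
    have c : ((normc (f_ n t) ^+ 2)%:E @[n --> \oo] --> (normc (f t) ^+ 2)%:E)%E.
      apply: cvg_EFin; first exact: nearW.
      rewrite expr2; apply: (@cvg_trans _ (normc (f_ n t) * normc (f_ n t) @[n --> \oo])).
        by apply: near_eq_cvg; apply: nearW => n; rewrite /= expr2.
      by apply: cvgM; apply: ccvg_normc; exact: ff.
    by rewrite (cvg_limn_einf_sup c).1.
  apply: (le_trans F); rewrite limn_einf_lim; apply: lime_le.
    exact: is_cvg_einfs.
  apply: nearW => n; apply: (@le_trans _ _ (\int[mu]_(t in D) (normc (f_ n t) ^+ 2)%:E)%E).
    by apply: ereal_inf_lbound; exists n => /=.
  by rewrite -/(sqn D (f_ n)) (sqn_fin (lf_ n)) lee_fin ler_pXn2r ?nnegrE ?nrm_ge0.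
have lf : isL2 D f by apply/isL2P; split => //; apply: le_lt_trans le _; rewrite ltry.
split => //; move: le; rewrite (sqn_fin lf) lee_fin.
by rewrite ler_pXn2r ?nnegrE ?nrm_ge0.
Qed.

Lemma cvgn_half_cauchy (u : nat -> R[i]) (C : R) : 0 <= C ->
  (forall n, normc (u n.+1 - u n) <= C * 2^-1 ^+ n) ->
  cvg ((u n : R[i]^o) @[n --> \oo]).
Proof.
move=> C0 uC.
have real (v : nat -> R) : (forall n, `|v n.+1 - v n| <= C * 2^-1 ^+ n) -> cvgn v.
  move=> vC.
  have cs : cvgn (series (fun n => v n.+1 - v n)).
    apply: normed_cvg; apply: (@series_le_cvg _ _ (geometric C 2^-1)) => //.
    - by move=> n /=; exact: normr_ge0.
    - by move=> n; rewrite /geometric /= mulr_ge0// exprn_ge0.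
    - by apply: is_cvg_geometric_series; rewrite ger0_norm// invf_lt1// ltr1n.
  have -> : v = (fun n => v 0%N + series (fun n => v n.+1 - v n) n).
    by apply/funext => n; rewrite /series /= telescope_sumr// addrC subrK.
  by apply: is_cvgD; [exact: is_cvg_cst|exact: cs].
have c1 : cvgn (fun n => complex.Re (u n)).
  by apply: real => n; rewrite (le_trans _ (uC n))// -ReN -ReD normRe_le.
have c2 : cvgn (fun n => complex.Im (u n)).
  by apply: real => n; rewrite (le_trans _ (uC n))// -ImN -ImD normIm_le.
apply/cvg_ex; exists (limn (fun n => complex.Re (u n)) +i* limn (fun n => complex.Im (u n))).
by apply/cvg_ReIm.
Qed.

(** A fast Cauchy sequence in the mean converges almost everywhere, hence
    in the mean by Fatou's lemma. *)
Lemma isL2_complete D (F_ : nat -> R -> R[i]) (C : R) : measurable D -> 0 <= C ->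
  (forall n, isL2 D (F_ n)) ->
  (forall n, nrm D (fun t => F_ n.+1 t - F_ n t) <= C * 4^-1 ^+ n) ->
  exists2 F, isL2 D F & forall n, nrm D (fun t => F_ n t - F t) <= 2 * C * 4^-1 ^+ n.
Proof.
move=> mD C0 lF FC.
have ld n : isL2 D (fun t => F_ n.+1 t - F_ n t) by exact: isL2B.
pose g n t : \bar R := (4 ^+ n * normc (F_ n.+1 t - F_ n t) ^+ 2)%:E.
have mg n : measurable_fun D (g n).
  apply/measurable_EFinP; apply: measurable_funM; first exact: measurable_cst.
  by apply: measurable_funX; apply: measurable_normc; exact: isL2_cmeas.
have g0 n t : D t -> (0 <= g n t)%E by move=> _; rewrite lee_fin mulr_ge0 ?exprn_ge0 ?sqr_ge0 ?normc_ge0.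
pose Sg t : \bar R := (\sum_(n <oo) g n t)%E.
have mS : measurable_fun D Sg by apply: ge0_emeasurable_sum => // n t Dt _; exact: g0.
have S0 t : D t -> (0 <= Sg t)%E by move=> Dt; apply: nneseries_ge0 => n _ _; exact: g0.
have Sy : (\int[mu]_(t in D) Sg t < +oo)%E.
  rewrite integral_nneseries//.
  apply: (@le_lt_trans _ _ (\sum_(n <oo) (geometric (C ^+ 2) (4^-1) n)%:E)%E).
    apply: lee_nneseries => n _.
      by move=> _; apply: integral_ge0 => t Dt; exact: g0.
    rewrite /g; under eq_integral do rewrite EFinM.
    rewrite ge0_integralZl_EFin ?exprn_ge0//; last 2 first.
    - by move=> t _; rewrite lee_fin sqr_ge0.
    - by apply: measurable_sqn; exact: isL2_cmeas.
    rewrite -/(sqn D (fun t => F_ n.+1 t - F_ n t)) (sqn_fin (ld n)) -EFinM lee_fin.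
    rewrite /geometric /=; apply: (@le_trans _ _ (4 ^+ n * (C * 4^-1 ^+ n) ^+ 2)).
      by rewrite ler_wpM2l ?exprn_ge0// ler_pXn2r ?nnegrE ?nrm_ge0 ?mulr_ge0 ?exprn_ge0.
    rewrite exprMn mulrCA ler_wpM2l ?sqr_ge0// expr2 mulrA -exprMn mulfV//.
    by rewrite expr1n mul1r.
  have c : cvgn (series (geometric (C ^+ 2) 4^-1)).
    by apply: is_cvg_geometric_series; rewrite ger0_norm// invf_lt1// ltr1n.
  have -> : (\sum_(n <oo) (geometric (C ^+ 2) (4^-1) n)%:E =
      (limn (series (geometric (C ^+ 2) 4^-1)))%:E)%E; last by rewrite ltry.
  apply/cvg_lim => //.
  have E : (fun n => (\sum_(0 <= i < n) (geometric (C ^+ 2) (4^-1) i)%:E)%E) =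
      (fun n => (series (geometric (C ^+ 2) 4^-1) n)%:E).
    by apply/funext => n; rewrite /= /series/= sumEFin.
  by rewrite E; apply: cvg_EFin; [exact: nearW|exact: c].
have iS : mu.-integrable D Sg.
  apply/integrableP; split => //; apply: le_lt_trans Sy; rewrite le_eqVlt.
  by apply/orP; left; apply/eqP; apply: eq_integral => t /[!inE] Dt; rewrite gee0_abs// S0.
pose G : set R := D `&` [set t | (Sg t < +oo)%E].
have mG : measurable G by exact: emeasurable_fun_infty_o.
have Gae : {ae mu, forall t, D t -> G t}.
  have := @integrable_ae _ _ _ mu D mD Sg iS; apply: ae_imp => t h Dt; split => //=.
  by have := h Dt; rewrite fin_numE => /andP[_]; rewrite -ltey.
pose u n t := F_ n t * (\1_G t : R)%:C.
have cu t : cvg ((u n t : R[i]^o) @[n --> \oo]).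
  rewrite /u indicE; have [tG|tG] := boolP (t \in G); last first.
    by under eq_fun do rewrite mulr0; exact: is_cvg_cst.
  under eq_fun do rewrite mulr1.
  have [Dt Syt] := set_mem tG.
  have Sfin : Sg t \is a fin_num by rewrite ge0_fin_numE// S0.
  apply: (@cvgn_half_cauchy _ (Num.sqrt (fine (Sg t)))) => [|n]; first exact: sqrtr_ge0.
  have le : (g n t <= Sg t)%E.
    rewrite /Sg (nneseries_split 0 n.+1)//; last by move=> k _; exact: g0.
    apply: (@le_trans _ _ (\sum_(0 <= k < 0 + n.+1) g k t)%E).
      rewrite big_nat_recr//=; apply: leeDr.
      by apply: sume_ge0 => k _; exact: g0.
    by apply: leeDl; apply: nneseries_ge0 => k _ _; exact: g0.
  rewrite -(fineK Sfin) lee_fin in le.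
  have e2 : 0 <= Num.sqrt (fine (Sg t)) * 2^-1 ^+ n by rewrite mulr_ge0 ?sqrtr_ge0 ?exprn_ge0.
  rewrite -(ler_pXn2r (n := 2))// ?nnegrE ?normc_ge0// exprMn sqr_sqrtr ?fine_ge0 ?S0//.
  rewrite -exprM mulnC exprM.
  have -> : (2^-1 : R) ^+ 2 = 4^-1 by rewrite exprVn -natrX.
  by rewrite exprVn ler_pdivlMr ?exprn_gt0// mulrC.
pose F t : R[i] := lim ((u n t : R[i]^o) @[n --> \oo]).
have uF t : (u n t : R[i]^o) @[n --> \oo] --> (F t : R[i]^o) by exact: cu.
have lu n : isL2 D (u n) by exact: isL2_indic.
have uae n : ae_eq mu D (u n) (F_ n).
  by move: Gae; apply: ae_imp => t h Dt; rewrite /u indicE mem_set ?mulr1//; exact: h.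
have step n k : nrm D (fun t => F_ n t - F_ (n + k)%N t) <=
    2 * C * 4^-1 ^+ n - 2 * C * 4^-1 ^+ (n + k).
  elim: k => [|k IH].
    rewrite addn0 subrr (@eq_nrm _ _ _ (fun=> 0 * F_ n 0)); last first.
      by move=> t _; rewrite subrr mul0r.
    have := isL2_cst0 mD; rewrite (_ : (fun=> 0) = (fun=> 0 * F_ n 0)); last first.
      by apply/funext => t; rewrite mul0r.
    move=> l0; rewrite (@eq_nrm _ _ _ (fun t => 0 * (0 * F_ n 0))); last by move=> t _; rewrite !mul0r.
    by rewrite nrmZ// normc0 mul0r.
  rewrite addnS (le_trans (ler_nrm_distD mD (lF n) (lF (n + k)%N) (lF (n + k).+1)))//.
  have h := FC (n + k)%N; rewrite nrm_distC in h.
  rewrite (le_trans (lerD IH h))// exprS.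
  have p0 : 0 <= C * 4^-1 ^+ (n + k) by rewrite mulr_ge0// exprn_ge0.
  move: p0; rewrite -!mulrA; set a := _ ^+ n; set b := _ ^+ (n + k).
  rewrite (mulrCA C 4^-1); move: (C * a) (C * b) => x y; lra.
have main n : isL2 D (fun t => u n t - F t) /\
    nrm D (fun t => u n t - F t) <= 2 * C * 4^-1 ^+ n.
  apply: (@le_nrm_fatou _ (fun k t => u n t - u (n + k)%N t)) => //.
  - by move=> k; exact: isL2B.
  - move=> t _; apply: ccvgB; first exact: ccvg_cst.
    have := uF t; rewrite -(cvg_shiftn n (fun m => u m t : R[i]^o)).
    by apply: eq_ccvg => m; rewrite addnC.
  - move=> k; rewrite (@nrm_ae_eq _ D _ (fun t => F_ n t - F_ (n + k)%N t))//.
    + rewrite (le_trans (step n k))// gerBl mulr_ge0 ?exprn_ge0//.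
      by rewrite mulr_ge0.
    + by apply: cmeasB; exact: isL2_cmeas.
    + by apply: cmeasB; exact: isL2_cmeas.
    + have := uae n; have := uae (n + k)%N; apply: ae_imp2 => t h1 h2 Dt.
      by rewrite h1// h2.
have lFF : isL2 D F.
  have [l0 _] := main 0%N; have := isL2B mD (lu 0%N) l0.
  by apply: eq_isL2 => // t _; rewrite subKr.
exists F => // n; have [l0 le0] := main n.
apply: le_trans le0; rewrite le_eqVlt; apply/orP; left; apply/eqP.
apply: nrm_ae_eq => //; try by apply: cmeasB; exact: isL2_cmeas.
by have := uae n; apply: ae_imp => t h Dt; rewrite h.
Qed.

End Completeness.

Section FourierPairs.
Variable R : realType.
Local Notation mu := (@lebesgue_measure R).
Implicit Types (f g h H : R -> R[i]) (s : seq (R[i] * R)).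

Let mT : measurable (setT : set R).
Proof. exact: measurableT. Qed.

Let mR := @measurable_Rplus R.

Definition fourier_cst : R := (Num.sqrt (2 * pi))^-1.

Lemma pi2_gt0 : 0 < 2 * pi :> R.
Proof. by rewrite mulr_gt0// pi_gt0. Qed.

Lemma fourier_cst_sqr : fourier_cst ^+ 2 = (2 * pi)^-1.
Proof. by rewrite exprVn sqr_sqrtr// ltW// pi2_gt0. Qed.

(** Finite sums of exponentials, given by their coefficients and exponents,
    and the boundary values of their Laplace transforms. *)
Definition exp_sum s (t : R) : R[i] := \sum_(p <- s) p.1 * powexp 0 p.2%:C t.

Definition ck_sum s (y : R) : R[i] :=
  \sum_(p <- s) (fourier_cst%:C * p.1) * ck p.2%:C y.

Definition decaying s := all (fun p => 0 < p.2) s.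

Definition scale_sum (c : R[i]) s := [seq (c * p.1, p.2) | p <- s].

Lemma exp_sum_cons p s t : exp_sum (p :: s) t = p.1 * powexp 0 p.2%:C t + exp_sum s t.
Proof. by rewrite /exp_sum big_cons. Qed.

Lemma ck_sum_cons p s y : ck_sum (p :: s) y =
  fourier_cst%:C * p.1 * ck p.2%:C y + ck_sum s y.
Proof. by rewrite /ck_sum big_cons. Qed.

Lemma exp_sum_cat s1 s2 t : exp_sum (s1 ++ s2) t = exp_sum s1 t + exp_sum s2 t.
Proof. by rewrite /exp_sum big_cat. Qed.

Lemma ck_sum_cat s1 s2 y : ck_sum (s1 ++ s2) y = ck_sum s1 y + ck_sum s2 y.
Proof. by rewrite /ck_sum big_cat. Qed.

Lemma exp_sumZ c s t : exp_sum (scale_sum c s) t = c * exp_sum s t.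
Proof.
by rewrite /exp_sum big_map mulr_sumr; apply: eq_bigr => p _ /=; rewrite mulrA.
Qed.

Lemma ck_sumZ c s y : ck_sum (scale_sum c s) y = c * ck_sum s y.
Proof. by rewrite /ck_sum big_map mulr_sumr; apply: eq_bigr => p _ /=; ring. Qed.

Lemma decaying_cat s1 s2 : decaying (s1 ++ s2) = decaying s1 && decaying s2.
Proof. exact: all_cat. Qed.

Lemma decayingZ c s : decaying (scale_sum c s) = decaying s.
Proof. by rewrite /decaying all_map; apply: eq_all => p. Qed.

Lemma isL2_exp_sum s : decaying s -> isL2 Rplus (exp_sum s).
Proof.
elim: s => [_|p s IH /= /andP[p0 ds]].
  by apply: eq_isL2 (isL2_cst0 mR) => // t _; rewrite /exp_sum big_nil.
have : isL2 Rplus (fun t => p.1 * powexp 0 p.2%:C t + exp_sum s t).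
  by apply: isL2D => //; [apply: isL2Zl => //; exact: isL2_powexp|exact: IH].
by apply: eq_isL2 => // t _; rewrite exp_sum_cons.
Qed.

Lemma isL2_ck_sum s : decaying s -> isL2 setT (ck_sum s).
Proof.
elim: s => [_|p s IH /= /andP[p0 ds]].
  by apply: eq_isL2 (isL2_cst0 mT) => // t _; rewrite /ck_sum big_nil.
have : isL2 setT (fun t => fourier_cst%:C * p.1 * ck p.2%:C t + ck_sum s t).
  by apply: isL2D => //; [apply: isL2Zl => //; exact: isL2_ck|exact: IH].
by apply: eq_isL2 => // t _; rewrite ck_sum_cons.
Qed.

Lemma inner_exp_ck (a b : R) : 0 < a -> 0 < b ->
  (fourier_cst%:C * fourier_cst%:C) * inner setT (ck a%:C) (ck b%:C) =
  inner Rplus (powexp 0 a%:C) (powexp 0 b%:C).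
Proof.
move=> a0 b0; rewrite /inner.
have cr (x : R) : conjc (x%:C) = x%:C by apply: complex_eq; rewrite //= oppr0.
under eq_fun do rewrite conj_ck cr.
rewrite cintegral_ck_ckN// -rmorphM -expr2 fourier_cst_sqr.
rewrite (@eq_cintegral _ _ _ (powexp 0 (a%:C + b%:C))); last first.
  by move=> t _; rewrite -powexpM !powexp0E conj_cexp -!rmorphM -!rmorphN cr.
rewrite cintegral_powexp; last by rewrite ReD /= addr_gt0.
rewrite expr1 fact0 mulrA -rmorphM mulVf ?rmorph1//.
by rewrite lt0r_neq0 ?pi2_gt0.
Qed.

(** By bilinearity this is the integral of a product of two Cauchy kernels,
    [cintegral_ck_ckN]. *)
Lemma inner_ck_sum s1 s2 : decaying s1 -> decaying s2 ->
  inner setT (ck_sum s1) (ck_sum s2) = inner Rplus (exp_sum s1) (exp_sum s2).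
Proof.
move=> d1 d2; elim: s1 d1 => [_|p s1 IH /= /andP[p0 d1]].
  rewrite (_ : ck_sum [::] = fun=> 0); last by apply/funext => y; rewrite /ck_sum big_nil.
  rewrite (_ : exp_sum [::] = fun=> 0); last by apply/funext => y; rewrite /exp_sum big_nil.
  by rewrite !inner0l.
have lc1 := isL2_ck_sum d1; have le1 := isL2_exp_sum d1.
have lc2 := isL2_ck_sum d2; have le2 := isL2_exp_sum d2.
have lp : isL2 setT (ck p.2%:C) by exact: isL2_ck.
have lq : isL2 Rplus (powexp 0 p.2%:C) by exact: isL2_powexp.
rewrite (funext (ck_sum_cons p s1)) (funext (exp_sum_cons p s1)).
rewrite (innerDl mT (isL2Zl _ mT lp) lc1 lc2) (innerDl mR (isL2Zl _ mR lq) le1 le2).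
rewrite (innerZl _ mT lp lc2) (innerZl _ mR lq le2) IH//; congr +%R.
rewrite -mulrA mulrCA; congr *%R => {IH d1 lc1 le1 lc2 le2}.
elim: s2 d2 => [_|q s2 IH /= /andP[q0 d2]].
  rewrite (_ : ck_sum [::] = fun=> 0); last by apply/funext => y; rewrite /ck_sum big_nil.
  rewrite (_ : exp_sum [::] = fun=> 0); last by apply/funext => y; rewrite /exp_sum big_nil.
  by rewrite !inner0r mulr0.
have lc2 := isL2_ck_sum d2; have le2 := isL2_exp_sum d2.
have lp' : isL2 setT (ck q.2%:C) by exact: isL2_ck.
have lq' : isL2 Rplus (powexp 0 q.2%:C) by exact: isL2_powexp.
rewrite (funext (ck_sum_cons q s2)) (funext (exp_sum_cons q s2)).
rewrite (innerDr mT (isL2Zl _ mT lp') lc2 lp) (innerDr mR (isL2Zl _ mR lq') le2 lq).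
rewrite (innerZr _ mT lp' lp) (innerZr _ mR lq' lq) mulrDr IH//; congr +%R.
rewrite -inner_exp_ck// conjcM (_ : conjc fourier_cst%:C = fourier_cst%:C).
  by ring.
by apply: complex_eq; rewrite //= oppr0.
Qed.

Lemma nrm_ck_sum s : decaying s -> nrm setT (ck_sum s) = nrm Rplus (exp_sum s).
Proof.
move=> ds; apply: (pexpIrn (n := 2)) => //; rewrite ?nnegrE ?nrm_ge0//.
have := inner_ck_sum ds ds; rewrite !inner_nrm => /(congr1 (@complex.Re R)).
by [].
Qed.

Lemma nrm_ck_sumB s1 s2 : decaying s1 -> decaying s2 ->
  nrm setT (fun y => ck_sum s1 y - ck_sum s2 y) =
  nrm Rplus (fun t => exp_sum s1 t - exp_sum s2 t).
Proof.
move=> d1 d2; have := @nrm_ck_sum (s1 ++ scale_sum (-1) s2).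
rewrite decaying_cat decayingZ d1 d2 => /(_ isT).
rewrite (@eq_nrm _ _ _ (fun y => ck_sum s1 y - ck_sum s2 y)); last first.
  by move=> y _; rewrite ck_sum_cat ck_sumZ mulN1r.
move->; apply: eq_nrm => y _; by rewrite exp_sum_cat exp_sumZ mulN1r.
Qed.

(** [H] is the boundary value of the Laplace transform of [h], in the sense
    of the extension by continuity from sums of exponentials. *)
Definition fourier_pair h H : Prop :=
  [/\ isL2 Rplus h, isL2 setT H & forall e : R, 0 < e -> exists s,
    [/\ decaying s, nrm Rplus (fun t => h t - exp_sum s t) <= e &
        nrm setT (fun y => H y - ck_sum s y) <= e]].

Lemma exp_sum_dense h (e : R) : isL2 Rplus h -> 0 < e -> exists2 s, decaying s &
  nrm Rplus (fun t => h t - exp_sum s t) <= e.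
Proof.
move=> lh; move: e; apply: (@exponentials_total _ (fun h => forall e : R, 0 < e ->
  exists2 s, decaying s & nrm Rplus (fun t => h t - exp_sum s t) <= e)) => //.
- split.
  + move=> a b f g lf lg Sf Sg e e0.
    have ea : 0 < e / 2 / (normc a + 1) by rewrite !divr_gt0// ltr_wpDl ?normc_ge0.
    have eb : 0 < e / 2 / (normc b + 1) by rewrite !divr_gt0// ltr_wpDl ?normc_ge0.
    have [s1 d1 h1] := Sf _ ea; have [s2 d2 h2] := Sg _ eb.
    exists (scale_sum a s1 ++ scale_sum b s2).
      by rewrite decaying_cat !decayingZ d1 d2.
    have l1 := isL2B mR lf (isL2_exp_sum d1); have l2 := isL2B mR lg (isL2_exp_sum d2).
    rewrite (@eq_nrm _ _ _ (fun t => a * (f t - exp_sum s1 t) + b * (g t - exp_sum s2 t))); last first.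
      by move=> t _; rewrite exp_sum_cat !exp_sumZ; ring.
    rewrite (le_trans (ler_nrmD mR (isL2Zl a mR l1) (isL2Zl b mR l2)))// !nrmZ//.
    rewrite (splitr e) lerD//.
      rewrite (le_trans (ler_wpM2l (normc_ge0 _) h1))// mulrC mulrAC ler_pdivrMr ?ltr_wpDl ?normc_ge0//.
      by rewrite ler_wpM2l ?lerDl// ltW// divr_gt0.
    rewrite (le_trans (ler_wpM2l (normc_ge0 _) h2))// mulrC mulrAC ler_pdivrMr ?ltr_wpDl ?normc_ge0//.
    by rewrite ler_wpM2l ?lerDl// ltW// divr_gt0.
  + move=> u f g lu lf lg Su ug uf e e0.
    have e20 : 0 < e / 2 by rewrite divr_gt0.
    have := nrm_dominated mR (fun n => isL2_cmeas (lu n)) lf lg uf ug.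
    move=> /cvgrPdist_le/(_ _ e20)[n _ /(_ n (leqnn n))].
    rewrite sub0r normrN ger0_norm ?nrm_ge0// => hn.
    have [s ds hs] := Su n _ e20; exists s => //.
    rewrite (le_trans (ler_nrm_distD mR lf (lu n) (isL2_exp_sum ds)))//.
    by rewrite (splitr e) lerD// nrm_distC.
- move=> a a0 e e0; exists [:: (1, a)]; first by rewrite /decaying /= a0.
  rewrite (@eq_nrm _ _ _ (fun t => 0 * powexp 0 a%:C t)).
    by rewrite nrmZ ?normc0 ?mul0r ?ltW//; exact: isL2_powexp.
  by move=> t _; rewrite exp_sum_cons /exp_sum big_nil /= mul1r addr0 subrr mul0r.
Qed.

Lemma fourier_pair_exists h : isL2 Rplus h -> exists H, fourier_pair h H.
Proof.
move=> lh.
have p4 n : 0 < 4^-1 ^+ n :> R by rewrite exprn_gt0// invr_gt0.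
have ex n : exists s, decaying s /\ nrm Rplus (fun t => h t - exp_sum s t) <= 4^-1 ^+ n.
  by have [s ds hs] := exp_sum_dense lh (p4 n); exists s.
pose s n := projT1 (cid (ex n)).
have ds n : decaying (s n) by rewrite /s; case: cid => x [].
have hs n : nrm Rplus (fun t => h t - exp_sum (s n) t) <= 4^-1 ^+ n.
  by rewrite /s; case: cid => x [].
have [|n|n|H lH hH] := @isL2_complete _ setT (fun n => ck_sum (s n)) 2 mT.
- by [].
- exact: isL2_ck_sum.
- rewrite nrm_ck_sumB//.
  have l1 := isL2_exp_sum (ds n.+1); have l2 := isL2_exp_sum (ds n).
  rewrite (le_trans (ler_nrm_distD mR l1 lh l2))//.
  rewrite (_ : 2 * 4^-1 ^+ n = 4^-1 ^+ n + 4^-1 ^+ n); last by ring.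
  rewrite lerD// nrm_distC (le_trans (hs n.+1))// exprS ler_piMl ?ltW//.
  by rewrite invf_lt1// ltr1n.
exists H; split => // e e0.
have z1 : `|4^-1 : R| < 1 by rewrite ger0_norm// invf_lt1// ltr1n.
have e40 : 0 < e / 4 by rewrite divr_gt0.
have /cvgrPdist_le/(_ _ e40)[n _ /(_ n (leqnn n))] := cvg_expr z1.
rewrite sub0r normrN (ger0_norm (ltW (p4 n))) => hn; exists (s n); split => //.
  by rewrite (le_trans (hs n))// (le_trans hn)// ler_pdivrMr// ler_peMr ?(ltW e0)// ler1n.
rewrite nrm_distC (le_trans (hH n))//; move: hn; lra.
Qed.

Lemma fourier_pair_inner h H k K : fourier_pair h H -> fourier_pair k K ->
  inner setT H K = inner Rplus h k.
Proof.
move=> [lh lH hH] [lk lK kK]; apply/eqP; rewrite -subr_eq0 -normc_eq0.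
rewrite eq_le normc_ge0 andbT.
pose M := nrm setT H + nrm setT K + 1 + (nrm Rplus h + nrm Rplus k + 1).
have M0 : 0 < M by rewrite /M addr_gt0// ltr_wpDl// addr_ge0 ?nrm_ge0.
apply/ler_addgt0Pr => e e0; rewrite add0r.
pose d := Num.min 1 (e / M).
have d0 : 0 < d by rewrite lt_min ltr01 divr_gt0.
have d01 : 0 <= d <= 1 by rewrite (ltW d0) ge_min lexx.
have [s [ds s1 s2]] := hH _ d0; have [r [dr r1 r2]] := kK _ d0.
have E := inner_ck_sum ds dr.
have h1 := inner_perturb mT lH lK (isL2_ck_sum ds) (isL2_ck_sum dr) d01 s2 r2.
have h2 := inner_perturb mR lh lk (isL2_exp_sum ds) (isL2_exp_sum dr) d01 s1 r1.
rewrite (le_trans (ler_normc_distD _ (inner setT (ck_sum s) (ck_sum r)) _))//.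
rewrite [X in _ + X]normc_distC E; rewrite E in h1.
rewrite (le_trans (lerD h1 h2))// -mulrDr -/M.
by rewrite -ler_pdivlMr// ge_min lexx orbT.
Qed.

Lemma fourier_pair_nrm h H : fourier_pair h H -> nrm setT H = nrm Rplus h.
Proof.
move=> hH; have := fourier_pair_inner hH hH; rewrite !inner_nrm.
move=> /(congr1 (@complex.Re R))/= e.
by apply: (pexpIrn (n := 2)) => //; rewrite ?nnegrE ?nrm_ge0.
Qed.

Lemma fourier_pair_linear (a b : R[i]) h H k K :
  fourier_pair h H -> fourier_pair k K ->
  fourier_pair (fun t => a * h t + b * k t) (fun y => a * H y + b * K y).
Proof.
move=> [lh lH hH] [lk lK kK]; split.
- by apply: isL2D => //; exact: isL2Zl.
- by apply: isL2D => //; exact: isL2Zl.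
move=> e e0; pose M := normc a + normc b + 1.
have M0 : 0 < M by rewrite ltr_wpDl// addr_ge0 ?normc_ge0.
have d0 : 0 < e / M by rewrite divr_gt0.
have [s [ds s1 s2]] := hH _ d0; have [r [dr r1 r2]] := kK _ d0.
exists (scale_sum a s ++ scale_sum b r); split.
- by rewrite decaying_cat !decayingZ ds dr.
- have l1 := isL2B mR lh (isL2_exp_sum ds); have l2 := isL2B mR lk (isL2_exp_sum dr).
  rewrite (@eq_nrm _ _ _ (fun t => a * (h t - exp_sum s t) + b * (k t - exp_sum r t))); last first.
    by move=> t _; rewrite exp_sum_cat !exp_sumZ; ring.
  rewrite (le_trans (ler_nrmD mR (isL2Zl a mR l1) (isL2Zl b mR l2)))// !nrmZ//.
  rewrite (le_trans (lerD (ler_wpM2l (normc_ge0 a) s1) (ler_wpM2l (normc_ge0 b) r1)))//.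
  rewrite -mulrDl mulrA ler_pdivrMr// mulrC ler_wpM2l ?(ltW e0)//.
  by rewrite /M lerDl.
- have l1 := isL2B mT lH (isL2_ck_sum ds); have l2 := isL2B mT lK (isL2_ck_sum dr).
  rewrite (@eq_nrm _ _ _ (fun t => a * (H t - ck_sum s t) + b * (K t - ck_sum r t))); last first.
    by move=> t _; rewrite ck_sum_cat !ck_sumZ; ring.
  rewrite (le_trans (ler_nrmD mT (isL2Zl a mT l1) (isL2Zl b mT l2)))// !nrmZ//.
  rewrite (le_trans (lerD (ler_wpM2l (normc_ge0 a) s2) (ler_wpM2l (normc_ge0 b) r2)))//.
  rewrite -mulrDl mulrA ler_pdivrMr// mulrC ler_wpM2l ?(ltW e0)//.
  by rewrite /M lerDl.
Qed.

Lemma fourier_pairB h H k K : fourier_pair h H -> fourier_pair k K ->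
  fourier_pair (fun t => h t - k t) (fun y => H y - K y).
Proof.
move=> hH kK; have := fourier_pair_linear 1 (-1) hH kK.
by congr fourier_pair; apply/funext => t; rewrite mul1r mulN1r.
Qed.

Definition poisson (w : R[i]) (s : R) : R :=
  complex.Re w / (pi * (complex.Re w ^+ 2 + (complex.Im w - s) ^+ 2)).

Lemma poissonE (w : R[i]) (s : R) : 0 < complex.Re w ->
  (poisson w s)%:C = (2 * pi)^-1%:C * (ck w (- s) + ck (conjc w) s).
Proof.
move=> w0.
have D0 : complex.Re w ^+ 2 + (complex.Im w - s) ^+ 2 != 0.
  by rewrite lt0r_neq0// ltr_pwDl ?sqr_ge0// exprn_gt0.
have p0 : pi != 0 :> R by rewrite lt0r_neq0 ?pi_gt0.
have E : ck (conjc w) s = conjc (ck w (- s)) by rewrite conj_ck opprK.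
have -> : ck w (- s) + ck (conjc w) s = (2 * complex.Re (ck w (- s)))%:C.
  rewrite E; case: (ck w (- s)) => x y; apply: complex_eq => /=; ring.
rewrite /ck Re_inv normc_sqr ReD ImD /= addr0 -rmorphM; congr (_%:C).
by rewrite /poisson; move: (_ + _) D0 => D D0; move: pi p0 => q q0; field; rewrite ?D0 ?q0.
Qed.

Lemma isL2_poisson (w : R[i]) : 0 < complex.Re w -> isL2 setT (fun y => (poisson w y)%:C).
Proof.
move=> w0; have w0' : 0 < complex.Re (conjc w) by case: w w0.
have : isL2 setT (fun y => (2 * pi)^-1%:C * (ck w (- y) + ck (conjc w) y)).
  by apply: isL2Zl => //; apply: isL2D => //; [exact: isL2_ckN|exact: isL2_ck].
by apply: eq_isL2 => // y _; rewrite poissonE.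
Qed.

Lemma laplace_exp_sum s (w : R[i]) : decaying s -> Cplus w ->
  laplace (exp_sum s) w =
  cintegral setT (fun y => ck_sum s y * (poisson w y)%:C).
Proof.
move=> ds w0; have w0' : 0 < complex.Re (conjc w) by case: w w0.
have lp := isL2_poisson w0.
elim: s ds => [_|p s IH /= /andP[p0 ds]].
  rewrite (_ : ck_sum [::] = fun=> 0); last by apply/funext => y; rewrite /ck_sum big_nil.
  rewrite (_ : exp_sum [::] = fun=> 0); last by apply/funext => y; rewrite /exp_sum big_nil.
  rewrite laplaceE (@eq_cintegral _ _ _ (fun=> 0)); last by move=> t _; rewrite mul0r.
  rewrite [RHS](@eq_cintegral _ _ _ (fun=> 0)); last by move=> t _; rewrite mul0r.
  by rewrite !cintegral_cst0 mulr0.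
have lq : isL2 Rplus (powexp 0 p.2%:C) by exact: isL2_powexp.
have lk : isL2 setT (ck p.2%:C) by exact: isL2_ck.
rewrite (_ : exp_sum (p :: s) = fun t => p.1 * powexp 0 p.2%:C t + 1 * exp_sum s t); last first.
  by apply/funext => t; rewrite exp_sum_cons mul1r.
rewrite laplace_linear//; last exact: isL2_exp_sum.
rewrite mul1r IH// laplace_powexp// expr1 fact0.
rewrite (@eq_cintegral _ _ (fun y => ck_sum (p :: s) y * _) (fun y =>
   (fourier_cst%:C * p.1 * (2 * pi)^-1%:C) *
     (ck p.2%:C y * ck w (- y) + ck p.2%:C y * ck (conjc w) y) +
   ck_sum s y * (poisson w y)%:C)); last first.
  by move=> y _; rewrite ck_sum_cons poissonE//; ring.
have i1 : cintegrable setT (fun y => ck p.2%:C y * ck w (- y)).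
  by apply: isL2_mul_cintegrable => //; exact: isL2_ckN.
have i2 : cintegrable setT (fun y => ck p.2%:C y * ck (conjc w) y).
  by apply: isL2_mul_cintegrable => //; exact: isL2_ck.
have i3 : cintegrable setT (fun y => ck_sum s y * (poisson w y)%:C).
  by apply: isL2_mul_cintegrable => //; exact: isL2_ck_sum.
rewrite cintegralD//; last by apply: cintegrableZl => //; exact: cintegrableD.
rewrite cintegralZl ?cintegralD//; last exact: cintegrableD.
rewrite cintegral_ck_ckN// cintegral_ck_ck// addr0; congr +%R.
have -> : (Num.sqrt (2 * pi))^-1 = fourier_cst by [].
have pw : p.2%:C + w != 0.
  by apply: contraTneq (addr_gt0 p0 w0) => /(congr1 (@complex.Re R)); rewrite ReD /= => ->; rewrite ltxx.
have : (2 * pi)^-1%:C * (2 * pi)%:C = 1 :> R[i].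
  by rewrite -rmorphM mulVf ?rmorph1// lt0r_neq0 ?pi2_gt0.
move: ((2 * pi)^-1%:C) ((2 * pi)%:C) (fourier_cst%:C) => x y c e.
transitivity (c * p.1 * (x * y) / (p.2%:C + w)); last by field.
by rewrite e; field.
Qed.

(** Checked on exponentials, where the Poisson kernel is a sum of two Cauchy
    kernels; both sides are continuous in the mean, as the Poisson kernel is
    square integrable. *)
Lemma fourier_pair_poisson h H (w : R[i]) : fourier_pair h H -> Cplus w ->
  laplace h w = cintegral setT (fun y => H y * (poisson w y)%:C).
Proof.
move=> [lh lH hH] w0; have lp := isL2_poisson w0.
apply/eqP; rewrite -subr_eq0 -normc_eq0 eq_le normc_ge0 andbT.
apply/ler_addgt0Pr => e e0; rewrite add0r.
pose M := laplace_bound w + nrm setT (fun y => (poisson w y)%:C) + 1.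
have M0 : 0 < M by rewrite ltr_wpDl// addr_ge0 ?laplace_bound_ge0 ?nrm_ge0.
have d0 : 0 < e / M by rewrite divr_gt0.
have [s [ds s1 s2]] := hH _ d0.
have ls := isL2_exp_sum ds; have lc := isL2_ck_sum ds.
rewrite (le_trans (ler_normc_distD _ (laplace (exp_sum s) w) _))//.
rewrite -laplaceB// (laplace_exp_sum ds w0) -cintegralB//; try exact: isL2_mul_cintegrable.
rewrite (@eq_cintegral _ _ _ (fun y => (ck_sum s y - H y) * (poisson w y)%:C)); last first.
  by move=> y _; rewrite mulrBl.
have h1 := normc_laplace_le (isL2B mR lh ls) w0.
have h2 := normc_cintegralM_le mT (isL2B mT lc lH) lp.
rewrite nrm_distC in h2.
have h3 := ler_wpM2l (laplace_bound_ge0 w) s1.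
have h4 := ler_wpM2r (nrm_ge0 setT (fun y => (poisson w y)%:C)) s2.
rewrite (le_trans (lerD (le_trans h1 h3) (le_trans h2 h4)))//.
rewrite [X in _ + X]mulrC -mulrDl mulrA ler_pdivrMr// mulrC ler_wpM2l ?(ltW e0)//.
by rewrite /M lerDl.
Qed.

End FourierPairs.

(** * Nontangential boundary values of Poisson integrals *)

Section Fatou.
Variable R : realType.
Local Notation mu := (@lebesgue_measure R).
Implicit Types (u v : R -> R) (w : R[i]).

Let mT : measurable (setT : set R).
Proof. exact: measurableT. Qed.

Lemma poisson_den_gt0 w (s : R) : 0 < complex.Re w ->
  0 < complex.Re w ^+ 2 + (complex.Im w - s) ^+ 2.
Proof. by move=> w0; rewrite ltr_pwDl ?sqr_ge0// exprn_gt0. Qed.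

Lemma poisson_ge0 w (s : R) : 0 < complex.Re w -> 0 <= poisson w s.
Proof.
move=> w0; rewrite divr_ge0 ?(ltW w0)// mulr_ge0 ?pi_ge0// ltW//.
exact: poisson_den_gt0.
Qed.

Lemma poisson_ReE w (s : R) : poisson w s = pi^-1 * complex.Re (ck w (- s)).
Proof.
rewrite /poisson /ck Re_inv normc_sqr ReD ImD /= addr0 invfM; ring.
Qed.

Lemma measurable_poisson w : 0 < complex.Re w -> measurable_fun setT (poisson w).
Proof. by move=> /isL2_poisson/isL2_cmeas[]. Qed.

Definition poisson_integrable v := measurable_fun setT v /\
  mu.-integrable setT (EFin \o (fun s => v s / (1 + s ^+ 2))).

Lemma onesqr_gt0 (s : R) : 0 < 1 + s ^+ 2.
Proof. by rewrite ltr_pwDl// sqr_ge0. Qed.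

Lemma poisson_le w : 0 < complex.Re w -> exists2 K : R, 0 <= K &
  forall s, poisson w s <= K / (1 + s ^+ 2).
Proof.
move=> w0; set x := complex.Re w; set y := complex.Im w.
pose K := 2 + (1 + 2 * y ^+ 2) / x ^+ 2.
have x20 : 0 < x ^+ 2 by rewrite exprn_gt0.
have K0 : 0 < K.
  by rewrite ltr_pwDl// divr_ge0 ?(ltW x20)// addr_ge0// mulr_ge0// sqr_ge0.
exists (x / pi * K) => [|s]; first by rewrite !mulr_ge0 ?invr_ge0 ?pi_ge0 ?ltW.
rewrite /poisson -/x -/y invfM mulrA -!mulrA ler_wpM2l ?(ltW w0)// ler_wpM2l ?invr_ge0 ?pi_ge0//.
rewrite ler_pdivlMr ?onesqr_gt0// mulrC ler_pdivrMr ?poisson_den_gt0//.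
have E : (1 + 2 * y ^+ 2) / x ^+ 2 * x ^+ 2 = 1 + 2 * y ^+ 2 by rewrite divfK ?lt0r_neq0.
have h : 0 <= (1 + 2 * y ^+ 2) / x ^+ 2 * (y - s) ^+ 2.
  rewrite mulr_ge0 ?sqr_ge0// divr_ge0 ?(ltW x20)//.
  by rewrite addr_ge0// mulr_ge0// sqr_ge0.
have h2 := sqr_ge0 (2 * y - s).
move: E h; rewrite /K; move: (_ / x ^+ 2) => Q E h.
have -> : (2 + Q) * (x ^+ 2 + (y - s) ^+ 2) =
    2 * x ^+ 2 + Q * x ^+ 2 + 2 * (y - s) ^+ 2 + Q * (y - s) ^+ 2 by ring.
rewrite E.
have : 2 * y ^+ 2 + 2 * (y - s) ^+ 2 = s ^+ 2 + (2 * y - s) ^+ 2 by ring.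
by move: h h2 x20; lra.
Qed.

Lemma integrable_poissonM v w : 0 < complex.Re w -> poisson_integrable v ->
  mu.-integrable setT (EFin \o (fun s => poisson w s * v s)).
Proof.
move=> w0 [mv iv]; have [K K0 le] := poisson_le w0.
have i1 := integrable_EFinZl mT iv K.
apply: le_integrable i1 => //.
  by apply/measurable_EFinP; apply: measurable_funM => //; exact: measurable_poisson.
move=> s _; rewrite /= lee_fin (normrM (poisson w s)) (normrM K) (normrM (v s)).
rewrite (ger0_norm (poisson_ge0 s w0)) (ger0_norm K0).
rewrite [leRHS]mulrCA [leRHS]mulrC ler_wpM2r//.
by rewrite gtr0_norm ?invr_gt0 ?onesqr_gt0.
Qed.

Lemma poisson_integrable_cst (c : R) : poisson_integrable (cst c).
Proof.
split; first exact: measurable_cst.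
have l1 := @isL2_ck R 1 ltr01.
have i1 := integrable_EFinZl mT (isL2_integrable l1) c.
apply: eq_integrable i1 => // s _.
by congr (_%:E); rewrite normc_ck /= add0r expr1n.
Qed.

Lemma poisson_integrableD u v : poisson_integrable u -> poisson_integrable v ->
  poisson_integrable (fun s => u s + v s).
Proof.
move=> [mu_ iu] [mv iv]; split; first exact: measurable_funD.
have := integrable_EFinD mT iu iv; apply: eq_integrable => // s _.
by rewrite /= mulrDl.
Qed.

Lemma poisson_integrable_le u v : measurable_fun setT u ->
  poisson_integrable v -> (forall s, `|u s| <= v s) -> poisson_integrable u.
Proof.
move=> mu_ [mv iv] uv; split => //; apply: le_integrable iv => //.
  apply/measurable_EFinP; apply: measurable_funM => //.
  by apply: measurable_funVr => //; apply: measurable_funD => //; exact: exprn_measurable.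
move=> s _; rewrite /= lee_fin !normrM ler_wpM2r//.
by rewrite (le_trans (uv s))// ler_norm.
Qed.

Lemma poisson_integrable_norm v : poisson_integrable v ->
  poisson_integrable (fun s => `|v s|).
Proof.
move=> [mv iv]; split; first by apply: measurableT_comp => //; exact: normr_measurable.
have := integrable_norm iv; apply: eq_integrable => // s _.
by rewrite /= normrM [X in _ * X]ger0_norm// invr_ge0 ltW// onesqr_gt0.
Qed.

Lemma poisson_integrable_isL2 (f : R -> R[i]) : isL2 setT f ->
  poisson_integrable (fun s => complex.Re (f s)) /\
  poisson_integrable (fun s => complex.Im (f s)).
Proof.
move=> lf; have [m1 m2] := isL2_cmeas lf.
have i : poisson_integrable (fun s => 1 + normc (f s) ^+ 2).
  apply: poisson_integrableD; first exact: poisson_integrable_cst.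
  split; first by apply: measurable_funX; apply: measurable_normc; exact: isL2_cmeas.
  apply: le_integrable (isL2_integrable lf) => //.
    apply/measurable_EFinP; apply: measurable_funM.
      by apply: measurable_funX; apply: measurable_normc; exact: isL2_cmeas.
    by apply: measurable_funVr => //; apply: measurable_funD => //; exact: exprn_measurable.
  move=> s _; rewrite /= lee_fin normrM ler_piMr// gtr0_norm ?invr_gt0 ?onesqr_gt0//.
  by rewrite invf_le1 ?onesqr_gt0// lerDl sqr_ge0.
have le (x : R) z : `|x| <= normc z -> `|x| <= 1 + normc z ^+ 2 :> R.
  by move=> /le_trans; apply; have := sqr_ge0 (normc z - 1); have := normc_ge0 z; nra.
split; apply: poisson_integrable_le i _ => // s; apply: le.
  exact: normRe_le.
exact: normIm_le.
Qed.

Lemma Rintegral_poisson w : 0 < complex.Re w -> \int[mu]_s poisson w s = 1.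
Proof.
move=> w0.
have d1 (s : R) := ckN s w0.
suff : cintegral setT (fun s => (poisson w s)%:C) = 1.
  by rewrite cintegral_real => /(congr1 (@complex.Re R)).
have ce (f : R -> R[i]) t d : cderiv f t d ->
    cderiv (fun s => (pi^-1 * complex.Re (f s))%:C) t (pi^-1 * complex.Re d)%:C.
  move=> [h _]; split; last exact: is_derive_cst.
  by have := is_deriveZ pi^-1 h; rewrite /GRing.scale/=.
apply: (@cintegral_FTC_exhaust _ setT
   (fun s => (pi^-1 * complex.Re (- ck_primitive w (- s)))%:C) _
   (fun s => (pi^-1 * complex.Re ('i%C * ck w (- s) ^+ 2))%:C)
   (fun n => - n.+1%:R) (fun n => n.+1%:R)) => //.
- by move=> t; rewrite poisson_ReE; apply: ce; exact: (d1 t).2.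
- move=> t; under eq_fun do rewrite poisson_ReE.
  by apply: ce; exact: (d1 t).1.
- apply: cintegrable_real => //.
  have [K K0 le] := poisson_le w0.
  have [_ i1] := poisson_integrable_cst 1.
  have [_ i2] := poisson_integrable_cst K.
  apply: le_integrable i2 => //.
    by apply/measurable_EFinP; exact: measurable_poisson.
  move=> s _; rewrite /= lee_fin ger0_norm ?poisson_ge0//.
  by rewrite (le_trans (le s))// ler_norm.
- by move=> n; rewrite -subr_gt0 opprK addr_gt0 ?ltr0n.
- move=> t _; near=> n; rewrite in_itv/= -ler_norml (@le_trans _ _ n%:R)// ?ler_nat//.
  by near: n; exact: nbhs_infty_ger.
have /cvg_ReIm[c _] := cvg_increment_ckN w0.
apply: (eq_ccvg (f := fun n => (pi^-1 * complex.Re (- ck_primitive w (- n.+1%:R) -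
  (- ck_primitive w (- - n.+1%:R))))%:C)) => [n|].
  by rewrite -rmorphB -mulrBr; congr (_ * _)%:C; rewrite ReD; congr +%R; rewrite ReN.
apply/cvg_ReIm; split => /=; last exact: cvg_cst.
rewrite [X in _ --> X](_ : _ = pi^-1 * complex.Re (pi%:C : R[i])); first exact: cvgMr c.
by rewrite mulVf// lt0r_neq0 ?pi_gt0.
Unshelve. all: by end_near. Qed.

Lemma poisson_integrable_locally v : poisson_integrable v ->
  locally_integrable setT v.
Proof.
move=> [mv iv]; split => //; first exact: openT.
move=> K _ cK; have mK : measurable K by exact: compact_measurable.
have [M [_ KM]] := compact_bounded cK.
have {}KM (s : R) : K s -> `|s| <= `|M| + 1.
  by move=> Ks; apply: KM => //; rewrite ltr_pwDr// ler_norm.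
have i1 := integrable_EFinZl mT iv (1 + (`|M| + 1) ^+ 2).
have /integrableP[_] : mu.-integrable K (EFin \o v); last exact.
have iK := @integrableS _ _ _ mu _ _ _ measurableT mK (@subsetT _ K) i1.
apply: (@le_integrable _ _ _ mu _ mK _ _ _ _ iK) => //.
  by apply/measurable_EFinP; exact: measurable_funS mv.
move=> s Ks; rewrite /= lee_fin normrM mulrC normrM -mulrA ler_peMr//.
rewrite [X in _ * X]gtr0_norm ?onesqr_gt0//.
rewrite gtr0_norm ?invr_gt0 ?onesqr_gt0// mulrC ler_pdivlMr ?onesqr_gt0// mul1r.
rewrite lerD2l -(real_normK (num_real s)) ler_pXn2r ?nnegrE ?addr_ge0//.
exact: KM.
Qed.

Lemma lebesgue_pt_ball v (y : R) (e : R) : poisson_integrable v ->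
  lebesgue_pt v y -> 0 < e -> exists2 d : R, 0 < d & forall r : R, 0 < r -> r <= d ->
    \int[mu]_(s in ball y r) `|v s - v y| <= (2 * r) * e.
Proof.
move=> iv /fine_cvgP[ffin /cvgrPdist_le/(_ e)] + e0 => /(_ e0) fc.
have [d /= d0 H] : \forall r \near (0 : R)^'+, davg v y r \is a fin_num /\
    `|0 - (fine \o davg v y) r| <= e by apply: filterS2 ffin fc.
exists (d / 2) => [|r r0 rd]; first by rewrite divr_gt0.
have [] := H r _ r0.
  by rewrite /ball_/= sub0r normrN gtr0_norm// (le_lt_trans rd)// ltr_pdivrMr// ltr_pMr// ltr1n.
move=> fin; rewrite sub0r normrN /= => le.
have {le} : (davg v y r <= e%:E)%E.
  by rewrite -(fineK fin) lee_fin (le_trans _ le)// ler_norm.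
have r2 : 0 < r *+ 2 by rewrite mulrn_wgt0.
rewrite /davg /iavg (lebesgue_measure_ball _ (ltW r0)) inver (gt_eqF r2).
rewrite muleC lee_pdivrMr// => le.
rewrite -lee_fin /Rintegral; set I := (\int[mu]_(_ in _) _)%E.
have I0 : (0 <= I)%E by apply: integral_ge0 => s _; rewrite lee_fin.
have le2 : (I <= (2 * r * e)%:E)%E.
  rewrite (_ : 2 * r * e = e * r *+ 2); last by rewrite -mulrnAr mulrC mulr_natl.
  by rewrite -mulrnAr EFinM; exact: le.
by rewrite fineK// ge0_fin_numE// (le_lt_trans le2)// ltry.
Qed.

Lemma mball (y r : R) : measurable (ball y r : set R).
Proof. exact: measurable_ball. Qed.

Section Dyadic.
Variables (g : R -> R) (y0 x e d : R).
Hypotheses (mg : measurable_fun setT g) (g0 : forall s, 0 <= g s).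
Hypotheses (x0 : 0 < x) (e0 : 0 <= e).
Hypothesis gd : forall r : R, 0 < r -> r <= d ->
  (\int[mu]_(s in ball y0 r) (g s)%:E <= (2 * r * e)%:E)%E.

Let kern s := x / (x ^+ 2 + (y0 - s) ^+ 2).

Let kern_den s : 0 < x ^+ 2 + (y0 - s) ^+ 2.
Proof. by rewrite ltr_pwDl ?sqr_ge0// exprn_gt0. Qed.

Let kern_ge0 s : 0 <= kern s.
Proof. by rewrite divr_ge0// ?(ltW x0)// ltW. Qed.

Let mkern : measurable_fun setT kern.
Proof.
apply: measurable_funM => //; apply: measurable_funVr => //.
apply: measurable_funD => //; apply: measurable_funX.
by apply: measurable_funD => //; exact: measurable_funN.
Qed.

Let mkg : measurable_fun setT (fun s => (kern s * g s)%:E).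
Proof. by apply/measurable_EFinP; exact: measurable_funM. Qed.

(** On the ring between the radii [2 ^ N * x] and [2 ^ N.+1 * x] the kernel is at
    most [(4 ^ N * x)^-1], so the ring contributes at most [4 * e / 2 ^ N]; the
    first ball contributes [2 * e], and these bounds sum to
    [(10 - 8 / 2 ^ N) * e]. *)
Lemma dyadic_near N : 2 ^+ N * x <= d ->
  (\int[mu]_(s in ball y0 (2 ^+ N * x)) (kern s * g s)%:E
     <= ((10 - 8 / 2 ^+ N) * e)%:E)%E.
Proof.
have le (D : set R) (c : R) : measurable D -> 0 <= c -> (forall s, D s -> kern s <= c) ->
    (\int[mu]_(s in D) (kern s * g s)%:E <= c%:E * \int[mu]_(s in D) (g s)%:E)%E.
  move=> mD c0 kc; rewrite -ge0_integralZl => //.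
  - apply: ge0_le_integral => //.
    + by move=> s _; rewrite lee_fin mulr_ge0.
    + by apply: measurable_funS mkg.
    + have mc : measurable_fun D (fun s => c * g s).
        by apply: measurable_funM => //; apply: measurable_funS mg.
      by apply: (eq_measurable_fun (fun s => (c * g s)%:E)) => [s _|]; [rewrite EFinM|exact/measurable_EFinP].
    + by move=> s Ds; rewrite -EFinM lee_fin ler_wpM2r// kc.
  - by apply/measurable_EFinP; exact: measurable_funS mg.
  - by move=> s _; rewrite lee_fin.
elim: N => [|N IH] Nd.
  rewrite expr0 mul1r divr1 (_ : 10 - 8 = 2); last by ring.
  have xi : 0 <= x^-1 by rewrite invr_ge0 ltW.
  apply: le_trans (le _ x^-1 _ _ _) _ => //; first exact: mball.
    move=> s _; rewrite /kern ler_pdivrMr// mulrDr expr2 mulrA mulVf ?lt0r_neq0// mul1r.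
    by rewrite lerDl mulr_ge0// sqr_ge0.
  rewrite (_ : 2 * e = x^-1 * (2 * x * e)); last by field; rewrite lt0r_neq0.
  rewrite EFinM lee_wpmul2l ?lee_fin//; apply: gd => //.
  by move: Nd; rewrite expr0 mul1r.
have p4 : 4 ^+ N = 2 ^+ N * 2 ^+ N :> R by rewrite -exprMn; congr (_ ^+ _); ring.
have p0 : (0 : R) < 2 ^+ N by rewrite exprn_gt0.
have px : 0 < 2 ^+ N * x by rewrite mulr_gt0.
have le12 : 2 ^+ N * x <= 2 ^+ N.+1 * x by rewrite exprS -mulrA; lra.
have sub : (ball y0 (2 ^+ N * x) : set R) `<=` ball y0 (2 ^+ N.+1 * x).
  by apply: le_ball.
rewrite -(setDUK sub) ge0_integral_setU => //; first last.
- by apply/disj_set2P; apply/seteqP; split => // s [? []].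
- by move=> s _; rewrite lee_fin mulr_ge0.
- by apply: measurable_funS mkg.
- by apply: measurableD; exact: mball.
- exact: mball.
apply: le_trans (leeD (IH (le_trans le12 Nd)) _) _.
  apply: (le_trans (le _ ((4 ^+ N * x)^-1) _ _ _)).
  - by apply: measurableD; exact: mball.
  - by rewrite invr_ge0 mulr_ge0 ?exprn_ge0// ltW.
  - move=> s [_ /negP]; rewrite /ball/= -leNgt => h.
    rewrite /kern ler_pdivrMr// mulrC ler_pdivlMr ?mulr_gt0 ?exprn_gt0//.
    rewrite mulrCA -expr2.
    apply: le_trans (_ : (2 ^+ N * x) ^+ 2 <= _).
      by rewrite p4 exprMn -!expr2.
    by rewrite ler_wpDl ?sqr_ge0// -[leRHS]real_normK ?num_real// ler_pXn2r ?nnegrE// ltW.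
  apply: lee_wpmul2l; first by rewrite lee_fin invr_ge0 mulr_ge0 ?exprn_ge0// ltW.
  apply: le_trans (gd _ Nd); last by rewrite mulr_gt0// exprn_gt0.
  apply: ge0_subset_integral => //.
  - by apply: measurableD; exact: mball.
  - exact: mball.
  - by apply/measurable_EFinP; exact: measurable_funS mg.
  - by move=> s _; rewrite lee_fin.
rewrite -EFinM -EFinD lee_fin.
rewrite p4 exprS; move: (2 ^+ N) p0 => p p0.
rewrite le_eqVlt; apply/orP; left; apply/eqP; field.
by rewrite !lt0r_neq0.
Qed.

(** [N] is the last step for which the ball stays within the radius [d]; outside
    that ball the distance to [y0] is at least [d / 2]. *)
Lemma dyadic_full (K G : R) : x <= d -> 0 <= K ->
  (forall s, d / 2 <= `|y0 - s| -> kern s <= x * (K / (1 + s ^+ 2))) ->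
  (\int[mu]_s (g s / (1 + s ^+ 2))%:E <= G%:E)%E ->
  (\int[mu]_s (kern s * g s)%:E <= (10 * e + x * K * G)%:E)%E.
Proof.
move=> xd K0 far Gle.
have [N [Nd Nd']] : exists N, 2 ^+ N * x <= d /\ d <= 2 ^+ N.+1 * x.
  have [M] : exists M, d < 2 ^+ M * x.
    exists (Num.truncn (d / x)).+1; rewrite -ltr_pdivrMr//.
    apply: lt_trans (truncnS_gt (d / x)) _.
    by rewrite -natrX ltr_nat ltn_expl.
  elim: M => [|M IH]; first by rewrite expr0 mul1r => /(le_lt_trans xd); rewrite ltxx.
  case: (lerP (2 ^+ M * x) d) => [h1 h2|h1 _]; last exact: IH.
  by exists M; split => //; exact: ltW.
set B : set R := ball y0 (2 ^+ N * x).
have mB : measurable B by exact: mball.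
rewrite -(setUv B) ge0_integral_setU => //; first last.
- by apply/disj_set2P; apply/seteqP; split => // s [].
- by move=> s _; rewrite lee_fin mulr_ge0.
- by rewrite setUv.
- exact: measurableC.
rewrite EFinD; apply: leeD.
  apply: le_trans (dyadic_near Nd) _; rewrite lee_fin ler_wpM2r// gerBl.
  by rewrite divr_ge0// exprn_ge0.
have mgs : measurable_fun setT (fun s => (g s / (1 + s ^+ 2))%:E).
  apply/measurable_EFinP; apply: measurable_funM => //; apply: measurable_funVr => //.
  by apply: measurable_funD => //; exact: exprn_measurable.
have xK : 0 <= x * K by rewrite mulr_ge0// ltW.
have gs0 s : 0 <= g s / (1 + s ^+ 2) by rewrite divr_ge0// ltW// onesqr_gt0.
apply: (@le_trans _ _ ((x * K)%:E * \int[mu]_s (g s / (1 + s ^+ 2))%:E)%E); last first.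
  by rewrite [leRHS]EFinM; apply: lee_wpmul2l => //; rewrite lee_fin.
apply: (@le_trans _ _ ((x * K)%:E * \int[mu]_(s in ~` B) (g s / (1 + s ^+ 2))%:E)%E); last first.
  apply: lee_wpmul2l; first by rewrite lee_fin.
  apply: ge0_subset_integral => //; first exact: measurableC.
  by move=> s _; rewrite lee_fin.
have mC := measurableC mB.
rewrite -ge0_integralZl => //; first last.
- by move=> s _; rewrite lee_fin.
- by apply: measurable_funS mgs.
apply: ge0_le_integral => //.
- by move=> s _; rewrite lee_fin mulr_ge0.
- by apply: measurable_funS mkg.
- apply: (eq_measurable_fun (fun s => (x * K * (g s / (1 + s ^+ 2)))%:E)) => [s _|]; first by rewrite EFinM.
  apply/measurable_EFinP; apply: measurable_funM => //.
  by apply/measurable_EFinP; apply: measurable_funS mgs.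
move=> s /negP; rewrite /B /ball/= -leNgt => h.
rewrite -EFinM lee_fin (_ : x * K * _ = x * (K / (1 + s ^+ 2)) * g s); last by ring.
rewrite ler_wpM2r// far//.
by rewrite (le_trans _ h)// ler_pdivrMr// mulrC mulrA -exprS.
Qed.

End Dyadic.

(** A Poisson kernel whose pole stays in a cone at [y0] is comparable to the
    kernel centred at [y0], so an average against it is controlled by averages
    over the balls of radius [2 ^ k x]; at a Lebesgue point those are small,
    and away from [y0] the kernel is [O(x)]. *)
Lemma poisson_nontangential v (y0 : R) : poisson_integrable v -> lebesgue_pt v y0 ->
  forall (C e : R), 0 <= C -> 0 < e -> exists2 d : R, 0 < d & forall w : R[i],
    0 < complex.Re w -> complex.Re w < d ->
    `|y0 - complex.Im w| <= C * complex.Re w ->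
    `|\int[mu]_s (poisson w s * v s) - v y0| <= e.
Proof.
move=> iv lv C e C0 e0.
pose g (s : R) : R := `|v s - v y0|.
have ig : poisson_integrable g.
  apply: poisson_integrable_norm; apply: poisson_integrableD => //.
  exact: poisson_integrable_cst.
have g0 s : 0 <= g s by exact: normr_ge0.
have gs0 s : 0 <= g s / (1 + s ^+ 2) by rewrite divr_ge0// ltW// onesqr_gt0.
pose B := 2 + 2 * C ^+ 2.
have B0 : 0 < B by rewrite ltr_pwDl// mulr_ge0// sqr_ge0.
pose e1 := e / (20 * B).
have e10 : 0 < e1 by rewrite divr_gt0// mulr_gt0.
have [d d0 gd] := lebesgue_pt_ball iv lv e10.
have gd' r : 0 < r -> r <= d ->
    (\int[mu]_(s in ball y0 r) (g s)%:E <= (2 * r * e1)%:E)%E.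
  move=> r0 rd; have := gd r r0 rd.
  rewrite -lee_fin /Rintegral fineK//.
  have /integrableP[_] : mu.-integrable (ball y0 r) (EFin \o g).
    have mB := mball y0 r.
    have [M MP] : exists M, forall s, ball y0 r s -> 1 + s ^+ 2 <= M.
      exists (1 + (`|y0| + r) ^+ 2) => s; rewrite /ball/= => h.
      rewrite lerD2l -(real_normK (num_real s)) ler_pXn2r ?nnegrE// ?addr_ge0//; last exact: ltW.
      rewrite (_ : s = y0 - (y0 - s)); last by rewrite opprB addrC subrK.
      by rewrite (le_trans (ler_normB _ _))// lerD2l ltW.
    have i1 := integrable_EFinZl mT ig.2 M.
    have iK := @integrableS _ _ _ mu _ _ _ measurableT mB (@subsetT _ _) i1.
    apply: (@le_integrable _ _ _ mu _ mB _ _ _ _ iK) => //.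
      by apply/measurable_EFinP; apply: measurable_funS ig.1.
    move=> s Bs; rewrite /= lee_fin mulrCA ger0_norm// ger0_norm; last first.
      rewrite mulr_ge0// divr_ge0 ?(ltW (onesqr_gt0 s))//.
      exact: le_trans (ltW (onesqr_gt0 s)) (MP s Bs).
    by rewrite ler_peMr// ler_pdivlMr ?onesqr_gt0// mul1r MP.
  move=> h; rewrite ge0_fin_numE; last by apply: integral_ge0 => s _; rewrite lee_fin.
  apply: le_lt_trans h; apply: ge0_le_integral => //; first exact: mball.
  - by apply/measurable_EFinP; apply: measurable_funS ig.1.
  - by apply/measurable_EFinP; apply: measurableT_comp => //; apply: measurable_funS ig.1.
  - by move=> s _ /=; rewrite lee_fin ler_norm.
pose K := 2 + 4 * (1 + 2 * y0 ^+ 2) / d ^+ 2.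
have d20 : 0 < d ^+ 2 by rewrite exprn_gt0.
have K0 : 0 < K.
  by rewrite ltr_pwDl// divr_ge0 ?(ltW d20)// mulr_ge0// addr_ge0// mulr_ge0// sqr_ge0.
pose G := \int[mu]_s (g s / (1 + s ^+ 2)).
have G0 : 0 <= G by apply: Rintegral_ge0.
have Gle : (\int[mu]_s (g s / (1 + s ^+ 2))%:E <= G%:E)%E.
  rewrite /G /Rintegral fineK//; have := ig.2; exact: integrable_fin_num.
have BKG : 0 <= B * (K * G) by rewrite !mulr_ge0// ltW.
exists (Num.min d (e / (2 * (1 + B * (K * G))))).
  by rewrite lt_min d0/= divr_gt0// mulr_gt0// ltr_pwDl.
move=> w; set x := complex.Re w; set Y := complex.Im w => x0.
rewrite lt_min => /andP[xd xe] cone.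
have far s : d / 2 <= `|y0 - s| ->
    x / (x ^+ 2 + (y0 - s) ^+ 2) <= x * (K / (1 + s ^+ 2)).
  move=> h; rewrite ler_wpM2l ?(ltW x0)//.
  rewrite ler_pdivlMr ?onesqr_gt0// mulrC ler_pdivrMr; last first.
    by rewrite ltr_pwDl ?sqr_ge0// exprn_gt0.
  have h2 : (d / 2) ^+ 2 <= (y0 - s) ^+ 2.
    rewrite -[leRHS](real_normK (num_real _)) ler_pXn2r ?nnegrE//.
    by rewrite divr_ge0// ltW.
  apply: le_trans (_ : K * (y0 - s) ^+ 2 <= _); last first.
    by rewrite ler_wpM2l ?(ltW K0)// lerDr sqr_ge0.
  have h3 : 1 + 2 * y0 ^+ 2 <= 4 * (1 + 2 * y0 ^+ 2) / d ^+ 2 * (y0 - s) ^+ 2.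
    apply: le_trans (_ : 4 * (1 + 2 * y0 ^+ 2) / d ^+ 2 * (d / 2) ^+ 2 <= _).
      rewrite le_eqVlt; apply/orP; left; apply/eqP; field.
      by rewrite lt0r_neq0.
    by rewrite ler_wpM2l// divr_ge0 ?(ltW d20)// mulr_ge0// addr_ge0// mulr_ge0// sqr_ge0.
  rewrite /K mulrDl; move: h3; move: (_ / d ^+ 2 * _) => q h3.
  by have := sqr_ge0 (2 * y0 - s); lra.
have cmp s : poisson w s <= B / pi * (x / (x ^+ 2 + (y0 - s) ^+ 2)).
  have k0 : 0 < x ^+ 2 + (y0 - s) ^+ 2 by rewrite ltr_pwDl ?sqr_ge0// exprn_gt0.
  have c2 : (y0 - Y) ^+ 2 <= C ^+ 2 * x ^+ 2.
    rewrite -exprMn -[leLHS](real_normK (num_real _)) ler_pXn2r ?nnegrE//.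
    by rewrite mulr_ge0// ltW.
  rewrite (_ : poisson w s = x / pi * (x ^+ 2 + (Y - s) ^+ 2)^-1); last first.
    by rewrite /poisson -/x -/Y invfM mulrA.
  rewrite [leRHS](_ : _ = x / pi * (B / (x ^+ 2 + (y0 - s) ^+ 2))); last by ring.
  rewrite ler_wpM2l ?divr_ge0 ?pi_ge0 ?(ltW x0)//.
  rewrite ler_pdivlMr// mulrC ler_pdivrMr ?poisson_den_gt0// -/x -/Y.
  have := sqr_ge0 (2 * (Y - s) - (y0 - s)); rewrite /B.
  have : 0 <= C ^+ 2 * (Y - s) ^+ 2 by rewrite mulr_ge0// sqr_ge0.
  have := sqr_ge0 x; move: c2.
  have -> : y0 - s = (y0 - Y) + (Y - s) by rewrite addrA subrK.
  by move: (y0 - Y) (Y - s) => a b; nra.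
have key := dyadic_full ig.1 g0 x0 (ltW e10) gd' (ltW xd) (ltW K0) far Gle.
have iP := integrable_poissonM x0 iv.
have iP1 := integrable_poissonM x0 (poisson_integrable_cst (v y0)).
have E : \int[mu]_s (poisson w s * v s) - v y0 = \int[mu]_s (poisson w s * (v s - v y0)).
  transitivity (\int[mu]_s (poisson w s * v s - poisson w s * v y0)).
    rewrite RintegralB//; congr (_ - _).
    rewrite RintegralZr//; first by rewrite Rintegral_poisson// mul1r.
    have := integrable_poissonM x0 (poisson_integrable_cst 1).
    by apply: eq_integrable => // s _; rewrite /= mulr1.
  by apply: eq_Rintegral => s _; rewrite mulrBr.
have ivB : poisson_integrable (fun s => v s - v y0).
  by apply: poisson_integrableD => //; exact: poisson_integrable_cst.
rewrite E; apply: le_trans (le_normr_Rintegral _ (integrable_poissonM x0 ivB)) _ => //.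
have igw := integrable_poissonM x0 ig.
rewrite -lee_fin /Rintegral fineK; last first.
  have i2 := integrable_norm (integrable_poissonM x0 ivB).
  exact: (integrable_fin_num _ i2).
apply: (@le_trans _ _ ((B / pi)%:E * \int[mu]_s (x / (x ^+ 2 + (y0 - s) ^+ 2) * g s)%:E)%E).
  have mk : measurable_fun setT (fun s : R => x / (x ^+ 2 + (y0 - s) ^+ 2)).
    apply: measurable_funM => //; apply: measurable_funVr => //.
    apply: measurable_funD => //; apply: measurable_funX.
    by apply: measurable_funD => //; exact: measurable_funN.
  have k0 (s : R) : 0 <= x / (x ^+ 2 + (y0 - s) ^+ 2).
    by rewrite divr_ge0 ?(ltW x0)// addr_ge0// sqr_ge0.
  rewrite -ge0_integralZl => //; first last.
  - by rewrite lee_fin divr_ge0 ?pi_ge0// ltW.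
  - by move=> s _; rewrite lee_fin mulr_ge0.
  - by apply/measurable_EFinP; apply: measurable_funM => //; exact: ig.1.
  apply: ge0_le_integral => //.
  - apply/measurable_EFinP; apply: measurableT_comp => //; apply: measurable_funM.
      exact: measurable_poisson.
    exact: ivB.1.
  - apply: (eq_measurable_fun (fun s : R => (B / pi * (x / (x ^+ 2 + (y0 - s) ^+ 2) * g s))%:E)) => [s _|].
      by rewrite EFinM.
    by apply/measurable_EFinP; apply: measurable_funM => //; apply: measurable_funM => //; exact: ig.1.
  move=> s _; rewrite -EFinM lee_fin normrM (ger0_norm (poisson_ge0 s x0)).
  by rewrite mulrA ler_wpM2r// cmp.
apply: le_trans (lee_wpmul2l _ key) _; first by rewrite lee_fin divr_ge0 ?pi_ge0// ltW.
rewrite -EFinM lee_fin.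
apply: (@le_trans _ _ (B * (10 * e1 + x * K * G))).
  have h0 : 0 <= 10 * e1 + x * K * G.
    apply: addr_ge0; first by rewrite mulr_ge0// ltW.
    by apply: mulr_ge0 => //; apply: mulr_ge0; exact: ltW.
  rewrite ler_wpM2r//.
  rewrite ler_pdivrMr ?pi_gt0// ler_peMr ?(ltW B0)//.
  by rewrite (le_trans _ (pi_ge2 R))// ler1n.
have -> : B * (10 * e1 + x * K * G) = e / 2 + x * (B * (K * G)).
  by rewrite /e1; field; rewrite lt0r_neq0.
rewrite [leRHS]splitr lerD2l.
move: xe; rewrite ltr_pdivlMr ?mulr_gt0 ?ltr_pwDl// => xe.
move: xe; move: (B * (K * G)) BKG => q q0; have := mulr_ge0 (ltW x0) q0.
by have := x0; lra.
Qed.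

Lemma lebesgue_pt_ae v : poisson_integrable v -> {ae mu, forall y, lebesgue_pt v y}.
Proof.
by move=> /poisson_integrable_locally; exact: lebesgue_differentiation.
Qed.

(** Approach to the boundary point [i y0] within cones of every opening. *)
Definition nontangential (F : R[i] -> R[i]) (y0 : R) (l : R[i]) :=
  forall C e : R, 0 <= C -> 0 < e -> exists2 d : R, 0 < d & forall w : R[i],
    0 < complex.Re w -> complex.Re w < d ->
    `|y0 - complex.Im w| <= C * complex.Re w -> normc (F w - l) <= e.

Lemma nontangential_boundary F (y0 : R) l : nontangential F y0 l ->
  (F (x +i* y0) : R[i]^o) @[x --> (0 : R)^'+] --> (l : R[i]^o).
Proof.
move=> nt; apply/cvg_normcP => e e0.
have e20 : 0 < e / 2 by rewrite divr_gt0.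
have [d d0 H] := nt 0 (e / 2) (lexx _) e20.
near=> x; apply: (@le_lt_trans _ _ (e / 2)); last by rewrite ltr_pdivrMr// ltr_pMr// ltr1n.
apply: H => /=.
- by near: x; exact: nbhs_right_gt.
- by near: x; exact: nbhs_right_lt.
- by rewrite subrr normr0 mul0r.
Unshelve. all: by end_near. Qed.

Lemma boundary_Cplus_eq F (y0 : R) l : nontangential F y0 l -> boundary_Cplus F y0 = l.
Proof.
move=> /nontangential_boundary h; rewrite /boundary_Cplus.
apply: (ccvg_unique (F := (0 : R)^'+) (f := fun x => F (x +i* y0))); last exact: h.
by move/cvgP: h.
Qed.

(** Almost every point is a Lebesgue point of both components of [H], whose
    Poisson integral is the transform. *)
Lemma laplace_nontangential h H : fourier_pair h H ->
  {ae mu, forall y, nontangential (laplace h) y (H y)}.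
Proof.
move=> hH; have [_ lH _] := hH; have [i1 i2] := poisson_integrable_isL2 lH.
move: (lebesgue_pt_ae i1) (lebesgue_pt_ae i2); apply: ae_imp2 => y l1 l2 C e C0 e0.
have e20 : 0 < e / 2 by rewrite divr_gt0.
have [d1 d10 H1] := poisson_nontangential i1 l1 C0 e20.
have [d2 d20 H2] := poisson_nontangential i2 l2 C0 e20.
exists (Num.min d1 d2) => [|w w0]; first by rewrite lt_min d10.
rewrite lt_min => /andP[wd1 wd2] cone.
rewrite (fourier_pair_poisson hH w0).
apply: (le_trans (normc_le _)); rewrite [e]splitr lerD//.
  rewrite ReD ReN [X in `|X - _|](_ : _ = \int[mu]_s (poisson w s * complex.Re (H s))); first exact: H1.
  by apply: eq_Rintegral => s _; rewrite ReM /= mulr0 subr0 mulrC.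
rewrite ImD ImN [X in `|X - _|](_ : _ = \int[mu]_s (poisson w s * complex.Im (H s))); first exact: H2.
by apply: eq_Rintegral => s _; rewrite ImM /= mulr0 add0r mulrC.
Qed.

End Fatou.

(** * Functionals without zeros on the powers of [1 - a X] *)

Lemma normcV (R : realType) (z : R[i]) : normc z^-1 = (normc z)^-1.
Proof.
have [->|z0] := eqVneq z 0; first by rewrite invr0 normc0 invr0.
apply: (mulfI (x := normc z)); first by rewrite normc_eq0.
by rewrite -normcM !divff ?normc_eq0// normc1.
Qed.

Lemma normc_nat (R : realType) (n : nat) : normc (n%:R : R[i]) = n%:R.
Proof. by rewrite -(rmorph_nat (real_complex R)) normc_real ger0_norm. Qed.

Section ZeroFree.
Variable R : realType.
Implicit Types (s : seq R[i]) (r : R[i]).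

(** The elementary symmetric function of degree [k], by the recursion that
    adds one root. *)
Fixpoint elsym s (k : nat) : R[i] :=
  if s is r :: s' then
    (if k is k'.+1 then elsym s' k + r * elsym s' k' else 1)
  else (k == 0%N)%:R.

Lemma elsym0 s : elsym s 0 = 1.
Proof. by case: s. Qed.

Lemma elsym_gt s k : (size s < k)%N -> elsym s k = 0.
Proof.
elim: s k => [|r s IH] [|k]//= ks; rewrite !IH ?mulr0 ?addr0//.
exact: ltnW.
Qed.

Lemma coef_prod_roots s i k : (i + k = size s)%N ->
  (\prod_(r <- s) ('X - r%:P))`_i = (-1) ^+ k * elsym s k.
Proof.
elim: s i k => [|r s IH] i k /=.
  by move/eqP; rewrite addn_eq0 => /andP[/eqP-> /eqP->]; rewrite big_nil coef1 mul1r.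
rewrite big_cons mulrBl coefB coefXM coefCM.
case: k => [|k].
  rewrite addn0 => ->; rewrite /= (IH _ 0%N) ?addn0// elsym0 nth_default ?mulr0 ?subr0//.
  by rewrite size_prod_XsubC.
rewrite addnS => -[ik]; rewrite (IH _ _ ik) exprS.
case: i ik => [|i] ik /=.
  rewrite (@elsym_gt s k.+1); last by rewrite -ik add0n.
  by ring.
by rewrite (IH _ k.+1) ?addnS// exprS; ring.
Qed.

Lemma normc_elsym_le s k : (forall r, r \in s -> normc r <= 1) ->
  normc (elsym s k) <= 'C(size s, k)%:R.
Proof.
elim: s k => [|r s IH] [|k] s1.
- by rewrite elsym0 normc1 bin0.
- by rewrite elsym_gt// normc0 ler0n.
- by rewrite elsym0 normc1 bin0.
rewrite [elsym _ _]/=.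
have s1' r' : r' \in s -> normc r' <= 1 by move=> h; apply: s1; rewrite inE h orbT.
rewrite binS natrD (le_trans (ler_normcD _ _))// lerD ?IH// normcM.
rewrite -[leRHS]mul1r ler_pM ?normc_ge0 ?IH//.
by apply: s1; rewrite inE eqxx.
Qed.

(** Newton's relation: [e_1 e_k - (k + 1) e_{k+1}] is the sum of the monomials
    of degree [k + 1] with exactly one squared variable, so it has
    [k * binomial (size s, k)] terms. *)
Lemma newton_le s k : (forall r, r \in s -> normc r <= 1) ->
  normc (elsym s 1 * elsym s k - k.+1%:R * elsym s k.+1) <= (k * 'C(size s, k))%:R.
Proof.
elim: s k => [|r s IH] [|k] s1.
- by rewrite elsym0 mulr1 mul1r subrr normc0 ler0n.
- by rewrite !(@elsym_gt [::])// !mulr0 subr0 normc0 ler0n.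
- by rewrite elsym0 mulr1 mul1r subrr normc0 ler0n.
have s1' r' : r' \in s -> normc r' <= 1 by move=> h; apply: s1; rewrite inE h orbT.
have r1 : normc r <= 1 by apply: s1; rewrite inE eqxx.
rewrite [elsym (r :: s) 1]/= [elsym (r :: s) k.+1]/= [elsym (r :: s) k.+2]/= elsym0 mulr1.
have -> : (elsym s 1 + r) * (elsym s k.+1 + r * elsym s k) -
    k.+2%:R * (elsym s k.+2 + r * elsym s k.+1) =
  (elsym s 1 * elsym s k.+1 - k.+2%:R * elsym s k.+2) +
  (r * (elsym s 1 * elsym s k - k.+1%:R * elsym s k.+1) + r * (r * elsym s k)).
  by rewrite -[k.+2%:R]natr1; ring.
rewrite binS mulnDr natrD (le_trans (ler_normcD _ _))// lerD ?IH//.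
rewrite mulSn addnC natrD (le_trans (ler_normcD _ _))// lerD//.
  by rewrite normcM -[leRHS]mul1r ler_pM ?normc_ge0 ?IH.
rewrite !normcM -[leRHS]mul1r ler_pM ?normc_ge0 ?mulr_ge0 ?normc_ge0//.
by rewrite -[leRHS]mul1r ler_pM ?normc_ge0 ?normc_elsym_le.
Qed.

Variable l : {poly R[i]} -> R[i].
Hypothesis l_lin : forall (a : R[i]) p q, l (a *: p + q) = a * l p + l q.
Hypothesis l_neq0 : forall (a : R[i]) n, normc a <= 1 -> l ((1 - a *: 'X) ^+ n) != 0.

Let l0 : l 0 = 0.
Proof. by apply: (addrI (l 0)); have := l_lin 1 0 0; rewrite scale1r mul1r !addr0. Qed.

Let lZ (a : R[i]) p : l (a *: p) = a * l p.
Proof. by have := l_lin a p 0; rewrite l0 !addr0. Qed.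

Let lD p q : l (p + q) = l p + l q.
Proof. by have := l_lin 1 p q; rewrite scale1r mul1r. Qed.

Let lsum n (p : 'I_n -> {poly R[i]}) : l (\sum_(i < n) p i) = \sum_(i < n) l (p i).
Proof.
elim: n p => [|n IH] p; first by rewrite !big_ord0.
by rewrite !big_ord_recr lD IH.
Qed.

Let m k := l 'X^k.

Let m0 : m 0 != 0.
Proof.
have := l_neq0 0 (a := 0); rewrite expr0 /m expr0; apply.
by rewrite normc0.
Qed.

Let lpow (a : R[i]) n : l ((1 - a *: 'X) ^+ n) =
  \sum_(k < n.+1) 'C(n, k)%:R * (- a) ^+ k * m k.
Proof.
rewrite -scaleNr exprDn lsum; apply: eq_bigr => i _.
by rewrite expr1n mul1r exprZn -scaler_nat !lZ mulrA.
Qed.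

(* For [r] outside the closed disk, [p.[r]] is [r ^ n] times the value of [l] at
   the power [(1 - r^-1 X) ^ n], so the roots of [p] have modulus at most one. *)
Let moment_le n k : (k < n)%N ->
  normc (n%:R * m 1 * m k - (n - k)%:R * m 0 * m k.+1) <= k%:R * normc (m 0) ^+ 2.
Proof.
move=> kn.
pose p : {poly R[i]} := \poly_(i < n.+1) ((-1) ^+ (n - i) * 'C(n, n - i)%:R * m (n - i)).
have sp : size p = n.+1.
  by apply: size_poly_eq; rewrite subnn bin0 expr0 !mul1r.
have lp : lead_coef p = m 0.
  by rewrite lead_coefE sp /= coef_poly ltnSn subnn bin0 expr0 !mul1r.
have [s ps] := closed_field_poly_normal p.
have ss : size s = n.
  by move: sp; rewrite ps size_scale ?lp// size_prod_XsubC => -[].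
have s1 r : r \in s -> normc r <= 1.
  move=> rs; rewrite leNgt; apply/negP => r1.
  have r0 : r != 0 by rewrite -normc_eq0 gt_eqF// (lt_trans _ r1).
  have : p.[r] = 0.
    by rewrite ps hornerZ; apply/eqP; rewrite mulf_eq0; apply/orP; right; rewrite -rootE root_prod_XsubC.
  have : p.[r] = r ^+ n * l ((1 - r^-1 *: 'X) ^+ n).
    rewrite lpow horner_poly mulr_sumr [LHS](reindex_inj rev_ord_inj) /=.
    apply: eq_bigr => i _; have i_n : (i <= n)%N by rewrite -ltnS.
    rewrite subSS (subKn i_n).
    have -> : r ^+ (n - i) = r ^+ n * r^-1 ^+ i.
      by rewrite exprVn -expfB_cond// (negPf r0) add0n -ltnS.
    by rewrite [(- r^-1) ^+ i]exprNn; ring.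
  move=> -> /eqP; rewrite mulf_eq0 expf_eq0 (negPf r0) andbF /=; apply/negP.
  apply: l_neq0; rewrite normcV invf_le1 ?normc_gt0//; exact: ltW.
have es j : (j <= n)%N -> m 0 * elsym s j = 'C(n, j)%:R * m j.
  move=> jn; have : p`_(n - j) = (-1) ^+ j * (m 0 * elsym s j).
    by rewrite ps lp coefZ (@coef_prod_roots _ _ j) ?ss ?subnK// mulrCA.
  rewrite coef_poly ltnS leq_subr subKn// -mulrA => /eqP.
  by rewrite (inj_eq (mulfI _)) ?signr_eq0// => /eqP.
have e1 := es 1%N (leq_ltn_trans (leq0n _) kn); rewrite bin1 in e1.
have ek := es k (ltnW kn); have ek1 := es k.+1 kn.
have Ck : 0 < 'C(n, k)%:R :> R by rewrite ltr0n bin_gt0 ltnW.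
rewrite -(ler_pM2l Ck).
have -> : 'C(n, k)%:R * normc (n%:R * m 1 * m k - (n - k)%:R * m 0 * m k.+1) =
    normc (m 0 * m 0 * (elsym s 1 * elsym s k - k.+1%:R * elsym s k.+1)).
  rewrite -[X in X * normc _]ger0_norm ?ler0n// -normc_real -normcM; congr normc.
  rewrite rmorph_nat.
  have -> : m 0 * m 0 * (elsym s 1 * elsym s k - k.+1%:R * elsym s k.+1) =
     (m 0 * elsym s 1) * (m 0 * elsym s k) - m 0 * (k.+1%:R * (m 0 * elsym s k.+1)) by ring.
  rewrite e1 ek ek1; rewrite [k.+1%:R * (_ * _)]mulrA -natrM mul_bin_left natrM; ring.
rewrite !normcM -expr2 [leRHS](_ : _ = normc (m 0) ^+ 2 * (k * 'C(n, k))%:R); last by rewrite natrM; ring.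
by rewrite ler_wpM2l ?sqr_ge0// -ss newton_le.
Qed.

(** Such a functional is a multiple of an evaluation: dividing the bound on the
    consecutive moments by [n] and letting [n] grow shows that the moments form
    a geometric progression. *)
Lemma zero_free_evaluation (w := l 'X / l 1) :
  normc w < 1 /\ forall p, l p = l 1 * p.[w].
Proof.
have mk k : m 1 * m k = m 0 * m k.+1.
  apply/eqP; rewrite -subr_eq0 -normc_eq0 eq_le normc_ge0 andbT.
  apply/ler_addgt0Pr => e e0; rewrite add0r.
  pose c := k%:R * (normc (m 0) ^+ 2 + normc (m 0 * m k.+1)).
  have c0 : 0 <= c by rewrite mulr_ge0// addr_ge0 ?normc_ge0// exprn_ge0// normc_ge0.
  have [n kn cn] : exists2 n, (k < n)%N & c <= e * n%:R.
    exists (maxn k.+1 (Num.truncn (c / e)).+1); first exact: leq_maxl.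
    rewrite mulrC -ler_pdivrMr// (le_trans (ltW (truncnS_gt _)))// ler_nat leq_maxr//.
  have n0 : 0 < n%:R :> R by rewrite ltr0n (leq_ltn_trans _ kn).
  rewrite -(ler_pM2l n0) [leRHS]mulrC; apply: le_trans cn.
  have -> : n%:R * normc (m 1 * m k - m 0 * m k.+1) =
      normc ((n%:R * m 1 * m k - (n - k)%:R * m 0 * m k.+1) - k%:R * (m 0 * m k.+1)).
    rewrite -[X in X * normc _]ger0_norm ?ler0n// -normc_real -normcM; congr normc.
    by rewrite rmorph_nat natrB ?(ltnW kn)//; ring.
  rewrite (le_trans (ler_normcB _ _))// /c mulrDr lerD ?moment_le//.
  by rewrite normcM normc_nat.
have w1 : l 1 = m 0 by rewrite /m expr0.
have mw k : m k = l 1 * w ^+ k.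
  elim: k => [|k IH]; first by rewrite expr0 mulr1 w1.
  apply: (mulfI m0); rewrite -mk IH exprS /w w1 /m expr1; field.
  by have := m0; rewrite /m expr0.
split.
  rewrite ltNge; apply/negP => h.
  have w0 : w != 0 by rewrite -normc_eq0 gt_eqF// (lt_le_trans _ h).
  have : l ((1 - w^-1 *: 'X) ^+ 1) = 0.
    rewrite lpow big_ord_recr big_ord1 /= bin0 bin1 (mw 1%N) (mw 0%N).
    by field.
  by apply/eqP; apply: l_neq0; rewrite normcV invf_le1 ?normc_gt0.
move=> p; rewrite -[p in LHS]coefK poly_def lsum horner_coef mulr_sumr.
by apply: eq_bigr => i _; rewrite lZ -/(m i) mw mulrCA.
Qed.

End ZeroFree.

(** * Schwarz's formula for the logarithm of [|1 - a zeta|] *)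

Lemma Rintegral_fatou (R : realType) (D : set R) (u_ : nat -> R -> R) (u : R -> R) (M : R) :
  measurable D ->
  (forall n, lebesgue_measure.-integrable D (EFin \o u_ n)) ->
  (forall n t, D t -> 0 <= u_ n t) -> measurable_fun D u ->
  {ae lebesgue_measure, forall t, D t -> u_ n t @[n --> \oo] --> u t} ->
  (forall n, \int[lebesgue_measure]_(t in D) u_ n t <= M) ->
  lebesgue_measure.-integrable D (EFin \o u) /\
  \int[lebesgue_measure]_(t in D) u t <= M.
Proof.
move=> mD iu u0 mu_ uae uM.
pose v t := Num.max (u t) 0.
have mv : measurable_fun D v by apply: measurable_maxr => //; exact: measurable_cst.
have uv : ae_eq lebesgue_measure D (EFin \o u) (EFin \o v).
  move: uae; apply: ae_imp => t ut Dt /=; suff h : 0 <= u t by rewrite /v max_l.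
  have ul := ut Dt; have -> : u t = limn (fun n => u_ n t) by rewrite (cvg_lim _ ul).
  apply: limr_ge; first exact/cvgP/ul.
  by apply: nearW => n; exact: u0.
have mun n : measurable_fun D (fun t => (u_ n t)%:E) by exact: (measurable_int _ (iu n)).
have F := @fatou _ _ _ lebesgue_measure D mD (fun n t => (u_ n t)%:E) mun
    (fun n t Dt => u0 n t Dt).
have le : (\int[lebesgue_measure]_(t in D) (v t)%:E <= M%:E)%E.
  have -> : (\int[lebesgue_measure]_(t in D) (v t)%:E =
      \int[lebesgue_measure]_(t in D) limn_einf (fun n => (u_ n t)%:E))%E.
    apply: ae_eq_integral => //.
    - exact/measurable_EFinP.
    - apply: (emeasurable_fun_cvg (fun n t => einfs (fun k => (u_ k t)%:E) n)).
        by move=> n; apply: measurable_fun_einfs.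
      by move=> t _; rewrite limn_einf_lim; exact: is_cvg_einfs.
    move: uv uae; apply: ae_imp2 => t h ut Dt; transitivity (u t)%:E; first exact/esym/h.
    have c : ((u_ n t)%:E @[n --> \oo] --> (u t)%:E)%E.
      by apply: cvg_EFin; [exact: nearW|exact: ut].
    by rewrite (cvg_limn_einf_sup c).1.
  apply: (le_trans F); rewrite limn_einf_lim; apply: lime_le.
    exact: is_cvg_einfs.
  apply: nearW => n.
  apply: (@le_trans _ _ (\int[lebesgue_measure]_(t in D) (u_ n t)%:E)%E).
    by apply: ereal_inf_lbound; exists n => /=.
  have := uM n; rewrite -lee_fin /Rintegral fineK//.
  by apply: integrable_fin_num => //; exact: iu.
have iv : lebesgue_measure.-integrable D (EFin \o v).
  apply: integrable_ge0 => //; first by move=> t _; rewrite le_max lexx orbT.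
  exact: le_lt_trans le (ltry _).
have iu' : lebesgue_measure.-integrable D (EFin \o u).
  apply/integrableP; split; first exact/measurable_EFinP.
  have [_] := integrableP _ _ _ iv; congr (_ < _)%E.
  apply: ae_eq_integral => //.
  - by apply: measurableT_comp => //; exact/measurable_EFinP.
  - by apply: measurableT_comp => //; exact/measurable_EFinP.
  by move: uv; apply: ae_imp => t h Dt; rewrite h.
split => //; rewrite -lee_fin /Rintegral fineK; last exact: integrable_fin_num.
apply: le_trans le; rewrite le_eqVlt; apply/orP; left; apply/eqP.
by apply: ae_eq_integral => //; exact/measurable_EFinP.
Qed.

Section Circle.
Variable R : realType.
Local Notation mu := (@lebesgue_measure R).
Local Notation circ := (`[0, 2 * pi]%classic : set R).
Implicit Types (z a w : R[i]) (t : R).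

Lemma measurable_circ : measurable circ.
Proof. exact: measurable_itv. Qed.
Hint Resolve measurable_circ : core.

Lemma integrable_circ_cst (M : R) : mu.-integrable circ (EFin \o cst M).
Proof.
have fin : (mu circ < +oo)%E.
  by rewrite lebesgue_measure_itv/=; case: ifP => _; rewrite -?EFinD ltry.
apply: measurable_bounded_integrable => //.
by exists `|M|; split; [exact: num_real|move=> x Mx t _; exact: ltW].
Qed.

Lemma Rintegral_circ_cst (M : R) : \int[mu]_(t in circ) M = 2 * pi * M.
Proof.
have E : mu circ = (2 * pi)%:E.
  by rewrite lebesgue_measure_itv/= lte_fin mulr_gt0 ?pi_gt0//= -EFinD subr0.
transitivity (M * fine (mu circ)); last by rewrite E mulrC.
by apply: Rintegral_cst.
Qed.

Lemma cintegrable_circ f (M : R) : cmeas circ f -> (forall t, normc (f t) <= M) ->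
  cintegrable circ f.
Proof. by move=> mf fM; apply: (cintegrable_le _ mf (integrable_circ_cst M)). Qed.

Definition zeta t : R[i] := cexp (0 +i* t).

Lemma normc_zeta t : normc (zeta t) = 1.
Proof. exact: cexp_im_normc. Qed.

Lemma zeta_conj t : zeta t * conjc (zeta t) = 1.
Proof. by rewrite mulc_conj normc_zeta expr1n. Qed.

Lemma zeta2pi : zeta (2 * pi) = 1.
Proof.
by rewrite /zeta /cexp /= expR0 mul1r mulrC mulr_natr cos2pi sin2pi.
Qed.

Lemma zeta0 : zeta 0 = 1.
Proof. exact: cexp0. Qed.

Lemma cderiv_zeta t : cderiv zeta t (zeta t * 'i%C).
Proof.
apply: cderiv_cexp; split => /=; [exact: is_derive_cst|exact: is_derive_id].
Qed.

Lemma cmeas_zeta (D : set R) : measurable D -> cmeas D zeta.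
Proof. by move=> mD; apply: (cderiv_cmeas mD) => t; exact: cderiv_zeta. Qed.

Lemma cintegral_conj (D : set R) f : measurable D -> cintegrable D f ->
  cintegral D (fun t => conjc (f t)) = conjc (cintegral D f).
Proof.
move=> mD [i1 i2]; apply: complex_eq => /=.
  by apply: eq_Rintegral => t _; case: (f t).
rewrite -mulN1r -RintegralZl//.
by apply: eq_Rintegral => t _; rewrite mulN1r; case: (f t).
Qed.

Lemma cintegrable_zetaX n : cintegrable circ (fun t => zeta t ^+ n).
Proof.
apply: (@cintegrable_circ _ 1); first by apply: cmeasX; exact: cmeas_zeta.
by move=> t; rewrite normcX normc_zeta expr1n.
Qed.

Lemma cintegral_zetaX n : cintegral circ (fun t => zeta t ^+ n.+1) = 0.
Proof.
have n0 : n.+1%:R * 'i != 0 :> R[i].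
  by rewrite mulf_eq0 pnatr_eq0 /= -normc_eq0 /= expr0n expr1n add0r sqrtr1 oner_eq0.
have d t := cderivX n (cderiv_zeta t).
rewrite (@cintegral_FTC2 _ (fun t => (n.+1%:R * 'i%C)^-1 * zeta t ^+ n.+1) _
  (fun t => n.+1%:R * zeta t ^+ n * (zeta t * 'i%C))).
- by rewrite zeta2pi zeta0 subrr.
- by rewrite mulr_gt0// pi_gt0.
- move=> t; apply: cderiv_eq (cderivM (cderiv_cst _ _) (d t)) _.
  rewrite mul0r add0r; set c := n.+1%:R * 'i%C in n0 *.
  rewrite (_ : n.+1%:R * _ * _ = c * zeta t ^+ n.+1); last by rewrite /c exprS; ring.
  by rewrite mulKf.
- by move=> t; exact: d.
Qed.

Lemma cintegral_circ1 : cintegral circ (fun=> 1 : R[i]) = (2 * pi)%:C.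
Proof. by rewrite (cintegral_real circ (fun=> 1)) Rintegral_circ_cst mulr1. Qed.

Definition schwarz z t : R[i] := (zeta t + z) / (zeta t - z).

Lemma schwarz_den z t : normc z < 1 -> zeta t - z != 0.
Proof.
move=> z1; rewrite -normc_eq0 gt_eqF//.
by apply: lt_le_trans (lerB_normc _ _); rewrite normc_zeta subr_gt0.
Qed.

Lemma normc_schwarz_le z t : normc z < 1 -> normc (schwarz z t) <= 2 / (1 - normc z).
Proof.
move=> z1; rewrite /schwarz normcM normcV ler_pM ?normc_ge0 ?invr_ge0 ?normc_ge0//.
  by rewrite (le_trans (ler_normcD _ _))// normc_zeta lerD2l ltW.
rewrite lef_pV2 ?posrE ?subr_gt0 ?normc_gt0 ?schwarz_den//.
by apply: le_trans (lerB_normc _ _); rewrite normc_zeta.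
Qed.

Lemma cmeas_schwarz z (D : set R) : measurable D -> cmeas D (schwarz z).
Proof.
move=> mD; apply: cmeasM; first by apply: cmeasD; [exact: cmeas_zeta|exact: cmeas_cst].
by apply: cmeasV => //; apply: cmeasB; [exact: cmeas_zeta|exact: cmeas_cst].
Qed.

Lemma cintegrable_schwarz z f (M : R) : normc z < 1 -> cmeas circ f ->
  (forall t, normc (f t) <= M) -> cintegrable circ (fun t => schwarz z t * f t).
Proof.
move=> z1 mf fM; apply: (@cintegrable_circ _ (2 / (1 - normc z) * M)).
  by apply: cmeasM => //; exact: cmeas_schwarz.
move=> t; rewrite normcM ler_pM ?normc_ge0//; exact: normc_schwarz_le.
Qed.

Let normc_conjX n t : normc (conjc (zeta t) ^+ n) = 1.
Proof. by rewrite normcX normc_conj normc_zeta expr1n. Qed.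

Let cmeas_conjX n : cmeas circ (fun t => conjc (zeta t) ^+ n).
Proof. by apply: cmeasX; apply: cmeas_conj; exact: cmeas_zeta. Qed.

Let integrable_conjX z n : normc z < 1 ->
  cintegrable circ (fun t => schwarz z t * conjc (zeta t) ^+ n).
Proof.
by move=> z1; apply: (@cintegrable_schwarz _ _ 1) => // t; rewrite normc_conjX.
Qed.

Let integrable_zetaX z n : normc z < 1 ->
  cintegrable circ (fun t => schwarz z t * zeta t ^+ n).
Proof.
move=> z1; apply: (@cintegrable_schwarz _ _ 1) => // [|t].
  by apply: cmeasX; exact: cmeas_zeta.
by rewrite normcX normc_zeta expr1n.
Qed.

Let conjXE n t : conjc (zeta t) ^+ n = conjc (zeta t ^+ n).
Proof. by elim: n => [|n IH]; rewrite ?expr0 ?rmorph1// !exprS IH conjcM. Qed.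

Let cintegral_conjX n : cintegral circ (fun t => conjc (zeta t) ^+ n.+1) = 0.
Proof.
rewrite (eq_cintegral (g := fun t => conjc (zeta t ^+ n.+1))) => [|t _]; last exact: conjXE.
by rewrite cintegral_conj ?cintegral_zetaX ?rmorph0//; exact: cintegrable_zetaX.
Qed.

(* Multiplying the kernel by [zeta - z] clears its denominator, which relates
   the moments of consecutive orders. *)
Let conj_step z n : normc z < 1 ->
  cintegral circ (fun t => schwarz z t * conjc (zeta t) ^+ n) -
  z * cintegral circ (fun t => schwarz z t * conjc (zeta t) ^+ n.+1) =
  cintegral circ (fun t => conjc (zeta t) ^+ n).
Proof.
move=> z1; rewrite -cintegralZl//; last exact: integrable_conjX.
rewrite -cintegralB//; [|exact: integrable_conjX|]; last first.
  by apply: cintegrableZl => //; exact: integrable_conjX.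
transitivity (cintegral circ (fun t => conjc (zeta t) ^+ n + z * conjc (zeta t) ^+ n.+1)).
  apply: eq_cintegral => t _; cbv beta; rewrite !exprS /schwarz.
  have h := schwarz_den t z1; have e := zeta_conj t.
  move: (conjc (zeta t) ^+ n) => c; move: (zeta t) (conjc (zeta t)) h e => u v h e.
  have -> : (u + z) / (u - z) * c - z * ((u + z) / (u - z) * (v * c)) =
     c * ((u + z) / (u - z)) * (1 - z * v) by ring.
  rewrite -e (_ : u * v - z * v = (u - z) * v); last by ring.
  rewrite mulrA -(mulrA c) divfK//.
  by rewrite (_ : c * (u + z) * v = (u * v) * c + z * (v * c)); [rewrite e mul1r|ring].
rewrite cintegralD//.
- rewrite cintegralZl ?cintegral_conjX ?mulr0 ?addr0//.
  by apply: (@cintegrable_circ _ 1) => // t; rewrite normc_conjX.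
- by apply: (@cintegrable_circ _ 1) => // t; rewrite normc_conjX.
- by apply: cintegrableZl => //; apply: (@cintegrable_circ _ 1) => // t; rewrite normc_conjX.
Qed.

Lemma schwarz_conjX z n : normc z < 1 ->
  cintegral circ (fun t => schwarz z t * conjc (zeta t) ^+ n.+1) = 0.
Proof.
move=> z1; pose J n := cintegral circ (fun t => schwarz z t * conjc (zeta t) ^+ n).
have Jle k : normc (J k) <= 2 * pi * (2 / (1 - normc z)).
  rewrite -Rintegral_circ_cst; apply: le_normc_cintegral_bound => //.
  - by apply: cmeasM => //; exact: cmeas_schwarz.
  - exact: integrable_circ_cst.
  - by move=> t _; rewrite normcM normc_conjX mulr1 normc_schwarz_le.
have Jz k : J n.+1 = z ^+ k * J (n.+1 + k)%N.
  elim: k => [|k ->]; first by rewrite mul1r addn0.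
  have := conj_step (n.+1 + k) z1; rewrite addSn cintegral_conjX => /eqP.
  rewrite subr_eq0 => /eqP; rewrite /J => ->.
  by rewrite exprS addnS; ring.
apply/eqP; rewrite -normc_eq0; apply/eqP; rewrite -/(J n.+1).
have h k : normc (J n.+1) <= 2 * pi * (2 / (1 - normc z)) * normc z ^+ k.
  by rewrite (Jz k) normcM normcX mulrC ler_wpM2r ?exprn_ge0 ?normc_ge0.
apply/eqP; rewrite eq_le normc_ge0 andbT.
have c0 : (2 * pi * (2 / (1 - normc z)) * normc z ^+ k) @[k --> \oo] --> (0 : R).
  rewrite -[X in _ --> X](mulr0 (2 * pi * (2 / (1 - normc z)))).
  by apply: cvgMr; apply: cvg_expr; rewrite ger0_norm ?normc_ge0.
rewrite -(cvg_lim _ c0)//; apply: limr_ge; first exact: cvgP c0.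
by apply: nearW => k; exact: h.
Qed.

Lemma schwarz1 z : normc z < 1 -> cintegral circ (schwarz z) = (2 * pi)%:C.
Proof.
move=> z1; have := conj_step 0 z1; rewrite schwarz_conjX// mulr0 subr0.
rewrite -cintegral_circ1 => e; transitivity (cintegral circ (fun t => schwarz z t * conjc (zeta t) ^+ 0)).
  by apply: eq_cintegral => t _; rewrite expr0 mulr1.
by rewrite e; apply: eq_cintegral => t _; rewrite expr0.
Qed.

Lemma schwarz_zetaX z n : normc z < 1 ->
  cintegral circ (fun t => schwarz z t * zeta t ^+ n.+1) = (2 * (2 * pi))%:C * z ^+ n.+1.
Proof.
move=> z1.
have step k : cintegral circ (fun t => schwarz z t * zeta t ^+ k.+1) =
    z * cintegral circ (fun t => schwarz z t * zeta t ^+ k) +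
    z * cintegral circ (fun t => zeta t ^+ k).
  rewrite -!cintegralZl//; [|exact: cintegrable_zetaX|exact: integrable_zetaX].
  apply/eqP; rewrite addrC -subr_eq -cintegralB//; [|exact: integrable_zetaX|]; last first.
    by apply: cintegrableZl => //; exact: integrable_zetaX.
  apply/eqP; transitivity (cintegral circ (fun t => zeta t ^+ k.+1 + z * zeta t ^+ k)).
    apply: eq_cintegral => t _ /=; have h := schwarz_den t z1.
    rewrite exprS; move: (zeta t ^+ k) => c; rewrite /schwarz; field; exact: h.
  rewrite cintegralD ?cintegral_zetaX ?add0r//; first exact: cintegrable_zetaX.
  by apply: cintegrableZl => //; exact: cintegrable_zetaX.
elim: n => [|n IH]; rewrite step.
  rewrite (_ : cintegral _ (fun t => _ * zeta t ^+ 0) = (2 * pi)%:C); last first.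
    by rewrite -(schwarz1 z1); apply: eq_cintegral => t _; rewrite expr0 mulr1.
  rewrite (_ : cintegral _ (fun t => zeta t ^+ 0) = (2 * pi)%:C) ?expr1; last first.
    by rewrite -cintegral_circ1.
  by rewrite (rmorphM _ 2 (2 * pi)); ring.
by rewrite IH cintegral_zetaX mulr0 addr0 [in RHS]exprS; ring.
Qed.

Definition log1_sum N w : R[i] := - \sum_(k < N) (k.+1%:R)^-1 * w ^+ k.+1.

Lemma log1_sumS N w : log1_sum N.+1 w = log1_sum N w - (N.+1%:R)^-1 * w ^+ N.+1.
Proof. by rewrite /log1_sum big_ord_recr opprD. Qed.

Lemma normc_log1_sum_le N w (r : R) : normc w <= r -> r < 1 ->
  normc (log1_sum N w) <= (1 - r)^-1.
Proof.
move=> wr r1; have r0 : 0 <= r := le_trans (normc_ge0 w) wr.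
rewrite /log1_sum normcNr (le_trans (ler_normc_sum _ _ _))//.
apply: (@le_trans _ _ (\sum_(k < N) r ^+ k)).
  apply: ler_sum => k _; rewrite normcM normcV normc_nat normcX.
  apply: (@le_trans _ _ (1 * r ^+ k.+1)).
    rewrite ler_pM ?invr_ge0 ?exprn_ge0 ?normc_ge0//; first by rewrite invf_le1 ?ltr0n// ler1n.
    by rewrite ler_pXn2r ?nnegrE ?normc_ge0.
  by rewrite mul1r exprS ler_piMl ?exprn_ge0// ltW.
have e : (1 - r) * \sum_(k < N) r ^+ k = 1 - r ^+ N.
  by rewrite -[LHS]opprK -mulNr opprB -subrX1 opprB.
by rewrite -(ler_pM2l (_ : 0 < 1 - r)) ?subr_gt0// e divff ?gt_eqF ?subr_gt0// gerBl exprn_ge0.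
Qed.

Lemma cderiv_sum (N : nat) (f : 'I_N -> R -> R[i]) (d : 'I_N -> R[i]) t :
  (forall i, cderiv (f i) t (d i)) ->
  cderiv (fun s => \sum_(i < N) f i s) t (\sum_(i < N) d i).
Proof.
elim: N f d => [|N IH] f d fd.
  rewrite big_ord0; under eq_fun do rewrite big_ord0; exact: cderiv_cst.
rewrite big_ord_recr; under eq_fun do rewrite big_ord_recr.
by apply: cderivD => //; apply: IH => i.
Qed.

(** With [L t] the opposite of the partial sum at [t w], the derivative of [cexp (L t) * (1 - t w)]
    telescopes to a multiple of [(t w) ^ N], and the mean value inequality
    bounds the increment. *)
Lemma cexp_log1_sum_le N w : normc w < 1 ->
  normc (cexp (log1_sum N w) - (1 - w)) <= expR (2 / (1 - normc w)) * normc w ^+ N.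
Proof.
move=> w1; set r := normc w.
pose L (t : R) := \sum_(k < N) (k.+1%:R)^-1 * (t%:C * w) ^+ k.+1.
pose f (t : R) := cexp (L t) * (1 - t%:C * w).
pose f' (t : R) := - (cexp (L t) * w * (t%:C * w) ^+ N).
have tw (t : R) : 0 <= t <= 1 -> normc (t%:C * w) <= r.
  by move=> /andP[t0 t1]; rewrite normcM normc_real ger0_norm// ler_piMl ?normc_ge0.
have Lle (t : R) : 0 <= t <= 1 -> normc (L t) <= (1 - r)^-1.
  by move=> /tw t1; have := normc_log1_sum_le N t1 w1; rewrite /log1_sum normcNr.
have df t : cderiv f t (f' t).
  have dw := cderiv_lin w t.
  have dL : cderiv L t (\sum_(k < N) w * (t%:C * w) ^+ k).
    apply: cderiv_sum => k; apply: cderiv_eq (cderivM (cderiv_cst _ _) (cderivX k dw)) _.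
    by rewrite mul0r add0r -mulrA mulKf ?pnatr_eq0// mulrC.
  apply: cderiv_eq (cderivM (cderiv_cexp dL) (cderivD (cderiv_cst 1 t) (cderivN dw))) _.
  rewrite -mulr_sumr /f' add0r.
  have e : (1 - t%:C * w) * \sum_(k < N) (t%:C * w) ^+ k = 1 - (t%:C * w) ^+ N.
    by rewrite -[LHS]opprK -mulNr opprB -subrX1 opprB.
  set S := \sum_(k < N) _ in e *.
  have -> : cexp (L t) * (w * S) * (1 - t%:C * w) + cexp (L t) * - w =
     cexp (L t) * w * ((1 - t%:C * w) * S - 1) by ring.
  by rewrite e; ring.
have r0 : 0 <= r by exact: normc_ge0.
have f'le (t : R) : 0 <= t <= 1 -> normc (f' t) <= expR (1 - r)^-1 * r ^+ N.
  move=> t01; rewrite /f' normcNr normcM normcX (normcM (cexp _) w) normc_cexp.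
  rewrite ler_pM ?mulr_ge0 ?exprn_ge0 ?normc_ge0 ?expR_ge0//.
    rewrite -[leRHS]mulr1 ler_pM ?expR_ge0 ?normc_ge0//; last exact: ltW.
    by rewrite ler_expR (le_trans _ (Lle t t01))// (le_trans _ (normRe_le _))// ler_norm.
  by rewrite lerXn2r ?nnegrE ?normc_ge0 ?tw.
have f0 : f 0 = 1.
  rewrite /f /L mul0r subr0 mulr1 big1 ?cexp0// => k _.
  by rewrite exprS mul0r mulr0.
have f1 : f 1 = cexp (- log1_sum N w) * (1 - w).
  by rewrite /f /L /log1_sum opprK mul1r.
have := cderiv_le (fun t _ => df t) f'le; rewrite f0 f1 cexpN => le.
have -> : cexp (log1_sum N w) - (1 - w) =
    - cexp (log1_sum N w) * ((cexp (log1_sum N w))^-1 * (1 - w) - 1).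
  by rewrite mulrBr mulNr mulrA mulfV ?cexp_neq0//; ring.
rewrite normcM normcNr normc_cexp.
rewrite (_ : 2 / (1 - r) = (1 - r)^-1 + (1 - r)^-1); last by ring.
rewrite expRD -mulrA ler_pM ?expR_ge0 ?normc_ge0//.
rewrite ler_expR (le_trans (ler_norm _))// (le_trans (normRe_le _))//.
exact: normc_log1_sum_le.
Qed.

Lemma cvg_cexp_log1_sum w : normc w < 1 ->
  (cexp (log1_sum N w) : R[i]^o) @[N --> \oo] --> (1 - w : R[i]^o).
Proof.
move=> w1; apply/cvg_normc0P.
apply: (@squeeze_cvgr _ _ _ _ (cst 0) (fun N => expR (2 / (1 - normc w)) * normc w ^+ N)).
- by apply: nearW => N; rewrite /= normc_ge0 cexp_log1_sum_le.
- exact: cvg_cst.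
rewrite -[X in _ --> X](mulr0 (expR (2 / (1 - normc w)))).
by apply: cvgMr; apply: cvg_expr; rewrite ger0_norm ?normc_ge0.
Qed.

Lemma ccvg_cexp (T : Type) (F : set_system T) {FF : Filter F} (f : T -> R[i]) a :
  (f x : R[i]^o) @[x --> F] --> (a : R[i]^o) ->
  (cexp (f x) : R[i]^o) @[x --> F] --> (cexp a : R[i]^o).
Proof.
move=> /cvg_normc0P fa; apply/cvg_normc0P.
apply: (@squeeze_cvgr _ _ _ _ (cst 0) (fun x =>
   normc (cexp a) * (normc (f x - a) * expR (normc (f x - a))))).
- apply: nearW => x; apply/andP; split; first exact: normc_ge0.
  have -> : cexp (f x) - cexp a = cexp a * (cexp (f x - a) - 1).
    by rewrite mulrBr mulr1 -cexpD addrCA subrr addr0.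
  by rewrite normcM ler_wpM2l ?normc_ge0 ?cexpB1_le.
- exact: cvg_cst.
rewrite -[X in _ --> X](mulr0 (normc (cexp a))); apply: cvgMr.
rewrite -[X in _ --> X](mul0r (expR 0)); apply: cvgM => //.
exact: (continuous_cvg (f := fun x => normc (f x - a)) _ (@continuous_expR R 0) fa).
Qed.

Definition log_mod a t : R := ln (normc (1 - a * zeta t)).

Lemma measurable_log_mod a (D : set R) : measurable D -> measurable_fun D (log_mod a).
Proof.
move=> mD; apply: measurableT_comp; first exact: measurable_ln.
apply: measurable_normc; apply: cmeasB; first exact: cmeas_cst.
by apply: cmeasM; [exact: cmeas_cst|exact: cmeas_zeta].
Qed.

(** The real part of a polynomial vanishing at [0] is half the sum of the
    polynomial and its conjugate, and the Schwarz kernel annihilates the powers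
    of the conjugate of [zeta]. *)
Lemma schwarz_log1_sum a z N : normc z < 1 ->
  cintegral circ (fun t => schwarz z t * (complex.Re (log1_sum N (a * zeta t)))%:C) =
  (2 * pi)%:C * log1_sum N (a * z).
Proof.
move=> z1.
have iX N' : cintegrable circ (fun t =>
    schwarz z t * (complex.Re (log1_sum N' (a * zeta t)))%:C).
  have m : cmeas circ (fun t => log1_sum N' (a * zeta t)).
    apply: cmeasN; apply: cmeas_sum => k; apply: cmeasM; first exact: cmeas_cst.
    by apply: cmeasX; apply: cmeasM; [exact: cmeas_cst|exact: cmeas_zeta].
  apply: (@cintegrable_schwarz _ _ (\sum_(k < N') normc a ^+ k.+1)) => //.
    by apply: cmeas_real; exact: m.1.
  move=> t; rewrite normc_real (le_trans (normRe_le _))// normcNr.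
  rewrite (le_trans (ler_normc_sum _ _ _))//; apply: ler_sum => k _.
  rewrite normcM normcV normc_nat normcX normcM normc_zeta mulr1.
  by rewrite ler_piMl ?exprn_ge0 ?normc_ge0// invf_le1 ?ltr0n// ler1n.
elim: N => [|N IH].
  rewrite [RHS](_ : _ = 0); last by rewrite /log1_sum big_ord0 oppr0 mulr0.
  rewrite -[RHS](cintegral_cst0 circ); apply: eq_cintegral => t _.
  by rewrite /log1_sum big_ord0 oppr0 mulr0.
pose c : R[i] := - ((2 * N.+1%:R)^-1 * a ^+ N.+1).
have i1 := integrable_zetaX N.+1 z1; have i2 := integrable_conjX N.+1 z1.
have j1 := cintegrableZl c measurable_circ i1.
have j2 := cintegrableZl (conjc c) measurable_circ i2.
transitivity (cintegral circ (fun t =>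
    schwarz z t * (complex.Re (log1_sum N (a * zeta t)))%:C +
    (c * (schwarz z t * zeta t ^+ N.+1) +
     conjc c * (schwarz z t * conjc (zeta t) ^+ N.+1)))).
  apply: eq_cintegral => t _; cbv beta.
  rewrite log1_sumS ReD rmorphD mulrDr; congr (_ + _).
  transitivity (schwarz z t * (c * zeta t ^+ N.+1 + conjc c * conjc (zeta t ^+ N.+1))); last first.
    by rewrite conjXE; ring.
  congr (_ * _).
  have -> : - ((N.+1%:R)^-1 * (a * zeta t) ^+ N.+1) = 2 * (c * zeta t ^+ N.+1).
    by rewrite /c exprMn; field; rewrite addrC natr1 pnatr_eq0.
  rewrite -conjcM; move: (c * zeta t ^+ N.+1) => q.
  by apply: complex_eq; rewrite ?ReD ?ImD ?ReM ?ImM /=; case: q => p q /=; ring.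
have j3 := cintegrableD measurable_circ j1 j2.
rewrite (cintegralD measurable_circ (iX N) j3).
rewrite [X in X + _ = _]IH.
rewrite cintegralD// !cintegralZl// schwarz_zetaX// schwarz_conjX// mulr0 addr0.
rewrite log1_sumS (rmorphM _ 2 (2 * pi)) /c exprMn.
move: (log1_sum N _) (a ^+ N.+1) (z ^+ N.+1) => L A Z.
by field; rewrite addrC natr1 pnatr_eq0.
Qed.

Lemma normc_1a_ge a t : 1 - normc a <= normc (1 - a * zeta t).
Proof. by apply: le_trans (lerB_normc _ _); rewrite normcM normc_zeta mulr1 normc1. Qed.

Lemma normc_1a_le a t : normc (1 - a * zeta t) <= 1 + normc a.
Proof. by apply: le_trans (ler_normcB _ _) _; rewrite normcM normc_zeta mulr1 normc1. Qed.

Lemma schwarz_log_lt1 a z : normc a < 1 -> normc z < 1 ->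
  cexp ((2 * pi)^-1%:C * cintegral circ (fun t => schwarz z t * (log_mod a t)%:C)) =
  1 - a * z.
Proof.
move=> a1 z1.
have az1 : normc (a * z) < 1.
  by rewrite normcM (le_lt_trans _ z1)// ler_piMl ?normc_ge0// ltW.
have c1 : (cintegral circ (fun t => schwarz z t * (complex.Re (log1_sum N (a * zeta t)))%:C) : R[i]^o)
    @[N --> \oo] --> (cintegral circ (fun t => schwarz z t * (log_mod a t)%:C) : R[i]^o).
  apply: (@cintegral_dominated _ _ _ _ (fun=> 2 / (1 - normc z) * (1 - normc a)^-1)) => //.
  - move=> N; apply: cmeasM; first exact: cmeas_schwarz.
    apply: cmeas_real; apply: (proj1 (_ : cmeas _ (fun t => log1_sum N (a * zeta t)))).
    apply: cmeasN; apply: cmeas_sum => k; apply: cmeasM; first exact: cmeas_cst.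
    by apply: cmeasX; apply: cmeasM; [exact: cmeas_cst|exact: cmeas_zeta].
  - by apply: cmeasM; [exact: cmeas_schwarz|apply: cmeas_real; exact: measurable_log_mod].
  - apply: aeW => t _; apply: ccvgMl.
    have at1 : normc (a * zeta t) < 1 by rewrite normcM normc_zeta mulr1.
    apply/cvg_ReIm; split => /=; last exact: cvg_cst.
    have n0 : 0 < normc (1 - a * zeta t).
      by apply: lt_le_trans (normc_1a_ge _ _); rewrite subr_gt0.
    have h : normc (cexp (log1_sum N (a * zeta t))) @[N --> \oo] --> normc (1 - a * zeta t).
      by apply: ccvg_normc; exact: cvg_cexp_log1_sum.
    have h2 : ln (normc (cexp (log1_sum N (a * zeta t)))) @[N --> \oo] --> log_mod a t.
      exact: (continuous_cvg _ (continuous_ln n0)) h.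
    apply: cvg_trans h2.
    by apply: near_eq_cvg; apply: nearW => N; rewrite normc_cexp expRK.
  - exact: integrable_circ_cst.
  - move=> N t _; rewrite normcM ler_pM ?normc_ge0 ?normc_schwarz_le//.
    rewrite normc_real (le_trans (normRe_le _))// normc_log1_sum_le//.
    by rewrite normcM normc_zeta mulr1.
apply: (ccvg_unique (F := \oo) (f := fun N => cexp ((2 * pi)^-1%:C *
    cintegral circ (fun t => schwarz z t * (complex.Re (log1_sum N (a * zeta t)))%:C)))).
  by apply: ccvg_cexp; exact: ccvgMl.
apply: (eq_ccvg _ (cvg_cexp_log1_sum az1)) => N.
rewrite schwarz_log1_sum// mulrA -rmorphM mulVf ?mul1r//.
by rewrite lt0r_neq0// mulr_gt0// pi_gt0.
Qed.

Lemma schwarz0 t : schwarz 0 t = 1.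
Proof. by rewrite /schwarz addr0 subr0 divff// cexp_neq0. Qed.

Lemma integrable_log_mod_lt1 a : normc a < 1 ->
  mu.-integrable circ (EFin \o log_mod a).
Proof.
move=> a1; have a0 := normc_ge0 a.
apply: le_integrable (integrable_circ_cst (ln 2 - ln (1 - normc a))) => //.
  by apply/measurable_EFinP; exact: measurable_log_mod.
move=> t _; rewrite /= lee_fin [leRHS]ger0_norm; last first.
  rewrite subr_ge0 ler_ln ?posrE ?subr_gt0//; lra.
have h1 := normc_1a_ge a t; have h2 := normc_1a_le a t.
have n0 : 0 < normc (1 - a * zeta t) by apply: lt_le_trans h1; rewrite subr_gt0.
have l1 : ln (1 - normc a) <= log_mod a t by rewrite ler_ln ?posrE ?subr_gt0.
have l2 : log_mod a t <= ln 2 by rewrite ler_ln ?posrE// (le_trans h2)// lerD2l ltW.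
have l3 : ln (1 - normc a) <= 0 by rewrite ln_le0// gerBl.
have l4 : 0 <= ln 2 :> R by rewrite ln_ge0// ler1n.
by rewrite ler_norml; apply/andP; split; lra.
Qed.

(** Jensen's formula without zeros. *)
Lemma Rintegral_log_mod_lt1 a : normc a < 1 -> \int[mu]_(t in circ) log_mod a t = 0.
Proof.
move=> a1; have := schwarz_log_lt1 a1 (_ : normc (0 : R[i]) < 1).
rewrite normc0 => /(_ ltr01); rewrite mulr0 subr0.
rewrite (eq_cintegral (g := fun t => (log_mod a t)%:C)) => [|t _]; last by rewrite schwarz0 mul1r.
rewrite cintegral_real -rmorphM cexp_real => /(congr1 (@complex.Re R))/= /(congr1 (@ln R)).
rewrite expRK ln1 => /eqP; rewrite mulf_eq0 invr_eq0 gt_eqF ?mulr_gt0 ?pi_gt0//= => /eqP.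
by [].
Qed.

(** A zero is an angle with a prescribed cosine, and at most two angles in
    [[0, 2 * pi]] have it. *)
Lemma zeta_level_null a : {ae mu, forall t, circ t -> 1 - a * zeta t != 0}.
Proof.
pose c := complex.Re a^-1.
have sub : ~` [set t | circ t -> 1 - a * zeta t != 0] `<=` [set acos c; 2 * pi - acos c].
  move=> t /= /not_implyP[]; rewrite in_itv/= => /andP[t0 t2] /negP; rewrite negbK subr_eq0 => /eqP az.
  have a0 : a != 0 by apply: contra_eq_neq az => ->; rewrite mul0r oner_neq0.
  have ec : cos t = c.
    rewrite /c -[a^-1]mulr1 az mulKf//; by rewrite /zeta /cexp /= expR0; ring.
  case: (lerP t pi) => tpi; [left|right].
    by rewrite -ec cosK// in_itv/= t0.
  have e2 : cos (2 * pi - t) = c.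
    by rewrite -ec -[RHS]cosN -[RHS]cosD2pi addrC mulr_natl.
  rewrite -e2 cosK ?subKr// in_itv/= subr_ge0 t2 /=; lra.
exists [set acos c; 2 * pi - acos c]; split => //.
  by apply: measurableU; exact: measurable_set1.
apply/eqP; rewrite eq_le measure_ge0 andbT.
apply: (@le_trans _ _ (mu [set acos c] + mu [set (2 * pi - acos c)%R])%E).
  by apply: measureU2; exact: measurable_set1.
by rewrite !lebesgue_measure_set1 adde0.
Qed.

Section LogMod.
Variable a : R[i].
Hypothesis a1 : normc a <= 1.

Let s n : R := 1 - n.+2%:R^-1.

Let s_gt0 n : 0 < s n.
Proof. by rewrite subr_gt0 invf_lt1// ltr1n. Qed.

Let s_lt1 n : s n < 1.
Proof. by rewrite gtrBl invr_gt0. Qed.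

Let cvg_s : s n @[n --> \oo] --> (1 : R).
Proof.
rewrite -[X in _ --> X]subr0; apply: cvgB; first exact: cvg_cst.
by have := @cvg_harmonic R; rewrite -(cvg_shiftn 1); under eq_fun do rewrite addn1.
Qed.

Let sa1 n : normc ((s n)%:C * a) < 1.
Proof.
rewrite normcM normc_real gtr0_norm//.
by rewrite (le_lt_trans _ (s_lt1 n))// ler_piMr// ltW.
Qed.

Let ccvg_s (w : R[i]) : ((s n)%:C * w : R[i]^o) @[n --> \oo] --> (w : R[i]^o).
Proof.
rewrite -[X in _ --> X]mul1r; apply: ccvgM; last exact: ccvg_cst.
by apply/cvg_ReIm; split => /=; [exact: cvg_s|exact: cvg_cst].
Qed.

Let half n t : normc (1 - a * zeta t) <= 2 * normc (1 - (s n)%:C * a * zeta t).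
Proof.
have h := normc_1a_ge ((s n)%:C * a) t; set q := normc (1 - (s n)%:C * a * zeta t) in h *.
have := ler_normc_distD 1 ((s n)%:C * a * zeta t) (a * zeta t); rewrite -/q.
have -> : normc ((s n)%:C * a * zeta t - a * zeta t) = (1 - s n) * normc a.
  have -> : (s n)%:C * a * zeta t - a * zeta t = (s n - 1)%:C * a * zeta t.
    have -> : (s n - 1)%:C = (s n)%:C - 1 by apply: complex_eq; rewrite /= ?subr0.
    by ring.
  by rewrite normcM normc_zeta mulr1 normcM normc_real distrC gtr0_norm ?subr_gt0.
have := ler_piMr (ltW (s_gt0 n)) a1.
move: h; rewrite normcM normc_real gtr0_norm//.
have := mulr_ge0 (ltW (s_gt0 n)) (normc_ge0 a).
have : (1 - s n) * normc a <= 1 - s n by rewrite ler_piMr// subr_ge0 ltW.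
lra.
Qed.

Let ln2_ge0 : 0 <= ln 2 :> R.
Proof. by rewrite ln_ge0// ler1n. Qed.

Let log_le n t : log_mod ((s n)%:C * a) t <= ln 2.
Proof.
have h2 := normc_1a_le ((s n)%:C * a) t; have h1 := normc_1a_ge ((s n)%:C * a) t.
have n0 : 0 < normc (1 - (s n)%:C * a * zeta t) by apply: lt_le_trans h1; rewrite subr_gt0.
by rewrite ler_ln ?posrE// (le_trans h2)// lerD2l ltW.
Qed.

Let log_cvg : {ae mu, forall t, circ t ->
  log_mod ((s n)%:C * a) t @[n --> \oo] --> log_mod a t}.
Proof.
move: (zeta_level_null a); apply: ae_imp => t h Dt; have {}h := h Dt.
have n0 : 0 < normc (1 - a * zeta t) by rewrite normc_gt0.
apply: (continuous_cvg _ (continuous_ln n0)); apply: ccvg_normc.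
apply: ccvgB; first exact: ccvg_cst.
apply: (@eq_ccvg _ _ _ (fun n => (s n)%:C * (a * zeta t))); last exact: ccvg_s.
by move=> n; rewrite mulrA.
Qed.

(** The radii [s n] increase to [1]; the functions [ln 2 - log_mod (s n * a)] are
    nonnegative and have constant integral by Jensen's formula, so Fatou's lemma
    applies. *)
Lemma integrable_log_mod : mu.-integrable circ (EFin \o log_mod a).
Proof.
have ic := integrable_circ_cst (ln 2).
have [iu _] : mu.-integrable circ (EFin \o (fun t => ln 2 - log_mod a t)) /\
    \int[mu]_(t in circ) (ln 2 - log_mod a t) <= 2 * pi * ln 2.
  apply: (@Rintegral_fatou _ _ (fun n t => ln 2 - log_mod ((s n)%:C * a) t)) => //.
  - move=> n; apply: integrable_EFinB => //; exact: integrable_log_mod_lt1.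
  - by move=> n t _; rewrite subr_ge0.
  - by apply: measurable_funB => //; exact: measurable_log_mod.
  - move: log_cvg; apply: ae_imp => t h Dt; apply: cvgB; first exact: cvg_cst.
    exact: h.
  - move=> n; rewrite RintegralB//; last exact: integrable_log_mod_lt1.
    by rewrite Rintegral_log_mod_lt1// subr0 Rintegral_circ_cst.
have := integrable_EFinB measurable_circ ic iu; apply: eq_integrable => // t _.
by rewrite /= subKr.
Qed.

(** The case [normc a < 1] passes to the limit along [s n * a]: by [half],
    [log_mod (s n * a)] exceeds [log_mod a - ln 2], which gives an integrable
    domination. *)
Lemma schwarz_log z : normc z < 1 ->
  cexp ((2 * pi)^-1%:C * cintegral circ (fun t => schwarz z t * (log_mod a t)%:C)) =
  1 - a * z.
Proof.
move=> z1.
pose h t := 2 / (1 - normc z) * (2 * ln 2 + `|log_mod a t|).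
have ih : mu.-integrable circ (EFin \o h).
  apply: integrable_EFinZl => //; apply: integrable_EFinD => //.
    exact: integrable_circ_cst.
  exact: integrable_norm integrable_log_mod.
(* The maximum only changes the integrand at the zeros of [1 - a zeta], where
   the approximations are unbounded. *)
pose g n t := Num.max (log_mod a t - ln 2) (log_mod ((s n)%:C * a) t).
have gE n t : 1 - a * zeta t != 0 -> g n t = log_mod ((s n)%:C * a) t.
  move=> nz; apply: max_r; have n0 : 0 < normc (1 - a * zeta t) by rewrite normc_gt0.
  have q0 : 0 < normc (1 - (s n)%:C * a * zeta t).
    by apply: lt_le_trans (normc_1a_ge _ _); rewrite subr_gt0.
  by rewrite lerBlDl -lnM ?posrE// ler_ln ?posrE ?mulr_gt0//; exact: half.
have mg n : measurable_fun circ (g n).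
  apply: measurable_maxr; last exact: measurable_log_mod.
  by apply: measurable_funB => //; exact: measurable_log_mod.
have ms n : cmeas circ (fun t => schwarz z t * (g n t)%:C).
  by apply: cmeasM; [exact: cmeas_schwarz|exact: cmeas_real].
have ml b : cmeas circ (fun t => schwarz z t * (log_mod b t)%:C).
  by apply: cmeasM; [exact: cmeas_schwarz|apply: cmeas_real; exact: measurable_log_mod].
have c1 : (cintegral circ (fun t => schwarz z t * (log_mod ((s n)%:C * a) t)%:C) : R[i]^o)
    @[n --> \oo] --> (cintegral circ (fun t => schwarz z t * (log_mod a t)%:C) : R[i]^o).
  apply: (@eq_ccvg _ _ _ (fun n => cintegral circ (fun t => schwarz z t * (g n t)%:C))).
    move=> n; apply: cintegral_ae_eq => //.
    by move: (zeta_level_null a); apply: ae_imp => t nz Dt; rewrite gE// nz.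
  apply: (cintegral_dominated _ ms (ml a) _ ih) => //.
    move: (zeta_level_null a) log_cvg; apply: ae_imp2 => t nz lc Dt.
    apply: ccvgMl; apply/cvg_ReIm; split => /=; last exact: cvg_cst.
    have := lc Dt; apply: cvg_trans; apply: near_eq_cvg; apply: nearW => n.
    by rewrite gE// nz.
  move=> n t _; rewrite normcM ler_pM ?normc_ge0 ?normc_schwarz_le// normc_real.
  have l1 := log_le n t; have l3 := ler_norm (log_mod a t).
  have l4 := ler_norm (- log_mod a t); rewrite normrN in l4.
  have l5 : log_mod a t - ln 2 <= g n t by rewrite le_max lexx.
  have l6 : g n t <= `|log_mod a t| + ln 2.
    by rewrite ge_max; apply/andP; split; have := ln2_ge0; have := normr_ge0 (log_mod a t); lra.
  by rewrite ler_norml; apply/andP; split; have := ln2_ge0; lra.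
apply: (ccvg_unique (F := \oo) (f := fun n => cexp ((2 * pi)^-1%:C *
    cintegral circ (fun t => schwarz z t * (log_mod ((s n)%:C * a) t)%:C)))).
  by apply: ccvg_cexp; exact: ccvgMl.
apply: (@eq_ccvg _ _ _ (fun n => 1 - (s n)%:C * (a * z))); last first.
  by apply: ccvgB; [exact: ccvg_cst|exact: ccvg_s].
by move=> n; rewrite mulrA schwarz_log_lt1.
Qed.

End LogMod.

End Circle.

(** * Minimum phase functions built from polynomials *)

Section Holomorphic.
Variable R : realType.
Implicit Types (F G : R[i] -> R[i]) (w z : R[i]).

Lemma derivable_near_eq F G w (r : R) : 0 < r ->
  (forall k, normc k < r -> F (k + w) = G (k + w)) ->
  derivable (G : R[i]^o -> R[i]^o) w 1 -> derivable (F : R[i]^o -> R[i]^o) w 1.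
Proof.
move=> r0 FG /cvg_ex[l hl]; apply/cvg_ex; exists l; apply: cvg_trans hl.
have e1' : (0 : R[i]) < r%:C by rewrite ltcR.
apply: near_eq_cvg; near=> k.
have kr : normc (k *: (1 : R[i])) < r.
  rewrite -ltcR -norm_normc /GRing.scale/= mulr1; near: k.
  by have := @dnbhs0_lt _ R[i]^o _ e1'.
have Fw : F w = G w by have := FG 0; rewrite normc0 add0r => /(_ r0).
by rewrite /= (FG _ kr) Fw.
Unshelve. all: by end_near. Qed.

Lemma Cplus_ball w : Cplus w -> exists2 r : R, 0 < r & forall k, normc k < r -> Cplus (k + w).
Proof.
move=> w0; exists (complex.Re w) => // k kr; rewrite /Cplus/= ReD.
have := normRe_le k; rewrite ler_norml => /andP[h _]; lra.
Qed.

Lemma Cdisk_ball z : Cdisk z -> exists2 r : R, 0 < r & forall k, normc k < r -> Cdisk (k + z).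
Proof.
move=> z0; exists (1 - normc z); first by rewrite subr_gt0.
by move=> k kr; rewrite /Cdisk /mkset (le_lt_trans (ler_normcD _ _))// -ltrBrDr.
Qed.

Lemma holomorphic_Cplus_eq F G : (forall w, Cplus w -> F w = G w) ->
  holomorphic_on Cplus G -> holomorphic_on Cplus F.
Proof.
move=> FG hG w w0; have [r r0 rw] := Cplus_ball w0.
by apply: (derivable_near_eq r0 _ (hG w w0)) => k /rw; exact: FG.
Qed.

Lemma holomorphic_Cdisk_eq F G : (forall w, Cdisk w -> F w = G w) ->
  holomorphic_on Cdisk G -> holomorphic_on Cdisk F.
Proof.
move=> FG hG w w0; have [r r0 rw] := Cdisk_ball w0.
by apply: (derivable_near_eq r0 _ (hG w w0)) => k /rw; exact: FG.
Qed.

Lemma derivable_power (c a : R[i]) n w :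
  derivable ((fun z => c * (1 - a * z) ^+ n) : R[i]^o -> R[i]^o) w 1.
Proof.
have d1 : derivable ((fun z => 1 - a * z) : R[i]^o -> R[i]^o) w 1.
  apply: (@derivableB _ _ _ (cst (1 : R[i]^o)) (fun z : R[i]^o => a * z : R[i]^o)).
    exact: derivable_cst.
  by apply: (@derivableM _ _ (cst a) id); [exact: derivable_cst|exact: derivable_id].
apply: (@derivableM _ _ (cst c) (fun z : R[i]^o => (1 - a * z) ^+ n)).
  exact: derivable_cst.
elim: n => [|n IH]; first exact: (@derivable_cst _ R[i]^o R[i]^o 1).
have -> : (fun z : R[i]^o => (1 - a * z) ^+ n.+1 : R[i]^o) =
    (fun z : R[i]^o => (1 - a * z) * (1 - a * z) ^+ n).
  by apply/funext => z; rewrite exprS.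
exact: (derivableM d1 IH).
Qed.

End Holomorphic.

Section Cayley.
Variable R : realType.
Implicit Types (z w : R[i]).

Definition cayley z : R[i] := (1 - z) / (1 + z).

Lemma Cplus1_neq0 w : Cplus w -> 1 + w != 0.
Proof.
by move=> w0; apply/eqP => /(congr1 (@complex.Re R)); rewrite ReD /=; move: w0; rewrite /Cplus/=; lra.
Qed.

Lemma Cdisk1_neq0 z : Cdisk z -> 1 + z != 0.
Proof.
move=> z1; rewrite -normc_eq0 gt_eqF//.
have := lerB_normc 1 (- z); rewrite normcNr normc1 opprK.
by apply: lt_le_trans; rewrite subr_gt0.
Qed.

Lemma cayley_disk w : Cplus w -> Cdisk (cayley w).
Proof.
move=> w0; rewrite /Cdisk /mkset /cayley normcM normcV ltr_pdivrMr ?normc_gt0 ?Cplus1_neq0// mul1r.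
rewrite -(@ltr_pXn2r _ 2) ?nnegrE ?normc_ge0// !normc_sqr !ReD !ImD ReN ImN /=.
by move: w0; rewrite /Cplus/=; nra.
Qed.

Lemma cayley_Cplus z : Cdisk z -> Cplus (cayley z).
Proof.
move=> z1; have n0 : 0 < normc (1 + z) ^+ 2 by rewrite exprn_gt0// normc_gt0 Cdisk1_neq0.
have : normc z ^+ 2 < 1 by rewrite exprn_ilt1 ?normc_ge0.
rewrite /Cplus/= /cayley ReM Re_inv Im_inv normc_sqr.
move: n0; set N := normc (1 + z) ^+ 2 => n0 h.
have -> : complex.Re (1 - z) * (complex.Re (1 + z) / N) -
    complex.Im (1 - z) * - (complex.Im (1 + z) / N) =
    (1 - (complex.Re z ^+ 2 + complex.Im z ^+ 2)) / N.
  by rewrite !ReD !ImD ReN ImN /=; ring.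
by rewrite divr_gt0// subr_gt0.
Qed.

Lemma cayley_inv z : 1 + z != 0 -> (1 + cayley z)^-1 = (1 + z) / 2.
Proof.
move=> z0; rewrite /cayley; have -> : 1 + (1 - z) / (1 + z) = 2 / (1 + z) by field.
by rewrite invf_div.
Qed.

Lemma cayleyK z : 1 + z != 0 -> cayley (cayley z) = z.
Proof.
move=> z0; rewrite {1}/cayley cayley_inv// /cayley; field.
by [].
Qed.

End Cayley.

Lemma ccvgX (R : realType) (T : Type) (F : set_system T) {FF : Filter F}
    (f : T -> R[i]) a n : (f x : R[i]^o) @[x --> F] --> (a : R[i]^o) ->
  (f x ^+ n : R[i]^o) @[x --> F] --> (a ^+ n : R[i]^o).
Proof.
move=> fa; elim: n => [|n IH]; first exact: ccvg_cst.
rewrite exprS; apply: (eq_ccvg (f := fun x => f x * f x ^+ n)) => [x|]; first by rewrite exprS.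
exact: ccvgM.
Qed.

Section OuterPower.
Variable R : realType.
Local Notation mu := (@lebesgue_measure R).
Local Notation circ := (`[0, 2 * pi]%classic : set R).
Variables (F : R[i] -> R[i]) (c : R) (a : R[i]) (n : nat).
Hypotheses (c0 : 0 < c) (a1 : normc a <= 1).
Hypothesis FE : forall z, Cdisk z -> F z = c%:C * (1 - a * z) ^+ n.

Let boundary_power t : boundary_disk F t = c%:C * (1 - a * zeta t) ^+ n.
Proof.
rewrite /boundary_disk; set l := RHS.
have h : (F (r%:C * cexp (0 +i* t)) : R[i]^o) @[r --> (1 : R)^'-] --> (l : R[i]^o).
  have h1 : (c%:C * (1 - a * (r%:C * zeta t)) ^+ n : R[i]^o) @[r --> (1 : R)^'-] --> (l : R[i]^o).
    apply: ccvgMl.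
    have h2 : (1 - a * (r%:C * zeta t) : R[i]^o) @[r --> (1 : R)^'-] --> (1 - a * zeta t : R[i]^o).
      apply: ccvgB; first exact: ccvg_cst.
      apply: ccvgMl; rewrite -[X in _ --> (X : R[i]^o)]mul1r.
      apply: ccvgM; last exact: ccvg_cst.
      apply/cvg_ReIm; split => /=; last exact: cvg_cst.
      exact: cvg_at_left_filter.
    exact: ccvgX.
  apply: cvg_trans h1; apply: near_eq_cvg; near=> r.
  rewrite FE//; suff : `|r| < 1.
    by rewrite /Cdisk /mkset normcM cexp_im_normc mulr1 normc_real.
  rewrite ltr_norml; apply/andP; split; last by near: r; exact: nbhs_left_lt.
  by near: r; apply: nbhs_left_gt; lra.
apply: (ccvg_unique (F := (1 : R)^'-) (f := fun r => F (r%:C * cexp (0 +i* t)))); last exact: h.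
by move/cvgP: h.
Unshelve. all: by end_near. Qed.

Let P : {poly R[i]} := c%:C *: (1 - a *: 'X) ^+ n.

Let FP z : Cdisk z -> F z = P.[z].
Proof. by move=> /FE ->; rewrite /P hornerZ horner_exp !hornerE. Qed.

(** The logarithm of the boundary modulus is [ln c + n * log_mod a], and the
    Schwarz integral of each term is known. *)
Lemma outer_disk_power : outer_disk F.
Proof.
have hF : holomorphic_on Cdisk F.
  by apply: (holomorphic_Cdisk_eq FE) => w _; exact: derivable_power.
split.
- split => //; exists (fun k => P`_k); split.
    move=> z z1; apply: cvg_near_cst; near=> N.
    rewrite /series/= FP// (@horner_coef_wide _ N) ?big_mkord//.
    by near: N; exact: nbhs_infty_ge.
  apply/cvg_ex; exists (\sum_(0 <= k < size P) normc P`_k ^+ 2).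
  apply: cvg_near_cst; near=> N; rewrite /series/=; have sN : (size P <= N)%N by near: N; exact: nbhs_infty_ge.
  rewrite (big_cat_nat (n := size P))//= [X in _ + X]big_nat_cond [X in _ + X]big1 ?addr0// => k /andP[/andP[sk _] _].
  by rewrite nth_default// normc0 expr0n.
- exists 0; first by rewrite /Cdisk /mkset normc0.
  rewrite FE; last by rewrite /Cdisk /mkset normc0.
  by rewrite mulr0 subr0 expr1n mulr1 -normc_eq0 normc_real normr_eq0 gt_eqF.
exists 1 => [|z z1]; first exact: normc1.
rewrite mul1r FE//.
have mz : cmeas circ (schwarz z) by apply: cmeas_schwarz; exact: measurable_circ.
have il : cintegrable circ (fun t => schwarz z t * (log_mod a t)%:C).
  apply: (@cintegrable_le _ _ _ (fun t => 2 / (1 - normc z) * `|log_mod a t|)) => //.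
  - by apply: cmeasM => //; apply: cmeas_real; exact: measurable_log_mod.
  - apply: integrable_EFinZl => //.
    exact: integrable_norm (integrable_log_mod a1).
  - by move=> t _; rewrite normcM normc_real ler_wpM2r// normc_schwarz_le.
have is_ : cintegrable circ (schwarz z).
  apply: (@cintegrable_circ _ _ (2 / (1 - normc z))) => // t.
  exact: normc_schwarz_le.
rewrite (cintegral_ae_eq (g := fun t =>
   (ln c)%:C * schwarz z t + n%:R * (schwarz z t * (log_mod a t)%:C))).
- have j1 : cintegrable circ (fun t => (ln c)%:C * schwarz z t) by apply: cintegrableZl.
  have j2 : cintegrable circ (fun t => n%:R * (schwarz z t * (log_mod a t)%:C)).
    by apply: cintegrableZl.
  rewrite cintegralD// !cintegralZl//.
  rewrite schwarz1// mulrDr cexpD; congr (_ * _).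
    rewrite mulrCA -rmorphM mulVf ?mulr1; last by rewrite lt0r_neq0// mulr_gt0 ?pi_gt0.
    by rewrite cexp_real lnK// posrE.
  by rewrite mulrCA cexpMn schwarz_log.
- exact: measurable_itv.
- apply: cmeasM => //; apply: cmeas_real; apply: measurableT_comp; first exact: measurable_ln.
  apply: (@eq_measurable_fun _ _ _ _ _ (fun t => normc (c%:C * (1 - a * zeta t) ^+ n))).
    by move=> t _; rewrite boundary_power.
  apply: measurable_normc; apply: cmeasM; first exact: cmeas_cst.
  apply: cmeasX; apply: cmeasB; first exact: cmeas_cst.
  by apply: cmeasM; [exact: cmeas_cst|apply: cmeas_zeta; exact: measurable_circ].
- apply: cmeasD; apply: cmeasM; try exact: cmeas_cst; first exact: mz.
  by apply: cmeasM => //; apply: cmeas_real; exact: measurable_log_mod.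
move: (zeta_level_null a); apply: ae_imp => t nz Dt; rewrite -/(zeta t) -/(schwarz z t).
have n0 : 0 < normc (1 - a * zeta t) by rewrite normc_gt0 nz.
rewrite boundary_power normcM normc_real gtr0_norm// normcX lnM ?posrE ?exprn_gt0//.
have -> : ln (normc (1 - a * zeta t) ^+ n) = n%:R * log_mod a t by rewrite lnXn// mulr_natl.
rewrite rmorphD rmorphM rmorph_nat mulrDr; congr (_ + _); first exact: mulrC.
exact: mulrCA.
Unshelve. all: by end_near. Qed.

End OuterPower.

(** * Operators preserving minimum phase, in the Laplace domain *)

Lemma real_complexM (R : realType) (x y : R) : (x * y)%:C = x%:C * y%:C :> R[i].
Proof. exact: rmorphM. Qed.

Lemma real_complex_nat (R : realType) n : (n%:R : R)%:C = n%:R :> R[i].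
Proof. exact: rmorph_nat. Qed.

Section PolyExp.
Variable R : realType.
Implicit Types (P Q : {poly R[i]}) (w z : R[i]).

(** The coefficients are normalized so that the transform is a polynomial in
    [(1 + w)^-1] with the coefficients of [Q], shifted by one. *)
Definition polyexp Q (t : R) : R[i] :=
  \sum_(k < size Q) (Q`_k / k`!%:R) * powexp k 1 t.

Lemma polyexp_wide N Q t : (size Q <= N)%N ->
  polyexp Q t = \sum_(k < N) (Q`_k / k`!%:R) * powexp k 1 t.
Proof.
move=> QN; rewrite /polyexp (big_ord_widen N (fun k => Q`_k / k`!%:R * powexp k 1 t) QN).
rewrite big_mkcond; apply: eq_bigr => k _; case: ltnP => // h.
by rewrite nth_default// !mul0r.
Qed.

Lemma polyexp_lin (a : R[i]) P Q t :
  polyexp (a *: P + Q) t = a * polyexp P t + polyexp Q t.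
Proof.
pose N := maxn (size P) (size Q).
have sN : (size (a *: P + Q)%R <= N)%N.
  by rewrite (leq_trans (size_polyD _ _))// geq_max leq_maxr andbT
    (leq_trans (size_scale_leq _ _))// leq_maxl.
rewrite (polyexp_wide _ sN) (polyexp_wide _ (leq_maxl _ (size Q))).
rewrite (polyexp_wide _ (leq_maxr (size P) _)) mulr_sumr -big_split.
by apply: eq_bigr => k _; rewrite coefD coefZ !mulrDl !mulrA.
Qed.

Lemma one_gt0 : 0 < complex.Re (1 : R[i]).
Proof. exact: ltr01. Qed.

Lemma isL2_polyexp Q : isL2 Rplus (polyexp Q).
Proof.
have mR : measurable (Rplus : set R) by exact: measurable_Rplus.
by apply: isL2_sum => // k; apply: isL2Zl => //; exact: isL2_powexp one_gt0.
Qed.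

Lemma laplace_polyexp Q w : Cplus w ->
  laplace (polyexp Q) w = (Num.sqrt (2 * pi))^-1%:C * ((1 + w)^-1 * Q.[(1 + w)^-1]).
Proof.
move=> w0; set c := (Num.sqrt _)^-1%:C.
have mR : measurable (Rplus : set R) by exact: measurable_Rplus.
have lp k : isL2 Rplus (powexp k (1 : R[i])) by exact: isL2_powexp one_gt0.
have step (a : nat -> R[i]) N : laplace (fun t => \sum_(k < N) a k * powexp k 1 t) w =
    \sum_(k < N) a k * laplace (powexp k 1) w.
  elim: N => [|N IH].
    rewrite big_ord0 laplaceE (eq_cintegral (g := fun=> 0)) => [|t _]; last first.
      by rewrite big_ord0 mul0r.
    by rewrite cintegral_cst0 mulr0.
  rewrite big_ord_recr -IH.
  have l1 : isL2 Rplus (fun t => \sum_(k < N) a k * powexp k 1 t).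
    by apply: isL2_sum => // k; exact: isL2Zl.
  have := laplace_linear 1 (a N) l1 (lp N) w0; rewrite mul1r /= => e.
  apply: etrans e; by congr (laplace _ w); apply/funext => t; rewrite big_ord_recr mul1r.
rewrite [LHS](step (fun k => Q`_k / k`!%:R)) horner_coef mulr_sumr mulr_sumr.
apply: eq_bigr => k _; rewrite laplace_powexp ?one_gt0// -/c.
have k0 : k`!%:R != 0 :> R[i] by rewrite pnatr_eq0 -lt0n fact_gt0.
rewrite -exprVn exprS; clearbody c; move: ((1 + w)^-1) => r; move: (r ^+ k) k0 => q.
move: (k`!%:R : R[i]) => K k0.
by field.
Qed.

Lemma sqrt2pi_neq0 : (Num.sqrt (2 * pi) : R) != 0.
Proof. by rewrite lt0r_neq0// sqrtr_gt0 mulr_gt0// pi_gt0. Qed.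

Let phi_cst : R := Num.sqrt pi / Num.sqrt (2 * pi).

Lemma phi_laplace_polyexp P z : Cdisk z ->
  Phi (laplace (polyexp (P \Po (2 *: 'X - 1)))) z = phi_cst%:C * P.[z].
Proof.
move=> z1; have z0 := Cdisk1_neq0 z1.
rewrite /Phi -/(cayley z) laplace_polyexp; last exact: cayley_Cplus.
rewrite cayley_inv// horner_comp.
have -> : (2 *: 'X - 1).[(1 + z) / 2] = z.
  by rewrite hornerD hornerN hornerZ hornerX -polyC1 hornerC; field.
rewrite /phi_cst; have := sqrt2pi_neq0; move: (Num.sqrt (2 * pi)) (Num.sqrt pi) => u v u0.
rewrite !real_complexM real_complex_nat.
move: (u^-1%:C) (v%:C) (P.[z]) => a b p; field.
by [].
Qed.

Lemma minimum_phase_power (a : R[i]) n : normc a <= 1 ->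
  minimum_phase (polyexp (((1 - a *: 'X) ^+ n) \Po (2 *: 'X - 1))).
Proof.
move=> a1; split; first exact: isL2_polyexp.
apply: (@outer_disk_power _ _ phi_cst a n) => // [|z z1].
  by rewrite divr_gt0 ?sqrtr_gt0 ?mulr_gt0 ?pi_gt0.
by rewrite phi_laplace_polyexp// horner_exp !hornerE.
Qed.

End PolyExp.

Section Operator.
Variable R : realType.
Variable A : (R -> R[i]) -> (R -> R[i]).
Hypotheses (cA : L2_continuous_linear A) (pA : preserves_minimum_phase A).
Implicit Types (f g : R -> R[i]) (w z : R[i]).

Let mR : measurable (Rplus : set R).
Proof. exact: measurable_Rplus. Qed.

Lemma laplace_op_linear (a b : R[i]) f g w : isL2 Rplus f -> isL2 Rplus g -> Cplus w ->
  laplace (A (fun t => a * f t + b * g t)) w =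
  a * laplace (A f) w + b * laplace (A g) w.
Proof.
move=> lf lg w0; have st := L2op_stable cA.
rewrite -laplace_linear//; [|exact: st|exact: st].
apply: laplace_ae_eq; last exact: (L2op_linear cA).
  by apply: st; apply: isL2D => //; exact: isL2Zl.
by apply: isL2D => //; apply: isL2Zl => //; exact: st.
Qed.

Lemma laplace_op_eq f g w : isL2 Rplus f -> isL2 Rplus g ->
  (forall t, Rplus t -> f t = g t) -> laplace (A f) w = laplace (A g) w.
Proof.
move=> lf lg fg; have st := L2op_stable cA.
apply: laplace_ae_eq; [exact: st|exact: st|].
by apply: (L2op_proper cA) => //; apply: aeW => t; exact: fg.
Qed.

Lemma outer_disk_neq0 (G : R[i] -> R[i]) z : outer_disk G -> Cdisk z -> G z != 0.
Proof.
move=> [_ _ [l l1 h]] z1; rewrite h// mulf_neq0 ?cexp_neq0//.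
by rewrite -normc_eq0 l1 oner_neq0.
Qed.

Lemma minimum_phase_laplace_neq0 f w : minimum_phase f -> Cplus w -> laplace f w != 0.
Proof.
move=> [_ o] w0; have := outer_disk_neq0 o (cayley_disk w0).
apply: contra_neq; rewrite /Phi => h.
by rewrite -/(cayley (cayley w)) cayleyK ?Cplus1_neq0// h mulr0.
Qed.

Lemma nrm_op_cvg0 (u : nat -> R -> R[i]) f : isL2 Rplus f -> (forall n, isL2 Rplus (u n)) ->
  nrm Rplus (fun t => u n t - f t) @[n --> \oo] --> (0 : R) ->
  nrm Rplus (fun t => A (u n) t - A f t) @[n --> \oo] --> (0 : R).
Proof.
move=> lf lu /cvgrPdist_lt uf; apply/cvgrPdist_lt => e e0.
have [d d0 H] := L2op_continuous cA lf e0.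
apply: filterS (uf d d0) => n; rewrite !sub0r !normrN !ger0_norm ?nrm_ge0// => h.
have := H (u n) (lu n); rewrite L2norm_nrm; last exact: isL2B.
rewrite L2norm_nrm ?lte_fin; first exact.
by apply: isL2B => //; exact: (L2op_stable cA).
Qed.

Lemma laplace_cvg (u : nat -> R -> R[i]) f w : isL2 Rplus f ->
  (forall n, isL2 Rplus (u n)) -> Cplus w ->
  nrm Rplus (fun t => u n t - f t) @[n --> \oo] --> (0 : R) ->
  (laplace (u n) w : R[i]^o) @[n --> \oo] --> (laplace f w : R[i]^o).
Proof.
move=> lf lu w0 uf; apply/cvg_normc0P.
apply: (@squeeze_cvgr _ _ _ _ (cst 0) (fun n => laplace_bound w * nrm Rplus (fun t => u n t - f t))).
- apply: nearW => n; apply/andP; split; first exact: normc_ge0.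
  by rewrite -laplaceB// normc_laplace_le//; exact: isL2B.
- exact: cvg_cst.
by rewrite -[X in _ --> X](mulr0 (laplace_bound w)); apply: cvgMr.
Qed.

Lemma dominated_closed_op w v c : Cplus w -> Cplus v ->
  dominated_closed (fun f => laplace (A f) w = c * laplace f v).
Proof.
move=> w0 v0; split => [a b f g lf lg hf hg|u f g lu lf lg hu ug uf].
  by rewrite laplace_op_linear// hf hg laplace_linear//; ring.
have c0 := nrm_dominated mR (fun n => isL2_cmeas (lu n)) lf lg uf ug.
have st := L2op_stable cA.
apply: (ccvg_unique (F := \oo) (f := fun n => laplace (A (u n)) w)).
  by apply: laplace_cvg => //; [exact: st|move=> n; exact: st|exact: nrm_op_cvg0].
apply: (eq_ccvg (f := fun n => c * laplace (u n) v)) => [n|]; first by rewrite hu.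
by apply: ccvgMl; exact: laplace_cvg.
Qed.

(** For fixed [w] the functional [f |-> (L A f)(w)] does not vanish on the
    minimum phase functions, in particular not on those transformed into
    [(1 - a z) ^ n]: on polynomials it is a multiple of an evaluation, and by
    density it is one on the whole space. *)
Lemma laplace_op_evaluation w : Cplus w -> exists v c, [/\ Cplus v, c != 0 &
  forall f, isL2 Rplus f -> laplace (A f) w = c * laplace f v].
Proof.
move=> w0; pose T Q := laplace (A (polyexp Q)) w.
pose q : {poly R[i]} := 2 *: 'X - 1.
have T_lin (a : R[i]) P Q : T (a *: P + Q) = a * T P + T Q.
  rewrite -[T Q]mul1r -laplace_op_linear//; try exact: isL2_polyexp.
  by congr (laplace (A _) w); apply/funext => t; rewrite polyexp_lin mul1r.
pose l P := T (P \Po q).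
have l_lin (a : R[i]) P Q : l (a *: P + Q) = a * l P + l Q.
  by rewrite /l comp_polyD comp_polyZ T_lin.
have l_neq0 (a : R[i]) n : normc a <= 1 -> l ((1 - a *: 'X) ^+ n) != 0.
  move=> a1; apply: minimum_phase_laplace_neq0 => //; apply: pA.
  exact: minimum_phase_power.
have lT P : l P = T (P \Po q) by [].
clearbody l; have [] := zero_free_evaluation l_lin l_neq0.
set o := l 'X / l 1 => o1 lE.
have l1 : l 1 != 0 by have := l_neq0 0 0%N; rewrite expr0 normc0 => /(_ ler01).
have v0 := cayley_Cplus o1; have d0 := Cdisk1_neq0 o1; set v := cayley o in v0.
have s0 : (Num.sqrt (2 * pi))%:C != 0 :> R[i].
  by rewrite -normc_eq0 normc_real normr_eq0 sqrt2pi_neq0.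
have v1 := Cplus1_neq0 v0.
exists v, (l 1 * (Num.sqrt (2 * pi))%:C * (1 + v)); split => //.
  by apply: mulf_neq0 => //; exact: mulf_neq0.
have TE Q : T Q = l 1 * (Num.sqrt (2 * pi))%:C * (1 + v) * laplace (polyexp Q) v.
  pose p : {poly R[i]} := 2^-1 *: ('X + 1).
  have pq : p \Po q = 'X.
    rewrite comp_polyZ comp_polyD comp_polyX -[1 in X in _ + X]/(1%:P) comp_polyC.
    by rewrite /q subrK scalerA mulVf ?scale1r// pnatr_eq0.
  have -> : T Q = l (Q \Po p) by rewrite lT -comp_polyA pq comp_polyXr.
  rewrite lE laplace_polyexp// horner_comp /p hornerZ hornerD hornerX -polyC1 hornerC.
  have -> : 2^-1 * (o + 1) = (1 + v)^-1 by rewrite cayley_inv// mulrC addrC.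
  have -> : (Num.sqrt (2 * pi))^-1%:C = ((Num.sqrt (2 * pi))%:C)^-1 :> R[i] by rewrite fmorphV.
  move: ((Num.sqrt (2 * pi))%:C) s0 => s s0; move: (Q.[_]) => y.
  have -> : l 1 * s * (1 + v) * (s^-1 * ((1 + v)^-1 * y)) =
      l 1 * y * (s / s) * ((1 + v) / (1 + v)) by ring.
  by rewrite !mulfV// !mulr1.
have S k : laplace (A (powexp k (1 : R[i]))) w = l 1 * (Num.sqrt (2 * pi))%:C * (1 + v) * laplace (powexp k 1) v.
  have -> : powexp k (1 : R[i]) = polyexp (k`!%:R *: 'X^k); last exact: TE.
  apply/funext => t; rewrite (@polyexp_wide _ k.+1); last first.
    by rewrite (leq_trans (size_scale_leq _ _))// size_polyXn.
  rewrite big_ord_recr /= big1 ?add0r => [|i _].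
    by rewrite coefZ coefXn eqxx mulr1 mulfV ?mul1r// pnatr_eq0 -lt0n fact_gt0.
  by rewrite coefZ coefXn (ltn_eqF (ltn_ord i)) mulr0 !mul0r.
have dc := dominated_closed_op (l 1 * (Num.sqrt (2 * pi))%:C * (1 + v)) w0 v0.
move=> f lf; apply: (exponentials_total dc) => // a a0.
exact: (dc_powexp dc S).
Qed.

End Operator.

(** * Transfer between the circle and the imaginary axis *)

Section ChangeOfVariable.
Variable R : realType.
Local Notation mu := (@lebesgue_measure R).
Local Notation circ := (`[0, 2 * pi]%classic : set R).
Implicit Types (f g : R -> R) (y : R).

Let mT : measurable (setT : set R).
Proof. exact: measurableT. Qed.

Let mC : measurable circ.
Proof. exact: measurable_itv. Qed.

(** The angle of the point of the circle that corresponds to [i y] under the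
    Cayley map, and its density. *)
Definition angle y : R := (if 0 <= y then 2 * pi else 0) - 2 * atan y.
Definition angle_density y : R := 2 / (1 + y ^+ 2).

Lemma measurable_atan (D : set R) : measurable D -> measurable_fun D (@atan R).
Proof.
move=> mD; apply: (measurable_funS measurableT) => //.
by apply: continuous_measurable_fun => y; exact: continuous_atan.
Qed.

Lemma measurable_angle : measurable_fun setT angle.
Proof.
apply: measurable_funB; last first.
  by apply: measurable_funM => //; exact: measurable_atan.
by apply: measurable_fun_ifT => //; exact: measurable_fun_ler.
Qed.

Lemma zeta_angle y : zeta (angle y) = cayley (0 +i* y).
Proof.
have E : zeta (angle y) = zeta (- atan y) ^+ 2.
  rewrite /angle; set s := if _ then _ else _.
  have s1 : zeta s = 1 by rewrite /s; case: ifP => _; rewrite ?zeta2pi ?zeta0.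
  have -> : zeta (s - 2 * atan y) = zeta s * zeta (- atan y) ^+ 2.
    rewrite expr2 /zeta -!cexpD; congr cexp; apply: complex_eq; rewrite !(ReD, ImD) /=; ring.
  by rewrite s1 mul1r.
have s2 : Num.sqrt (1 + y ^+ 2) ^+ 2 = 1 + y ^+ 2 by rewrite sqr_sqrtr// ltW// onesqr_gt0.
have s0 : Num.sqrt (1 + y ^+ 2) != 0 by rewrite gt_eqF// sqrtr_gt0 onesqr_gt0.
have sa : sin (atan y) = y / Num.sqrt (1 + y ^+ 2).
  have := atanK y; rewrite /tan cos_atan invrK => {2}<-.
  by rewrite mulfK.
have z : zeta (- atan y) = ((Num.sqrt (1 + y ^+ 2))^-1)%:C * (1 - 0 +i* y).
  apply: complex_eq; rewrite /zeta /cexp /= expR0 cosN sinN cos_atan sa; ring.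
have n0 : 1 + 0 +i* y != 0 :> R[i].
  by apply/eqP => /(congr1 (@complex.Re R)) /=; lra.
rewrite E z exprMn /cayley; apply: (mulIf n0); rewrite divfK//.
have -> : (((Num.sqrt (1 + y ^+ 2))^-1)%:C ^+ 2 : R[i]) = ((1 + y ^+ 2)^-1)%:C.
  by rewrite -rmorphXn exprVn s2.
rewrite -mulrA; have -> : (1 - 0 +i* y) ^+ 2 * (1 + 0 +i* y) = (1 + y ^+ 2)%:C * (1 - 0 +i* y).
  by rewrite expr2; apply: complex_eq; rewrite /=; ring.
rewrite mulrA -real_complexM mulVf ?mul1r//.
by rewrite gt_eqF// onesqr_gt0.
Qed.

Lemma angle_density_gt0 y : 0 < angle_density y.
Proof. by rewrite divr_gt0// onesqr_gt0. Qed.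

Lemma integrable_density (M : R) : mu.-integrable setT (EFin \o (fun y => M * angle_density y)).
Proof.
have [_ i2] := poisson_integrable_cst (2 : R).
exact: (integrable_EFinZl mT i2 M).
Qed.

Lemma measurable_density : measurable_fun setT angle_density.
Proof.
have /integrableP[/measurable_EFinP + _] := integrable_density 1.
by apply: eq_measurable_fun => y _; rewrite mul1r.
Qed.

Lemma integrable_bounded_circ f (M : R) : measurable_fun setT f ->
  (forall t, `|f t| <= M) -> mu.-integrable circ (EFin \o f).
Proof.
move=> mf fM; apply: le_integrable (integrable_circ_cst M) => //.
  by apply/measurable_EFinP; apply: measurable_funS mf.
by move=> t _ /=; rewrite lee_fin (le_trans (fM t))// ler_norm.
Qed.

Lemma integrable_bounded_density f (M : R) : measurable_fun setT f ->
  (forall t, `|f t| <= M) ->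
  mu.-integrable setT (EFin \o (fun y => f (angle y) * angle_density y)).
Proof.
move=> mf fM; apply: le_integrable (integrable_density M) => //.
  apply/measurable_EFinP; apply: measurable_funM; last exact: measurable_density.
  by apply: measurableT_comp => //; exact: measurable_angle.
move=> y _ /=; rewrite lee_fin normrM (ger0_norm (ltW (angle_density_gt0 y))).
rewrite [leRHS]ger0_norm; first by rewrite ler_wpM2r// ltW// angle_density_gt0.
by rewrite mulr_ge0 ?(ltW (angle_density_gt0 y))// (le_trans _ (fM 0)).
Qed.

Lemma Rintegral_setI (D E : set R) (u : R -> R) : measurable D ->
  \int[mu]_(y in D) (\1_E y * u y) = \int[mu]_(y in D `&` E) u y.
Proof.
move=> mD; have := @cintegral_indic _ D E (fun y => (u y)%:C) mD.
rewrite cintegral_real => /(congr1 (@complex.Re R)) /= <-.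
by apply: eq_Rintegral => y _; rewrite /= mulr0 subr0 mulrC.
Qed.

Lemma Rintegral_atan_between (c e : R) : - (pi / 2) <= c -> c < e -> e <= pi / 2 ->
  \int[mu]_(y in [set y | c <= atan y < e]) angle_density y = 2 * (e - c).
Proof.
move=> c2 ce e2; set D := [set y | _].
pose r n : R := (e - c) / 3 * n.+1%:R^-1.
have r0 n : 0 < r n by rewrite mulr_gt0 ?invr_gt0 ?divr_gt0 ?subr_gt0.
have r1 n : r n <= (e - c) / 3.
  by rewrite ler_piMr ?divr_ge0 ?subr_ge0 ?(ltW ce)// invf_le1 ?ltr0n// ler1n.
have rc : r n @[n --> \oo] --> (0 : R).
  rewrite -[X in _ --> X](mulr0 ((e - c) / 3)); apply: cvgMr; exact: cvg_harmonic.
pose a n := Num.max c (- (pi / 2) + r n); pose b n := e - r n.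
have ab n : a n < b n.
  by rewrite /a /b gt_max; apply/andP; split; have := r0 n; have := r1 n; lra.
have ain n : - (pi / 2) < a n < pi / 2.
  apply/andP; split; last by apply: (lt_le_trans (ab n)); rewrite /b; have := r0 n; lra.
  by rewrite /a lt_max; apply/orP; right; have := r0 n; lra.
have bin n : - (pi / 2) < b n < pi / 2.
  have /andP[h1 _] := ain n; rewrite (lt_trans h1 (ab n)) /b /=; have := r0 n; lra.
have atan_tan (x : R) : - (pi / 2) < x < pi / 2 -> atan (tan x) = x.
  by move=> h; apply: tanK; rewrite in_itv.
have tanab n : tan (a n) < tan (b n).
  rewrite ltNge; apply/negP => h; have := ab n.
  rewrite -(atan_tan _ (ain n)) -(atan_tan _ (bin n)) ltNge => /negP; apply.
  by have := h; rewrite le_eqVlt => /predU1P[->//|/lt_atan/ltW].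
suff : cintegral D (fun y => (angle_density y)%:C) = (2 * (e - c))%:C.
  by rewrite cintegral_real => /(congr1 (@complex.Re R)).
have mD : measurable D.
  have -> : D = @atan R @^-1` `[c, e[%classic.
    by apply/seteqP; split => y; rewrite /D /= in_itv.
  by rewrite -[X in measurable X]setTI; apply: measurable_atan => //; exact: measurable_itv.
have dA y : cderiv (fun y => (2 * atan y)%:C) y (angle_density y)%:C.
  split => /=; last exact: is_derive_cst.
  by have := is_deriveZ 2 (is_derive1_atan y); rewrite /GRing.scale/=.
have dd y : cderiv (fun y => (angle_density y)%:C) y
    (2 * complex.Re (- ('i%C * ck (1 : R[i]) y ^+ 2)))%:C.
  split; last exact: is_derive_cst.
  have -> : (fun y => complex.Re (angle_density y)%:C) = (fun s => 2 * complex.Re (ck (1 : R[i]) s)).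
    apply/funext => s; rewrite /ck Re_inv normc_sqr ReD ImD /= addr0 add0r expr1n.
    by rewrite /angle_density mul1r.
  have [h _] := cderiv_ck y (@one_gt0 R).
  by have := is_deriveZ 2 h; rewrite /GRing.scale/=.
apply: (cintegral_FTC_exhaust (F := fun y => (2 * atan y)%:C) mD dA dd
  (a := fun n => tan (a n)) (b := fun n => tan (b n))) => //.
- apply: cintegrable_real => //.
  have i1 := @integrableS _ _ _ mu _ _ _ measurableT mD (@subsetT _ _) (integrable_density 1).
  by apply: eq_integrable i1 => // y _; rewrite /= mul1r.
- move=> n y; rewrite /= in_itv/= => /andP[ty yt].
  have le_atan (x z : R) : x <= z -> atan x <= atan z.
    by rewrite le_eqVlt => /predU1P[->//|/lt_atan/ltW].
  have := le_atan _ _ ty; have := le_atan _ _ yt.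
  rewrite !atan_tan// => h1 h2; rewrite /D /=; apply/andP; split.
    by apply: le_trans h2; rewrite /a le_max lexx.
  by apply: (le_lt_trans h1); rewrite /b; have := r0 n; lra.
- move=> y /andP[cy ye].
  have h1 : 0 < Num.min (e - atan y) (atan y + pi / 2).
    by rewrite lt_min subr_gt0 ye /=; have := atan_gtNpi2 y; lra.
  have /cvgrPdist_lt/(_ _ h1) := rc; apply: filterS => n.
  rewrite sub0r normrN (gtr0_norm (r0 n)) lt_min => /andP[h2 h3].
  have tan_le (x z : R) : - (pi / 2) < x < pi / 2 -> x <= atan z -> tan x <= z.
    move=> hx xz; rewrite leNgt; apply/negP => /lt_atan; rewrite atan_tan//.
    by rewrite ltNge xz.
  have le_tan (x z : R) : - (pi / 2) < x < pi / 2 -> atan z <= x -> z <= tan x.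
    move=> hx xz; rewrite leNgt; apply/negP => /lt_atan; rewrite atan_tan//.
    by rewrite ltNge xz.
  rewrite in_itv/= tan_le//=; first by rewrite le_tan// /b; lra.
  by rewrite /a ge_max cy /=; lra.
apply: (eq_ccvg (f := fun n => (2 * (b n - a n))%:C)) => [n|].
  by rewrite -rmorphB !atan_tan// mulrBr.
apply/cvg_ReIm; split => /=; last exact: cvg_cst.
apply: cvgMr; apply: cvgB.
  by rewrite -[X in _ --> X]subr0; apply: cvgB; [exact: cvg_cst|exact: rc].
apply: (@squeeze_cvgr _ _ _ _ (cst c) (fun n => c + r n)).
- apply: nearW => n; rewrite /= le_max lexx /= ge_max; apply/andP; split; have := r0 n; lra.
- exact: cvg_cst.
- by rewrite -[X in _ --> X]addr0; apply: cvgD; [exact: cvg_cst|exact: rc].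
Qed.

Definition transfers f :=
  \int[mu]_(t in circ) f t = \int[mu]_y (f (angle y) * angle_density y).

Lemma transfersD f g (M N : R) : measurable_fun setT f -> measurable_fun setT g ->
  (forall t, `|f t| <= M) -> (forall t, `|g t| <= N) ->
  transfers f -> transfers g -> transfers (fun t => f t + g t).
Proof.
move=> mf mg fM gN; rewrite /transfers => hf hg.
rewrite RintegralD//; [|exact: integrable_bounded_circ fM|exact: integrable_bounded_circ gN].
rewrite hf hg -RintegralD//.
- by apply: eq_Rintegral => y _; rewrite mulrDl.
- exact: integrable_bounded_density fM.
- exact: integrable_bounded_density gN.
Qed.

Lemma transfersZ f (k M : R) : measurable_fun setT f ->
  (forall t, `|f t| <= M) -> transfers f -> transfers (fun t => k * f t).
Proof.
move=> mf fM; rewrite /transfers => hf.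
rewrite RintegralZl//; last exact: integrable_bounded_circ fM.
rewrite hf -RintegralZl//; last exact: integrable_bounded_density fM.
by apply: eq_Rintegral => y _; rewrite mulrA.
Qed.

Lemma transfers_limit (u : nat -> R -> R) f (M : R) :
  (forall n, measurable_fun setT (u n)) -> measurable_fun setT f ->
  (forall n t, `|u n t| <= M) -> (forall t, u n t @[n --> \oo] --> f t) ->
  (forall n, transfers (u n)) -> transfers f.
Proof.
move=> mu_ mf uM uf hu.
have c1 : \int[mu]_(t in circ) u n t @[n --> \oo] --> \int[mu]_(t in circ) f t.
  apply: (proj2 (@Rintegral_dominated R circ u f (cst M) mC _ _ _ _ _)) => //.
  - by move=> n; apply: measurable_funS (mu_ n).
  - by apply: measurable_funS mf.
  - by apply: aeW => t _; exact: uf.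
  - exact: integrable_circ_cst.
have mcomp g : measurable_fun setT g ->
    measurable_fun setT (fun y => g (angle y) * angle_density y).
  move=> mg; apply: measurable_funM; last exact: measurable_density.
  by apply: measurableT_comp => //; exact: measurable_angle.
have c2 : \int[mu]_y (u n (angle y) * angle_density y) @[n --> \oo] -->
    \int[mu]_y (f (angle y) * angle_density y).
  apply: (proj2 (@Rintegral_dominated R setT (fun n y => u n (angle y) * angle_density y)
    (fun y => f (angle y) * angle_density y) (fun y => M * angle_density y) mT _ _ _ _ _)).
  - by move=> n; exact: mcomp.
  - exact: mcomp.
  - by apply: aeW => y _; apply: cvgMl; exact: uf.
  - exact: integrable_density.
  - move=> n y _; rewrite normrM (ger0_norm (ltW (angle_density_gt0 y))).
    by rewrite ler_wpM2r// ltW// angle_density_gt0.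
rewrite /transfers -(cvg_lim _ c1)// -(cvg_lim _ c2)//.
rewrite (_ : (fun n => \int[mu]_(t in circ) u n t) =
  (fun n => \int[mu]_y (u n (angle y) * angle_density y)))//.
by apply/funext => n; exact: hu.
Qed.

Let mindic (B : set R) : measurable B -> measurable_fun setT (\1_B : R -> R).
Proof. by move=> mB; apply: measurable_indic. Qed.

(** A ray cuts the circle in an arc, which the angle pulls back to the union of
    two intervals, one on each side of [0], described by bounds on the
    arctangent. *)
Lemma transfers_ray (a : R) : transfers (\1_`]a, +oo[).
Proof.
pose c := Num.max (- (a / 2)) (- (pi / 2)).
pose e := Num.min (pi - a / 2) (pi / 2).
have p0 := pi_gt0 R.
have D0 (x : R) : \int[mu]_(y in [set y | x <= atan y < x]) angle_density y = 0.
  rewrite (_ : [set y | _] = set0) ?Rintegral_set0//.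
  by apply/seteqP; split => // y /= /andP[h1 h2]; have := le_lt_trans h1 h2; rewrite ltxx.
have mD (x z : R) : measurable [set y : R | x <= atan y < z].
  have -> : [set y : R | x <= atan y < z] = @atan R @^-1` `[x, z[%classic.
    by apply/seteqP; split => y; rewrite /= in_itv.
  by rewrite -[X in measurable X]setTI; apply: measurable_atan => //; exact: measurable_itv.
have DE (x z : R) : - (pi / 2) <= x -> x <= z -> z <= pi / 2 ->
    \int[mu]_y (\1_[set y | x <= atan y < z] y * angle_density y) = 2 * (z - x).
  move=> x2; rewrite Rintegral_setI// setTI le_eqVlt => /predU1P[<- _|xz z2].
    by rewrite D0// subrr mulr0.
  exact: Rintegral_atan_between.
have ind (x z : R) : mu.-integrable setT
    (EFin \o (fun y => \1_[set y | x <= atan y < z] y * angle_density y)).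
  have i1 := integrable_density 1; apply: le_integrable i1 => //.
    apply/measurable_EFinP; apply: measurable_funM; last exact: measurable_density.
    by apply: mindic.
  move=> y _ /=; rewrite lee_fin normrM mul1r ler_piMl// indicE.
  by case: (_ \in _); rewrite ?normr1 ?normr0.
rewrite /transfers.
case: (ltrP a 0) => [a0|a0].
  transitivity (\int[mu]_(t in circ) (1 : R)).
    apply: eq_Rintegral => t.
    by rewrite inE/= in_itv/= => /andP[t0 _]; rewrite indicE mem_set//= in_itv/= (lt_le_trans a0 t0).
  rewrite Rintegral_circ_cst mulr1.
  have h : - (pi / 2) < pi / 2 :> R by lra.
  have := Rintegral_atan_between (lexx _) h (lexx _); rewrite opprK -splitr => <-.
  rewrite (_ : [set y | _] = setT); last first.
    by apply/seteqP; split => // y _ /=; rewrite ltW ?atan_gtNpi2//= atan_ltpi2.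
  apply: eq_Rintegral => y _; rewrite indicE mem_set ?mul1r//= in_itv/= andbT (lt_trans a0)//.
  rewrite /angle; have := atan_ltpi2 y; case: ifPn => [_|]; first by lra.
  by rewrite -ltNge => /lt_atan; rewrite atan0; lra.
case: (lerP (2 * pi) a) => [a2|a2].
  transitivity (\int[mu]_(t in circ) (0 : R)).
    apply: eq_Rintegral => t.
    rewrite inE/= in_itv/= => /andP[_ t2]; rewrite indicE memNset//= in_itv/= andbT.
    by apply/negP; rewrite -leNgt (le_trans t2 a2).
  rewrite Rintegral_circ_cst mulr0; symmetry.
  transitivity (\int[mu]_(y in setT) (0 : R)); last by rewrite Rintegral_cst// mul0r.
    apply: eq_Rintegral => y _; rewrite indicE memNset ?mul0r//= in_itv/= andbT; apply/negP; rewrite -leNgt.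
    apply: le_trans a2; rewrite /angle; have := atan_gtNpi2 y; case: ifPn => [y0 _|_]; last by lra.
    have : 0 <= atan y by move: y0; rewrite le_eqVlt => /predU1P[<-|/lt_atan]; rewrite atan0 => // /ltW.
  by lra.
have -> : \int[mu]_(t in circ) \1_`]a, +oo[ t = 2 * pi - a.
  transitivity (\int[mu]_(t in circ) (\1_`]a, +oo[ t * cst 1 t)).
    by apply: eq_Rintegral => t _; rewrite mulr1.
  rewrite Rintegral_setI//.
  have -> : circ `&` `]a, +oo[ = `]a, 2 * pi]%classic.
    apply/seteqP; split => t /=; rewrite !in_itv/= !andbT.
      by move=> [/andP[_ ->] ->].
    by move=> /andP[at_ ->]; rewrite at_ (ltW (le_lt_trans a0 at_)).
  transitivity (1 * fine (mu `]a, 2 * pi]%classic)); first by apply: Rintegral_cst; exact: measurable_itv.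
  by rewrite lebesgue_measure_itv/= lte_fin a2 mul1r.
have cpi : - (pi / 2) <= c by rewrite le_max lexx orbT.
have c2 : c <= pi / 2 by rewrite ge_max; apply/andP; split; lra.
have e0 : 0 <= e by rewrite le_min; apply/andP; split; lra.
have e2 : e <= pi / 2 by rewrite ge_min lexx orbT.
transitivity (2 * (c - - (pi / 2)) + 2 * (e - 0)).
  rewrite /c /e maxEle minEle.
  by case: (lerP (- (a / 2)) (- (pi / 2))) => h; case: (lerP (pi - a / 2) (pi / 2)) => h'; lra.
rewrite -(DE _ _ (lexx _) cpi c2) -(DE _ _ _ e0 e2); last by lra.
rewrite -RintegralD//.
apply: eq_Rintegral => y _; rewrite -mulrDl; congr (_ * _).
have la := atan_ltpi2 y; have ga := atan_gtNpi2 y.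
have E (b : R -> bool) x : \1_[set x | b x] x = (b x)%:R :> R.
  rewrite indicE; congr ((nat_of_bool _)%:R); apply/idP/idP => [/set_mem//|h].
  exact/mem_set.
rewrite (E (fun y => - (pi / 2) <= atan y < c)) (E (fun y => 0 <= atan y < e)).
rewrite (E (fun t => t \in `]a, +oo[)) in_itv/= andbT /angle /c /e.
rewrite (ltW ga) /=.
case: (lerP 0 y) => [y0|y0].
  have h0 : 0 <= atan y by move: y0; rewrite le_eqVlt => /predU1P[<-|/lt_atan]; rewrite atan0 => // /ltW.
  have -> : (atan y < Num.max (- (a / 2)) (- (pi / 2))) = false.
    by apply/negbTE; rewrite -leNgt ge_max; apply/andP; split; lra.
  rewrite h0 /= add0r lt_min la andbT; congr ((nat_of_bool _)%:R).
  by apply/idP/idP; lra.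
have h0 : atan y < 0 by have := lt_atan y0; rewrite atan0.
rewrite leNgt h0 /= addr0 lt_max [X in _ || X]ltNge (ltW ga) orbF; congr ((nat_of_bool _)%:R).
by apply/idP/idP; lra.
Qed.

Let indic_le1 (B : set R) t : `|\1_B t : R| <= 1.
Proof. by rewrite indicE; case: (_ \in _); rewrite ?normr0 ?normr1. Qed.

Lemma transfers_indic (B : set R) : measurable B -> transfers (\1_B).
Proof.
move=> mB.
pose H := [set B : set R | measurable B /\ transfers (\1_B)].
suff : H B by case.
have hT : transfers (\1_(setT : set R)).
  apply: (transfers_limit (u := fun n => \1_`](- n.+1%:R), +oo[) (M := 1)) => //.
  - move=> t; rewrite indicT; apply: cvg_near_cst; near=> n.
    rewrite indicE mem_set//= in_itv/= andbT ltrNl.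
    apply: (@lt_le_trans _ _ (Num.truncn `|t|).+1%:R).
      by apply: (le_lt_trans _ (truncnS_gt _)); rewrite -normrN ler_norm.
    by rewrite ler_nat; near: n; exact: nbhs_infty_ge.
  - by move=> n; exact: transfers_ray.
have := @lambda_system_subset R (@RGenOInfty.G R) _ setT H _ _ _ B.
apply => //.
- move=> _ _ [x ->] [y ->]; exists (Num.max x y).
  apply/seteqP; split => t /=; rewrite !in_itv/= !andbT gt_max.
    by move=> [-> ->].
  by move/andP.
- split => //.
  + move=> A1 A2 A12 [m1 S1] [m2 S2]; split; first exact: measurableD.
    have S3 : transfers (fun t => \1_A1 t + -1 * \1_A2 t).
      apply: (transfersD (M := 1) (N := 1)) => //.
      * by apply: measurable_funM => //; by apply: mindic.
      * by move=> t; rewrite mulN1r normrN.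
      * by apply: (@transfersZ _ _ 1) => //; by apply: mindic.
    rewrite (_ : \1_(A1 `\` A2) = (fun t => \1_A1 t + -1 * \1_A2 t))//; apply/funext => t.
    rewrite !indicE in_setD; case: (boolP (t \in A2)) => tA2.
      by rewrite (mem_set (A12 _ (set_mem tA2))) mulr1 subrr.
    by rewrite mulr0 addr0 andbT.
  + move=> F ndF HF.
    have mF : measurable (\bigcup_i F i) by apply: bigcupT_measurable => i; case: (HF i).
    split => //.
    apply: (transfers_limit (u := fun n => \1_(F n)) (M := 1)) => //.
    * by move=> n; apply: mindic; case: (HF n).
    * move=> t; rewrite [in X in _ --> X]indicE.
      have [[n _ tn]|nt] := pselect ((\bigcup_i F i) t).
        rewrite mem_set; last by exists n.
        apply: cvg_near_cst; exists n => // m /= nm.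
        by rewrite indicE mem_set//; have /subsetPset := ndF _ _ nm; exact.
      rewrite memNset//; apply: cvg_near_cst; apply: nearW => m.
      by rewrite indicE memNset// => tm; apply: nt; exists m.
    * by move=> n; case: (HF n).
- move=> _ [x ->]; split; first exact: measurable_itv.
  exact: transfers_ray.
- exact: (eq_ind _ (fun X : set (set R) => X B) mB _ (@RGenOInfty.measurableE R)).
Unshelve. all: by end_near. Qed.

Import HBNNSimple.

Lemma transfers_bounded f (M : R) : measurable_fun setT f ->
  (forall t, 0 <= f t <= M) -> transfers f.
Proof.
move=> mf fM.
have mv : measurable_fun setT (fun t => (f t)%:E) by exact/measurable_EFinP.
pose s n : {nnsfun R >-> R} := nnsfun_approx mT mv n.
have v0 (t : R) : setT t -> (0 <= (f t)%:E)%E by move=> _; rewrite lee_fin; have /andP[] := fM t.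
have sc (t : R) : s n t @[n --> \oo] --> f t.
  by have /fine_cvg := cvg_nnsfun_approx mT mv v0 (I : setT t); apply.
have sl (t : R) n : s n t <= f t.
  have c := sc t; rewrite -(cvg_lim _ c)//.
  apply: nondecreasing_cvgn_le; last by apply/cvg_ex; eexists; exact: c.
  by move=> m k mk; have /lefP := nd_nnsfun_approx mT mv mk; exact.
have sM n t : `|s n t| <= M.
  rewrite ger0_norm; last exact: fun_ge0.
  by rewrite (le_trans (sl t n))//; have /andP[] := fM t.
have ms (h : {nnsfun R >-> R}) : measurable_fun setT (h : R -> R) by exact: measurable_funP.
apply: (transfers_limit _ mf sM sc) => [n|n]; first exact: ms.
move: (s n) => {sM sl sc} h.
have my (y : R) : measurable (h @^-1` [set y] : set R).
  by rewrite -[X in measurable X]setTI; exact: measurable_funP.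
have -> : (h : R -> R) = (fun t => \sum_(y <- finmap.enum_fset (fset_set (range h)))
       y * \1_(h @^-1` [set y]) t).
  by apply/funext => t; rewrite fimfunE fsbig_finite.
elim: (finmap.enum_fset _) => [|y l IH].
  rewrite (_ : (fun t => _) = cst 0); last by apply/funext => t; rewrite big_nil.
  rewrite /transfers Rintegral_cst// mul0r; symmetry.
  transitivity (\int[mu]_(y in setT) (0 : R)); last by rewrite Rintegral_cst// mul0r.
  by apply: eq_Rintegral => y _; rewrite mul0r.
rewrite (_ : (fun t => _) = (fun t => y * \1_(h @^-1` [set y]) t +
   \sum_(z <- l) z * \1_(h @^-1` [set z]) t)); last by apply/funext => t; rewrite big_cons.
apply: (transfersD (M := `|y|) (N := \sum_(z <- l) `|z|)) => //.
- by apply: measurable_funM => //; by apply: mindic.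
- by apply: measurable_sum => z; apply: measurable_funM => //; by apply: mindic.
- by move=> t; rewrite normrM ler_piMr.
- move=> t; rewrite (le_trans (ler_norm_sum _ _ _))//; apply: ler_sum => z _.
  by rewrite normrM ler_piMr.
- by apply: (@transfersZ _ _ 1) => //; exact: transfers_indic.
Qed.

Lemma transfers_bounded_norm f (M : R) : measurable_fun setT f ->
  (forall t, `|f t| <= M) -> transfers f.
Proof.
move=> mf fM; have M0 : 0 <= M by exact: le_trans (fM 0).
have h t : 0 <= f t + M <= 2 * M by have := fM t; rewrite ler_norml => /andP[? ?]; apply/andP; split; lra.
have mfM : measurable_fun setT (fun t => f t + M) by apply: measurable_funD.
have S : transfers (fun t => (f t + M) + - M * \1_setT t).
  apply: (transfersD (M := 2 * M) (N := M)) => //.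
  - by apply: measurable_funM => //; by apply: mindic.
  - by move=> t; have /andP[h1 h2] := h t; rewrite ger0_norm.
  - by move=> t; rewrite normrM normrN (ger0_norm M0) ler_piMr.
  - exact: transfers_bounded h.
  - by apply: (@transfersZ _ _ 1) => //; exact: transfers_indic.
rewrite (_ : f = (fun t => (f t + M) + - M * \1_setT t))//.
by apply/funext => t; rewrite indicT mulr1 addrK.
Qed.

Let measurable_transfer f : measurable_fun setT f ->
  measurable_fun setT (fun y => f (angle y) * angle_density y).
Proof.
move=> mf; apply: measurable_funM; last exact: measurable_density.
by apply: measurableT_comp => //; exact: measurable_angle.
Qed.

Lemma transfers_integrable f : measurable_fun setT f ->
  mu.-integrable circ (EFin \o f) ->
  mu.-integrable setT (EFin \o (fun y => f (angle y) * angle_density y)) /\ transfers f.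
Proof.
move=> mf if_.
have d0 y := ltW (angle_density_gt0 y).
have ia := integrable_norm if_.
have ma : measurable_fun setT (fun t => `|f t|) by apply: measurableT_comp.
pose u n t := Num.min `|f t| n%:R.
have u0 n t : 0 <= u n t by rewrite le_min normr_ge0 ler0n.
have ub n t : `|u n t| <= n%:R by rewrite ger0_norm// ge_min lexx orbT.
have mu_ n : measurable_fun setT (u n) by apply: measurable_minr.
have iaT : mu.-integrable setT (EFin \o (fun y => `|f (angle y)| * angle_density y)).
  apply: (proj1 (_ : _ /\ \int[mu]_y (`|f (angle y)| * angle_density y) <= \int[mu]_(t in circ) `|f t|)).
  apply: (@Rintegral_fatou _ setT (fun n y => u n (angle y) * angle_density y)) => //.
  - by move=> n; exact: integrable_bounded_density (ub n).
  - by move=> n y _; rewrite mulr_ge0.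
  - exact: (measurable_transfer ma).
  - apply: aeW => y _; apply: cvgMl; apply: cvg_near_cst; near=> n; apply/min_idPl.
    rewrite (le_trans (ltW (truncnS_gt _)))// ler_nat; near: n.
    exact: nbhs_infty_ge.
  - move=> n; have := transfers_bounded_norm (mu_ n) (ub n); rewrite /transfers => <-.
    apply: le_Rintegral => //; first exact: integrable_bounded_circ (ub n).
    by move=> t _; rewrite ge_min lexx.
have ifT : mu.-integrable setT (EFin \o (fun y => f (angle y) * angle_density y)).
  apply: le_integrable iaT => //; first by apply/measurable_EFinP; exact: measurable_transfer.
  by move=> y _ /=; rewrite lee_fin !normrM normr_id.
split => //.
pose v n t := Num.max (- n%:R) (Num.min (f t) n%:R).
have vn n t : `|v n t| <= n%:R.
  by rewrite ler_norml /v le_max lexx /= ge_max ge_min lexx orbT andbT -subr_ge0 opprK addr_ge0.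
have vf n t : `|v n t| <= `|f t|.
  have := ler_norm (f t); have := ler_norm (- f t); rewrite normrN => h1 h2.
  have n0 : 0 <= n%:R :> R by exact: ler0n.
  rewrite ler_norml /v; apply/andP; split.
    by rewrite le_max; apply/orP; right; rewrite le_min; apply/andP; split; have := normr_ge0 (f t); lra.
  by rewrite ge_max ge_min; apply/andP; split; [have := normr_ge0 (f t); lra|rewrite h2].
have vc t : v n t @[n --> \oo] --> f t.
  apply: cvg_near_cst; near=> n.
  have : `|f t| <= n%:R.
    by rewrite (le_trans (ltW (truncnS_gt _)))// ler_nat; near: n; exact: nbhs_infty_ge.
  rewrite ler_norml => /andP[h1 h2]; rewrite /v.
  by rewrite (min_l h2) (max_r h1).
have mv n : measurable_fun setT (v n) by apply: measurable_maxr => //; exact: measurable_minr.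
have c1 : \int[mu]_(t in circ) v n t @[n --> \oo] --> \int[mu]_(t in circ) f t.
  apply: (proj2 (@Rintegral_dominated R circ v f (fun t => `|f t|) mC _ _ _ _ _)) => //.
  - by move=> n; apply: measurable_funS (mv n).
  - by apply: measurable_funS mf.
  - by apply: aeW => t _; exact: vc.
have c2 : \int[mu]_y (v n (angle y) * angle_density y) @[n --> \oo] -->
    \int[mu]_y (f (angle y) * angle_density y).
  apply: (proj2 (@Rintegral_dominated R setT (fun n y => v n (angle y) * angle_density y)
    (fun y => f (angle y) * angle_density y) (fun y => `|f (angle y)| * angle_density y) mT _ _ _ _ _)).
  - by move=> n; exact: measurable_transfer.
  - exact: measurable_transfer.
  - by apply: aeW => y _; apply: cvgMl; exact: vc.
  - exact: iaT.
  - by move=> n y _; rewrite normrM (ger0_norm (d0 y)) ler_wpM2r.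
rewrite /transfers -(cvg_lim _ c1)// -(cvg_lim _ c2)//.
rewrite (_ : (fun n => \int[mu]_(t in circ) v n t) =
  (fun n => \int[mu]_y (v n (angle y) * angle_density y)))//.
by apply/funext => n; exact: transfers_bounded_norm (mv n) (vn n).
Unshelve. all: by end_near. Qed.

End ChangeOfVariable.

(** * Boundary functions *)

Section BoundaryMeasurable.
Variable R : realType.
Variables (F : set_system R) (D : nat -> set R) (s : nat -> R).
Context {FF : ProperFilter F}.
Hypotheses (FD : forall n, F (D n)) (DF : forall P, F P -> exists n, D n `<=` P).
Hypotheses (Ds : forall m n, (m <= n)%N -> D m (s n)) (D0 : forall n, D n `<=` D 0%N).

Let E (g : R -> R -> R) : set R := \bigcap_k \bigcup_n
  [set y | forall x x', D n x -> D n x' -> `|g x y - g x' y| <= k.+1%:R^-1].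

Let measurable_E g : (forall x, D 0%N x -> continuous (g x)) -> measurable (E g).
Proof.
move=> cg; apply: bigcapT_measurable => k; apply: bigcupT_measurable => n.
apply: closed_measurable.
have -> : [set y | forall x x', D n x -> D n x' -> `|g x y - g x' y| <= k.+1%:R^-1] =
    \bigcap_(p in [set p : R * R | D n p.1 /\ D n p.2])
      (fun y => `|g p.1 y - g p.2 y|) @^-1` [set r | r <= k.+1%:R^-1].
  apply/seteqP; split => y /= h; first by move=> [x x'] [/= ? ?]; exact: h.
  by move=> x x' Dx Dx'; exact: (h (x, x')).
apply: closed_bigI => -[x x'] [/= Dx Dx'].
have c1 : continuous (g x) := cg _ (D0 Dx).
have c2 : continuous (g x') := cg _ (D0 Dx').
apply: closed_comp; last exact: closed_le.
by move=> y _; exact: (cvg_norm (cvgB (c1 y) (c2 y))).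
Qed.

Let cvg_E g y : cvg (g x y @[x --> F]) <-> E g y.
Proof.
split=> [/cvg_ex[l /cvgrPdist_le h] k _|Ey].
  have e0 : 0 < k.+1%:R^-1 / 2 :> R by rewrite divr_gt0 ?invr_gt0.
  have [n nP] := DF (h _ e0); exists n => //= x x' Dx Dx'.
  have := nP _ Dx; have := nP _ Dx' => /= h1 h2.
  rewrite (splitr k.+1%:R^-1) (le_trans (ler_distD l _ _))// lerD// distrC//.
apply/cauchy_cvgP/cauchy_exP => e e0.
have [k ke] : exists k, k.+1%:R^-1 < e.
  exists (Num.truncn e^-1); rewrite invf_plt ?posrE//; exact: truncnS_gt.
have [n _ nP] := Ey k I; exists (g (s n) y).
suff h : F [set x | ball (g (s n) y) e (g x y)] by exact: h.
apply: (filterS _ (FD n)) => x Dx; rewrite /ball/=.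
by apply: le_lt_trans ke; apply: nP => //; exact: Ds.
Qed.

Let cvg_s : s n @[n --> \oo] --> F.
Proof.
move=> P /DF[m mP]; exists m => // n /= mn; apply: mP; exact: Ds.
Qed.

(** Membership in the set where the limit exists is a countable condition on
    closed sets, by the Cauchy criterion along the basis [D]; on it the limit is
    taken along the sequence [s], off it [lim] is constant. *)
Lemma cmeas_lim (g : R -> R -> R[i]) :
  (forall x, D 0%N x -> continuous (fun y => complex.Re (g x y))) ->
  (forall x, D 0%N x -> continuous (fun y => complex.Im (g x y))) ->
  cmeas setT (fun y => lim ((g x y : R[i]^o) @[x --> F])).
Proof.
move=> c1 c2; set b := fun y => _.
pose C := E (fun x y => complex.Re (g x y)) `&` E (fun x y => complex.Im (g x y)).
have mC : measurable C by apply: measurableI; exact: measurable_E.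
have bC : cmeas C b.
  apply: (@cmeas_cvg _ _ _ _ (fun n y => g (s n) y)) => [n|y [/cvg_E/cvg_ex[u hu] /cvg_E/cvg_ex[v hv]]].
    have Dn : D 0%N (s n) by exact: Ds.
    by split; apply: (measurable_funS measurableT) => //;
      apply: continuous_measurable_fun; [exact: c1|exact: c2].
  have h : (g x y : R[i]^o) @[x --> F] --> (u +i* v : R[i]^o) by apply/cvg_ReIm.
  have -> : b y = u +i* v.
    by apply: (ccvg_unique (F := F) (f := fun x => g x y)); [move/cvgP: h|exact: h].
  exact: (cvg_comp _ _ cvg_s h).
have bN : cmeas (~` C) b.
  apply: (@eq_cmeas _ _ _ _ (fun=> (point : R[i]^o))); last exact: cmeas_cst.
  move=> y; rewrite inE => Cy; symmetry; rewrite /b; apply: (@dvgP R[i]^o) => /cvg_ex[l /cvg_ReIm[h1 h2]].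
  by apply: Cy; split; apply/cvg_E/cvg_ex; [exists (complex.Re l)|exists (complex.Im l)].
have mN := measurableC mC.
by split; rewrite -(setUv C); apply/measurable_funU => //; split; [exact: bC.1|exact: bN.1|exact: bC.2|exact: bN.2].
Qed.

End BoundaryMeasurable.

Section Boundary.
Variable R : realType.
Local Notation mu := (@lebesgue_measure R).
Local Notation circ := (`[0, 2 * pi]%classic : set R).

Lemma holomorphic_cvg (U : set R[i]) (G : R[i] -> R[i]) (g : R -> R[i]) (y : R) :
  holomorphic_on U G -> U (g y) ->
  (g x : R[i]^o) @[x --> y] --> (g y : R[i]^o) ->
  (G (g x) : R[i]^o) @[x --> y] --> (G (g y) : R[i]^o).
Proof.
move=> hG Uy gc; have /derivable1_diffP/differentiable_continuous c := hG _ Uy.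
exact: (cvg_comp _ _ gc c).
Qed.

Lemma continuous_vertical (G : R[i] -> R[i]) (x : R) : holomorphic_on Cplus G -> 0 < x ->
  continuous (fun y => complex.Re (G (x +i* y))) /\
  continuous (fun y => complex.Im (G (x +i* y))).
Proof.
move=> hG x0.
have h y : (G (x +i* y') : R[i]^o) @[y' --> y] --> (G (x +i* y) : R[i]^o).
  apply: (holomorphic_cvg (g := fun y => x +i* y) hG) => //.
  by apply/cvg_ReIm; split => /=; [exact: cvg_cst|exact: cvg_id].
by split => y; have /cvg_ReIm[] := h y.
Qed.

Lemma cmeas_boundary_Cplus (G : R[i] -> R[i]) : holomorphic_on Cplus G ->
  cmeas setT (boundary_Cplus G).
Proof.
move=> hG.
apply: (@cmeas_lim R ((0 : R)^'+) (fun n => `]0, n.+1%:R^-1[%classic) (fun n => n.+2%:R^-1)).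
- move=> n; near=> x; rewrite /= in_itv/=; apply/andP; split.
    by near: x; exact: nbhs_right_gt.
  by near: x; apply: nbhs_right_lt; rewrite invr_gt0.
- move=> P [e /= e0 eP]; exists (Num.truncn e^-1) => x /=; rewrite in_itv/= => /andP[x0 xe].
  apply: eP => //=; rewrite sub0r normrN gtr0_norm//; apply: (lt_trans xe).
  by rewrite invf_plt ?posrE//; exact: truncnS_gt.
- move=> m n mn; rewrite /= in_itv/= invr_gt0 ltr0n /=.
  by rewrite ltf_pV2 ?posrE// ltr_nat ltnS.
- move=> n x /=; rewrite !in_itv/= => /andP[-> /= h]; apply: (lt_le_trans h).
  by rewrite lef_pV2 ?posrE// ler_nat.
- by move=> x /=; rewrite in_itv/= => /andP[x0 _]; exact: (continuous_vertical hG x0).1.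
- by move=> x /=; rewrite in_itv/= => /andP[x0 _]; exact: (continuous_vertical hG x0).2.
Unshelve. all: by end_near. Qed.

Lemma cmeas_boundary_disk (G : R[i] -> R[i]) : holomorphic_on Cdisk G ->
  cmeas setT (boundary_disk G).
Proof.
move=> hG.
have h (r : R) : 0 < r < 1 -> forall t, (G (r%:C * zeta t') : R[i]^o) @[t' --> t] --> (G (r%:C * zeta t) : R[i]^o).
  move=> /andP[r0 r1] t; apply: (holomorphic_cvg (g := fun t => r%:C * zeta t) hG).
    by rewrite /Cdisk /mkset normcM normc_zeta mulr1 normc_real gtr0_norm.
  apply: ccvgMl; have [c1 c2] := cderiv_continuous (cderiv_zeta t).
  by apply/cvg_ReIm.
apply: (@cmeas_lim R ((1 : R)^'-) (fun n => `]1 - n.+1%:R^-1, 1[%classic) (fun n => 1 - n.+2%:R^-1)).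
- move=> n; near=> x; rewrite /= in_itv/=; apply/andP; split.
    by near: x; apply: nbhs_left_gt; rewrite gtrBl invr_gt0.
  by near: x; exact: nbhs_left_lt.
- move=> P [e /= e0 eP]; exists (Num.truncn e^-1) => x /=; rewrite in_itv/= => /andP[xe x1].
  apply: eP => //=; rewrite gtr0_norm ?subr_gt0//.
  have : (Num.truncn e^-1).+1%:R^-1 < e by rewrite invf_plt ?posrE//; exact: truncnS_gt.
  by move: xe; rewrite ltrBlDr ltrBlDl => h1 h2; apply: (lt_trans h1); rewrite ltrD2l.
- move=> m n mn; rewrite /= in_itv/= gtrBl invr_gt0 ltr0n andbT ltrD2l ltrN2.
  by rewrite ltf_pV2 ?posrE// ltr_nat ltnS.
- move=> n x /=; rewrite !in_itv/= => /andP[hx ->]; rewrite andbT; apply: le_lt_trans hx.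
  by rewrite lerD2l lerN2 lef_pV2 ?posrE// ler_nat.
- move=> x /=; rewrite in_itv/= invr1 subrr => x01 t.
  by have /cvg_ReIm[] := h x x01 t.
- move=> x /=; rewrite in_itv/= invr1 subrr => x01 t.
  by have /cvg_ReIm[] := h x x01 t.
Unshelve. all: by end_near. Qed.

Lemma laplace_damped h (x : R) w : Cplus w ->
  laplace (fun t => h t * (expR (- (x * t)))%:C) w = laplace h (x%:C + w).
Proof.
move=> w0; rewrite /laplace; congr (_ * _); apply: eq_cintegral => t _.
rewrite -mulrA; congr (_ * _); rewrite -cexp_real -cexpD; congr cexp.
by apply: complex_eq; rewrite !(ReD, ImD, ReN, ImN, ReM, ImM) /=; ring.
Qed.

(** The values of the transform of [h] on the vertical line of abscissa [x]
    are the boundary values of the transform of [h t * exp (- x t)]. *)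
Lemma H2Cplus_laplace (G : R[i] -> R[i]) h : isL2 Rplus h ->
  (forall w, Cplus w -> G w = laplace h w) -> H2Cplus G.
Proof.
move=> lh GE; have hol := laplace_holomorphic lh.
have mR : measurable (Rplus : set R) by exact: measurable_Rplus.
split; first exact: (holomorphic_Cplus_eq GE).
exists (nrm Rplus h ^+ 2) => x x0.
pose hx t := h t * (expR (- (x * t)))%:C.
have le_h t : Rplus t -> normc (hx t) <= normc (h t).
  move=> /RplusP t0; rewrite normcM normc_real ger0_norm ?expR_ge0//.
  by rewrite ler_piMr ?normc_ge0// expR_le1// oppr_le0 mulr_ge0// ltW.
have lx : isL2 Rplus hx.
  apply: (isL2_dominated mR _ lh le_h); apply: cmeasM; first exact: isL2_cmeas.
  apply: cmeas_real; apply: (measurable_funS measurableT) => //.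
  apply: measurableT_comp; first exact: measurable_expR.
  by apply: measurable_funN; apply: measurable_funM.
have [H hH] := fourier_pair_exists lx; have [_ lH _] := hH.
have [m1 m2] := continuous_vertical hol x0.
have mG : cmeas setT (fun y => laplace h (x +i* y)).
  by apply: continuous_cmeas.
have e : ae_eq mu setT (fun y => laplace h (x +i* y)) H.
  move: (laplace_nontangential hH); apply: ae_imp => y /nontangential_boundary nt _.
  apply: (ccvg_unique (F := (0 : R)^'+) (f := fun u => laplace hx (u +i* y))); last exact: nt.
  have c : (laplace h ((x + u) +i* y) : R[i]^o) @[u --> (0 : R)] --> (laplace h ((x + 0) +i* y) : R[i]^o).
    apply: (holomorphic_cvg (g := fun u => (x + u) +i* y) hol); first by rewrite /Cplus/= addr0.
    apply/cvg_ReIm; split => /=; last exact: cvg_cst.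
    by apply: cvgD; [exact: cvg_cst|exact: cvg_id].
  have {}c := cvg_at_right_filter c; rewrite addr0 in c.
  apply: cvg_trans c; apply: near_eq_cvg; near=> u.
  have u0 : 0 < u by near: u; exact: nbhs_right_gt.
  rewrite laplace_damped//; congr (laplace h _); by apply: complex_eq; rewrite ?ReD ?ImD /= ?add0r.
have lG := isL2_ae_eq measurableT lH mG (ae_imp (fun y h Dy => esym (h Dy)) e).
have -> : (\int[mu]_(y in [set: R]) (normc (G (x +i* y)) ^+ 2)%:E)%E = sqn setT (fun y => laplace h (x +i* y)).
  by apply: eq_integral => y _; rewrite GE.
rewrite (sqn_fin lG) lee_fin (nrm_ae_eq measurableT (isL2_cmeas lG) (isL2_cmeas lH) e).
rewrite (fourier_pair_nrm hH) ler_pXn2r ?nnegrE ?nrm_ge0//.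
exact: nrm_le.
Unshelve. all: by end_near. Qed.

Lemma Rintegral_nonintegrable (D : set R) (u : R -> R) : measurable D ->
  measurable_fun D u -> ~ mu.-integrable D (EFin \o u) -> \int[mu]_(t in D) u t = 0.
Proof.
move=> mD mu_ nu; rewrite /Rintegral; case E : (\int[mu]_(t in D) _)%E => [r||]//.
exfalso; apply: nu; move: E; rewrite integralE => E.
have : (\int[mu]_(t in D) ((EFin \o u)^\+ t) - \int[mu]_(t in D) ((EFin \o u)^\- t))%E \is a fin_num.
  by rewrite E.
rewrite fin_numB => /andP[p n].
have meu : measurable_fun D (EFin \o u) by exact/measurable_EFinP.
apply/integrableP; split => //.
rewrite (_ : (fun x => _) = (fun t => (EFin \o u)^\+ t + (EFin \o u)^\- t)%E); last first.
  by apply/funext => t; have := congr1 (fun f => f t) (fune_abse (EFin \o u)).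
rewrite ge0_integralD//; [|exact: measurable_funepos|exact: measurable_funeneg].
by rewrite lte_add_pinfty// ltey_eq ?p ?n.
Qed.

End Boundary.

Section OuterTransfer.
Variable R : realType.
Local Notation mu := (@lebesgue_measure R).
Local Notation circ := (`[0, 2 * pi]%classic : set R).
Variables (h : R -> R[i]) (F : R[i] -> R[i]).
Hypotheses (lh : isL2 Rplus h) (oG : outer_disk (Phi (laplace h))).
Hypothesis FE : forall w, Cplus w -> F w = laplace h w.

Let G := Phi (laplace h).
Let v (t : R) := ln (normc (boundary_disk G t)).
Let V (y : R) := v (angle y).

Implicit Types (z w : R[i]) (t y : R).

Let mC : measurable circ.
Proof. exact: measurable_itv. Qed.

Let mv : measurable_fun setT v.
Proof.
have [[hG _] _ _] := oG; apply: measurableT_comp; first exact: measurable_ln.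
exact: (measurable_normc (cmeas_boundary_disk hG)).
Qed.

Let Re_schwarz z t : normc z < 1 ->
  complex.Re (schwarz z t) = (1 - normc z ^+ 2) / normc (zeta t - z) ^+ 2.
Proof.
move=> z1; rewrite /schwarz ReM Re_inv Im_inv.
have n1 := normc_sqr (zeta t); rewrite normc_zeta expr1n in n1.
have n2 := normc_sqr z; rewrite !ReD !ImD !ReN !ImN.
have -> : 1 - normc z ^+ 2 = complex.Re (zeta t) ^+ 2 + complex.Im (zeta t) ^+ 2 -
   (complex.Re z ^+ 2 + complex.Im z ^+ 2) by rewrite -n1 -n2.
move: (complex.Re (zeta t)) (complex.Im (zeta t)) (complex.Re z) (complex.Im z) => a b c d.
move: (normc (zeta t - z) ^+ 2) => N; ring.
Qed.

Let ReMr (a : R[i]) (b : R) : complex.Re (a * b%:C) = complex.Re a * b.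
Proof. by rewrite ReM /= mulr0 subr0. Qed.

Let ImMr (a : R[i]) (b : R) : complex.Im (a * b%:C) = complex.Im a * b.
Proof. by rewrite ImM /= mulr0 add0r. Qed.

Let normc_G z : normc z < 1 ->
  normc (G z) = expR ((2 * pi)^-1 * \int[mu]_(t in circ) (complex.Re (schwarz z t) * v t)).
Proof.
move=> z1; have [_ _ [l l1 E]] := oG.
rewrite /G E// normcM l1 mul1r normc_cexp mulrC ReMr mulrC; congr (expR (_ * _)).
by rewrite /cintegral /=; apply: eq_Rintegral => t _; rewrite ReMr.
Qed.

(* Otherwise all the integrals in the representation of [G] would have the
   value zero, so [G] would have constant modulus and bounded [v]. *)
Let iv : mu.-integrable circ (EFin \o v).
Proof.
have [//|niv] := pselect (mu.-integrable circ (EFin \o v)).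
have G1 z : normc z < 1 -> normc (G z) = 1.
  move=> z1; rewrite normc_G// Rintegral_nonintegrable ?mulr0 ?expR0//.
    apply: measurable_funM; last by apply: measurable_funS mv.
    exact: (cmeas_schwarz z mC).1.
  move=> iP; apply: niv; pose c := (1 - normc z ^+ 2) / 4.
  have c1 : 0 < 1 - normc z ^+ 2 by rewrite subr_gt0 exprn_ilt1 ?normc_ge0.
  have c0 : 0 < c by rewrite divr_gt0.
  have i1 := integrable_EFinZl mC iP c^-1; apply: le_integrable i1 => //.
    by apply/measurable_EFinP; apply: measurable_funS mv.
  move=> t _ /=; rewrite lee_fin normrM normrM mulrA ler_peMl//.
  rewrite gtr0_norm ?invr_gt0// mulrC ler_pdivlMr// mul1r Re_schwarz//.
  have d0 : 0 < normc (zeta t - z) ^+ 2 by rewrite exprn_gt0// normc_gt0 schwarz_den.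
  rewrite ger0_norm; last by rewrite divr_ge0 ?ltW.
  rewrite /c ler_pM2l// lef_pV2 ?posrE//.
  have : normc (zeta t - z) <= 2.
    by rewrite (le_trans (ler_normcB _ _))// normc_zeta lerD2l ltW.
  by have := normc_ge0 (zeta t - z); nra.
have v01 t : v t = 0 \/ v t = ln (normc (point : R[i]^o)).
  rewrite /v /boundary_disk.
  have [c|nc] := pselect (cvg ((G (r%:C * cexp (0 +i* t)) : R[i]^o) @[r --> (1 : R)^'-])); last first.
    by right; rewrite dvgP.
  left; have n1 : normc (G (r%:C * cexp (0 +i* t))) @[r --> (1 : R)^'-] --> normc (lim ((G (r%:C * cexp (0 +i* t)) : R[i]^o) @[r --> (1 : R)^'-])).
    by apply: ccvg_normc; exact: c.
  have n2 : normc (G (r%:C * cexp (0 +i* t))) @[r --> (1 : R)^'-] --> (1 : R).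
    apply: cvg_near_cst; near=> r; apply: G1; rewrite normcM cexp_im_normc mulr1 normc_real.
    rewrite ltr_norml; apply/andP; split; last by near: r; exact: nbhs_left_lt.
    by near: r; apply: nbhs_left_gt; lra.
  by rewrite (cvg_unique _ n1 n2)// ln1.
apply: (integrable_bounded_circ (M := `|ln (normc (point : R[i]^o))|)) => // t.
by case: (v01 t) => ->; rewrite ?normr0.
Unshelve. all: by end_near. Qed.

Let schwarz_angle w y : Cplus w ->
  schwarz (cayley w) (angle y) = (y%:C * w + 'i%C) / (y%:C + 'i%C * w).
Proof.
move=> w0; have w1 := Cplus1_neq0 w0.
have n0 : 1 + 0 +i* y != 0 :> R[i].
  by apply/eqP => /(congr1 (@complex.Re R)) /=; lra.
have dz := schwarz_den (angle y) (cayley_disk w0).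
have ii : 'i%C * 'i%C = -1 :> R[i] by rewrite -expr2 sqr_i.
have yi : 0 +i* y = 'i%C * y%:C :> R[i] by apply: complex_eq; rewrite ?ReM ?ImM /=; ring.
have d0 : y%:C + 'i%C * w != 0.
  apply/eqP => /(congr1 (@complex.Im R)); rewrite ImD ImM /=.
  by move: w0; rewrite /Cplus/=; lra.
rewrite /schwarz; apply: (mulIf dz); rewrite divfK//.
apply: (mulIf d0); rewrite [RHS]mulrAC divfK//.
rewrite zeta_angle yi /cayley; rewrite yi in n0.
move: ('i%C : R[i]) ii n0 d0 => i ii n0 d0.
apply/eqP; rewrite -subr_eq0; apply/eqP.
have -> : (((1 - i * y%:C) / (1 + i * y%:C) + (1 - w) / (1 + w)) * (y%:C + i * w) -
   ((y%:C * w + i) * ((1 - i * y%:C) / (1 + i * y%:C) - (1 - w) / (1 + w)))) =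
   (i * i + 1) * (2 * y%:C * (1 - w ^+ 2)) / ((1 + i * y%:C) * (1 + w)).
  by field; rewrite n0 w1.
by rewrite ii addNr !mul0r.
Qed.

Let schwarz_poisson w y : Cplus w ->
  complex.Re (schwarz (cayley w) (angle y)) * angle_density y = 2 * pi * poisson w y.
Proof.
move=> w0; rewrite schwarz_angle// poisson_ReE.
have d0 : w + 0 +i* (- y) != 0 := ck_neq0 (- y) w0.
have d1 : y%:C + 'i%C * w = 'i%C * (w + 0 +i* (- y)).
  by apply: complex_eq; rewrite !(ReD, ImD, ReM, ImM) /=; ring.
have i0 : 'i%C != 0 :> R[i].
  by apply/eqP => /(congr1 (@complex.Im R)) /= /eqP; rewrite oner_eq0.
have -> : (y%:C * w + 'i%C) / (y%:C + 'i%C * w) = (1 + y ^+ 2)%:C * ck w (- y) - 0 +i* y.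
  rewrite d1 /ck; apply: (mulIf (mulf_neq0 i0 d0)); rewrite divfK ?mulf_neq0//.
  transitivity ((1 + y ^+ 2)%:C * 'i%C - 0 +i* y * ('i%C * (w + 0 +i* (- y)))).
    by apply: complex_eq; rewrite !(ReD, ImD, ReN, ImN, ReM, ImM) /=; ring.
  by move: (w + 0 +i* (- y)) d0 => D d0; rewrite mulrBl -mulrA (mulrC D^-1) mulfK.
rewrite ReD ReN ReM /= oppr0 addr0 mul0r subr0 /angle_density.
move: (1 + y ^+ 2) (lt0r_neq0 (onesqr_gt0 y)) => q q0.
move: (pi : R) (lt0r_neq0 (pi_gt0 R)) => p p0; move: (complex.Re _) => k.
by field; rewrite ?p0 ?q0.
Qed.

Let iV : poisson_integrable V.
Proof.
have mV : measurable_fun setT V by apply: measurableT_comp mv _; exact: measurable_angle.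
split => //; have [iT _] := transfers_integrable mv iv.
have := integrable_EFinZl measurableT iT 2^-1; apply: eq_integrable => // y _.
rewrite /= -/(V y) /angle_density; congr (_%:E).
by move: (1 + y ^+ 2) (lt0r_neq0 (onesqr_gt0 y)) => q q0; field.
Qed.

Let transferC (f : R -> R[i]) : cmeas setT f -> cintegrable circ f ->
  cintegral circ f = cintegral setT (fun y => f (angle y) * (angle_density y)%:C).
Proof.
move=> [m1 m2] [i1 i2]; have [_ t1] := transfers_integrable m1 i1.
have [_ t2] := transfers_integrable m2 i2.
apply: complex_eq => /=; [rewrite t1|rewrite t2]; apply: eq_Rintegral => y _.
  by rewrite ReMr.
by rewrite ImMr.
Qed.

Let schwarz_bounded z u : normc z < 1 -> measurable_fun setT u ->
  mu.-integrable circ (EFin \o u) ->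
  cintegrable circ (fun t => schwarz z t * (u t)%:C).
Proof.
move=> z1 mu_ iu.
apply: (@cintegrable_le _ _ _ (fun t => 2 / (1 - normc z) * `|u t|)) => //.
- apply: cmeasM; first exact: cmeas_schwarz.
  by apply: cmeas_real; apply: measurable_funS mu_.
- by apply: integrable_EFinZl => //; exact: integrable_norm iu.
- by move=> t _; rewrite normcM normc_real ler_wpM2r// normc_schwarz_le.
Qed.

Let normc_G_poisson w : Cplus w ->
  normc (G (cayley w)) = expR (\int[mu]_y (poisson w y * V y)).
Proof.
move=> w0; have z1 := cayley_disk w0; rewrite normc_G//; congr expR.
have [iS _] := schwarz_bounded z1 mv iv.
have iS' : mu.-integrable circ (EFin \o (fun t => complex.Re (schwarz (cayley w) t) * v t)).
  by apply: eq_integrable iS => // t _; rewrite /= ReMr.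
have mS : measurable_fun setT (fun t => complex.Re (schwarz (cayley w) t) * v t).
  by apply: measurable_funM => //; exact: (cmeas_schwarz _ _).1.
have [_ ->] := transfers_integrable mS iS'.
transitivity ((2 * pi)^-1 * \int[mu]_y (2 * pi * (poisson w y * V y))).
  congr (_ * _); apply: eq_Rintegral => y _.
  by rewrite mulrAC schwarz_poisson// mulrA.
have gen (u : R -> R) : mu.-integrable setT (EFin \o u) ->
    (2 * pi)^-1 * \int[mu]_y (2 * pi * u y) = \int[mu]_y u y.
  by move=> iu; rewrite RintegralZl// mulKf// gt_eqF// mulr_gt0// pi_gt0.
exact: gen (integrable_poissonM w0 iV).
Qed.

Let phi_cst : R := 2 * Num.sqrt pi.

Let phi_cst_gt0 : 0 < phi_cst.
Proof. by rewrite mulr_gt0// sqrtr_gt0 pi_gt0. Qed.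

Let FG w : Cplus w -> F w = (1 + cayley w) / phi_cst%:C * G (cayley w).
Proof.
move=> w0; rewrite FE// /G /Phi -/(cayley (cayley w)) cayleyK ?Cplus1_neq0//.
have z0 := Cdisk1_neq0 (cayley_disk w0).
have p0 : phi_cst%:C != 0 :> R[i] by rewrite -normc_eq0 normc_real normr_eq0 gt_eqF.
rewrite -/phi_cst; move: (phi_cst%:C) p0 => p p0; field.
by rewrite z0 p0.
Qed.

(* Almost everywhere the modulus of the boundary function is the limit of the
   exponentials of the Poisson integrals; in particular it is not zero. *)
Let boundary_ae : {ae mu, forall y,
  normc (boundary_Cplus F y) = normc (1 + zeta (angle y)) / phi_cst * expR (V y)}.
Proof.
have [H hH] := fourier_pair_exists lh.
move: (laplace_nontangential hH) (lebesgue_pt_ae iV); apply: ae_imp2 => y nt leb.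
have ntF : nontangential F y (H y).
  move=> C e C0 e0; have [d d0 P] := nt C e C0 e0; exists d => // w w0 wd cone.
  by rewrite FE//; exact: P.
rewrite (boundary_Cplus_eq ntF).
have c1 : normc (F (x +i* y)) @[x --> (0 : R)^'+] --> normc (H y).
  by apply: ccvg_normc; exact: nontangential_boundary ntF.
have n0 : 1 + 0 +i* y != 0 :> R[i].
  by apply/eqP => /(congr1 (@complex.Re R)) /=; lra.
have c2 : (cayley (x +i* y) : R[i]^o) @[x --> (0 : R)^'+] --> (zeta (angle y) : R[i]^o).
  have cx : ((x +i* y) : R[i]^o) @[x --> (0 : R)^'+] --> (0 +i* y : R[i]^o).
    apply/cvg_ReIm; split => /=; last exact: cvg_cst.
    exact: cvg_at_right_filter.
  have k1 : (1 - (x +i* y) : R[i]^o) @[x --> (0 : R)^'+] --> (1 - 0 +i* y : R[i]^o).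
    by apply: ccvgB; [exact: ccvg_cst|exact: cx].
  have k2 : (1 + (x +i* y) : R[i]^o) @[x --> (0 : R)^'+] --> (1 + 0 +i* y : R[i]^o).
    by apply: ccvgD; [exact: ccvg_cst|exact: cx].
  by rewrite zeta_angle; exact: (ccvgM k1 (ccvgV n0 k2)).
have c3 : \int[mu]_s (poisson (x +i* y) s * V s) @[x --> (0 : R)^'+] --> V y.
  apply/cvgrPdist_le => e e0; have [d d0 P] := poisson_nontangential iV leb (lexx 0) e0.
  near=> x; rewrite distrC; apply: P => /=.
  - by near: x; exact: nbhs_right_gt.
  - by near: x; exact: nbhs_right_lt.
  - by rewrite subrr normr0 mul0r.
apply: (cvg_unique _ c1) => //.
have c4 : normc (1 + cayley (x +i* y)) / phi_cst * expR (\int[mu]_s (poisson (x +i* y) s * V s))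
    @[x --> (0 : R)^'+] --> normc (1 + zeta (angle y)) / phi_cst * expR (V y).
  apply: cvgM.
    have k1 : (1 + cayley (x +i* y) : R[i]^o) @[x --> (0 : R)^'+] --> (1 + zeta (angle y) : R[i]^o).
      by apply: ccvgD; [exact: ccvg_cst|exact: c2].
    by apply: cvgMl; exact: (ccvg_normc k1).
  exact: (continuous_cvg _ (@continuous_expR R (V y)) c3).
apply: cvg_trans c4; apply: near_eq_cvg; near=> x.
have x0 : Cplus (x +i* y) by rewrite /Cplus/=; near: x; exact: nbhs_right_gt.
by rewrite FG// normcM normc_G_poisson// normcM normcV normc_real gtr0_norm.
Unshelve. all: by end_near. Qed.

Let one_plus_zeta_gt0 y : 0 < normc (1 + zeta (angle y)).
Proof.
rewrite normc_gt0 zeta_angle.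
have n0 : 1 + 0 +i* y != 0 :> R[i] by apply/eqP => /(congr1 (@complex.Re R)) /=; lra.
have -> : 1 + cayley (0 +i* y) = 2 / (1 + 0 +i* y) by rewrite /cayley; field.
by rewrite mulf_neq0 ?invr_neq0// pnatr_eq0.
Qed.

Lemma boundary_Cplus_neq0_ae : {ae mu, forall y, boundary_Cplus F y != 0}.
Proof.
move: boundary_ae; apply: ae_imp => y e; rewrite -normc_gt0 e.
by rewrite mulr_gt0 ?expR_gt0// divr_gt0 ?phi_cst_gt0// one_plus_zeta_gt0.
Qed.

(** Under the Cayley map the outer function [1 + z] accounts for the factor
    that distinguishes the two Hardy spaces. *)
Lemma outer_Cplus_of_disk : outer_Cplus F.
Proof.
have HF : H2Cplus F by exact: (H2Cplus_laplace lh FE).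
have Fneq0 w : Cplus w -> F w != 0.
  move=> w0; rewrite FE//; exact: (minimum_phase_laplace_neq0 (conj lh oG)).
split => //.
  by exists 1; [exact: ltr01|apply: Fneq0; exact: ltr01].
have [_ _ [l l1 E]] := oG; exists l => // w w0.
have z1 := cayley_disk w0; set z := cayley w in z1 *.
pose q t := log_mod (-1) t - ln phi_cst + v t.
have n1 : normc (-1 : R[i]) <= 1 by rewrite normcNr normc1.
have il := integrable_log_mod n1; have ml : measurable_fun setT (log_mod (-1 : R[i])).
  exact: measurable_log_mod.
have ic := integrable_circ_cst (ln phi_cst).
have mq : measurable_fun setT q.
  by apply: measurable_funD => //; apply: measurable_funB.
have iq : mu.-integrable circ (EFin \o q).
  apply: integrable_EFinD => //; exact: integrable_EFinB.
have j1 := schwarz_bounded z1 ml il.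
have j2 := schwarz_bounded z1 (measurable_cst (ln phi_cst)) ic.
have j3 := schwarz_bounded z1 mv iv.
have S1 : cintegral circ (fun t => schwarz z t * (q t)%:C) =
    cintegral circ (fun t => schwarz z t * (log_mod (-1) t)%:C) -
    (2 * pi)%:C * (ln phi_cst)%:C + cintegral circ (fun t => schwarz z t * (v t)%:C).
  rewrite -(schwarz1 z1) -cintegralZr//; last first.
    by apply: (@cintegrable_circ _ _ (2 / (1 - normc z))) => [|t]; [exact: cmeas_schwarz|exact: normc_schwarz_le].
  rewrite -cintegralB// -cintegralD//; last exact: cintegrableB.
  apply: eq_cintegral => t _.
  cbv beta; rewrite /q; move: (schwarz z t) (log_mod _ t) (v t) => [k1 k2] a b.
  by apply: complex_eq => /=; ring.
have p0 : (2 * pi)%:C != 0 :> R[i] by rewrite -normc_eq0 normc_real normr_eq0 gt_eqF// mulr_gt0// pi_gt0.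
have c0 : phi_cst%:C != 0 :> R[i] by rewrite -normc_eq0 normc_real normr_eq0 gt_eqF.
have key (a b : R[i]) : cexp ((2 * pi)^-1%:C * a) = 1 + z ->
    (1 + z) / phi_cst%:C * (l * cexp ((2 * pi)^-1%:C * b)) =
    l * cexp ((2 * pi)^-1%:C * (a - (2 * pi)%:C * (ln phi_cst)%:C + b)).
  move=> ea; have -> : ((2 * pi)^-1)%:C * (a - (2 * pi)%:C * (ln phi_cst)%:C + b) =
      ((2 * pi)^-1)%:C * a - (ln phi_cst)%:C + ((2 * pi)^-1)%:C * b.
    rewrite mulrDr mulrBr; congr (_ - _ + _).
    by rewrite mulrA -real_complexM mulVf ?mul1r// gt_eqF// mulr_gt0// pi_gt0.
  rewrite cexpD cexpB ea cexp_real lnK ?posrE//.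
  by move: (cexp _) (phi_cst%:C) => x p; ring.
have -> : F w = l * cexp ((2 * pi)^-1%:C * cintegral circ (fun t => schwarz z t * (q t)%:C)).
  have GE : G z = l * cexp ((2 * pi)^-1%:C * cintegral circ (fun t => schwarz z t * (v t)%:C)).
    exact: (E z z1).
  rewrite S1 FG// -/z GE; apply: key; rewrite schwarz_log// mulN1r opprK//.
congr (_ * cexp _).
have mS : cmeas setT (fun t => schwarz z t * (q t)%:C).
  by apply: cmeasM; [exact: cmeas_schwarz|exact: cmeas_real].
rewrite (transferC mS); last exact: schwarz_bounded.
have [hol _] := HF.
have mU : measurable_fun setT (fun y => ln (normc (boundary_Cplus F y))).
  apply: measurableT_comp; first exact: measurable_ln.
  exact: (measurable_normc (cmeas_boundary_Cplus hol)).
have mK : cmeas setT (fun y => (y%:C * w + 'i%C) / (y%:C + 'i%C * w)).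
  have my : cmeas setT (fun y : R => y%:C) by exact: cmeas_real.
  apply: cmeasM; first by apply: cmeasD; [apply: cmeasM => //; exact: cmeas_cst|exact: cmeas_cst].
  by apply: cmeasV => //; apply: cmeasD => //; exact: cmeas_cst.
have mD : cmeas setT (fun y => ((angle_density y)%:C : R[i])).
  by apply: cmeas_real; exact: measurable_density.
have iK : cintegrable setT (fun y => (schwarz z (angle y) * (q (angle y))%:C) * (angle_density y)%:C).
  have [i1 i2] := schwarz_bounded z1 mq iq; have [m1 m2] := mS.
  have [k1 _] := transfers_integrable m1 i1; have [k2 _] := transfers_integrable m2 i2.
  split; [apply: eq_integrable k1|apply: eq_integrable k2] => // y _.
    exact: (congr1 EFin (esym (ReMr _ _))).
  exact: (congr1 EFin (esym (ImMr _ _))).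
rewrite [X in _ = _ * X](cintegral_ae_eq (g := fun y => 2^-1%:C *
   ((schwarz z (angle y) * (q (angle y))%:C) * (angle_density y)%:C))) //.
- rewrite cintegralZl// mulrA -real_complexM; congr (_%:C * _).
  by rewrite invfM mulrC.
- apply: cmeasM => //; apply: cmeas_real; apply: measurable_funM => //.
  by apply: measurable_funVr => //; apply: measurable_funD => //; exact: exprn_measurable.
- apply: cmeasM; first exact: cmeas_cst.
  exact: cintegrable_cmeas iK.
move: boundary_ae; apply: ae_imp => y e _.
rewrite -[schwarz z _]/(schwarz (cayley w) _) schwarz_angle// e.
have n0 := one_plus_zeta_gt0 y.
rewrite lnM ?posrE ?expR_gt0 ?divr_gt0// ln_div ?posrE// expRK.
rewrite /q /log_mod mulN1r opprK -/(V y) /angle_density.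
move: (_ / _ : R[i]) => K; move: (_ - _ + _ : R) => Q.
rewrite -mulrA -real_complexM mulrCA -real_complexM; congr (_ * _%:C).
by move: (1 + y ^+ 2) (lt0r_neq0 (onesqr_gt0 y)) => r r0; field.
Qed.

End OuterTransfer.

(** * Integrals depending on a parameter *)

Section ProductIntegral.
Context {d1 d2 : measure_display} {T1 : measurableType d1} {T2 : measurableType d2}.
Context {R : realType}.
Variables (m1 : {sigma_finite_measure set T1 -> \bar R}).
Variables (m2 : {sigma_finite_measure set T2 -> \bar R}).

Lemma measurable_section_Rintegral (g : T1 * T2 -> R) : measurable_fun setT g ->
  measurable_fun setT (fun x => \int[m2]_y g (x, y)).
Proof.
move=> mg; have mg' : measurable_fun setT (EFin \o g) by exact/measurable_EFinP.
rewrite /Rintegral; apply: measurableT_comp => //.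
rewrite (_ : (fun x => \int[m2]_y (g (x, y))%:E)%E = fun x =>
  (\int[m2]_y ((EFin \o g)^\+ (x, y)) - \int[m2]_y ((EFin \o g)^\- (x, y)))%E); last first.
  by apply/funext => x; rewrite [LHS]integralE; congr (_ - _)%E; apply: eq_integral => y _; rewrite ?funeposE ?funenegE.
apply: emeasurable_funB.
  by apply: (@measurable_fun_fubini_tonelli_F _ _ _ _ _ m2); [exact: measurable_funepos|].
by apply: (@measurable_fun_fubini_tonelli_F _ _ _ _ _ m2); [exact: measurable_funeneg|].
Qed.

(** A product bound makes the function integrable for the product measure, and
    every section integrable, so that no exceptional set arises. *)
Lemma Rintegral_exchange (g : T1 * T2 -> R) (a : T1 -> R) (b : T2 -> R) :
  measurable_fun setT g -> m1.-integrable setT (EFin \o a) ->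
  m2.-integrable setT (EFin \o b) -> (forall x y, `|g (x, y)| <= a x * b y) ->
  \int[m1]_x (\int[m2]_y g (x, y)) = \int[m2]_y (\int[m1]_x g (x, y)).
Proof.
move=> mg ia ib gab.
have mg' : measurable_fun setT (EFin \o g) by exact/measurable_EFinP.
have ma : measurable_fun setT (fun x => `|a x|).
  by have /integrableP[/measurable_EFinP h _] := ia; exact: measurableT_comp.
have mb : measurable_fun setT (fun y => `|b y|).
  by have /integrableP[/measurable_EFinP h _] := ib; exact: measurableT_comp.
have ib' x : m2.-integrable setT (fun y => (a x * b y)%:E).
  by have := integrableZl measurableT (a x) ib.
have ia' y : m1.-integrable setT (fun x => (a x * b y)%:E).
  by have := integrableZr measurableT (b y) ia.
have i2 x : m2.-integrable setT (fun y => (g (x, y))%:E).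
  apply: (le_integrable _ _ _ (ib' x)) => //.
    exact/measurable_EFinP/(measurableT_comp mg (pair1_measurable x)).
  by move=> y _ /=; rewrite lee_fin (le_trans (gab x y))// ler_norm.
have i1 y : m1.-integrable setT (fun x => (g (x, y))%:E).
  apply: (le_integrable _ _ _ (ia' y)) => //.
    exact/measurable_EFinP/(measurableT_comp mg (pair2_measurable y)).
  by move=> x _ /=; rewrite lee_fin (le_trans (gab x y))// ler_norm.
have ig : (m1 \x m2)%E.-integrable setT (EFin \o g).
  apply/integrable12ltyP => //.
  apply: (@le_lt_trans _ _ (\int[m1]_x (`|a x| * \int[m2]_y `|b y|)%:E)%E).
    apply: ge0_le_integral.
    - exact: measurableT.
    - by move=> x _; apply: integral_ge0.
    - apply: (@measurable_fun_fubini_tonelli_F _ _ _ _ _ m2 (fun z => `|(g z)%:E|%E)) => //.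
      exact: measurableT_comp.
    - apply/measurable_EFinP; apply: measurable_funM; first exact: ma.
      exact: measurable_cst.
    move=> x _.
    have -> : (`|a x| * \int[m2]_y `|b y|)%:E = (\int[m2]_y (`|a x| * `|b y|)%:E)%E.
      rewrite EFinM /Rintegral fineK; last first.
        apply: integrable_fin_num; first exact: measurableT.
        exact: (integrable_norm ib).
      rewrite -ge0_integralZl//; exact/measurable_EFinP.
    apply: ge0_le_integral.
    - exact: measurableT.
    - by [].
    - apply: measurableT_comp => //; exact: (measurableT_comp mg' (pair1_measurable x)).
    - by apply/measurable_EFinP; apply: measurable_funM; [exact: measurable_cst|exact: mb].
    - by move=> y _; rewrite /= lee_fin (le_trans (gab x y))// -normrM ler_norm.
  rewrite -[ltLHS]fineK ?ltry//; apply: integrable_fin_num => //.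
  have ia2 := integrable_norm ia.
  by have := integrableZr measurableT (\int[m2]_y `|b y|) ia2.
rewrite /Rintegral; congr fine.
transitivity (\int[m1]_x \int[m2]_y (g (x, y))%:E)%E.
  apply: eq_integral => x _; rewrite fineK//; exact: integrable_fin_num.
transitivity (\int[m2]_y \int[m1]_x (g (x, y))%:E)%E; first exact: Fubini ig.
by apply: eq_integral => y _; rewrite fineK//; exact: integrable_fin_num.
Qed.

End ProductIntegral.

(** * Every operator is a weighted composition operator *)

Section Evaluation.
Variable R : realType.
Local Notation mu := (@lebesgue_measure R).
Implicit Types (f g : R -> R[i]) (w z : R[i]).

Lemma real_complexX (x : R) n : (x ^+ n)%:C = x%:C ^+ n :> R[i].
Proof. by elim: n => [|n IH]; rewrite ?expr0// !exprS real_complexM IH. Qed.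

Lemma real_complexV (x : R) : x != 0 -> (x^-1)%:C = (x%:C)^-1 :> R[i].
Proof.
move=> x0; have c0 : x%:C != 0 :> R[i] by rewrite -normc_eq0 normc_real normr_eq0.
by apply: (mulfI c0); rewrite -real_complexM !mulfV.
Qed.

Lemma powexp_real k (t : R) : powexp k 1 t = (t ^+ k * expR (- t))%:C.
Proof.
rewrite /powexp mul1r (_ : - t%:C = (- t)%:C) ?cexp_real ?real_complexM//.
by apply: complex_eq; rewrite ?ReN ?ImN//= oppr0.
Qed.

Lemma sigma1E : sigma1 = powexp 1 1 :> (R -> R[i]).
Proof. by apply/funext => t; rewrite /sigma1 powexp_real expr1 mulrC. Qed.

Lemma sigma0E : sigma0 = (fun t => 1 * powexp 0 1 t + (-1) * powexp 1 1 t) :> (R -> R[i]).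
Proof.
apply/funext => t; rewrite /sigma0 mul1r mulN1r !powexp_real expr0 expr1.
by apply: complex_eq; rewrite ?ReD ?ReN ?ImD ?ImN/= ?subr0//; ring.
Qed.

Lemma isL2_powexp1 k : isL2 Rplus (powexp k (1 : R[i])).
Proof. by apply: isL2_powexp; exact: one_gt0. Qed.

Lemma isL2_sigma1 : isL2 Rplus (sigma1 : R -> R[i]).
Proof. by rewrite sigma1E; exact: isL2_powexp1. Qed.

Lemma isL2_sigma0 : isL2 Rplus (sigma0 : R -> R[i]).
Proof.
rewrite sigma0E; apply: isL2D; [exact: measurable_Rplus| |];
  by apply: isL2Zl; [exact: measurable_Rplus|exact: isL2_powexp1].
Qed.

Lemma laplace_sigma1 w : Cplus w ->
  laplace sigma1 w = (Num.sqrt (2 * pi))^-1%:C * ((1 + w) ^+ 2)^-1.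
Proof. by move=> w0; rewrite sigma1E laplace_powexp ?one_gt0// mul1r. Qed.

Lemma laplace_sigma0 w : Cplus w ->
  laplace sigma0 w = (Num.sqrt (2 * pi))^-1%:C * (w / (1 + w) ^+ 2).
Proof.
move=> w0; have n0 := Cplus1_neq0 w0.
rewrite sigma0E laplace_linear//; [|exact: isL2_powexp1..].
rewrite !laplace_powexp ?one_gt0// expr1 -[0`!]/1%N -[1`!]/1%N.
by move: ((Num.sqrt (2 * pi))^-1%:C) => k; field.
Qed.

(** The transform of [t ^ k * exp (- t)] is a positive multiple of
    [(1 + z) ^ k] on the disk. *)
Lemma minimum_phase_powexp k : minimum_phase (powexp k (1 : R[i])).
Proof.
split; first exact: isL2_powexp1.
apply: (@outer_disk_power _ _
  (Num.sqrt pi * (Num.sqrt (2 * pi))^-1 * (k`!%:R * 2^-1 ^+ k)) (-1) k).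
- by rewrite !mulr_gt0 ?invr_gt0 ?exprn_gt0 ?sqrtr_gt0 ?mulr_gt0 ?pi_gt0 ?ltr0n ?fact_gt0.
- by rewrite normcNr normc1.
move=> z z1; have z0 := Cdisk1_neq0 z1.
rewrite /Phi -/(cayley z) laplace_powexp ?one_gt0//; last exact: cayley_Cplus.
rewrite -exprVn cayley_inv// !real_complexM real_complexX !real_complex_nat.
rewrite (@real_complexV 2) ?pnatr_eq0// real_complex_nat mulN1r opprK exprMn !exprS.
move: ((1 + z) ^+ k) (2^-1 ^+ k : R[i]) (k`!%:R : R[i]) => a b c.
by move: ((Num.sqrt pi)%:C) ((Num.sqrt (2 * pi))^-1%:C) => u v; field.
Qed.

(** The boundary functions agree almost everywhere, and the boundary function
    determines the norm. *)
Lemma laplace_injective f g : isL2 Rplus f -> isL2 Rplus g ->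
  (forall w, Cplus w -> laplace f w = laplace g w) -> L2eq Rplus f g.
Proof.
move=> lf lg fg.
have [F hF] := fourier_pair_exists lf; have [G hG] := fourier_pair_exists lg.
have hB := fourier_pairB hF hG; have [lB lFG _] := hB.
have lF : isL2 setT F by case: hF.
apply: nrm0_ae_eq => //; first exact: measurable_Rplus.
rewrite -(fourier_pair_nrm hB) (@nrm_ae_eq _ _ _ (fun y => 0 * F y)) //.
- by rewrite nrmZ// normc0 mul0r.
- exact: isL2_cmeas lFG.
- by apply: cmeasM; [exact: cmeas_cst|exact: isL2_cmeas lF].
move: (laplace_nontangential hF) (laplace_nontangential hG); apply: ae_imp2 => y nF nG _.
have nF' : nontangential (laplace g) y (F y).
  move=> C e C0 e0; have [d d0 P] := nF C e C0 e0; exists d => // w w0 wd cone.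
  by rewrite -fg//; exact: P.
by rewrite -(boundary_Cplus_eq nF') (boundary_Cplus_eq nG) subrr mul0r.
Qed.

Definition op_alpha (A : (R -> R[i]) -> (R -> R[i])) w : R[i] :=
  laplace (A sigma0) w + laplace (A sigma1) w.

Definition op_symbol (A : (R -> R[i]) -> (R -> R[i])) w : R[i] :=
  laplace (A sigma0) w / laplace (A sigma1) w.

Definition op_weight (A : (R -> R[i]) -> (R -> R[i])) w : R[i] :=
  (Num.sqrt (2 * pi))%:C * (1 + op_symbol A w) * op_alpha A w.

Section Operator.
Variable A : (R -> R[i]) -> (R -> R[i]).
Hypotheses (cA : L2_continuous_linear A) (pA : preserves_minimum_phase A).

(** The functional [f |-> laplace (A f) w] is a multiple of the evaluation of
    [laplace f] at some [v]; as the transforms of the two test functions are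
    proportional to [v / (1 + v) ^ 2] and [1 / (1 + v) ^ 2], the quotient of
    their images recovers [v] and the sum recovers the multiple. *)
Lemma op_evaluation w : Cplus w ->
  [/\ Cplus (op_symbol A w), laplace (A sigma1) w != 0
    & forall f, isL2 Rplus f ->
        laplace (A f) w = op_weight A w * laplace f (op_symbol A w)].
Proof.
move=> w0; have [v [c [v0 c0 E]]] := laplace_op_evaluation cA pA w0.
have v1 := Cplus1_neq0 v0; have s0 := sqrt2pi_neq0 R.
have E0 := E _ isL2_sigma0; have E1 := E _ isL2_sigma1.
rewrite laplace_sigma0// in E0; rewrite laplace_sigma1// in E1.
have r0 : (Num.sqrt (2 * pi))%:C != 0 :> R[i].
  by rewrite -normc_eq0 normc_real normr_eq0.
rewrite real_complexV// in E0 E1; move: E0 E1 => E0 E1.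
have n1 : laplace (A sigma1) w != 0.
  by rewrite E1 !mulf_neq0// ?invr_neq0// expf_neq0.
have xiE : op_symbol A w = v.
  rewrite /op_symbol E0 E1; move: ((Num.sqrt (2 * pi))%:C) r0 => r r0.
  by field; rewrite c0 v1 r0.
have kE : op_weight A w = c.
  rewrite /op_weight /op_alpha xiE E0 E1; move: ((Num.sqrt (2 * pi))%:C) r0 => r r0.
  by field; rewrite v1 r0.
by split => //; rewrite ?xiE// => f lf; rewrite kE E.
Qed.

Lemma op_symbol_holomorphic : holomorphic_on Cplus (op_symbol A).
Proof.
move=> w w0; have [_ n1 _] := op_evaluation w0.
apply: derivableM.
  by apply: laplace_holomorphic => //; exact: (L2op_stable cA isL2_sigma0).
apply: derivableV => //.
by apply: laplace_holomorphic => //; exact: (L2op_stable cA isL2_sigma1).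
Qed.

(** [sigma0 t + sigma1 t = exp (- t)]. *)
Lemma op_alphaE w : Cplus w -> op_alpha A w = laplace (A (powexp 0 1)) w.
Proof.
move=> w0; rewrite (@laplace_op_eq _ _ cA _ (fun t => 1 * sigma0 t + 1 * sigma1 t)).
- rewrite (laplace_op_linear cA _ _ isL2_sigma0 isL2_sigma1 w0) !mul1r.
  by [].
- exact: isL2_powexp1.
- apply: isL2D; [exact: measurable_Rplus| |];
    apply: isL2Zl; [exact: measurable_Rplus|exact: isL2_sigma0|exact: measurable_Rplus|exact: isL2_sigma1].
- by move=> t _; rewrite sigma0E sigma1E; ring.
Qed.

Lemma op_alpha_outer : outer_Cplus (op_alpha A).
Proof.
have [l o] := pA (minimum_phase_powexp 0).
exact: (outer_Cplus_of_disk l o op_alphaE).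
Qed.

Lemma op_inverse_laplace f : isL2 Rplus f ->
  is_inverse_laplace (Mop (op_weight A) (Cop (op_symbol A) (laplace f))) (A f).
Proof.
move=> lf; have lAf := L2op_stable cA lf.
have E w : Cplus w -> Mop (op_weight A) (Cop (op_symbol A) (laplace f)) w = laplace (A f) w.
  by move=> /op_evaluation[_ _ P]; rewrite P.
split => //; last by move=> w w0; rewrite E.
exact: (H2Cplus_laplace lAf E).
Qed.

Lemma boundary_sigma1_neq0 : {ae mu, forall y, boundary_Cplus (laplace (A sigma1)) y != 0}.
Proof.
have [l o] := pA (minimum_phase_powexp 1); rewrite sigma1E.
exact: (boundary_Cplus_neq0_ae l o).
Qed.

End Operator.

(** The symbol and the weight are computed from the images of [sigma0] and
    [sigma1] only. *)
Lemma op_determined (A B : (R -> R[i]) -> (R -> R[i])) f :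
  L2_continuous_linear A -> preserves_minimum_phase A ->
  L2_continuous_linear B -> preserves_minimum_phase B ->
  L2eq Rplus (A sigma0) (B sigma0) -> L2eq Rplus (A sigma1) (B sigma1) ->
  isL2 Rplus f -> L2eq Rplus (A f) (B f).
Proof.
move=> cA pA cB pB e0 e1 lf.
have l0 := L2op_stable cA isL2_sigma0; have l1 := L2op_stable cA isL2_sigma1.
have m0 := L2op_stable cB isL2_sigma0; have m1 := L2op_stable cB isL2_sigma1.
apply: laplace_injective; [exact: L2op_stable cA _ lf|exact: L2op_stable cB _ lf|].
move=> w w0; have [_ _ EA] := op_evaluation cA pA w0.
have [_ _ EB] := op_evaluation cB pB w0; rewrite (EA f lf) (EB f lf).
by rewrite /op_weight /op_symbol /op_alpha (laplace_ae_eq _ l0 m0 e0) (laplace_ae_eq _ l1 m1 e1).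
Qed.

End Evaluation.

(** * Truncated integrals *)

Section Truncation.
Variable R : realType.
Local Notation mu := (@lebesgue_measure R).
Implicit Types (D I : set R) (f g h H : R -> R[i]) (s w : R[i]).

Lemma cmeas_section (G : R -> R -> R[i]) :
  cmeas setT (fun p : R * R => G p.1 p.2) ->
  cmeas setT (fun x => cintegral setT (G x)).
Proof.
move=> [m1 m2]; split.
  exact: (@measurable_section_Rintegral _ _ _ _ _ mu (fun p => complex.Re (G p.1 p.2))).
exact: (@measurable_section_Rintegral _ _ _ _ _ mu (fun p => complex.Im (G p.1 p.2))).
Qed.

Lemma cintegral_exchange (G : R -> R -> R[i]) (a b : R -> R) :
  cmeas setT (fun p : R * R => G p.1 p.2) ->
  mu.-integrable setT (EFin \o a) -> mu.-integrable setT (EFin \o b) ->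
  (forall x y, normc (G x y) <= a x * b y) ->
  cintegral setT (fun x => cintegral setT (G x)) =
  cintegral setT (fun y => cintegral setT (fun x => G x y)).
Proof.
move=> [m1 m2] ia ib Gab; apply: complex_eq.
  apply: (@Rintegral_exchange _ _ _ _ _ mu mu (fun p => complex.Re (G p.1 p.2)) a b) => //.
  by move=> x y; exact: le_trans (normRe_le _) (Gab x y).
apply: (@Rintegral_exchange _ _ _ _ _ mu mu (fun p => complex.Im (G p.1 p.2)) a b) => //.
by move=> x y; exact: le_trans (normIm_le _) (Gab x y).
Qed.

Definition restr D f t : R[i] := f t * (\1_D t : R)%:C.

Lemma restr_in D f t : D t -> restr D f t = f t.
Proof. by move=> Dt; rewrite /restr indicE mem_set// mulr1. Qed.

Lemma restr_out D f t : ~ D t -> restr D f t = 0.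
Proof. by move=> Dt; rewrite /restr indicE memNset// mulr0. Qed.

Lemma normc_restr_le D f t : normc (restr D f t) <= normc (f t).
Proof.
have [Dt|Dt] := pselect (D t); first by rewrite restr_in.
by rewrite restr_out// normc0 normc_ge0.
Qed.

Lemma Re_restr D f t : complex.Re (restr D f t) = complex.Re (f t) * \1_D t.
Proof. by rewrite /restr ReM /= mulr0 subr0. Qed.

Lemma Im_restr D f t : complex.Im (restr D f t) = complex.Im (f t) * \1_D t.
Proof. by rewrite /restr ImM /= mulr0 add0r. Qed.

Lemma cmeas_restr D f : measurable D -> cmeas D f -> cmeas setT (restr D f).
Proof.
move=> mD [m1 m2]; split.
  have := (measurable_restrictT (fun t => complex.Re (f t)) mD).1 m1.
  by rewrite patch_indic; apply: eq_measurable_fun => t _; rewrite Re_restr.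
have := (measurable_restrictT (fun t => complex.Im (f t)) mD).1 m2.
by rewrite patch_indic; apply: eq_measurable_fun => t _; rewrite Im_restr.
Qed.

Lemma cintegrable_restr D f : measurable D -> cintegrable D f ->
  cintegrable setT (restr D f).
Proof.
move=> mD ic; have iN := cintegrable_normc mD ic.
have mf := cmeas_restr mD (cintegrable_cmeas ic).
apply: (cintegrable_le measurableT mf _ (fun t _ => lexx _)).
apply: integrable_ge0; [exact: measurable_normc|by move=> t _; exact: normc_ge0|].
have -> : (\int[mu]_(t in setT) (normc (restr D f t))%:E =
           \int[mu]_(t in D) (normc (f t))%:E)%E.
  rewrite [RHS]integral_mkcond; apply: eq_integral => t _.
  rewrite patchE; case: ifPn => [/set_mem Dt|/negP Dt]; first by rewrite restr_in.
  by rewrite restr_out ?normc0// => /mem_set.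
by rewrite -[ltLHS]fineK ?ltry//; apply: integrable_fin_num.
Qed.

Lemma cintegral_supp D I f : measurable D -> I `<=` D ->
  (forall t, ~ I t -> f t = 0) -> cintegral D f = cintegral I f.
Proof.
move=> mD ID f0; rewrite -[in RHS](setIidr ID) -cintegral_indic//.
apply: eq_cintegral => t _.
have [It|It] := pselect (I t); first by rewrite indicE mem_set// mulr1.
by rewrite f0// mul0r.
Qed.

Lemma cintegral_restr I f g : cintegral I (fun t => f t * g t) =
  cintegral setT (fun t => f t * restr I g t).
Proof.
rewrite (@cintegral_supp setT I)//; last by move=> t It; rewrite restr_out ?mulr0.
by apply: eq_cintegral => t /set_mem It; rewrite restr_in.
Qed.

Lemma isL2_restr D I f : measurable D -> measurable I -> isL2 D f -> isL2 D (restr I f).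
Proof. by move=> mD mI lf; exact: isL2_indic. Qed.

Lemma isL2_restr_sub D I f : measurable D -> measurable I -> I `<=` D ->
  isL2 I f -> isL2 D (restr I f).
Proof.
move=> mD mI ID lf.
have c := cintegrable_restr mI (cintegrable_real mI (isL2_integrable lf)).
have [c1 _] := cintegrableS mD measurableT (@subsetT _ D) c.
apply: (isL2_le mD _ c1); first by apply: cmeasS (cmeas_restr mI (isL2_cmeas lf)).
move=> t _; have [It|It] := pselect (I t); first by rewrite !restr_in.
by rewrite !restr_out// normc0 expr0n.
Qed.

Lemma nrm_restr D f (e : R) : measurable D -> isL2 D f -> 0 < e ->
  exists n : nat, forall T : R, n%:R <= T ->
    nrm D (fun t => restr `[- T, T] f t - f t) <= e.
Proof.
move=> mD lf e0.
have lr T : isL2 D (restr `[- T, T] f) by apply: isL2_restr => //; exact: measurable_itv.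
have c : nrm D (fun t => restr `[- n%:R, n%:R] f t - f t) @[n --> \oo] --> (0 : R).
  apply: (@nrm_dominated _ D (fun n : nat => restr `[- n%:R, n%:R] f) f f) => //.
  - by move=> n; apply: isL2_cmeas; exact: lr.
  - apply: aeW => t _.
    have c0 : (f t : R[i]^o) @[_ --> \oo] --> (f t : R[i]^o) by exact: ccvg_cst.
    apply: cvg_trans c0.
    apply: near_eq_cvg; near=> n.
    by rewrite restr_in// /mkset /= in_itv/= -ler_norml; near: n; exact: nbhs_infty_ger.
  - by move=> n t _; exact: normc_restr_le.
move/cvgrPdist_le: c => /(_ e e0)[n _ P]; exists n => T nT.
have := P n (leqnn n); rewrite sub0r normrN ger0_norm ?nrm_ge0//; apply: le_trans.
apply: nrm_le => //; [by apply: isL2B => //; exact: lr..|move=> t _].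
have [It|It] := pselect ((`[- T, T]%classic : set R) t).
  by rewrite restr_in// subrr normc0 normc_ge0.
rewrite !restr_out// => In; apply: It; move: In; rewrite /mkset /= !in_itv/= => /andP[].
by move=> a b; apply/andP; split; lra.
Unshelve. all: by end_near. Qed.

Lemma L2lim_intro D (u : R -> R -> R[i]) g : measurable D ->
  (forall T, 0 <= T -> isL2 D (u T)) -> isL2 D g ->
  (forall e : R, 0 < e -> exists n : nat, forall T, 0 <= T -> n%:R <= T ->
     nrm D (fun t => u T t - g t) <= e) ->
  L2lim D u g.
Proof.
move=> mD lu lg small.
have pos : \forall T \near +oo, 0 <= (T : R) by apply: nbhs_pinfty_ge; exact: num_real.
have E : \forall T \near +oo, L2norm D (fun t => u T t - g t) = (nrm D (fun t => u T t - g t))%:E.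
  by move: pos; apply: filterS => T T0; apply: L2norm_nrm; apply: isL2B => //; exact: lu.
split => //; first by move: pos; apply: filterS; exact: lu.
apply/fine_cvgP; split; first by move: E; apply: filterS => T ->.
apply/cvgrPdist_le => e e0; have [n P] := small e e0.
have big : \forall T \near +oo, n%:R <= (T : R) by apply: nbhs_pinfty_ge; exact: num_real.
near=> T; rewrite sub0r normrN /= (near E T)// ger0_norm ?nrm_ge0//.
by apply: P; near: T.
Unshelve. all: by end_near. Qed.

Lemma integrable_itv_cst (a b M : R) : mu.-integrable `[a, b] (EFin \o cst M).
Proof.
apply: continuous_compact_integrable; first exact: segment_compact.
by apply: continuous_subspaceT; exact: cst_continuous.
Qed.

Lemma isL2_itv_cintegrable (a b : R) f : isL2 `[a, b] f -> cintegrable `[a, b] f.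
Proof.
move=> lf; have mI : measurable (`[a, b]%classic : set R) by exact: measurable_itv.
have l1 : isL2 `[a, b] (fun=> 1 : R[i]).
  apply: (@isL2_le _ _ _ (cst 1)); [exact: mI|by apply: cmeas_cst| |].
    by apply: integrable_itv_cst.
  by move=> t _; rewrite normc1 expr1n.
have := isL2_mul_cintegrable mI lf l1; apply: eq_cintegrable => // t _.
by rewrite mulr1.
Qed.

Lemma sub_Rplus (T : R) : `[0, T]%classic `<=` (Rplus : set R).
Proof. by move=> t; rewrite /mkset /= in_itv/= => /andP[t0 _]; apply/RplusP. Qed.

Lemma isL2_Rplus_itv (T : R) f : isL2 Rplus f -> isL2 `[0, T] f.
Proof.
apply: isL2S; [exact: measurable_itv|exact: measurable_Rplus|exact: sub_Rplus].
Qed.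

(** The Laplace integral over a bounded interval, without the normalizing
    constant; it makes sense for every complex [s]. *)
Definition trunc_laplace (T : R) f s : R[i] :=
  cintegral `[0, T] (fun t => cexp (- (t%:C * s)) * f t).

Lemma laplace_supp (T : R) f s : (forall t, Rplus t -> ~ (`[0, T]%classic : set R) t -> f t = 0) ->
  laplace f s = (fourier_cst R)%:C * trunc_laplace T f s.
Proof.
move=> f0; rewrite /laplace /trunc_laplace; congr (_ * _).
transitivity (cintegral Rplus (fun t => (cexp (- (t%:C * s)) * f t) * (\1_(`[0, T]) t : R)%:C)).
  apply: eq_cintegral => t /set_mem tp.
  have [It|It] := pselect ((`[0, T]%classic : set R) t).
    by rewrite indicE mem_set// mulr1 mulrC [s * _]mulrC.
  by rewrite f0// mulr0 !mul0r.
rewrite cintegral_indic ?(setIidr (@sub_Rplus T))//; exact: measurable_Rplus.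
Qed.

Lemma laplace_restr (T : R) f s :
  laplace (restr `[- T, T] f) s = (fourier_cst R)%:C * trunc_laplace T f s.
Proof.
rewrite (@laplace_supp T) => [|t /RplusP t0 It].
  congr (_ * _); apply: eq_cintegral => t /set_mem; rewrite /mkset /= in_itv/= => /andP[t0 tT].
  by rewrite restr_in// /mkset /= in_itv/= tT andbT; lra.
rewrite restr_out// => J; apply: It; move: J; rewrite /mkset /= !in_itv/= => /andP[_ tT].
by rewrite t0 tT.
Qed.

Lemma normc_cexp_itv_le (T t : R) s : 0 <= t <= T ->
  normc (cexp (- (t%:C * s))) <= expR (T * normc s).
Proof.
move=> /andP[t0 tT]; rewrite normc_cexp ler_expR ReN ReM /= mul0r subr0.
have := normRe_le s; rewrite ler_norml => /andP[h _].
have n0 := normc_ge0 s; have := ler_wpM2r n0 tT; have := ler_wpM2l t0 h; lra.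
Qed.

Lemma cmeas_expM (D : set R) s : measurable D -> cmeas D (fun t => cexp (- (t%:C * s))).
Proof.
move=> mD; apply: cmeas_cexp; apply: cmeasN; apply: cmeasM; last exact: cmeas_cst.
by apply: cmeas_real.
Qed.

Lemma trunc_laplace_cintegrable (T : R) f s : isL2 `[0, T] f ->
  cintegrable `[0, T] (fun t => cexp (- (t%:C * s)) * f t).
Proof.
move=> lf; have mI : measurable (`[0, T]%classic : set R) by exact: measurable_itv.
have iF := cintegrable_normc mI (isL2_itv_cintegrable lf).
apply: (@cintegrable_le _ _ _ (fun t => expR (T * normc s) * normc (f t))) => //.
- by apply: cmeasM; [exact: cmeas_expM|exact: isL2_cmeas lf].
- exact: integrable_EFinZl.
move=> t; rewrite /mkset /= in_itv/= => It.
by rewrite normcM ler_wpM2r ?normc_ge0// normc_cexp_itv_le.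
Qed.

(** The kernel differs from its value at [s0] by the factor
    [cexp (- (t * (s - s0))) - 1]. *)
Lemma trunc_laplace_lipschitz (T : R) f s0 : 0 <= T -> isL2 `[0, T] f ->
  exists2 C : R, 0 <= C & forall s, normc (s - s0) <= 1 ->
    normc (trunc_laplace T f s - trunc_laplace T f s0) <= C * normc (s - s0).
Proof.
move=> T0 lf; have mI : measurable (`[0, T]%classic : set R) by exact: measurable_itv.
have iF := cintegrable_normc mI (isL2_itv_cintegrable lf).
pose C := expR (T * normc s0) * (T * expR T).
exists (C * \int[mu]_(t in `[0, T]) normc (f t)).
  by rewrite !mulr_ge0 ?expR_ge0// Rintegral_ge0// => t _; exact: normc_ge0.
move=> s s1; set d := s - s0 in s1 *.
rewrite /trunc_laplace -cintegralB//; [|exact: trunc_laplace_cintegrable..].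
have -> : C * \int[mu]_(t in `[0, T]) normc (f t) * normc d =
    \int[mu]_(t in `[0, T]) (C * normc d * normc (f t)).
  by rewrite RintegralZl// mulrAC.
apply: le_normc_cintegral_bound => //.
- apply: cmeasB; apply: cintegrable_cmeas; exact: trunc_laplace_cintegrable.
- exact: integrable_EFinZl.
move=> t; rewrite /mkset /= in_itv/= => It; have /andP[t0 tT] := It.
have -> : cexp (- (t%:C * s)) * f t - cexp (- (t%:C * s0)) * f t =
    cexp (- (t%:C * s0)) * (cexp (- (t%:C * d)) - 1) * f t.
  rewrite (_ : - (t%:C * s) = - (t%:C * s0) + - (t%:C * d)); last by rewrite /d; ring.
  by rewrite cexpD; ring.
rewrite normcM ler_wpM2r ?normc_ge0// normcM /C -mulrA.
apply: ler_pM; [exact: normc_ge0|exact: normc_ge0|exact: normc_cexp_itv_le|].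
apply: le_trans (cexpB1_le _) _; rewrite normcNr normcM normc_real ger0_norm//.
have td : t * normc d <= T * normc d by rewrite ler_wpM2r ?normc_ge0.
rewrite [leRHS]mulrAC; apply: ler_pM; [by rewrite mulr_ge0 ?normc_ge0|exact: expR_ge0|exact: td|].
rewrite ler_expR (le_trans td)//; have := ler_wpM2l T0 s1; lra.
Qed.

Lemma trunc_laplace_cvg (T : R) f (X : Type) (F : set_system X) {FF : Filter F}
    (b : X -> R[i]) s0 : 0 <= T -> isL2 `[0, T] f ->
  (b x : R[i]^o) @[x --> F] --> (s0 : R[i]^o) ->
  (trunc_laplace T f (b x) : R[i]^o) @[x --> F] --> (trunc_laplace T f s0 : R[i]^o).
Proof.
move=> T0 lf cb; have [C C0 P] := trunc_laplace_lipschitz s0 T0 lf.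
apply/cvg_normcP => e e0.
have d0 : 0 < Num.min 1 (e / (C + 1)) by rewrite lt_min ltr01 divr_gt0// ltr_wpDl.
have H : \forall x \near F, normc (b x - s0) < Num.min 1 (e / (C + 1)).
  by move: cb => /cvg_normcP; apply.
move: H; apply: filterS => x.
rewrite lt_min => /andP[x1 x2]; apply: le_lt_trans (P _ (ltW x1)) _.
apply: le_lt_trans (ler_wpM2l C0 (ltW x2)) _.
by rewrite mulrA ltr_pdivrMr ?ltr_wpDl// mulrC ltr_pM2l//; lra.
Qed.

Lemma cmeas_trunc_laplace (T : R) f (b : R -> R[i]) : isL2 `[0, T] f ->
  cmeas setT b -> cmeas setT (fun y => trunc_laplace T f (b y)).
Proof.
move=> lf [b1 b2].
have mI : measurable (`[0, T]%classic : set R) by exact: measurable_itv.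
have [f1 f2] := cmeas_restr mI (isL2_cmeas lf).
have -> : (fun y => trunc_laplace T f (b y)) = fun y =>
    cintegral setT (fun t => cexp (- (t%:C * b y)) * restr `[0, T] f t).
  by apply/funext => y; rewrite /trunc_laplace cintegral_restr.
apply: (@cmeas_section (fun y t => cexp (- (t%:C * b y)) * restr `[0, T] f t)).
apply: cmeasM.
  apply: cmeas_cexp; apply: cmeasN; apply: cmeasM.
    by apply: cmeas_real; exact: measurable_snd.
  split; first exact: (measurableT_comp b1 measurable_fst).
  exact: (measurableT_comp b2 measurable_fst).
split; first exact: (measurableT_comp f1 measurable_snd).
exact: (measurableT_comp f2 measurable_snd).
Qed.

End Truncation.

(** * Inversion of the Fourier transform *)

Section Inversion.
Variable R : realType.
Local Notation mu := (@lebesgue_measure R).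
Implicit Types (D I : set R) (f g h H : R -> R[i]) (s w : R[i]).

Lemma boundary_Cplus_lim (F : R[i] -> R[i]) (y : R) l :
  (F (x +i* y) : R[i]^o) @[x --> (0 : R)^'+] --> (l : R[i]^o) -> boundary_Cplus F y = l.
Proof.
move=> h; rewrite /boundary_Cplus.
apply: (ccvg_unique (F := (0 : R)^'+) (f := fun x => F (x +i* y))); last exact: h.
by move/cvgP: h.
Qed.

Lemma ccvg_vertical (y : R) :
  ((x +i* y) : R[i]^o) @[x --> (0 : R)^'+] --> (0 +i* y : R[i]^o).
Proof. by apply/cvg_ReIm; split => /=; [exact: cvg_at_right_filter|exact: cvg_cst]. Qed.

(** For a function of bounded support the integral defining the Laplace
    transform converges on the imaginary axis too, and gives the boundary
    function. *)
Lemma fourier_pair_supp (T : R) f H : 0 <= T -> fourier_pair f H ->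
  (forall t, Rplus t -> ~ (`[0, T]%classic : set R) t -> f t = 0) ->
  {ae mu, forall y, H y = (fourier_cst R)%:C * trunc_laplace T f (0 +i* y)}.
Proof.
move=> T0 fH f0; have lf : isL2 Rplus f by case: fH.
move: (laplace_nontangential fH); apply: ae_imp => y nt.
apply: (ccvg_unique (F := (0 : R)^'+) (f := fun x => laplace f (x +i* y))).
  exact: nontangential_boundary nt.
apply: (eq_ccvg (f := fun x => (fourier_cst R)%:C * trunc_laplace T f (x +i* y))).
  by move=> x; rewrite (laplace_supp _ f0).
apply: ccvgMl; apply: (@trunc_laplace_cvg _ T f _ _ _ (fun x => x +i* y) _ T0 (isL2_Rplus_itv _ lf)).
exact: ccvg_vertical.
Qed.

Definition inverse_truncated (N : R) H t : R[i] :=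
  (fourier_cst R)%:C * cintegral `[- N, N] (fun y => cexp (0 +i* (y * t)) * H y).

Section Pair.
Variables (h H : R -> R[i]) (N : R).
Hypothesis hH : fourier_pair h H.

Let lh : isL2 Rplus h. Proof. by case: hH. Qed.
Let lH : isL2 setT H. Proof. by case: hH. Qed.
Let mN : measurable (`[- N, N]%classic : set R). Proof. exact: measurable_itv. Qed.
Let k := (fourier_cst R)%:C : R[i].
Let HN := restr `[- N, N] H.
Let kN := inverse_truncated N H.

Let iHN : cintegrable setT HN.
Proof.
apply: cintegrable_restr => //; apply: isL2_itv_cintegrable.
by apply: isL2S lH.
Qed.

Let mHN : cmeas setT HN. Proof. exact: cintegrable_cmeas iHN. Qed.

Let normc_expi (a : R) : normc (cexp (0 +i* a) : R[i]) = 1.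
Proof. exact: cexp_im_normc. Qed.

Let iexpHN t : cintegrable setT (fun y => cexp (0 +i* (y * t)) * HN y).
Proof.
apply: (@cintegrable_le _ _ _ (fun y => normc (HN y))) => //.
- apply: cmeasM => //; apply: cmeas_cexp; apply: cmeas_pair => //.
  by apply: measurable_funM.
- exact: cintegrable_normc.
by move=> y _; rewrite normcM normc_expi mul1r.
Qed.

Let kNE t : kN t = cintegral setT (fun y => k * (cexp (0 +i* (y * t)) * HN y)).
Proof. by rewrite cintegralZl// /kN /inverse_truncated cintegral_restr. Qed.

Let cmeas_snd (f : R -> R[i]) : cmeas setT f -> cmeas setT (fun p : R * R => f p.2).
Proof.
move=> [f1 f2]; split; first exact: (measurableT_comp f1 measurable_snd).
exact: (measurableT_comp f2 measurable_snd).
Qed.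

Let cmeas_fst (f : R -> R[i]) : cmeas setT f -> cmeas setT (fun p : R * R => f p.1).
Proof.
move=> [f1 f2]; split; first exact: (measurableT_comp f1 measurable_fst).
exact: (measurableT_comp f2 measurable_fst).
Qed.

Let cmeas_kernel : cmeas setT (fun p : R * R => cexp (0 +i* (p.2 * p.1)) * HN p.2).
Proof.
apply: cmeasM; last exact: cmeas_snd.
apply: cmeas_cexp; apply: cmeas_pair => //.
by apply: measurable_funM; [exact: measurable_snd|exact: measurable_fst].
Qed.

Let mkN : cmeas setT kN.
Proof.
have -> : kN = fun t => cintegral setT (fun y => k * (cexp (0 +i* (y * t)) * HN y)).
  by apply/funext => t; exact: kNE.
apply: (@cmeas_section _ (fun t y => k * (cexp (0 +i* (y * t)) * HN y))).
by apply: cmeasM; [exact: cmeas_cst|exact: cmeas_kernel].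
Qed.

Let bound : R := \int[mu]_(y in setT) (normc k * normc (HN y)).

Let kN_le t : normc (kN t) <= bound.
Proof.
rewrite kNE; apply: le_normc_cintegral_bound => //.
- by apply: cmeasM; [exact: cmeas_cst|exact: cintegrable_cmeas].
- by apply: integrable_EFinZl => //; exact: cintegrable_normc.
by move=> y _; rewrite normcM [normc (_ * HN y)]normcM normc_expi mul1r.
Qed.

Let eps := nrm setT (fun y => HN y - H y).

Section Bounded.
Variable M : R.
Hypothesis M0 : 0 <= M.
Local Notation I := (`[0, M]%classic : set R).
Let mI : measurable I. Proof. exact: measurable_itv. Qed.
Let IR : I `<=` Rplus. Proof. exact: sub_Rplus. Qed.
Let phi := restr I (fun t => kN t - h t).
Let kM := restr I kN.
Let hM := restr I h.

Lemma isL2_inverse_truncated : isL2 I kN.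
Proof.
apply: (@isL2_le _ _ _ (cst (bound ^+ 2))).
- exact: mI.
- by apply: cmeasS mkN.
- by apply: integrable_itv_cst.
by move=> t _; rewrite ler_pXn2r ?nnegrE ?normc_ge0// (le_trans (normc_ge0 _) (kN_le t)).
Qed.

Let lpsi : isL2 I (fun t => kN t - h t).
Proof. by apply: isL2B; [exact: mI|exact: isL2_inverse_truncated|exact: isL2_Rplus_itv]. Qed.

Let mR : measurable (Rplus : set R). Proof. exact: measurable_Rplus. Qed.

Let lphi : isL2 Rplus phi. Proof. exact: (isL2_restr_sub mR mI IR lpsi). Qed.
Let lkM : isL2 Rplus kM. Proof. exact: (isL2_restr_sub mR mI IR isL2_inverse_truncated). Qed.
Let lhM : isL2 Rplus hM. Proof. exact: (isL2_restr_sub mR mI IR (isL2_Rplus_itv _ lh)). Qed.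

Let iphi : cintegrable setT phi.
Proof. exact: (cintegrable_restr mI (isL2_itv_cintegrable lpsi)). Qed.

Let conjc0 : conjc (0 : R[i]) = 0.
Proof. by apply: complex_eq => //=; rewrite oppr0. Qed.

Let conjk : conjc k = k.
Proof. by apply: complex_eq => //=; rewrite oppr0. Qed.

Let G t y := k * (cexp (0 +i* (y * t)) * HN y) * conjc (phi t).

Let G_section y :
  cintegral setT (fun t => G t y) = HN y * conjc (k * trunc_laplace M phi (0 +i* y)).
Proof.
have lI : isL2 I phi by apply: isL2_Rplus_itv.
rewrite conjcM conjk /trunc_laplace -cintegral_conj//; last exact: trunc_laplace_cintegrable.
have E t : conjc (cexp (- (t%:C * (0 +i* y))) * phi t) = cexp (0 +i* (y * t)) * conjc (phi t).
  rewrite conjcM conj_cexp; congr (cexp _ * _).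
  by apply: complex_eq => /=; ring.
rewrite (@cintegral_supp _ setT I)//; last first.
  by move=> t It; rewrite /G /phi (restr_out _ It) conjc0 mulr0.
have i0 := trunc_laplace_cintegrable (0 +i* y) lI.
have i1 : cintegrable I (fun t => cexp (0 +i* (y * t)) * conjc (phi t)).
  apply: (@cintegrable_le _ _ _ (fun t => normc (phi t))) => //.
  - apply: cmeasM; last by apply: cmeas_conj; exact: isL2_cmeas lI.
    by apply: cmeas_cexp; apply: cmeas_pair => //; apply: measurable_funM.
  - by apply: cintegrable_normc => //; exact: isL2_itv_cintegrable.
  by move=> t _; rewrite normcM normc_expi mul1r normc_conj.
transitivity (cintegral I (fun t => (k * HN y) * (cexp (0 +i* (y * t)) * conjc (phi t)))).
  by apply: eq_cintegral => t _; rewrite /G; ring.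
rewrite cintegralZl// [k * HN y]mulrC -mulrA; congr (_ * (_ * _)).
by apply: eq_cintegral => t _; rewrite E.
Qed.

Let inner_kM K : fourier_pair phi K -> inner Rplus kM phi = inner setT HN K.
Proof.
move=> pK; have lK : isL2 setT K by case: pK.
have supp t : ~ I t -> phi t = 0 by move=> It; rewrite /phi (restr_out _ It).
have aeK := fourier_pair_supp M0 pK (fun t _ => supp t).
transitivity (cintegral setT (fun t => kN t * conjc (phi t))).
  rewrite (@cintegral_supp _ setT I)//; last by move=> t It; rewrite supp// conjc0 mulr0.
  rewrite /inner (@cintegral_supp _ Rplus I)//; last by move=> t It; rewrite supp// conjc0 mulr0.
  by apply: eq_cintegral => t /set_mem It; rewrite /kM (restr_in _ It).
transitivity (cintegral setT (fun t => cintegral setT (G t))).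
  apply: eq_cintegral => t _; rewrite kNE -cintegralZr//.
  by apply: cintegrableZl.
transitivity (cintegral setT (fun y => cintegral setT (fun t => G t y))).
  apply: (cintegral_exchange (a := fun t => normc k * normc (phi t)) (b := fun y => normc (HN y))).
  - apply: cmeasM; last by apply: cmeas_conj; apply: cmeas_fst; exact: cintegrable_cmeas iphi.
    by apply: cmeasM; [exact: cmeas_cst|exact: cmeas_kernel].
  - by apply: integrable_EFinZl => //; exact: cintegrable_normc.
  - exact: cintegrable_normc.
  move=> t y; rewrite /G normcM [normc (k * _)]normcM [normc (_ * HN y)]normcM.
  by rewrite normc_expi mul1r normc_conj mulrAC.
transitivity (cintegral setT (fun y => HN y * conjc (k * trunc_laplace M phi (0 +i* y)))).
  by apply: eq_cintegral => y _; rewrite G_section.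
apply: cintegral_ae_eq => //.
- apply: cmeasM => //; apply: cmeas_conj; apply: cmeasM; first exact: cmeas_cst.
  apply: cmeas_trunc_laplace; first exact: isL2_Rplus_itv.
  by apply: cmeas_pair.
- by apply: cmeasM => //; apply: cmeas_conj; exact: isL2_cmeas lK.
by move: aeK; apply: ae_imp => y e _; rewrite e.
Qed.

(** Duality: testing the error on the interval against itself moves it to the
    frequency side, where it is paired with the part of [H] that the
    truncation discards. *)
Lemma nrm_inversion_itv : nrm Rplus phi <= eps.
Proof.
have [K pK] := fourier_pair_exists lphi; have lK : isL2 setT K by case: pK.
have lHN : isL2 setT HN by exact: isL2_restr.
have E1 : inner Rplus phi phi = inner Rplus kM phi - inner Rplus hM phi.
  rewrite -(innerBl mR lkM lhM lphi); apply: eq_cintegral => t _.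
  by congr (_ * _); rewrite /phi /kM /hM /restr mulrBl.
have E2 : inner Rplus hM phi = inner setT H K.
  rewrite (fourier_pair_inner hH pK); apply: eq_cintegral => t _.
  have [It|It] := pselect (I t); first by rewrite /hM (restr_in _ It).
  by rewrite /phi (restr_out _ It) conjc0 !mulr0.
have E : (nrm Rplus phi ^+ 2)%:C = inner setT (fun y => HN y - H y) K.
  by rewrite -inner_nrm E1 E2 (inner_kM pK) (innerBl measurableT lHN lH lK).
have := normc_inner_le measurableT (isL2B measurableT lHN lH) lK.
rewrite -E normc_real ger0_norm ?sqr_ge0// (fourier_pair_nrm pK) -/eps.
have := nrm_ge0 Rplus phi; rewrite le_eqVlt => /orP[/eqP <- _|p].
  exact: nrm_ge0.
by rewrite expr2 ler_pM2r.
Qed.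

End Bounded.

Lemma nrm_inversion : isL2 Rplus kN /\ nrm Rplus (fun t => kN t - h t) <= eps.
Proof.
have mR := @measurable_Rplus R.
have [l1 l2] : isL2 Rplus (fun t => kN t - h t) /\ nrm Rplus (fun t => kN t - h t) <= eps.
  apply: (@le_nrm_fatou _ _ (fun n : nat => restr `[0, n%:R] (fun t => kN t - h t))).
  - exact: mR.
  - move=> n; apply: (isL2_restr_sub mR (measurable_itv _) (@sub_Rplus R _)).
    by apply: isL2B; [exact: measurable_itv|exact: isL2_inverse_truncated|exact: isL2_Rplus_itv].
  - move=> t /RplusP t0.
    have c0 : (kN t - h t : R[i]^o) @[_ --> \oo] --> (kN t - h t : R[i]^o) by exact: ccvg_cst.
    apply: cvg_trans c0; apply: near_eq_cvg; near=> n.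
    by rewrite restr_in// /mkset /= in_itv/= t0 /=; near: n; exact: nbhs_infty_ger.
  - by move=> n; apply: nrm_inversion_itv; exact: ler0n.
split => //; apply: (eq_isL2 (f := fun t => (kN t - h t) + h t)) => //.
  by move=> t _; rewrite subrK.
exact: isL2D.
Unshelve. all: by end_near. Qed.

End Pair.

Lemma fourier_inversion h H : fourier_pair h H ->
  L2lim Rplus (fun N t => inverse_truncated N H t) h.
Proof.
move=> hH; have [lh lH _] := hH.
apply: L2lim_intro => //; first exact: measurable_Rplus.
  by move=> N _; have [] := nrm_inversion N hH.
move=> e e0; have [n P] := nrm_restr measurableT lH e0.
by exists n => N _ nN; apply: le_trans (nrm_inversion N hH).2 (P N nN).
Qed.

End Inversion.

(** * The integral representation *)

Section Oscillatory.
Variable R : realType.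
Local Notation mu := (@lebesgue_measure R).
Variable A : (R -> R[i]) -> (R -> R[i]).
Hypotheses (cA : L2_continuous_linear A) (pA : preserves_minimum_phase A).
Implicit Types (f H : R -> R[i]).

(** On a function of bounded support the representation
    [laplace (A f) w = op_weight A w * laplace f (op_symbol A w)] passes to the
    imaginary axis, where the quotient defining the symbol has a boundary value
    because its denominator has a nonzero one. *)
Lemma truncated_boundary (T : R) f H : 0 <= T -> isL2 Rplus f ->
  fourier_pair (A (restr `[- T, T] f)) H ->
  {ae mu, forall y, H y =
    boundary_Cplus (op_alpha A) y * (1 + boundary_Cplus (op_symbol A) y) *
    trunc_laplace T f (boundary_Cplus (op_symbol A) y)}.
Proof.
move=> T0 lf pH.
have lT : isL2 Rplus (restr `[- T, T] f).
  by apply: isL2_restr => //; exact: measurable_Rplus.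
have [S0 p0] := fourier_pair_exists (L2op_stable cA (@isL2_sigma0 R)).
have [S1 p1] := fourier_pair_exists (L2op_stable cA (@isL2_sigma1 R)).
have both : {ae mu, forall y, nontangential (laplace (A sigma0)) y (S0 y) /\
    nontangential (laplace (A sigma1)) y (S1 y)}.
  by move: (laplace_nontangential p0) (laplace_nontangential p1); apply: ae_imp2.
have good : {ae mu, forall y, nontangential (laplace (A (restr `[- T, T] f))) y (H y) /\
    boundary_Cplus (laplace (A sigma1)) y != 0}.
  by move: (laplace_nontangential pH) (boundary_sigma1_neq0 pA); apply: ae_imp2.
move: both good; apply: ae_imp2 => y [n0 n1] [nH nz].
rewrite (boundary_Cplus_eq n1) in nz.
have r0 := nontangential_boundary n0; have r1 := nontangential_boundary n1.
have rH := nontangential_boundary nH.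
have rxi : (op_symbol A (x +i* y) : R[i]^o) @[x --> (0 : R)^'+] --> (S0 y / S1 y : R[i]^o).
  exact: (ccvgM r0 (ccvgV nz r1)).
have ral : (op_alpha A (x +i* y) : R[i]^o) @[x --> (0 : R)^'+] --> (S0 y + S1 y : R[i]^o).
  exact: (ccvgD r0 r1).
rewrite (boundary_Cplus_lim rxi) (boundary_Cplus_lim ral).
have rE : (trunc_laplace T f (op_symbol A (x +i* y)) : R[i]^o) @[x --> (0 : R)^'+] -->
    (trunc_laplace T f (S0 y / S1 y) : R[i]^o).
  apply: (@trunc_laplace_cvg _ T f _ _ _ (fun x => op_symbol A (x +i* y)) _ T0 (isL2_Rplus_itv _ lf)).
  exact: rxi.
have r2 : (1 + op_symbol A (x +i* y) : R[i]^o) @[x --> (0 : R)^'+] --> (1 + S0 y / S1 y : R[i]^o).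
  by apply: ccvgD; [exact: ccvg_cst|exact: rxi].
have rR : (op_alpha A (x +i* y) * (1 + op_symbol A (x +i* y)) *
    trunc_laplace T f (op_symbol A (x +i* y)) : R[i]^o) @[x --> (0 : R)^'+] -->
    ((S0 y + S1 y) * (1 + S0 y / S1 y) * trunc_laplace T f (S0 y / S1 y) : R[i]^o).
  exact: (ccvgM (ccvgM ral r2) rE).
apply: (ccvg_unique (F := (0 : R)^'+) (f := fun x => laplace (A (restr `[- T, T] f)) (x +i* y))).
  exact: rH.
apply: cvg_trans rR; apply: near_eq_cvg; near=> x.
have x0 : Cplus (x +i* y) by rewrite /Cplus/=; near: x; exact: nbhs_right_gt.
have [_ _ ->] := op_evaluation cA pA x0; last by [].
have s0 := sqrt2pi_neq0 R.
have q0 : (Num.sqrt (2 * pi))%:C != 0 :> R[i] by rewrite -normc_eq0 normc_real normr_eq0.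
rewrite laplace_restr /op_weight /fourier_cst real_complexV//.
move: ((Num.sqrt (2 * pi))%:C) q0 => q q0.
by move: (op_symbol A _) (op_alpha A _) (trunc_laplace _ _ _) => b a E; field.
Unshelve. all: by end_near. Qed.

(** The outer integral is the inversion of the Fourier transform of [A f]; the
    truncated inner integrals are the boundary functions of the images of the
    truncations, so they converge because the boundary map is isometric and [A]
    is continuous. *)
Lemma op_oscillatory f : isL2 Rplus f ->
  oscillatory_representation (op_alpha A) (op_symbol A) f (A f).
Proof.
move=> lf; have lAf := L2op_stable cA lf; have mR := @measurable_Rplus R.
have [H pH] := fourier_pair_exists lAf; have lH : isL2 setT H by case: pH.
exists H; last exact: (fourier_inversion pH).
pose fT (T : R) := restr `[- T, T] f.
have lT T : isL2 Rplus (fT T) by apply: isL2_restr => //; exact: measurable_itv.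
pose u (T y : R) := boundary_Cplus (op_alpha A) y * (1 + boundary_Cplus (op_symbol A) y) *
    trunc_laplace T f (boundary_Cplus (op_symbol A) y).
have mxi : cmeas setT (boundary_Cplus (op_symbol A)).
  exact: (cmeas_boundary_Cplus (op_symbol_holomorphic cA pA)).
have mal : cmeas setT (boundary_Cplus (op_alpha A)).
  by apply: cmeas_boundary_Cplus; have [[]] := op_alpha_outer cA pA.
have mu_ T : cmeas setT (u T).
  apply: cmeasM.
    by apply: cmeasM => //; apply: cmeasD => //; exact: cmeas_cst.
  by apply: cmeas_trunc_laplace => //; exact: isL2_Rplus_itv.
have key T : 0 <= T -> isL2 setT (u T) /\
    nrm setT (fun y => u T y - H y) = nrm Rplus (fun t => A (fT T) t - A f t).
  move=> T0; have lA := L2op_stable cA (lT T).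
  have [HT pT] := fourier_pair_exists lA; have lHT : isL2 setT HT by case: pT.
  have ae := truncated_boundary T0 lf pT.
  have lu : isL2 setT (u T).
    apply: (isL2_ae_eq measurableT lHT (mu_ T)).
    by move: ae; apply: ae_imp => y e _.
  split => //; rewrite -(fourier_pair_nrm (fourier_pairB pT pH)).
  apply: nrm_ae_eq => //.
  - by apply: cmeasB; exact: isL2_cmeas.
  - by apply: cmeasB; exact: isL2_cmeas.
  by move: ae; apply: ae_imp => y e _; rewrite e.
have lim : L2lim setT u H; last exact: lim.
apply: L2lim_intro => //; first by move=> T /key[].
move=> e e0; have [d d0 P] := L2op_continuous cA lf e0.
have d20 : 0 < d / 2 by rewrite divr_gt0.
have [n Q] := nrm_restr mR lf d20; exists n => T T0 nT.
have [_ ->] := key T T0; have lAT := L2op_stable cA (lT T).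
have lB := isL2B mR (lT T) lf.
have small : (L2norm Rplus (fun t => fT T t - f t)%R < d%:E)%E.
  by rewrite (L2norm_nrm lB) lte_fin (le_lt_trans (Q T nT))// ltr_pdivrMr// ltr_pMr// ltr1n.
have := P _ (lT T) small; rewrite (L2norm_nrm (isL2B mR lAT lAf)) lte_fin.
exact: ltW.
Qed.

End Oscillatory.

Theorem theorem7 (R : realType) :
  (forall A B : (R -> R[i]) -> (R -> R[i]),
     L2_continuous_linear A -> preserves_minimum_phase A ->
     L2_continuous_linear B -> preserves_minimum_phase B ->
     L2eq Rplus (A sigma0) (B sigma0) ->
     L2eq Rplus (A sigma1) (B sigma1) ->
     forall f, isL2 Rplus f -> L2eq Rplus (A f) (B f)) /\
  (forall A : (R -> R[i]) -> (R -> R[i]),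
     L2_continuous_linear A -> preserves_minimum_phase A ->
     let alpha := fun w : R[i] =>
       laplace (A sigma0) w + laplace (A sigma1) w in
     let xi := fun w : R[i] =>
       laplace (A sigma0) w / laplace (A sigma1) w in
     let kappa := fun w : R[i] =>
       (Num.sqrt (2 * pi))%:C * (1 + xi w) * alpha w in
     [/\ forall f, isL2 Rplus f ->
           is_inverse_laplace (Mop kappa (Cop xi (laplace f))) (A f),
         forall f, isL2 Rplus f ->
           oscillatory_representation alpha xi f (A f),
         outer_Cplus alpha,
         holomorphic_on Cplus xi
       & forall w, Cplus w -> Cplus (xi w)]).
Proof.
split=> [A B cA pA cB pB e0 e1 f lf|A cA pA alpha xi kappa].
  exact: (op_determined cA pA cB pB e0 e1 lf).
split.
- by move=> f; exact: (op_inverse_laplace cA pA).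
- by move=> f; exact: (op_oscillatory cA pA).
- exact: (op_alpha_outer cA pA).
- exact: (op_symbol_holomorphic cA pA).
by move=> w /(op_evaluation cA pA)[].
Qed.
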